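(* Let $(B_\varepsilon,h)$ be the Bergman bundle over $X=\mathbb C^n$ (with its standard hermitian metric) associated with $U_\varepsilon=\{(z,w)\in\mathbb C^n\times\mathbb C^n:|\overline w-z|<\varepsilon\}$, $\varepsilon>0$. The curvature tensor of $(B_\varepsilon,h)$ is given by $$\langle\Theta_{B_\varepsilon,h}\sigma(v,Jv),\sigma\rangle_h=\varepsilon^{-2}\sum_{\alpha\in\mathbb N^n}\Bigg(\bigg|\sum_j\sqrt{\alpha_j}\;\xi_{\alpha-c_j}v_j\bigg|^2+\sum_j(|\alpha|+n)\,|\xi_\alpha|^2|v_j|^2\Bigg)$$ for every $\sigma=\sum_\alpha\xi_\alpha e_\alpha\in B_{\varepsilon'}$, $\varepsilon'>\varepsilon$, and every tangent vector $v=\sum_jv_j\,\partial/\partial z_j$.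
   Context: **Bergman bundle.** For $z\in\mathbb C^n$ let $U_{\varepsilon,z}=\{w\in\mathbb C^n:|w-\overline z|<\varepsilon\}$ be the fiber of the first projection $U_\varepsilon\to\mathbb C^n$, and let $B_{\varepsilon,z}$ be the Hilbert space of holomorphic $n$-forms $f=f(w)\,dw_1\wedge\dots\wedge dw_n$ on $U_{\varepsilon,z}$ with $\|f\|_h^2=\int_{U_{\varepsilon,z}}2^{-n}i^{n^2}f\wedge\overline f=\int_{U_{\varepsilon,z}}|f(w)|^2d\lambda(w)<+\infty$, $\lambda$ being Lebesgue measure. $B_\varepsilon\to\mathbb C^n$ is the resulting real analytic Hilbert bundle, trivialized by $f_z\mapsto f_z(\varepsilon w+\overline z)$, $w$ in the unit ball. For $\varepsilon'>\varepsilon$, $B_{\varepsilon',z}$ is contained in $B_{\varepsilon,z}$ by restriction. **Orthonormal frame.** $e_\alpha(z,w)=\pi^{-n/2}\varepsilon^{-|\alpha|-n}\sqrt{\frac{(|\alpha|+n)!}{\alpha_1!\cdots\alpha_n!}}\,(w-\overline z)^\alpha\,dw_1\wedge\dots\wedge dw_n$, $\alpha\in\mathbb N^n$, is a real analytic orthonormal frame of $B_\varepsilon$. $(c_j)_{1\le j\le n}$ is the canonical basis of $\mathbb Z^n$, and $\xi_\beta=0$ if $\beta\notin\mathbb N^n$. **Connection and curvature.** The Chern connection is $\nabla_h=\nabla_h^{1,0}+\nabla_h^{0,1}$, where $\nabla_h^{0,1}=\overline\partial_z$ acting on families $f(z,w)\,dw_1\wedge\dots\wedge dw_n$ holomorphic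 in $w$, and $\nabla_h^{1,0}$ is determined by $\partial|\sigma|_h^2=\langle\nabla_h^{1,0}\sigma,\sigma\rangle_h+\langle\sigma,\nabla_h^{0,1}\sigma\rangle_h$ on smooth sections $\sigma$ of $B_{\varepsilon'}$, $\varepsilon'>\varepsilon$. The curvature is $\Theta_{B_\varepsilon,h}=\nabla_h^{1,0}\nabla_h^{0,1}+\nabla_h^{0,1}\nabla_h^{1,0}=\sum_{j,k}\Theta_{jk}\,dz_j\wedge d\overline z_k$, and the notation $\langle\Theta_{B_\varepsilon,h}\sigma(v,Jv),\sigma\rangle_h$ stands for the hermitian form $\sum_{j,k}\langle\Theta_{jk}\sigma,\sigma\rangle_h\,v_j\overline v_k$. *)

(* Defs.v *)
From HB Require Import structures.
From mathcomp Require Import all_boot all_order all_algebra.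
From mathcomp Require Import all_classical all_reals all_analysis.
From mathcomp Require Import complex.

Set Implicit Arguments.
Unset Strict Implicit.
Unset Printing Implicit Defensive.

Import Order.TTheory GRing.Theory Num.Theory.
Import numFieldNormedType.Exports.

Local Open Scope measure_display_scope.
Local Open Scope classical_set_scope.
Local Open Scope ring_scope.
Local Open Scope complex_scope.

(* With [R[i]^o], the complex field as a normed space over itself,
   [differentiable] means complex differentiable. *)
Notation Cn R n := 'rV[R[i]^o]_n.

Definition sqmod (R : realType) (x : R[i]) : R :=
  complex.Re x ^+ 2 + complex.Im x ^+ 2.

Definition conjv (R : realType) (n : nat) (z : Cn R n) : Cn R n :=
  \row_(j < n) conjc (z 0 j : R[i]).

(* Euclidean ball, meant for r > 0. The library norm on row vectors is the sup
   norm, which induces the same topology but not the same balls. *)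
Definition eball (R : realType) (n : nat) (c : Cn R n) (r : R) : set (Cn R n) :=
  [set w | \sum_(j < n) sqmod (w 0 j - c 0 j) < r ^+ 2].

Definition fiber (R : realType) (n : nat) (eps : R) (z : Cn R n) :
  set (Cn R n) := eball (conjv z) eps.

(* The library registers [m1 \x m2] as a measure, but its sigma-finite
   structure is not found by inference; this copy carries both. *)
Section product_measure.
Context (d1 d2 : measure_display) (T1 : measurableType d1)
  (T2 : measurableType d2) (R : realType)
  (m1 : {sigma_finite_measure set T1 -> \bar R})
  (m2 : {sigma_finite_measure set T2 -> \bar R}).

Definition prodm : set (T1 * T2)%type -> \bar R := (m1 \x m2)%E.

HB.instance Definition _ := Measure.on prodm.

Let prodm_sigma_finite : sigma_finite setT prodm.
Proof.
have /sigma_finiteP[F [TF ndF Foo]] := sigma_finiteT m1.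
have /sigma_finiteP[G [TG ndG Goo]] := sigma_finiteT m2.
exists (fun n => F n `*` G n).
  rewrite -setXTT TF TG predeqE => -[x y]; split.
    move=> [/= [n _ Fnx] [k _ Gky]]; exists (maxn n k) => //; split.
    - by move: x Fnx; exact/subsetPset/ndF/leq_maxl.
    - by move: y Gky; exact/subsetPset/ndG/leq_maxr.
  by move=> [n _ []/= ? ?]; split; exists n.
move=> k; have [? ?] := Foo k; have [? ?] := Goo k.
split; first exact: measurableX.
by rewrite /prodm product_measure1E// lte_mul_pinfty// ge0_fin_numE.
Qed.

HB.instance Definition _ :=
  Measure_isSigmaFinite.Build _ _ _ prodm prodm_sigma_finite.

End product_measure.

(* C^n as a measurable space: ((R * R) * ((R * R) * ... * unit)), the factors
   R * R holding the real and imaginary parts of the coordinates. *)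
Fixpoint Cpow_display (R : realType) (n : nat) : measure_display :=
  if n is m.+1 then
    measure_prod_display
      (measure_prod_display (sigma_display (R.-ocitv.-measurable),
                             sigma_display (R.-ocitv.-measurable)),
       Cpow_display R m)
  else default_measure_display.

Fixpoint Cpow (R : realType) (n : nat) : measurableType (Cpow_display R n) :=
  match n with
  | 0 => unit
  | m.+1 => ((measurableTypeR R * measurableTypeR R) * Cpow R m)%type
  end.

(* Lebesgue measure on C^n; for n = 0 the unit mass at the single point. *)
Fixpoint lebesgueC (R : realType) (n : nat) :
    {sigma_finite_measure set (Cpow R n) -> \bar R} :=
  match n return {sigma_finite_measure set (Cpow R n) -> \bar R} with
  | 0 => dirac tt
  | m.+1 => prodm (prodm (@lebesgue_measure R) (@lebesgue_measure R))
                  (lebesgueC R m)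
  end.

Fixpoint coord (R : realType) (n : nat) : Cpow R n -> nat -> R[i] :=
  match n return Cpow R n -> nat -> R[i] with
  | 0 => fun _ _ => 0
  | m.+1 => fun p k => if k is k'.+1 then coord p.2 k' else p.1.1 +i* p.1.2
  end.

Definition vec (R : realType) (n : nat) (p : Cpow R n) : Cn R n :=
  \row_(j < n) coord p j.

Section bergman.
Context (R : realType) (n : nat).

(* The holomorphic n-form f(w) dw_1 /\ ... /\ dw_n is represented by f. *)
Definition L2sq (c : Cn R n) (r : R) (f : Cn R n -> R[i]^o) : \bar R :=
  (\int[lebesgueC R n]_(p in @vec R n @^-1` eball c r)
     (sqmod (f (vec p)))%:E)%E.

(* Only the values of f on the ball matter. *)
Definition bergman (c : Cn R n) (r : R) : set (Cn R n -> R[i]^o) :=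
  [set f | (forall w, eball c r w -> differentiable f w) /\
           (L2sq c r f < +oo)%E].

(* The hermitian product of B_{eps,z}. *)
Definition inner (eps : R) (z : Cn R n) (f g : Cn R n -> R[i]^o) : R[i] :=
  let h p := (f (vec p) : R[i]) * conjc (g (vec p) : R[i]) in
  let D := @vec R n @^-1` fiber eps z in
  (\int[lebesgueC R n]_(p in D) complex.Re (h p))
  +i* (\int[lebesgueC R n]_(p in D) complex.Im (h p)).

(* [class_C E N k F]: F is a map of class C^k from C^n = R^{2n} to the space E
   with squared norm N, i.e. F has continuous iterated directional derivatives
   (along real lines) up to order k, limits being taken in norm and derivatives
   lying in E. *)
Fixpoint class_C (V : lmodType R[i]) (E : set V) (N : V -> \bar R)
    (k : nat) (F : Cn R n -> V) : Prop :=
  [/\ forall z, E (F z),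
      forall z, N (F z' - F z) @[z' --> z] --> (0 : \bar R)%E
    & if k is m.+1 then
        forall v : Cn R n, exists2 G : Cn R n -> V,
          forall z, N ((t%:C)^-1 *: (F (z + (t%:C : R[i]^o) *: v) - F z) - G z)
                    @[t --> (0 : R)^'] --> (0 : \bar R)%E
          & class_C E N m G
      else True].

Definition smooth (V : lmodType R[i]) (E : set V) (N : V -> \bar R)
    (F : Cn R n -> V) : Prop := forall k, class_C E N k F.

Definition smooth_fun (phi : Cn R n -> R[i]) : Prop :=
  smooth (V := R[i]^o) setT (fun x => (sqmod x)%:E) phi.

(* A family sigma z w of functions of w; only the values for w in the fiber
   over z are meaningful. *)
Definition familyCn := Cn R n -> Cn R n -> R[i]^o.

Definition trivialization (eps : R) (sigma : familyCn) : familyCn :=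
  fun z w => sigma z ((eps%:C : R[i]^o) *: w + conjv z).

(* Smooth sections over C^n of the Hilbert bundle B_eps. *)
Definition smooth_section (eps : R) (sigma : familyCn) : Prop :=
  smooth (bergman 0 1) (L2sq 0 1) (trivialization eps sigma).

(* Sections of B_eps that are smooth sections of B_{eps'} for some eps' > eps. *)
Definition extendable_section (eps : R) (sigma : familyCn) : Prop :=
  exists2 eps', eps < eps' & smooth_section eps' sigma.

Definition real_derive (v : Cn R n) (g : Cn R n -> R[i]) (z : Cn R n) : R[i] :=
  (derive1 (fun t : R => complex.Re (g (z + (t%:C : R[i]^o) *: v))) 0)
  +i* (derive1 (fun t : R => complex.Im (g (z + (t%:C : R[i]^o) *: v))) 0).

Definition ej (j : 'I_n) : Cn R n := delta_mx 0 j.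

(* Wirtinger derivatives d/dz_j and d/dzbar_j. *)
Definition dz (j : 'I_n) (g : Cn R n -> R[i]) (z : Cn R n) : R[i] :=
  2^-1 * (real_derive (ej j) g z
          - (0 +i* 1) * real_derive (((0 +i* 1) : R[i]^o) *: ej j) g z).

Definition dzbar (j : 'I_n) (g : Cn R n -> R[i]) (z : Cn R n) : R[i] :=
  2^-1 * (real_derive (ej j) g z
          + (0 +i* 1) * real_derive (((0 +i* 1) : R[i]^o) *: ej j) g z).

(* nabla^{0,1} sigma = \sum_j nabla01 j sigma dzbar_j, where z is differentiated
   with w fixed. *)
Definition nabla01 (j : 'I_n) (sigma : familyCn) : familyCn :=
  fun z w => dzbar j (fun z' => sigma z' w) z.

(* D is the (1,0)-part of the Chern connection of B_eps:
   nabla^{1,0} sigma = \sum_j D j sigma dz_j. *)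
Record is_nabla10 (eps : R) (D : 'I_n -> familyCn -> familyCn) : Prop := {
  nabla10_section : forall j sigma,
    extendable_section eps sigma -> extendable_section eps (D j sigma);
  nabla10_additive : forall j sigma tau,
    extendable_section eps sigma -> extendable_section eps tau ->
    forall z w, fiber eps z w ->
      D j (fun z' w' => sigma z' w' + tau z' w') z w
      = D j sigma z w + D j tau z w;
  nabla10_leibniz : forall j phi sigma,
    smooth_fun phi -> extendable_section eps sigma ->
    forall z w, fiber eps z w ->
      D j (fun z' w' => phi z' * sigma z' w') z w
      = dz j phi z * sigma z w + phi z * D j sigma z w;
  nabla10_metric : forall j sigma,
    extendable_section eps sigma ->
    forall z,
      dz j (fun z' => inner eps z' (sigma z') (sigma z')) z
      = inner eps z (D j sigma z) (sigma z)
        + inner eps z (sigma z) (nabla01 j sigma z)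
}.

(* The operator characterized by [is_nabla10]. Two such operators agree on the
   fibers of B_eps; outside them values of families are irrelevant. *)
Definition nabla10 (eps : R) : 'I_n -> familyCn -> familyCn :=
  xget (fun _ _ _ _ => 0) (is_nabla10 eps).

(* Theta = \sum_{j,k} Theta_jk dz_j /\ dzbar_k; the sign comes from
   nabla^{0,1} (s dz_j) = \sum_k nabla01 k s dzbar_k /\ dz_j. *)
Definition curvature (eps : R) (j k : 'I_n) (sigma : familyCn) : familyCn :=
  fun z w => nabla10 eps j (nabla01 k sigma) z w
             - nabla01 k (nabla10 eps j sigma) z w.

(* <Theta sigma (v, Jv), sigma>_h at the point z. *)
Definition curvature_form (eps : R) (sigma : familyCn) (z v : Cn R n) : R[i] :=
  \sum_(j < n) \sum_(k < n)
    inner eps z (curvature eps j k sigma z) (sigma z)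
    * (v 0 j : R[i]) * conjc (v 0 k : R[i]).

Definition multi := {ffun 'I_n -> nat}.

Definition mlen (a : multi) : nat := (\sum_(j < n) a j)%N.

Definition frame (eps : R) (a : multi) : familyCn := fun z w =>
  (powR pi (- (n%:R / 2)) * eps ^- (mlen a + n)
   * Num.sqrt ((mlen a + n)`!%:R / (\prod_(j < n) (a j)`!)%:R))%:C
  * \prod_(j < n) (w 0 j - (conjv z) 0 j : R[i]) ^+ a j.

(* f = \sum_a xi a * e_a(z, .) in B_{eps,z}: the finite partial sums converge
   to f in norm along the finite sets of multi-indices ordered by inclusion. *)
Definition frame_expansion (eps : R) (z : Cn R n) (f : Cn R n -> R[i]^o)
    (xi : multi -> R[i]) : Prop :=
  forall d : R, 0 < d -> exists A : seq multi, forall B : seq multi,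
    uniq B -> {subset A <= B} ->
    (L2sq (conjv z) eps
       (fun w => f w - \sum_(a <- B) xi a * frame eps a z w)%R < d%:E)%E.

(* xi_{a - c_j}, which is 0 when a - c_j is not in N^n. *)
Definition xi_lower (xi : multi -> R[i]) (a : multi) (j : 'I_n) : R[i] :=
  if a j == 0%N then 0 else xi [ffun i => (a i - (i == j))%N].

End bergman.

(* Main.v *)
Require Import Defs.
From HB Require Import structures.
From mathcomp Require Import all_boot all_order all_algebra.
From mathcomp Require Import all_classical all_reals all_analysis.
From mathcomp Require Import measurable_realfun.
From mathcomp Require Import complex ring lra.

Set Implicit Arguments.
Unset Strict Implicit.
Unset Printing Implicit Defensive.

Import Order.TTheory GRing.Theory Num.Theory.
Import numFieldNormedType.Exports.

Local Open Scope classical_set_scope.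
Local Open Scope ring_scope.
Local Open Scope complex_scope.

(** The bundle is trivialized by translation: a section sigma is the family
    T z u = sigma z (u + conj z) in the Bergman space of the fixed ball
    B = {|u| < eps}, and the metric no longer depends on z. Because the centre of
    the fibre moves with conj z, differentiating sigma in conj z_k at fixed w
    becomes dzbar_k - pd_k, where pd_k is the derivative in u_k ([centred_nabla01]).
    The metric identity then forces the (1,0)-part of the connection to be
    dz_j + A_j, with A_j the adjoint of pd_j on the Bergman space of B
    ([chern10_is_nabla10]); by polarization no other operator has the defining
    properties ([nabla10_unique]). A_j and pd_k act in the fibre variable, hence
    commute with the derivatives in z, so that the curvature is the commutator of
    pd_k and A_j ([centred_curvature]).

    The adjoint is again a differential operator,
    A_j f = eps^-2 u_j (E f + (n + 1) f) with E the radial derivative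
    ([ip_pd_adj]). This follows from integration by parts against the weight
    |u|^2 - eps^2, which vanishes on the sphere, and the integration by parts
    follows from the translation invariance of Lebesgue measure
    ([ball_divergence]). On monomials A_k raises the k-th exponent and pd_j lowers
    the j-th one. Their adjointness makes the monomials orthogonal and gives their
    norms ([ip_monomial]), so the frame is orthonormal and the commutator is explicit
    on it. With c = a + c_k,
    <Theta_jk sigma, e_a> = eps^-2 (sqrt(c_j c_k) xi_(c - c_j)
    + delta_jk (|a| + n) xi_a) ([ip_commutator_centred_frame]).

    Multiplying by conj(xi_a) v_j conj(v_k) and summing over |a| <= N, the first
    terms regroup by c into full squares over |c| <= N + 1, the second ones are
    the remaining part of the formula over |a| <= N. These truncations converge to
    the curvature form by the Cauchy-Schwarz inequality and lie between two
    consecutive partial sums of the series, whose terms are nonnegative; this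
    proves convergence and the formula at once ([curvature_form_esum]).

    The function theory needed is that holomorphic functions which are square
    integrable on a ball are bounded with all their derivatives on smaller ones,
    with linear bounds in the norm; this is how pd_k and A_j act on smooth sections
    of B_eps', eps' > eps, with values in B_eps. It rests on the mean value property
    over circles, which is Goursat's theorem for closed forms in logarithmic
    coordinates ([goursat], [circle_mean]); averaging over rotations passes to
    balls and bounds evaluation ([ball_mean], [sqmod_le_nsq]), and weighting by
    the conjugate phase gives Cauchy's estimate ([slice_mean1], [cauchy_pd]). *)

(** * Affine changes of variables for Lebesgue measure on C^n *)

Section affine.
Context (R : realType).
Local Notation mu := (@lebesgue_measure R).
Local Notation mR := (measurableTypeR R).
Local Open Scope ereal_scope.

Lemma measurable_affine (x b : R) :
  measurable_fun setT (fun t : mR => (x * t + b)%R : mR).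
Proof. by apply: measurable_funD => //; exact: measurable_funM. Qed.

Lemma integral_affine_pos (F : mR -> \bar R) (x b : R) : (0 < x)%R ->
  measurable_fun setT F -> (forall t, 0 <= F t) ->
  \int[mu]_t F (x * t + b)%R = (x^-1)%:E * \int[mu]_t F t.
Proof.
move=> x0 mF F0.
pose phi : measurableTypeR R -> measurableTypeR R := fun t => (x * t + b)%R.
have mphi : measurable_fun setT phi by exact: measurable_affine.
pose m' : {measure set mR -> \bar R} := mscale (NngNum (ltW x0)) (pushforward mu phi).
have E A : measurable A -> mu A = m' mphi A.
  apply: lebesgue_measure_unique => _ [[c d]] _ <-.
  change (mu [set` `]c, d]] = x%:E * mu (phi @^-1` [set` `]c, d]])).
  have -> : phi @^-1` [set` `]c, d]] = [set` `]((c - b) / x)%R, ((d - b) / x)%R]].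
    apply/seteqP; split=> t /=; rewrite !in_itv /= /phi.
      by rewrite ltr_pdivrMr// ler_pdivlMr// => /andP[h1 h2]; apply/andP; split; lra.
    by rewrite ltr_pdivrMr// ler_pdivlMr// => /andP[h1 h2]; apply/andP; split; lra.
  rewrite !lebesgue_measure_itv/= !lte_fin ltr_pM2r ?invr_gt0// ltrD2r.
  case: ifPn => _; last by rewrite mule0.
  rewrite -!EFinB -EFinM; congr EFin; field; exact: lt0r_neq0.
have : \int[mu]_t F t = \int[m' mphi]_t F t by apply: eq_measure_integral => A mA _; exact: E.
rewrite /m' ge0_integral_mscale//= ge0_integral_pushforward// => ->.
by rewrite muleA -EFinM mulVf ?mul1e ?preimage_setT// lt0r_neq0.
Qed.

Lemma integral_affine (F : mR -> \bar R) (x b : R) : x != 0%R ->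
  measurable_fun setT F -> (forall t, 0 <= F t) ->
  \int[mu]_t F (x * t + b)%R = (`|x|^-1)%:E * \int[mu]_t F t.
Proof.
move=> x0 mF F0; case: (ltrP 0 x) => xs.
  by rewrite gtr0_norm// integral_affine_pos.
have nx0 : (0 < - x)%R by rewrite oppr_gt0 lt_neqAle x0.
rewrite ler0_norm// -(integral_affine_pos b nx0)//.
pose G : mR -> \bar R := fun t => F (- x * t + b)%R.
have mG : measurable_fun setT G by apply: measurableT_comp => //; exact: measurable_affine.
transitivity (\int[mu]_t G (- t)%R).
  by apply: eq_integral => t _; rewrite /G mulrNN.
transitivity (\int[pushforward mu (-%R : mR -> mR)]_t G t).
  rewrite ge0_integral_pushforward// ?preimage_setT//.
  by move=> y _; exact: F0.
by apply: eq_measure_integral => //= A mA _; exact: lebesgue_measureN.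
Qed.

End affine.

Section affineC.
Context (R : realType).
Local Notation mu := (@lebesgue_measure R).
Local Notation mR := (measurableTypeR R).
Local Open Scope ereal_scope.

Definition affC (a c : R[i]) (p : (mR * mR)%type) : (mR * mR)%type :=
  ((complex.Re a * p.1 - complex.Im a * p.2 + complex.Re c)%R,
   (complex.Re a * p.2 + complex.Im a * p.1 + complex.Im c)%R).

Lemma measurable_affC a c : measurable_fun setT (affC a c).
Proof.
apply/measurable_fun_pairP; split.
  apply: measurable_funD => //.
  by apply: measurable_funB => //; apply: measurable_funM.
apply: measurable_funD => //.
by apply: measurable_funD => //; apply: measurable_funM.
Qed.

(** With a nonzero real part the linear map is a product of two shears with
    one-dimensional dilations, so two one-dimensional changes of variable
    give its Jacobian. *)
Lemma integral_affC_Re (F : (mR * mR)%type -> \bar R) (a c : R[i]) : complex.Re a != 0%R ->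
  measurable_fun setT F -> (forall p, 0 <= F p) ->
  \int[prodm mu mu]_p F (affC a c p) = ((sqmod a)^-1)%:E * \int[prodm mu mu]_p F p.
Proof.
case: a => x y /= x0 mF F0.
set u := complex.Re c; set v := complex.Im c.
pose al := ((x ^+ 2 + y ^+ 2) / x)%R.
have sq0 : (0 < x ^+ 2 + y ^+ 2)%R.
  by rewrite ltr_pwDl ?sqr_ge0// lt_neqAle sqr_ge0 eq_sym sqrf_eq0 x0.
have al0 : al != 0%R by rewrite mulf_neq0 ?invr_eq0// gt_eqF.
rewrite /prodm.
rewrite (fubini_tonelli2 (fun p => F (affC (x +i* y) c p)))//; last first.
  by apply: measurableT_comp => //; exact: measurable_affC.
pose G : (mR * mR)%type -> \bar R := fun q =>
  F (q.1, (al * q.2 + (y / x * (q.1 - u) + v))%R).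
have mG : measurable_fun setT G.
  apply: measurableT_comp => //; apply/measurable_fun_pairP; split.
    exact: measurable_fst.
  apply: measurable_funD => //; first exact: measurable_funM.
  apply: measurable_funD => //; apply: measurable_funM => //.
  exact: measurable_funB.
have G0 q : 0 <= G q by exact: F0.
rewrite /fubini_G.
transitivity (\int[mu]_t ((`|x|^-1)%:E * \int[mu]_s G (s, t))).
  apply: eq_integral => t _.
  have mGt : measurable_fun setT (fun s : mR => G (s, t)).
    exact: measurable_fun_pair1.
  rewrite -(integral_affine (- y * t + u) x0 mGt); last by move=> s; exact: F0.
  apply: eq_integral => s _; congr F; rewrite /affC/=; congr pair.
    by rewrite -/u; ring.
  by rewrite -/v /al; field.
rewrite ge0_integralZl//; last 2 first.
- exact: (measurable_fun_fubini_tonelli_G (m1 := mu) G mG G0).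
- by move=> t _; apply: integral_ge0.
rewrite -(fubini_tonelli G mG G0) (fubini_tonelli1 F mF F0).
transitivity ((`|x|^-1)%:E * \int[mu]_s ((`|al|^-1)%:E * \int[mu]_t F (s, t))).
  congr (_ * _); apply: eq_integral => s _.
  rewrite -(integral_affine (y / x * (s - u) + v) al0)//.
  exact: (measurable_fun_pair2 _ mF).
rewrite ge0_integralZl//; last 2 first.
- exact: (measurable_fun_fubini_tonelli_F (m2 := mu) F mF F0).
- by move=> t _; apply: integral_ge0.
rewrite muleA -EFinM -invfM -normrM /sqmod /=; congr (_^-1%:E * _)%E.
rewrite /al mulrC divfK// ger0_norm//; exact: ltW.
Qed.

Lemma sqmodM (a b : R[i]) : (sqmod (a * b) = sqmod a * sqmod b)%R.
Proof. by case: a b => [? ?] [? ?]; rewrite /sqmod/=; ring. Qed.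

Lemma integral_affC (F : (mR * mR)%type -> \bar R) (a c : R[i]) : (a != 0)%R ->
  measurable_fun setT F -> (forall p, 0 <= F p) ->
  \int[prodm mu mu]_p F (affC a c p) = ((sqmod a)^-1)%:E * \int[prodm mu mu]_p F p.
Proof.
move=> a0 mF F0; have [Ra|/negPf Ra] := boolP (complex.Re a != 0%R).
  exact: integral_affC_Re.
(* a purely imaginary multiplier is the product of two with nonzero real part *)
move: Ra a0 => /eqP; case: a => x y /= -> a0.
pose b : R[i] := (1 +i* 1)%R.
pose d : R[i] := ((y / 2) +i* (y / 2))%R.
have y0 : y != 0%R by apply: contra a0 => /eqP ->.
have E p : affC (Complex 0%R y) c p = affC b c (affC d 0%R p).
  by rewrite /affC/=; congr pair; field.
transitivity (\int[prodm mu mu]_p F (affC b c (affC d 0%R p))).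
  by apply: eq_integral => p _; rewrite E.
rewrite (@integral_affC_Re (F \o affC b c))//=; last 2 first.
- by rewrite mulf_neq0// invr_eq0.
- by apply: measurableT_comp => //; exact: measurable_affC.
rewrite integral_affC_Re//= ?oner_neq0// muleA -EFinM -invfM -sqmodM.
congr ((sqmod _)^-1%:E * _)%E; rewrite /d /b.
by apply/eqP; rewrite eq_complex/=; apply/andP; split; apply/eqP; field.
Qed.
End affineC.

Section affine_Cpow.
Context (R : realType).

Fixpoint affCn (n : nat) (a c : nat -> R[i]) : Cpow R n -> Cpow R n :=
  match n return Cpow R n -> Cpow R n with
  | 0 => id
  | m.+1 => fun p => (affC (a 0%N) (c 0%N) p.1, affCn (a \o S) (c \o S) p.2)
  end.

Lemma measurable_affCn n (a c : nat -> R[i]) : measurable_fun setT (@affCn n a c).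
Proof.
elim: n a c => [|n IH] a c //=.
apply/measurable_fun_pairP; split.
  exact: (measurableT_comp (measurable_affC (a 0%N) (c 0%N)) measurable_fst).
exact: (measurableT_comp (IH (a \o S) (c \o S)) measurable_snd).
Qed.

Lemma coord_affCn n (a c : nat -> R[i]) (p : Cpow R n) k : (k < n)%N ->
  Defs.coord (affCn a c p) k = a k * Defs.coord p k + c k.
Proof.
elim: n a c p k => [|n IH] a c p [|k] //=.
  by move=> _; case: (a 0%N) (c 0%N) => x y [u v].
by rewrite ltnS => kn; rewrite IH.
Qed.

Lemma integral_affCn n (a c : nat -> R[i]) (F : Cpow R n -> \bar R) :
  (forall k, a k != 0) ->
  measurable_fun setT F -> (forall p, 0 <= F p)%E ->
  (\int[lebesgueC R n]_p F (affCn a c p)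
   = ((\prod_(k < n) sqmod (a k))^-1)%:E * \int[lebesgueC R n]_p F p)%E.
Proof.
elim: n a c F => [|n IH] a c F a0 mF F0.
  by rewrite big_ord0 invr1 mul1e.
have sq0 : (0 <= (\prod_(k < n) sqmod ((a \o S) k))^-1)%R.
  by rewrite invr_ge0 prodr_ge0// => k _; rewrite /sqmod addr_ge0 ?sqr_ge0.
rewrite /= {1 3}/prodm.
have mF2 : measurable_fun setT (F \o @affCn n.+1 a c).
  by apply: measurableT_comp => //; exact: measurable_affCn.
pose mu2 := prodm (@lebesgue_measure R) (@lebesgue_measure R).
rewrite [LHS](@fubini_tonelli1 _ _ _ _ R mu2 (lebesgueC R n) _ mF2); last by move=> q; exact: F0.
rewrite (@fubini_tonelli1 _ _ _ _ R mu2 (lebesgueC R n) _ mF)//.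
rewrite {1}/fubini_F.
transitivity (\int[prodm (@lebesgue_measure R) (@lebesgue_measure R)]_q
   (((\prod_(k < n) sqmod ((a \o S) k))^-1)%:E * fubini_F (lebesgueC R n) F (affC (a 0%N) (c 0%N) q)))%E.
  apply: eq_integral => q _; rewrite -(IH (a \o S) (c \o S))//.
    by move=> k; exact: a0.
  exact: (measurable_fun_pair2 _ mF).
have mFF := measurable_fun_fubini_tonelli_F (m2 := lebesgueC R n) F mF F0.
rewrite ge0_integralZl//; last 2 first.
- exact: (measurableT_comp mFF (measurable_affC (a 0%N) (c 0%N))).
- by move=> q _; apply: integral_ge0.
rewrite (integral_affC _ (a0 0%N) mFF); last by move=> q; apply: integral_ge0.
by rewrite muleA -EFinM big_ord_recl invfM mulrC.
Qed.

End affine_Cpow.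

(** * Moduli and Euclidean norms *)

Section modulus.
Context (R : realType).
Implicit Types x y : R[i].

Definition cmod x : R := Num.sqrt (sqmod x).

Lemma sqmod_ge0 x : 0 <= sqmod x.
Proof. by rewrite /sqmod addr_ge0 ?sqr_ge0. Qed.

Lemma cmod_ge0 x : 0 <= cmod x. Proof. exact: sqrtr_ge0. Qed.

Lemma sqr_cmod x : cmod x ^+ 2 = sqmod x.
Proof. by rewrite sqr_sqrtr// sqmod_ge0. Qed.

Lemma normcmod x : `|x| = (cmod x)%:C. Proof. by rewrite normc_def. Qed.

Lemma cmodM x y : cmod (x * y) = cmod x * cmod y.
Proof. by rewrite /cmod sqmodM sqrtrM// sqmod_ge0. Qed.

Lemma cmodD x y : cmod (x + y) <= cmod x + cmod y.
Proof. by rewrite -lecR rmorphD/= -!normcmod ler_normD. Qed.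

Lemma cmodN x : cmod (- x) = cmod x.
Proof. by case: x => a b; rewrite /cmod /sqmod /= !sqrrN. Qed.

Lemma cmodB x y : cmod (x - y) <= cmod x + cmod y.
Proof. by rewrite -(cmodN y) cmodD. Qed.

Lemma cmod_distC x y : cmod (x - y) = cmod (y - x).
Proof. by rewrite -cmodN opprB. Qed.

Lemma cmod0 : cmod (0 : R[i]) = 0.
Proof. by rewrite /cmod /sqmod/= expr0n/= addr0 sqrtr0. Qed.

Lemma sqmod0 : sqmod (0 : R[i]) = 0.
Proof. by rewrite /sqmod/= expr0n/= addr0. Qed.

Lemma cmod1 : cmod (1 : R[i]) = 1.
Proof. by rewrite /cmod /sqmod/= expr0n/= addr0 expr1n sqrtr1. Qed.

Lemma cmodX x k : cmod (x ^+ k) = cmod x ^+ k.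
Proof. by elim: k => [|k IH]; rewrite ?expr0 ?cmod1// !exprS cmodM IH. Qed.

Lemma cmod_real (t : R) : cmod t%:C = `|t|.
Proof. by rewrite /cmod /sqmod/= expr0n/= addr0 sqrtr_sqr. Qed.

Lemma cmod_ger0 (t : R) : 0 <= t -> cmod t%:C = t.
Proof. by move=> t0; rewrite cmod_real ger0_norm. Qed.

Lemma cmodi : cmod (0 +i* 1 : R[i]) = 1.
Proof. by rewrite /cmod /sqmod/= expr0n/= add0r expr1n sqrtr1. Qed.

Lemma sqmod_conj x : sqmod x^* = sqmod x.
Proof. by case: x => a b; rewrite /sqmod/= sqrrN. Qed.

Lemma cmod_conj x : cmod x^* = cmod x.
Proof. by rewrite /cmod sqmod_conj. Qed.

Lemma sqmodN x : sqmod (- x) = sqmod x.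
Proof. by rewrite -!sqr_cmod cmodN. Qed.

Lemma mul_conj x : x * x^* = (sqmod x)%:C.
Proof. by case: x => a b; rewrite /sqmod; simpc; congr (_ +i* _); ring. Qed.

Lemma cmod_eq0 x : (cmod x == 0) = (x == 0).
Proof. by rewrite -(inj_eq (@complexI R)) -normcmod normr_eq0. Qed.

Lemma sqmod_eq0 x : (sqmod x == 0) = (x == 0).
Proof. by rewrite -sqr_cmod sqrf_eq0 cmod_eq0. Qed.

Lemma cmod_gt0 x : (0 < cmod x) = (x != 0).
Proof. by rewrite lt_neqAle cmod_ge0 andbT eq_sym cmod_eq0. Qed.

Lemma cmodV x : cmod x^-1 = (cmod x)^-1.
Proof.
have [->|x0] := eqVneq x 0; first by rewrite invr0 cmod0 invr0.
apply: (mulfI (x := cmod x)); first by rewrite cmod_eq0.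
by rewrite -cmodM !divff ?cmod1// cmod_eq0.
Qed.

Lemma Re_le_cmod x : `|complex.Re x| <= cmod x.
Proof. by rewrite -sqrtr_sqr /cmod ler_wsqrtr// /sqmod lerDl sqr_ge0. Qed.

Lemma Im_le_cmod x : `|complex.Im x| <= cmod x.
Proof. by rewrite -sqrtr_sqr /cmod ler_wsqrtr// /sqmod lerDr sqr_ge0. Qed.

Lemma cmod_le_ReIm x : cmod x <= `|complex.Re x| + `|complex.Im x|.
Proof.
case: x => a b /=; have -> : (a +i* b) = a%:C + (0 +i* 1) * b%:C :> R[i].
  by simpc.
by apply: le_trans (cmodD _ _) _; rewrite cmodM cmodi mul1r !cmod_real.
Qed.

Lemma cmod_sum (I : Type) (r : seq I) (P : pred I) (F : I -> R[i]) :
  cmod (\sum_(i <- r | P i) F i) <= \sum_(i <- r | P i) cmod (F i).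
Proof.
elim/big_rec2: _ => [|i y1 y2 _ h]; first by rewrite cmod0.
by apply: le_trans (cmodD _ _) _; rewrite lerD2l.
Qed.

Lemma cmod_triangle_sub x y : `|cmod x - cmod y| <= cmod (x - y).
Proof.
rewrite ler_norml; apply/andP; split.
  rewrite lerBrDr addrC lerBlDr cmod_distC.
  by rewrite [leRHS]addrC -[X in cmod X <= _](subrK x) cmodD.
by rewrite lerBlDr -[X in cmod X <= _](subrK y); exact: cmodD.
Qed.

Lemma ReM_real (t : R) x : complex.Re (t%:C * x) = t * complex.Re x.
Proof. by case: x => a b /=; rewrite mul0r subr0. Qed.

Lemma ImM_real (t : R) x : complex.Im (t%:C * x) = t * complex.Im x.
Proof. by case: x => a b /=; rewrite mul0r addr0. Qed.

Lemma cReD x y : complex.Re (x + y) = complex.Re x + complex.Re y.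
Proof. by case: x y => [? ?] [? ?]. Qed.
Lemma cImD x y : complex.Im (x + y) = complex.Im x + complex.Im y.
Proof. by case: x y => [? ?] [? ?]. Qed.
Lemma cReN x : complex.Re (- x) = - complex.Re x.
Proof. by case: x => [? ?]. Qed.
Lemma cImN x : complex.Im (- x) = - complex.Im x.
Proof. by case: x => [? ?]. Qed.
Lemma cReM x y : complex.Re (x * y) = complex.Re x * complex.Re y - complex.Im x * complex.Im y.
Proof. by case: x y => [? ?] [? ?]. Qed.
Lemma cImM x y : complex.Im (x * y) = complex.Re x * complex.Im y + complex.Im x * complex.Re y.
Proof. by case: x y => [? ?] [? ?]. Qed.
Lemma eqReIm x y : complex.Re x = complex.Re y -> complex.Im x = complex.Im y -> x = y.
Proof. by case: x y => [? ?] [? ?] /= -> ->. Qed.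
End modulus.

Section euclid.
Context (R : realType) (n : nat).
Implicit Types u v w : Cn R n.

Definition sqn u : R := \sum_(j < n) sqmod (u 0 j : R[i]).
Definition enorm u : R := Num.sqrt (sqn u).

Lemma sqn_ge0 u : 0 <= sqn u.
Proof. by apply: sumr_ge0 => j _; exact: sqmod_ge0. Qed.

Lemma enorm_ge0 u : 0 <= enorm u. Proof. exact: sqrtr_ge0. Qed.

Lemma sqr_enorm u : enorm u ^+ 2 = sqn u.
Proof. by rewrite sqr_sqrtr// sqn_ge0. Qed.

Lemma sqnN u : sqn (- u) = sqn u.
Proof. by apply: eq_bigr => j _; rewrite mxE sqmodN. Qed.

Lemma enormN u : enorm (- u) = enorm u.
Proof. by rewrite /enorm sqnN. Qed.

Lemma enorm_distC u v : enorm (u - v) = enorm (v - u).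
Proof. by rewrite -enormN opprB. Qed.

Lemma sqnZ (a : R[i]) u : sqn ((a : R[i]^o) *: u) = sqmod a * sqn u.
Proof. by rewrite /sqn mulr_sumr; apply: eq_bigr => j _; rewrite mxE -sqmodM. Qed.

Lemma enormZ (a : R[i]) u : enorm ((a : R[i]^o) *: u) = cmod a * enorm u.
Proof. by rewrite /enorm sqnZ sqrtrM// sqmod_ge0. Qed.

Lemma sqn0 : sqn 0 = 0.
Proof. by rewrite /sqn big1// => j _; rewrite mxE sqmod0. Qed.

Lemma enorm0 : enorm 0 = 0.
Proof. by rewrite /enorm sqn0 sqrtr0. Qed.

Lemma sqmod_coord u j : sqmod (u 0 j : R[i]) <= sqn u.
Proof.
by rewrite /sqn (bigD1 j)//= lerDl sumr_ge0// => i _; exact: sqmod_ge0.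
Qed.

Lemma cmod_coord u j : cmod (u 0 j : R[i]) <= enorm u.
Proof. by rewrite /cmod ler_wsqrtr// sqmod_coord. Qed.

Lemma sqn_eq0 u : sqn u = 0 -> u = 0.
Proof.
move=> u0; apply/rowP => j; rewrite mxE; apply/eqP; rewrite -(@sqmod_eq0 R).
by rewrite eq_le sqmod_ge0 andbT -u0 sqmod_coord.
Qed.

Lemma enorm_gt0 u : u != 0 -> 0 < enorm u.
Proof.
move=> u0; rewrite lt_neqAle enorm_ge0 andbT; apply: contra u0 => /eqP u0.
by apply/eqP/sqn_eq0; rewrite -sqr_enorm -u0 expr0n.
Qed.

Lemma sqmodD_le (x y : R[i]) (a b : R) : 0 < a -> 0 < b ->
  sqmod (x + y) <= (1 + b / a) * sqmod x + (1 + a / b) * sqmod y.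
Proof.
move=> a0 b0; rewrite -!sqr_cmod.
have h : cmod (x + y) ^+ 2 <= (cmod x + cmod y) ^+ 2.
  by rewrite lerXn2r ?nnegrE ?cmod_ge0 ?addr_ge0 ?cmod_ge0// cmodD.
apply: le_trans h _.
set s := cmod x; set t := cmod y.
rewrite -subr_ge0.
have -> : (1 + b / a) * s ^+ 2 + (1 + a / b) * t ^+ 2 - (s + t) ^+ 2
  = (b * s - a * t) ^+ 2 / (a * b).
  by field; rewrite !gt_eqF.
by rewrite divr_ge0 ?sqr_ge0// mulr_ge0// ltW.
Qed.

Lemma enormD u v : enorm (u + v) <= enorm u + enorm v.
Proof.
have [->|u0] := eqVneq u 0; first by rewrite enorm0 !add0r.
have [->|v0] := eqVneq v 0; first by rewrite enorm0 !addr0.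
have a0 := enorm_gt0 u0; have b0 := enorm_gt0 v0.
rewrite -(@ler_pXn2r _ 2)// ?nnegrE ?enorm_ge0 ?addr_ge0 ?enorm_ge0//.
rewrite sqr_enorm.
apply: (@le_trans _ _ ((1 + enorm v / enorm u) * sqn u + (1 + enorm u / enorm v) * sqn v)).
  rewrite /sqn !mulr_sumr -big_split/=; apply: ler_sum => j _.
  by rewrite mxE; exact: sqmodD_le.
rewrite -!sqr_enorm le_eqVlt; apply/orP; left; apply/eqP; field.
by rewrite !gt_eqF.
Qed.

Lemma enormB u v : enorm (u - v) <= enorm u + enorm v.
Proof. by rewrite -(enormN v) enormD. Qed.

Lemma eballE (c : Cn R n) (r : R) w : 0 <= r -> eball c r w <-> enorm (w - c) < r.
Proof.
move=> r0; rewrite /eball/=.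
have -> : \sum_(j < n) sqmod (w 0 j - c 0 j : R[i]) = enorm (w - c) ^+ 2.
  by rewrite sqr_enorm; apply: eq_bigr => j _; rewrite !mxE.
by rewrite ltr_pXn2r ?nnegrE ?enorm_ge0.
Qed.

Lemma eball0E (r : R) w : 0 <= r -> eball 0 r w <-> enorm w < r.
Proof. by move=> r0; rewrite eballE// subr0. Qed.

Lemma enorm_le_sum u : enorm u <= \sum_(j < n) cmod (u 0 j : R[i]).
Proof.
have S0 : 0 <= \sum_(j < n) cmod (u 0 j : R[i]).
  by apply: sumr_ge0 => j _; exact: cmod_ge0.
rewrite -(@ler_pXn2r _ 2)// ?nnegrE ?enorm_ge0// sqr_enorm /sqn expr2 mulr_suml.
apply: ler_sum => j _; rewrite -sqr_cmod expr2 ler_wpM2l ?cmod_ge0//.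
by rewrite (bigD1 j)//= lerDl sumr_ge0// => i _; exact: cmod_ge0.
Qed.

Lemma nbhs_enormP (w : Cn R n) (P : set (Cn R n)) :
  nbhs w P <-> exists2 d : R, 0 < d & forall w', enorm (w' - w) < d -> P w'.
Proof.
split.
  move=> /nbhs_ballP[e /= e0 eP].
  have eE : e = (complex.Re e)%:C.
    by move: e0; rewrite ltcE/= => /andP[/eqP]; case: (e) => a b /= ->.
  have d0 : 0 < complex.Re e by move: e0; rewrite {1}eE ltcR.
  exists (complex.Re e) => // w' hw; apply: eP.
  rewrite mx_norm_ball /ball_/= /Num.norm/= mx_normE.
  rewrite (_ : e = (NngNum (ltW e0))%:num)// num_lt.
  apply/bigmax_ltP; split=> //= -[i j] _; rewrite -num_lt/=.
  rewrite !mxE (ord1 i) normcmod eE ltcR cmod_distC.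
  by apply: le_lt_trans hw; have := cmod_coord (w' - w) j; rewrite !mxE.
move=> [d d0 dP]; apply/nbhs_ballP.
have e0 : 0 < (d / n.+1%:R)%:C :> R[i] by rewrite ltcR divr_gt0.
exists (d / n.+1%:R)%:C => //= w'.
rewrite mx_norm_ball /ball_/= => hw; apply: dP.
apply: le_lt_trans (enorm_le_sum _) _.
apply: (@le_lt_trans _ _ (\sum_(j < n) (d / n.+1%:R))).
  apply: ler_sum => j _; rewrite -lecR -normcmod.
  apply: le_trans (ltW hw); rewrite [leRHS]/Num.norm/= mx_normE.
  have -> : `|(w' - w) 0 j| = (`|(w - w') ((0 : 'I_1), j).1 ((0 : 'I_1), j).2|%:nng)%:num :> R[i].
    by rewrite /= !mxE distrC.
  by rewrite num_le; exact: (le_bigmax _ (fun i => `|(w - w') i.1 i.2|%:nng)).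
rewrite sumr_const card_ord -[_ *+ n]mulr_natr -mulrA gtr_pMr ?invr_gt0//.
by rewrite mulrC ltr_pdivrMr// mul1r ltr_nat.
Qed.

Lemma nbhs_cmodP (x : R[i]^o) (P : set R[i]^o) :
  nbhs x P <-> exists2 d : R, 0 < d & forall y : R[i], cmod (y - x) < d -> P y.
Proof.
split.
  move=> /nbhs_ballP[e /= e0 eP].
  have eE : e = (complex.Re e)%:C.
    by move: e0; rewrite ltcE/= => /andP[/eqP]; case: (e) => a b /= ->.
  have d0 : 0 < complex.Re e by move: e0; rewrite {1}eE ltcR.
  exists (complex.Re e) => // y hy; apply: eP.
  by rewrite /ball/= distrC normcmod eE ltcR.
move=> [d d0 dP]; apply/nbhs_ballP; exists d%:C => /=; first by rewrite ltcR.
by move=> y; rewrite /ball/= distrC normcmod ltcR; exact: dP.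
Qed.

End euclid.

(** * Continuous functions on C^n are measurable *)

Section discretization.
Context d (X : measurableType d).

(** A countable measurable partition with a representative in each cell:
    composing with such a map makes any function measurable. *)
Definition discretization (g : X -> X) :=
  exists c : X -> nat, exists2 h : nat -> X,
    forall x, g x = h (c x) & forall k, measurable (c @^-1` [set k]).

Lemma measurable_comp_discretization d' (Y : measurableType d') (g : X -> X)
  (f : X -> Y) : discretization g -> measurable_fun setT (f \o g).
Proof.
move=> [c [h gE mc]] _ B mB; rewrite setTI.
have -> : (f \o g) @^-1` B = \bigcup_(k in [set k | B (f (h k))]) (c @^-1` [set k]).
  apply/seteqP; split => [x /= Bx|x [k /= Bk /= ck]].
    by exists (c x) => //=; rewrite -gE.
  by rewrite gE ck.
by apply: bigcup_measurable => k _; exact: mc.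
Qed.

(** Rounding maps whose images converge give pointwise limits of measurable
    functions, so continuity along the limits is all that is asked of f. *)
Lemma measurable_fun_discretization (R : realType) (g : nat -> X -> X)
  (D : set X) (f : X -> R) :
  measurable D -> (forall m, discretization (g m)) ->
  (forall x, D x -> (fun m => f (g m x)) @ \oo --> f x) ->
  measurable_fun D (f : X -> measurableTypeR R).
Proof.
move=> mD dg cf; apply: (measurable_fun_cvg (h := fun m => f \o g m)) => //.
move=> m; apply: measurable_funTS; exact: measurable_comp_discretization.
Qed.
End discretization.

Lemma discretization_prod d1 d2 (X : measurableType d1) (Y : measurableType d2)
  (g1 : X -> X) (g2 : Y -> Y) : discretization g1 -> discretization g2 ->
  discretization (fun p : X * Y => (g1 p.1, g2 p.2)).
Proof.
move=> [c1 [h1 gE1 m1]] [c2 [h2 gE2 m2]].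
exists (fun p => pickle (c1 p.1, c2 p.2)).
exists (fun k => if pickle_inv k is Some ab then (h1 ab.1, h2 ab.2) else (h1 0%N, h2 0%N)).
  by move=> x; rewrite pickleK_inv /= gE1 gE2.
move=> k; case kE : (pickle_inv k : option (nat * nat)) => [[a b]|].
  rewrite [X in measurable X](_ : _ = (c1 @^-1` [set a]) `*` (c2 @^-1` [set b])).
    exact: measurableX.
  apply/seteqP; split => p /=.
    by move=> pk; move: kE; rewrite -pk pickleK_inv => -[].
  move=> [e1 e2]; rewrite -e1 -e2 in kE.
  by have := @pickle_invK (nat * nat)%type k; rewrite kE.
rewrite [X in measurable X](_ : _ = set0)//.
apply/seteqP; split => p //= pk.
by move: kE; rewrite -pk pickleK_inv.
Qed.

Section grid.
Context (R : realType).

Definition gridR (m : nat) (x : measurableTypeR R) : measurableTypeR R :=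
  (Num.floor (x * m.+1%:R))%:~R / m.+1%:R.

Lemma discretization_gridR m : discretization (gridR m).
Proof.
exists (fun x => pickle (Num.floor (x * m.+1%:R) : int)).
exists (fun k => if pickle_inv k is Some z then (z : int)%:~R / m.+1%:R else 0).
  by move=> x; rewrite pickleK_inv.
move=> k; case kE : (pickle_inv k : option int) => [z|].
  rewrite [X in measurable X](_ : _ = [set` `[(z%:~R / m.+1%:R : R), ((z + 1)%:~R / m.+1%:R : R)[ ]) //.
  apply/seteqP; split => x /=.
    move=> pk; move: kE; rewrite -pk pickleK_inv => -[<-].
    by rewrite in_itv/= ler_pdivrMr// ltr_pdivlMr// floor_le_tmp// floorD1_gt.
  rewrite in_itv/= ler_pdivrMr// ltr_pdivlMr// => h.
  by rewrite (floor_def h); have := @pickle_invK int k; rewrite kE.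
rewrite [X in measurable X](_ : _ = set0)//.
apply/seteqP; split => p //= pk.
by move: kE; rewrite -pk pickleK_inv.
Qed.

Lemma gridR_le m x : `|gridR m x - x| <= m.+1%:R^-1.
Proof.
have -> : gridR m x - x = - ((x * m.+1%:R - (Num.floor (x * m.+1%:R))%:~R) / m.+1%:R).
  by rewrite /gridR; field.
rewrite normrN normrM normfV [`|m.+1%:R|]ger0_norm// -[leRHS]mul1r ler_wpM2r ?invr_ge0//.
rewrite ger0_norm; first by rewrite lerBlDr ltW// addrC -intrD1 floorD1_gt.
by rewrite subr_ge0 floor_le_tmp.
Qed.

Fixpoint gridC (n m : nat) : Cpow R n -> Cpow R n :=
  match n return Cpow R n -> Cpow R n with
  | 0 => id
  | k.+1 => fun p => ((gridR m p.1.1, gridR m p.1.2), gridC m p.2)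
  end.

Lemma discretization_gridC n m : discretization (@gridC n m).
Proof.
elim: n => [|n IH].
  exists (fun _ => 0%N); exists (fun _ => tt); first by case.
  by move=> k.
apply: (discretization_prod (g1 := fun q => (gridR m q.1, gridR m q.2))) => //.
by apply: discretization_prod; exact: discretization_gridR.
Qed.

Lemma coord_gridC n m (p : Cpow R n) k :
  cmod (Defs.coord (gridC m p) k - Defs.coord p k) <= 2 / m.+1%:R.
Proof.
elim: n p k => [|n IH] p k /=; first by rewrite subrr cmod0.
case: k => [|k] //.
apply: le_trans (cmod_le_ReIm _) _ => /=.
by rewrite (mulr_natl _ 2) mulr2n lerD// gridR_le.
Qed.

Lemma vec_gridC n m (p : Cpow R n) :
  enorm (vec (gridC m p) - vec p) <= 2 * n%:R / m.+1%:R.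
Proof.
apply: le_trans (enorm_le_sum _) _.
apply: (@le_trans _ _ (\sum_(j < n) (2 / m.+1%:R))).
  by apply: ler_sum => j _; rewrite !mxE coord_gridC.
by rewrite sumr_const card_ord -[_ *+ n]mulr_natr mulrAC.
Qed.

Lemma cvg_gridR (x : R) : (fun m => gridR m x) @ \oo --> x.
Proof.
have : (fun m : nat => m.+1%:R^-1 : R) @ \oo --> (0 : R) by exact: cvg_harmonic.
move=> /cvgrPdist_le H; apply/cvgrPdist_le => e /H; apply: filterS => m.
rewrite sub0r normrN ger0_norm ?invr_ge0// => hm.
by rewrite distrC; exact: le_trans (gridR_le _ _) hm.
Qed.

Lemma cvg_gridC n (p : Cpow R n) : (fun m => vec (gridC m p)) @ \oo --> vec p.
Proof.
move=> A /nbhs_enormP[d d0 dA].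
have : (fun m => gridR m (0 : R)) @ \oo --> (0 : R) by exact: cvg_gridR.
have : (fun m : nat => m.+1%:R^-1 : R) @ \oo --> (0 : R) by exact: cvg_harmonic.
have e0 : 0 < d / (2 * n%:R + 1).
  by rewrite divr_gt0// ltr_wpDl// mulr_ge0.
move=> /cvgrPdist_lt /(_ _ e0) H _; rewrite /nbhs/=.
apply: filterS H => m; rewrite sub0r normrN ger0_norm ?invr_ge0// => hm.
apply: dA; apply: le_lt_trans (vec_gridC m p) _.
apply: (@le_lt_trans _ _ ((2 * n%:R + 1) / m.+1%:R)).
  by rewrite ler_wpM2r ?invr_ge0// lerDl.
by rewrite mulrC -ltr_pdivlMr// ltr_wpDl// mulr_ge0.
Qed.

(** [Cpow] carries a product sigma-algebra and [Cn] the topology; grids of mesh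
    tending to 0 relate the two without any comparison of Borel sets. *)
Lemma measurable_continuous_vec n (D : set (Cpow R n)) (f : Cn R n -> R) :
  measurable D -> (forall p, D p -> {for vec p, continuous f}) ->
  measurable_fun D (fun p => f (vec p) : measurableTypeR R).
Proof.
move=> mD cf; apply: (measurable_fun_discretization (g := @gridC n)) => //.
  exact: discretization_gridC.
move=> p Dp; apply: cvg_comp; last exact: (cf p Dp).
exact: cvg_gridC.
Qed.

End grid.

(** * Balls: invariance, homogeneity and volume *)

Section affine_vec.
Context (R : realType) (n : nat).
Local Notation muC := (lebesgueC R n).
Local Notation Cn := (Cn R n).

Definition cofn (c : Cn) (k : nat) : R[i] :=
  if insub k is Some j then c 0 (j : 'I_n) else 0.

Lemma vec_affCn (a : R[i]) (c : Cn) (p : Cpow R n) :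
  vec (affCn (fun _ => a) (cofn c) p) = (a : R[i]^o) *: vec p + c.
Proof.
apply/rowP => j; rewrite !mxE coord_affCn//.
by congr (_ + _); rewrite /cofn insubT//= => h; congr (c 0 _); exact: val_inj.
Qed.

Lemma enorm_triangle_sub (u v : Cn) : `|enorm u - enorm v| <= enorm (u - v).
Proof.
rewrite ler_norml; apply/andP; split.
  rewrite lerBrDr [leLHS]addrC lerBlDr enorm_distC [leRHS]addrC.
  by rewrite [leRHS]addrC [leRHS]addrC -[X in enorm X <= _](subrK u); exact: enormD.
by rewrite lerBlDr -[X in enorm X <= _](subrK v); exact: enormD.
Qed.

Lemma continuous_enormP (f : Cn -> R) (w : Cn) :
  (forall e, 0 < e -> exists2 d : R, 0 < d &
    forall w', enorm (w' - w) < d -> `|f w' - f w| < e) ->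
  {for w, continuous f}.
Proof.
move=> H A /nbhs_ballP[e /= e0 eA]; apply/nbhs_enormP.
have [d d0 dP] := H e e0; exists d => // w' /dP h.
by apply: eA; rewrite /ball/= distrC.
Qed.

Lemma continuous_enorm (c w : Cn) : {for w, continuous (fun w : Cn => enorm (w - c))}.
Proof.
apply: continuous_enormP => e e0; exists e => // w' h.
apply: le_lt_trans h; have := enorm_triangle_sub (w' - c) (w - c).
by rewrite opprB addrA subrK.
Qed.

Lemma measurable_enorm (c : Cn) :
  measurable_fun setT (fun p : Cpow R n => enorm (vec p - c) : measurableTypeR R).
Proof.
by apply: (measurable_continuous_vec (f := fun w => enorm (w - c))) => // p _; exact: continuous_enorm.
Qed.

Definition preball (c : Cn) (r : R) : set (Cpow R n) := @vec R n @^-1` eball c r.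

Lemma measurable_preball (c : Cn) r : measurable (preball c r).
Proof.
have -> : preball c r = (fun p => enorm (vec p - c)) @^-1` [set` `]-oo, `|r|[ ].
  apply/seteqP; split => p /=; rewrite in_itv/= -eballE ?normr_ge0// /preball /eball/=.
    by rewrite real_normK ?num_real.
  by rewrite real_normK ?num_real.
by rewrite -[X in measurable X]setTI; apply: measurable_enorm.
Qed.

Lemma ge0_integral_affine (a c : nat -> R[i]) (D : set (Cpow R n))
    (F : Cpow R n -> \bar R) : (forall k, a k != 0) ->
    measurable D -> measurable_fun D F -> (forall p, D p -> 0 <= F p)%E ->
  (\int[muC]_(p in D) F p = (\prod_(k < n) sqmod (a k))%:E *
   \int[muC]_(p in affCn a c @^-1` D) F (affCn a c p))%E.
Proof.
move=> a0 mD mF F0.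
rewrite integral_mkcond [in RHS]integral_mkcond.
have mF' : measurable_fun setT (F \_ D).
  by apply/(measurable_restrict F mD measurableT); rewrite setTI.
have F0' p : (0 <= (F \_ D) p)%E.
  by rewrite patchE; case: ifPn => // /set_mem; exact: F0.
have := integral_affCn c a0 mF' F0'.
rewrite [X in X = _ -> _](_ : _ = \int[muC]_p ((fun q => F (affCn a c q)) \_
  (affCn a c @^-1` D)) p)%E; last first.
  apply: eq_integral => p _; rewrite !patchE.
  have -> : (affCn a c p \in D) = (p \in affCn a c @^-1` D).
    by apply/idP/idP; rewrite !inE.
  by [].
move=> ->; rewrite muleA -EFinM divff ?mul1e//.
by apply/prodf_neq0 => k _; rewrite sqmod_eq0.
Qed.

(** Applying the formula for nonnegative functions to the positive and negative
    parts extends the change of variables to integrable functions. *)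
Lemma integrable_affCn (a c : nat -> R[i]) (D : set (Cpow R n))
    (h : Cpow R n -> R) : (forall k, a k != 0) -> measurable D ->
    muC.-integrable D (EFin \o h) ->
  muC.-integrable (affCn a c @^-1` D) (EFin \o (h \o affCn a c)) /\
  \int[muC]_(p in D) h p = (\prod_(k < n) sqmod (a k)) *
  \int[muC]_(p in affCn a c @^-1` D) h (affCn a c p).
Proof.
move=> a0 mD ih; have /integrableP[mh hoo] := ih.
set D' := affCn a c @^-1` D.
have mD' : measurable D'.
  by rewrite -[X in measurable X]setTI; exact: measurable_affCn.
set s := \prod_(k < n) _.
have s0 : 0 <= s by apply: prodr_ge0 => k _; exact: sqmod_ge0.
have sn0 : s != 0 by apply/prodf_neq0 => k _; rewrite sqmod_eq0.
have mh' : measurable_fun D' (EFin \o (h \o affCn a c)).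
  apply: (measurable_comp mD _ mh); first by move=> _ [p Dp <-].
  by apply: measurable_funTS; exact: measurable_affCn.
have ih' : muC.-integrable D' (EFin \o (h \o affCn a c)).
  apply/integrableP; split => //.
  have E := ge0_integral_affine c a0 mD (measurableT_comp (@abse_measurable _ _) mh) (fun p _ => abse_ge0 _).
  rewrite -(@lte_pmul2l _ s%:E)//; last by rewrite lte_fin lt_neqAle eq_sym sn0.
  apply: (le_lt_trans (y := (\int[muC]_(p in D) `|(h p)%:E|)%E)).
    by rewrite E.
  by rewrite gt0_muley// lte_fin lt_neqAle eq_sym sn0.
split => //; rewrite /Rintegral.
rewrite -[s]/(fine s%:E) -fineM//; last exact: integrable_fin_num.
congr fine; rewrite integralE [in RHS]integralE.
have -> : (\int[muC]_(p in D) (fun x => (h x)%:E)^\+ p =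
    s%:E * \int[muC]_(p in D') (fun x => (h (affCn a c x))%:E)^\+ p)%E.
  rewrite (ge0_integral_affine c a0 mD (measurable_funepos mh) (fun p _ => funepos_ge0 _ p)).
  by congr (_ * _)%E; apply: eq_integral => p _; rewrite !funeposE.
have -> : (\int[muC]_(p in D) (fun x => (h x)%:E)^\- p =
    s%:E * \int[muC]_(p in D') (fun x => (h (affCn a c x))%:E)^\- p)%E.
  rewrite (ge0_integral_affine c a0 mD (measurable_funeneg mh) (fun p _ => funeneg_ge0 _ p)).
  by congr (_ * _)%E; apply: eq_integral => p _; rewrite !funenegE.
rewrite [RHS]muleBr//.
apply: fin_num_adde_defr; exact: (integrable_pos_fin_num mD' ih').
Qed.

Lemma preimage_preball (a : R[i]) (c w : Cn) (r : R) : a != 0 ->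
  affCn (fun _ => a) (cofn c) @^-1` (preball w r) =
  preball ((a^-1 : R[i]^o) *: (w - c)) (r / cmod a).
Proof.
move=> a0; have sa0 : 0 < sqmod a by rewrite lt_neqAle sqmod_ge0 eq_sym sqmod_eq0 a0.
have E p : \sum_(j < n) sqmod (vec p 0 j - ((a^-1 : R[i]^o) *: (w - c)) 0 j) * sqmod a =
    \sum_(j < n) sqmod (((a : R[i]^o) *: vec p + c) 0 j - w 0 j).
  apply: eq_bigr => j _; rewrite !mxE mulrC -sqmodM; congr sqmod.
  by field.
by apply/seteqP; split => p; rewrite /preball /eball/= vec_affCn expr_div_n
  sqr_cmod ltr_pdivlMr// mulr_suml E.
Qed.

Lemma integral_ball_affine (a : R[i]) (c w : Cn) (r : R)
    (F : Cn -> \bar R) : a != 0 ->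
    measurable_fun (preball w r) (F \o @vec R n) ->
    (forall p, preball w r p -> 0 <= F (vec p))%E ->
  (\int[muC]_(p in preball w r) F (vec p) = (sqmod a ^+ n)%:E *
   \int[muC]_(p in preball ((a^-1 : R[i]^o) *: (w - c)) (r / cmod a))
      F ((a : R[i]^o) *: vec p + c)%R)%E.
Proof.
move=> a0 mF F0.
rewrite (ge0_integral_affine (cofn c) (fun _ => a0) (measurable_preball w r) mF)//.
rewrite prodr_const card_ord preimage_preball//; congr (_ * _)%E.
by apply: eq_integral => p _ /=; rewrite vec_affCn.
Qed.

Lemma measure_ball_scale (r : R) : 0 < r ->
  muC (preball 0 r) = (((r ^+ 2) ^+ n)%:E * muC (preball 0 1))%E.
Proof.
move=> r0.
have E x : muC (preball 0 x) = (\int[muC]_(p in preball 0 x) 1)%E.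
  by rewrite integral_cst ?mul1e//; exact: measurable_preball.
rewrite !E (@integral_ball_affine r%:C 0 0 r (fun _ => 1%E))//; last 2 first.
- by rewrite -cmod_eq0 cmod_real normr_eq0 gt_eqF.
- exact: measurable_cst.
rewrite subr0 scaler0 cmod_real gtr0_norm// divff ?gt_eqF//.
by rewrite -sqr_cmod cmod_real real_normK// num_real.
Qed.

End affine_vec.

Section ball_volume.
Context (R : realType).
Local Notation mu := (@lebesgue_measure R).

Fixpoint gamma_prim (m : nat) (t : R) : R :=
  if m is k.+1 then k.+1%:R * gamma_prim k t - t ^+ k.+1 * expR (- t)
  else - expR (- t).

Lemma is_derive_expRN (t : R) : is_derive t 1 (fun t : R => expR (- t)) (- expR (- t)).
Proof. by apply: is_derive_eq; rewrite mulrN1. Qed.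

Lemma is_derive_pow m (t : R) : is_derive t 1 (fun t : R => t ^+ m.+1) (m.+1%:R * t ^+ m).
Proof.
have h := @is_deriveX R R id m.+1 t 1 1 (is_derive_id _ _).
by move: h; rewrite exprfctE => h; apply: is_derive_eq; rewrite /= /GRing.scale/= mulr1.
Qed.

Lemma is_derive_gamma_prim m (t : R) :
  is_derive t 1 (gamma_prim m) (t ^+ m * expR (- t)).
Proof.
have he := is_derive_expRN t.
elim: m => [|m IH].
  rewrite expr0 mul1r; have h := is_deriveN he.
  by apply: is_derive_eq; rewrite opprK.
apply: (is_derive_eq (is_deriveB (is_deriveZ m.+1%:R IH) (is_deriveM (is_derive_pow m t) he))).
by rewrite /GRing.scale/=; ring.
Qed.

Lemma gamma_prim0 m : gamma_prim m 0 = - m`!%:R.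
Proof.
elim: m => [|m IH] /=; first by rewrite oppr0 expR0.
by rewrite IH expr0n/= mul0r subr0 mulrN -natrM.
Qed.

Lemma cvg_pow_expRN m : t ^+ m * expR (- t) @[t --> (+oo : set_system R)] --> (0 : R).
Proof.
apply: (@squeeze_cvgr _ _ _ _ (cst 0) (fun t => m.+1`!%:R / t)); last 2 first.
- exact: cvg_cst.
- rewrite -[X in _ --> X](mulr0 m.+1`!%:R); apply: cvgMl_tmp.
  apply/gtr0_cvgV0 => //; exact: nbhs_pinfty_gt.
near=> t.
have t0 : 0 < t by near: t; exact: nbhs_pinfty_gt.
rewrite mulr_ge0 ?expR_ge0 ?exprn_ge0 ?(ltW t0)//= expRN.
rewrite ler_pdivlMr// mulrAC ler_pdivrMr ?expR_gt0// mulrC -ler_pdivrMl ?ltr0n ?fact_gt0//.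
have := expR_ge1Dxn m (ltW t0); rewrite exprS; apply: le_trans.
by rewrite [leLHS]mulrC lerDr.
Unshelve. all: end_near. Qed.

Lemma cvg_gamma_prim m : gamma_prim m t @[t --> (+oo : set_system R)] --> (0 : R).
Proof.
elim: m => [|m IH] /=.
  by rewrite -[X in _ --> X]oppr0; apply: cvgN; exact: cvgr_expR.
rewrite -[X in _ --> X](subr0 (0 : R)) -{1}(mulr0 m.+1%:R); apply: cvgB.
  exact: cvgMl_tmp.
exact: (cvg_pow_expRN m.+1).
Qed.

(** The incomplete Gamma integral at an integer is elementary: [gamma_prim] is
    a primitive that vanishes at infinity. *)
Lemma integral_gamma m (a : R) : 0 <= a ->
  (\int[mu]_(t in `[a, +oo[) (t ^+ m * expR (- t))%:E = (- gamma_prim m a)%:E)%E.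
Proof.
move=> a0; rewrite (@ge0_continuous_FTC2y _ _ (gamma_prim m) a 0).
- by rewrite sub0e.
- by move=> x ax; rewrite mulr_ge0 ?expR_ge0// exprn_ge0// (le_trans a0).
- apply: continuous_subspaceT => x.
  apply: cvgM; first exact: exprn_continuous.
  apply: continuous_comp; [exact: opp_continuous|exact: continuous_expR].
- exact: cvg_gamma_prim.
- by move=> x _; have [] := is_derive_gamma_prim m x.
- apply: cvg_at_right_filter; apply: differentiable_continuous.
  by apply/derivable1_diffP; have [] := is_derive_gamma_prim m a.
- by move=> x _; rewrite derive1E; apply: derive_val; exact: is_derive_gamma_prim.
Qed.

End ball_volume.

Section ball_volume2.
Context (R : realType).
Local Notation mu := (@lebesgue_measure R).

Definition gauss_vec n (p : Cpow R n) : R := expR (- sqn (vec p)).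

Lemma sqn_vecS n (p : Cpow R n.+1) :
  sqn (vec p) = p.1.1 ^+ 2 + p.1.2 ^+ 2 + sqn (vec p.2).
Proof.
rewrite /sqn big_ord_recl !mxE/=; congr (_ + _).
by apply: eq_bigr => j _; rewrite !mxE.
Qed.

Lemma measurable_sqn n : measurable_fun setT (fun p : Cpow R n => sqn (vec p) : measurableTypeR R).
Proof.
have -> : (fun p : Cpow R n => sqn (vec p)) = (fun p => enorm (vec p - 0) ^+ 2).
  by apply/funext => p; rewrite subr0 sqr_enorm.
by apply: measurable_funX; exact: measurable_enorm.
Qed.

Lemma measurable_gauss_vec n : measurable_fun setT (@gauss_vec n : _ -> measurableTypeR R).
Proof.
apply: measurableT_comp; first exact: measurable_expR.
by apply: measurable_funN; exact: measurable_sqn.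
Qed.

Lemma integral_gauss_vec n :
  (\int[lebesgueC R n]_p (gauss_vec p)%:E = (pi ^+ n)%:E)%E.
Proof.
elim: n => [|n IH].
  rewrite integral_dirac// diracT mul1e /gauss_vec.
  by rewrite /sqn big_ord0 oppr0 expR0.
pose mu2 := prodm mu mu.
have mg := @measurable_gauss_vec n.+1.
have mG : measurable_fun setT (EFin \o @gauss_vec n.+1) by exact/measurable_EFinP.
rewrite [LHS](@fubini_tonelli1 _ _ _ _ R mu2 (lebesgueC R n) _ mG); last first.
  by move=> p; rewrite lee_fin expR_ge0.
rewrite /fubini_F /=.
have gE q p : gauss_vec (n := n.+1) (q, p) = gauss_fun q.1 * gauss_fun q.2 * gauss_vec p.
  by rewrite /gauss_vec sqn_vecS /gauss_fun -!expRD/= !opprD.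
have mg1 : measurable_fun setT (fun q : measurableTypeR R * measurableTypeR R =>
    (gauss_fun q.1 * gauss_fun q.2)%:E).
  apply/measurable_EFinP; apply: measurable_funM.
    exact: (measurableT_comp measurable_gauss_fun measurable_fst).
  exact: (measurableT_comp measurable_gauss_fun measurable_snd).
transitivity (\int[mu2]_q ((gauss_fun q.1 * gauss_fun q.2)%:E * (pi ^+ n)%:E))%E.
  apply: eq_integral => q _; rewrite -IH -ge0_integralZl//.
  - by apply: eq_integral => p _; rewrite gE EFinM.
  - by apply/measurable_EFinP; exact: measurable_gauss_vec.
  - by move=> p _; rewrite lee_fin expR_ge0.
  - by rewrite lee_fin mulr_ge0// gauss_fun_ge0.
rewrite ge0_integralZr//; last 2 first.
- by move=> q _; rewrite lee_fin mulr_ge0// gauss_fun_ge0.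
- by rewrite lee_fin exprn_ge0// pi_ge0.
rewrite /mu2 /prodm fubini_tonelli1//; last first.
  by move=> q; rewrite lee_fin mulr_ge0// gauss_fun_ge0.
rewrite /fubini_F/=.
transitivity (\int[mu]_x ((gauss_fun x)%:E * (Num.sqrt pi)%:E) * (pi ^+ n)%:E)%E.
  congr (_ * _)%E; apply: eq_integral => x _; rewrite -integralT_gauss -ge0_integralZl//.
  - by apply/measurable_EFinP; exact: measurable_gauss_fun.
  - by move=> p _; rewrite lee_fin gauss_fun_ge0.
  - by rewrite lee_fin gauss_fun_ge0.
rewrite ge0_integralZr//; last 2 first.
- by apply/measurable_EFinP; exact: measurable_gauss_fun.
- by move=> q _; rewrite lee_fin gauss_fun_ge0.
rewrite integralT_gauss -!EFinM exprS -expr2 sqr_sqrtr//.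
exact: pi_ge0.
Qed.

(** Layer-cake evaluation of the Gaussian integral: integrating e^-t over
    t > |p|^2 first gives the Gaussian, integrating over p first gives the
    volume of the ball of radius sqrt t. *)
Lemma measure_ball1 n :
  lebesgueC R n (preball 0 1) = (pi ^+ n / n`!%:R)%:E.
Proof.
set V := lebesgueC R n (preball 0 1).
pose f : measurableTypeR R * Cpow R n -> \bar R := fun q =>
  (\1_([set q | sqn (vec q.2) < q.1]) q * expR (- q.1))%:E.
have mS : measurable [set q : measurableTypeR R * Cpow R n | sqn (vec q.2) < q.1].
  rewrite (_ : [set q | _] = (fun q => q.1 - sqn (vec q.2)) @^-1` [set` `]0, +oo[ ]).
    rewrite -[X in measurable X]setTI; apply: (_ : measurable_fun setT _) => //.
    apply: measurable_funB; first exact: measurable_fst.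
    exact: (measurableT_comp (@measurable_sqn n) measurable_snd).
  by apply/seteqP; split => q /=; rewrite in_itv/= andbT subr_gt0.
have mf : measurable_fun setT f.
  apply/measurable_EFinP; apply: measurable_funM; first exact: measurable_indic.
  apply: measurableT_comp; first exact: measurable_expR.
  by apply: measurable_funN; exact: measurable_fst.
have f0 q : (0 <= f q)%E by rewrite lee_fin mulr_ge0 ?expR_ge0.
have mexp : measurable_fun setT (fun t : measurableTypeR R => (expR (- t))%:E).
  apply/measurable_EFinP.
  by apply: measurableT_comp; [exact: measurable_expR|exact: measurable_funN].
have T := @fubini_tonelli _ _ _ _ R mu (lebesgueC R n) f mf f0.
have E2 : (\int[lebesgueC R n]_p \int[mu]_t f (t, p) = (pi ^+ n)%:E)%E.
  rewrite -integral_gauss_vec; apply: eq_integral => p _.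
  transitivity (\int[mu]_(t in `]sqn (vec p), +oo[) (expR (- t))%:E)%E.
    rewrite [RHS]integral_mkcond; apply: eq_integral => t _; rewrite patchE /f indicE /=.
    have [h|h] := ltP (sqn (vec p)) t.
      by rewrite !mem_set ?mul1r//= in_itv/= h.
    by rewrite !memNset ?mul0r//= ?in_itv/= ltNge h.
  rewrite integral_itv_obnd_cbnd//; last exact: measurable_funTS.
  transitivity (\int[mu]_(t in `[sqn (vec p), +oo[) (t ^+ 0 * expR (- t))%:E)%E.
    by apply: eq_integral => t _; rewrite expr0 mul1r.
  by rewrite integral_gamma ?sqn_ge0//= opprK.
have E1 : (\int[mu]_t \int[lebesgueC R n]_p f (t, p) = (n`!%:R)%:E * V)%E.
  transitivity (\int[mu]_(t in `]0%R, +oo[) ((t ^+ n * expR (- t))%:E * V))%E.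
    rewrite [RHS]integral_mkcond; apply: eq_integral => t _; rewrite patchE.
    have -> : (\int[lebesgueC R n]_p f (t, p) =
        (expR (- t))%:E * \int[lebesgueC R n]_p (\1_([set p | sqn (vec p) < t]) p)%:E)%E.
      rewrite -ge0_integralZl//.
      - by apply: eq_integral => p _; rewrite /f -EFinM mulrC !indicE.
      - apply/measurable_EFinP; apply: measurable_indic.
        rewrite (_ : [set p | _] = (fun p => sqn (vec p)) @^-1` [set` `]-oo, t[ ]).
          by rewrite -[X in measurable X]setTI; apply: measurable_sqn.
        by apply/seteqP; split => q /=; rewrite in_itv.
    have [h|h] := ltP 0 t.
      rewrite mem_set/=; last by rewrite in_itv/= h.
      have SE : [set p : Cpow R n | sqn (vec p) < t] = preball 0 (Num.sqrt t).
        apply/seteqP; split => p; rewrite /preball/= eball0E ?sqrtr_ge0//.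
          by rewrite /enorm ltr_sqrt.
        by rewrite /enorm ltr_sqrt.
      rewrite SE integral_indic ?setIT; [|exact: measurableT|exact: measurable_preball].
      have rt0 : 0 < Num.sqrt t by rewrite sqrtr_gt0.
      have := measure_ball_scale n rt0; rewrite sqr_sqrtr ?(ltW h)// => SB.
      transitivity ((expR (- t))%:E * ((t ^+ n)%:E * V))%E.
        by congr (_ * _)%E; exact: SB.
      by rewrite muleA -EFinM mulrC.
    rewrite memNset/=; last by rewrite in_itv/= ltNge h.
    rewrite integral0_eq ?mule0// => p _; rewrite indicE memNset//=.
    by apply/negP; rewrite -leNgt (le_trans h)// sqn_ge0.
  have mp : measurable_fun (`]0%R, +oo[ : set (measurableTypeR R))
      (fun t : measurableTypeR R => (t ^+ n * expR (- t))%:E).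
    apply/measurable_EFinP/measurable_funTS; apply: measurable_funM.
      by apply: measurable_funX.
    by apply: measurableT_comp; [exact: measurable_expR|exact: measurable_funN].
  have p0 t : (`]0%R, +oo[%classic : set (measurableTypeR R)) t ->
      (0 <= (t ^+ n * expR (- t))%:E)%E.
    rewrite /= in_itv/= andbT => t0.
    by rewrite lee_fin mulr_ge0 ?expR_ge0// exprn_ge0// ltW.
  rewrite (ge0_integralZr mu _ mp p0)//; last exact: measure_ge0.
  rewrite integral_itv_obnd_cbnd//.
  by rewrite integral_gamma// gamma_prim0 opprK.
move: T; rewrite E1 E2 => T.
have n0 : n`!%:R != 0 :> R by rewrite pnatr_eq0 -lt0n fact_gt0.
have -> : V = ((n`!%:R^-1)%:E * ((n`!%:R)%:E * V))%E.
  by rewrite muleA -EFinM mulVf// mul1e.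
by rewrite T -EFinM mulrC.
Qed.

Lemma measure_ball n r : 0 < r ->
  lebesgueC R n (preball 0 r) = (pi ^+ n * (r ^+ 2) ^+ n / n`!%:R)%:E.
Proof.
move=> r0; rewrite measure_ball_scale// measure_ball1 -EFinM; congr EFin.
by rewrite mulrCA mulrA.
Qed.

End ball_volume2.

(** * Complex differentials *)

Section complex_differential.
Context (R : realType) (n : nat).
Local Notation Cn := (Cn R n).
Implicit Types (f g : Cn -> R[i]^o) (w h : Cn) (L : 'I_n -> R[i]).

Definition lform L h : R[i]^o := \sum_(j < n) L j * (h 0 j : R[i]).

Lemma lform_linear L : linear (lform L).
Proof.
move=> a u v; rewrite /lform /GRing.scale/= mulr_sumr -big_split/=.
by apply: eq_bigr => j _; rewrite !mxE mulrDr mulrCA.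
Qed.

HB.instance Definition _ L :=
  GRing.isLinear.Build R[i]^o Cn R[i]^o _ (lform L) (lform_linear L).

Lemma mxnorm_le_enorm h : `|h| <= (enorm h)%:C.
Proof.
rewrite [leLHS]/Num.norm/= mx_normE.
have e0 := enorm_ge0 h.
have e1 : 0 <= (enorm h)%:C :> R[i] by rewrite lecR.
rewrite (_ : (enorm h)%:C = (NngNum e1)%:num)// num_le.
apply/bigmax_leP; split=> //= -[i j] _; rewrite -num_le/=.
by rewrite (ord1 i) normcmod lecR cmod_coord.
Qed.

Lemma enorm_le_mxnorm h : (enorm h)%:C <= n%:R * `|h|.
Proof.
apply: (@le_trans _ _ (\sum_(j < n) `|h 0 j|)).
  rewrite (eq_bigr (fun j => (cmod (h 0 j : R[i]))%:C)) => [|j _]; last exact: normcmod.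
  by rewrite -rmorph_sum lecR; exact: enorm_le_sum.
apply: (@le_trans _ _ (\sum_(j < n) `|h|)).
  apply: ler_sum => j _; rewrite [leRHS]/Num.norm/= mx_normE.
  have -> : `|h 0 j| = (`|h ((0 : 'I_1), j).1 ((0 : 'I_1), j).2|%:nng)%:num :> R[i] by [].
  by rewrite num_le; exact: (le_bigmax _ (fun i => `|h i.1 i.2|%:nng)).
by rewrite sumr_const card_ord -[_ *+ n]mulr_natl.
Qed.

Definition coefsum L : R := \sum_(j < n) cmod (L j).

Lemma coefsum_ge0 L : 0 <= coefsum L.
Proof. by apply: sumr_ge0 => j _; exact: cmod_ge0. Qed.

Lemma lform_bound L h : cmod (lform L h) <= coefsum L * enorm h.
Proof.
apply: le_trans (cmod_sum _ _ _) _; rewrite /coefsum mulr_suml.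
apply: ler_sum => j _; rewrite cmodM ler_wpM2l ?cmod_ge0//.
exact: cmod_coord.
Qed.

Lemma continuous_lform L : continuous (lform L).
Proof.
move=> w A /nbhs_cmodP[e e0 eA]; apply/nbhs_enormP.
exists (e / (coefsum L + 1)); first by rewrite divr_gt0// ltr_wpDl// coefsum_ge0.
move=> w' hw; apply: eA; rewrite -[_ - _](linearB (lform L)).
apply: le_lt_trans (lform_bound _ _) _.
apply: (@le_lt_trans _ _ ((coefsum L + 1) * enorm (w' - w))).
  by rewrite ler_wpM2r ?enorm_ge0// lerDl.
by rewrite mulrC -ltr_pdivlMr// ltr_wpDl// coefsum_ge0.
Qed.

(** Differentiability at w with differential [lform L], read off in the
    Euclidean norm; quantitative estimates start from this form. *)
Definition cdiff_at f w L :=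
  forall e : R, 0 < e -> exists2 d : R, 0 < d & forall h, enorm h < d ->
    cmod (f (w + h) - f w - lform L h : R[i]) <= e * enorm h.

(** The complex partial derivative in the j-th coordinate. *)
Definition pd (j : 'I_n) f w : R[i] := 'd f w (ej R j).

Lemma ejE h : h = \sum_(j < n) (h 0 j) *: ej R j.
Proof. by rewrite {1}(row_sum_delta h). Qed.

Lemma diff_lform f w h : differentiable f w ->
  'd f w h = lform (fun j => pd j f w) h.
Proof.
move=> df; rewrite {1}(ejE h) linear_sum/=; apply: eq_bigr => j _.
by rewrite linearZ /pd mulrC.
Qed.

Lemma enorm_small_near (P : set Cn) :
  (\forall h \near (0 : Cn), P h) <-> exists2 d : R, 0 < d & forall h, enorm h < d -> P h.
Proof.
split.
  by move=> /nbhs_enormP[d d0 dP]; exists d => // h hd; apply: dP; rewrite subr0.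
move=> [d d0 dP]; apply/nbhs_enormP; exists d => // h; rewrite subr0; exact: dP.
Qed.

Lemma lecR_pos (x : R[i]) : 0 < x -> exists2 e : R, 0 < e & x = e%:C.
Proof.
move=> x0; exists (complex.Re x).
  by move: x0; rewrite ltcE/= => /andP[].
by move: x0; rewrite ltcE/= => /andP[/eqP]; case: x => a b /= ->.
Qed.

Lemma differentiable_cdiff f w : differentiable f w -> cdiff_at f w (fun j => pd j f w).
Proof.
move=> df e e0; have /eqaddoP H := diff_locally df.
have e1 : 0 < e%:C :> R[i] by rewrite ltcR.
have /enorm_small_near[d d0 dP] := H _ e1.
exists d => // h /dP /=; rewrite !fctE /= => hh.
rewrite -lecR -normcmod -diff_lform// rmorphM.
rewrite [h + w]addrC opprD addrA in hh; apply: le_trans hh _.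
rewrite ler_wpM2l//; last exact: mxnorm_le_enorm.
exact: ltW.
Qed.

Lemma cdiff_differentiable f w L : cdiff_at f w L ->
  differentiable f w /\ forall j, pd j f w = L j.
Proof.
move=> H.
have E : f \o shift w = cst (f w) + lform L +o_ (0 : Cn) id.
  apply/eqaddoP => e' /lecR_pos[e e0 ->].
  have e1 : 0 < e / n.+1%:R by rewrite divr_gt0.
  have [d d0 dP] := H _ e1; apply/enorm_small_near; exists d => // h /dP /=.
  rewrite !fctE /= [h + w]addrC opprD addrA => hh.
  rewrite normcmod; apply: (@le_trans _ _ (e / n.+1%:R * enorm h)%:C).
    by rewrite lecR.
  rewrite rmorphM/=; apply: (@le_trans _ _ ((e / n.+1%:R)%:C * (n%:R * `|h|))).
    by rewrite ler_wpM2l ?enorm_le_mxnorm// lecR ltW.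
  rewrite mulrA ler_wpM2r//.
  have -> : n%:R = (n%:R : R)%:C :> R[i] by rewrite rmorph_nat.
  rewrite -rmorphM lecR -mulrA ler_piMr ?(ltW e0)// mulrC ler_pdivrMr// mul1r.
  by rewrite ler_nat.
have cL := @continuous_lform L.
have dE : 'd f w = lform L :> (Cn -> R[i]^o) by exact: diff_unique.
split.
  by apply/diff_locallyP; rewrite dE.
move=> j; rewrite /pd dE /lform (bigD1 j)//= big1 => [|i ij].
  by rewrite mxE !eqxx mulr1 addr0.
by rewrite mxE (negbTE ij) mulr0.
Qed.

Definition ccont f w := forall e : R, 0 < e -> exists2 d : R, 0 < d &
  forall w', enorm (w' - w) < d -> cmod (f w' - f w : R[i]) < e.

Lemma cdiff_ccont f w L : cdiff_at f w L -> ccont f w.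
Proof.
move=> H e e0; have [d d0 dP] := H 1 ltr01.
have b0 : 0 < coefsum L + 2 by rewrite ltr_wpDl// coefsum_ge0.
exists (Num.min d (e / (coefsum L + 2))) => [|w']; first by rewrite lt_min d0 divr_gt0.
rewrite lt_min => /andP[h1 h2]; have := dP _ h1; rewrite [w + _]addrC subrK mul1r => h3.
have -> : f w' - f w = (f w' - f w - lform L (w' - w)) + lform L (w' - w) :> R[i].
  by rewrite subrK.
apply: le_lt_trans (cmodD _ _) _.
apply: (@le_lt_trans _ _ (enorm (w' - w) + coefsum L * enorm (w' - w))).
  by rewrite lerD// lform_bound.
apply: (@le_lt_trans _ _ ((coefsum L + 2) * enorm (w' - w))).
  rewrite -{1}[enorm (w' - w)]mul1r -mulrDl ler_wpM2r ?enorm_ge0//; lra.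
by rewrite mulrC -ltr_pdivlMr.
Qed.

Lemma ccont_Re f w : ccont f w -> {for w, continuous (fun w => complex.Re (f w))}.
Proof.
move=> H; apply: continuous_enormP => e /H[d d0 dP]; exists d => // w' /dP.
by apply: le_lt_trans; rewrite -cReN -cReD; exact: Re_le_cmod.
Qed.

Lemma ccont_Im f w : ccont f w -> {for w, continuous (fun w => complex.Im (f w))}.
Proof.
move=> H; apply: continuous_enormP => e /H[d d0 dP]; exists d => // w' /dP.
by apply: le_lt_trans; rewrite -cImN -cImD; exact: Im_le_cmod.
Qed.

Lemma ccont_cst (c : R[i]) w : ccont (fun _ => c) w.
Proof. by move=> e e0; exists 1 => // w' _; rewrite subrr cmod0. Qed.

Lemma ccontD f g w : ccont f w -> ccont g w -> ccont (fun w => f w + g w) w.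
Proof.
move=> F G e e0; have e2 : 0 < e / 2 by rewrite divr_gt0.
have [d1 d10 h1] := F _ e2; have [d2 d20 h2] := G _ e2.
exists (Num.min d1 d2) => [|w']; first by rewrite lt_min d10.
rewrite lt_min => /andP[/h1 a /h2 b].
have -> : f w' + g w' - (f w + g w) = (f w' - f w) + (g w' - g w) :> R[i] by ring.
apply: le_lt_trans (cmodD _ _) _; lra.
Qed.

Lemma ccontM f g w : ccont f w -> ccont g w -> ccont (fun w => (f w : R[i]) * g w) w.
Proof.
move=> F G e e0.
have B0 : 0 < cmod (f w) + cmod (g w) + 1.
  by rewrite ltr_wpDl// addr_ge0// cmod_ge0.
set B := _ + 1 in B0; pose e1 := Num.min 1 (e / B / 2).
have e10 : 0 < e1 by rewrite lt_min ltr01 !divr_gt0.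
have [d1 d10 h1] := F _ e10; have [d2 d20 h2] := G _ e10.
exists (Num.min d1 d2) => [|w']; first by rewrite lt_min d10.
rewrite lt_min => /andP[/h1 a /h2 b].
have -> : (f w' : R[i]) * g w' - (f w : R[i]) * g w =
  ((f w' - f w) * (g w' - g w) + (f w : R[i]) * (g w' - g w) + (f w' - f w) * (g w : R[i]))%R :> R[i].
  by ring.
apply: le_lt_trans (cmodD _ _) _; apply: le_lt_trans (lerD (cmodD _ _) (lexx _)) _.
rewrite !cmodM; set x := cmod (_ - _) in a *; set y := cmod (_ - _) in b *.
have x0 : 0 <= x by exact: cmod_ge0. have y0 : 0 <= y by exact: cmod_ge0.
have e1B : e1 * B <= e / 2.
  rewrite -ler_pdivlMr//; apply: le_trans (_ : e / B / 2 <= _).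
    by rewrite ge_min lexx orbT.
  by rewrite mulrAC.
have x1 : x <= 1 by rewrite (le_trans (ltW a))// ge_min lexx.
have F0 : 0 <= cmod (f w) by exact: cmod_ge0.
have G0 : 0 <= cmod (g w) by exact: cmod_ge0.
have t1 : x * y <= e1.
  by apply: (@le_trans _ _ (1 * y)); rewrite ?ler_wpM2r// mul1r ltW.
have t2 : cmod (f w) * y <= cmod (f w) * e1 by rewrite ler_wpM2l// ltW.
have t3 : x * cmod (g w) <= e1 * cmod (g w) by rewrite ler_wpM2r// ltW.
have : e1 * B = e1 + cmod (f w) * e1 + e1 * cmod (g w) by rewrite /B; ring.
lra.
Qed.

Lemma ccont_conj f w : ccont f w -> ccont (fun w => (f w : R[i])^*) w.
Proof.
move=> F e /F[d d0 dP]; exists d => // w' /dP.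
by rewrite -rmorphB cmod_conj.
Qed.

Lemma ccont_sum (I : Type) (r : seq I) (P : pred I) (F : I -> Cn -> R[i]^o) w :
  (forall i, P i -> ccont (F i) w) -> ccont (fun w => \sum_(i <- r | P i) F i w) w.
Proof.
move=> H; elim: r => [|i r IH].
  have -> : (fun w => \sum_(i <- [::] | P i) F i w) = (fun _ => 0 : R[i]).
    by apply/funext => u; rewrite big_nil.
  exact: ccont_cst.
have -> : (fun w => \sum_(i <- i :: r | P i) F i w) =
  (fun w => (if P i then F i w else 0) + \sum_(i <- r | P i) F i w).
  by apply/funext => u; rewrite big_cons; case: (P i); rewrite ?add0r.
apply: ccontD => //; case Pi: (P i); [exact: H|exact: ccont_cst].
Qed.

Lemma ccont_ext f g w : (exists2 d : R, 0 < d & forall w', enorm (w' - w) < d -> f w' = g w') ->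
  ccont f w -> ccont g w.
Proof.
move=> [d d0 dE] F e /F[d' d'0 d'P]; exists (Num.min d d'); first by rewrite lt_min d0.
move=> w'; rewrite lt_min => /andP[h1 h2].
by rewrite -(dE _ h1) -dE ?subrr ?enorm0//; exact: d'P.
Qed.

End complex_differential.

(** * Complex-valued integrals *)

Section complex_integral.
Context d (T : measurableType d) (R : realType) (mu : {measure set T -> \bar R}).
Implicit Types (D : set T) (h g : T -> R[i]).

Definition cintegrable D h :=
  mu.-integrable D (EFin \o (fun x => complex.Re (h x))) /\
  mu.-integrable D (EFin \o (fun x => complex.Im (h x))).

Definition cint D h : R[i] :=
  (\int[mu]_(x in D) complex.Re (h x)) +i* (\int[mu]_(x in D) complex.Im (h x)).

Lemma eq_cint D h g : (forall x, D x -> h x = g x) -> cint D h = cint D g.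
Proof.
by move=> hg; congr Complex; apply: eq_Rintegral => x /set_mem /hg ->.
Qed.

Lemma eq_cintegrable D h g : measurable D -> (forall x, D x -> h x = g x) ->
  cintegrable D h -> cintegrable D g.
Proof.
move=> mD hg [h1 h2]; split.
  by apply: eq_integrable h1 => // x /set_mem /hg /= ->.
by apply: eq_integrable h2 => // x /set_mem /hg /= ->.
Qed.

Lemma cintegrableD D h g : measurable D -> cintegrable D h -> cintegrable D g ->
  cintegrable D (fun x => h x + g x).
Proof.
move=> mD [h1 h2] [g1 g2]; split.
  apply: eq_integrable (integrableD mD h1 g1) => // x _ /=.
  by rewrite -EFinD cReD.
apply: eq_integrable (integrableD mD h2 g2) => // x _ /=.
by rewrite -EFinD cImD.
Qed.

Lemma cintD D h g : measurable D -> cintegrable D h -> cintegrable D g ->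
  cint D (fun x => h x + g x) = cint D h + cint D g.
Proof.
move=> mD [h1 h2] [g1 g2]; rewrite /cint.
under eq_Rintegral do rewrite cReD.
under [in X in _ +i* X]eq_Rintegral do rewrite cImD.
by rewrite !RintegralD.
Qed.

Lemma integrableRZ D (a : R) (f : T -> R) : measurable D ->
  mu.-integrable D (EFin \o f) -> mu.-integrable D (EFin \o (fun x => a * f x)).
Proof.
by move=> mD hf; apply: eq_integrable (integrableZl mD a hf) => // x _ /=; rewrite EFinM.
Qed.

Lemma cintegrableZ D (a : R[i]) h : measurable D -> cintegrable D h ->
  cintegrable D (fun x => a * h x).
Proof.
move=> mD [h1 h2]; split.
  have i1 := integrableRZ (complex.Re a) mD h1.
  have i2 := integrableRZ (complex.Im a) mD h2.
  by apply: eq_integrable (integrableB mD i1 i2) => // x _ /=; rewrite -EFinB cReM.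
have i1 := integrableRZ (complex.Re a) mD h2.
have i2 := integrableRZ (complex.Im a) mD h1.
by apply: eq_integrable (integrableD mD i1 i2) => // x _ /=; rewrite -EFinD cImM.
Qed.

Lemma cintZ D (a : R[i]) h : measurable D -> cintegrable D h ->
  cint D (fun x => a * h x) = a * cint D h.
Proof.
move=> mD [h1 h2]; rewrite /cint.
have i1 := integrableRZ (complex.Re a) mD h1.
have i2 := integrableRZ (complex.Im a) mD h2.
have i3 := integrableRZ (complex.Re a) mD h2.
have i4 := integrableRZ (complex.Im a) mD h1.
apply: eqReIm; rewrite ?cReM ?cImM /=.
  under eq_Rintegral do rewrite cReM.
  by rewrite RintegralB// !RintegralZl.
under eq_Rintegral do rewrite cImM.
by rewrite RintegralD// !RintegralZl.
Qed.

Lemma cintegrableN D h : measurable D -> cintegrable D h -> cintegrable D (fun x => - h x).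
Proof.
move=> mD /(cintegrableZ (-1) mD); apply: eq_cintegrable => // x _.
by rewrite mulN1r.
Qed.

Lemma cintN D h : measurable D -> cintegrable D h -> cint D (fun x => - h x) = - cint D h.
Proof.
move=> mD ih; rewrite -mulN1r -cintZ//; apply: eq_cint => x _.
by rewrite mulN1r.
Qed.

Lemma cintegrableB D h g : measurable D -> cintegrable D h -> cintegrable D g ->
  cintegrable D (fun x => h x - g x).
Proof. by move=> mD ih ig; apply: cintegrableD => //; exact: cintegrableN. Qed.

Lemma cintB D h g : measurable D -> cintegrable D h -> cintegrable D g ->
  cint D (fun x => h x - g x) = cint D h - cint D g.
Proof.
move=> mD ih ig; rewrite (cintD (g := fun x => - g x))// ?cintN//.
exact: cintegrableN.
Qed.

Lemma cint_conj D h : measurable D -> cintegrable D h ->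
  cint D (fun x => (h x)^*) = (cint D h)^*.
Proof.
move=> mD [h1 h2]; rewrite /cint /=; congr Complex.
  by apply: eq_Rintegral => x _; case: (h x).
rewrite -mulN1r -RintegralZl//.
by apply: eq_Rintegral => x _; rewrite mulN1r; case: (h x).
Qed.

Lemma cintegrable0 D : measurable D -> cintegrable D (fun _ => 0).
Proof. by move=> mD; split => /=; exact: integrable0. Qed.

Lemma cint0 D : cint D (fun _ => 0) = 0.
Proof. by rewrite /cint/= /Rintegral integral0. Qed.

Lemma cintegrable_sum (I : Type) (r : seq I) (P : pred I) D (F : I -> T -> R[i]) :
  measurable D -> (forall i, P i -> cintegrable D (F i)) ->
  cintegrable D (fun x => \sum_(i <- r | P i) F i x).
Proof.
move=> mD iF; elim: r => [|i r IH].
  by apply: eq_cintegrable (cintegrable0 mD) => // x _; rewrite big_nil.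
have h : cintegrable D (fun x => (if P i then F i x else 0) + \sum_(j <- r | P j) F j x).
  by apply: cintegrableD => //; case Pi: (P i); [exact: iF|exact: cintegrable0].
by apply: eq_cintegrable h => // x _; rewrite big_cons; case: (P i); rewrite ?add0r.
Qed.

Lemma cint_sum (I : Type) (r : seq I) (P : pred I) D (F : I -> T -> R[i]) :
  measurable D -> (forall i, P i -> cintegrable D (F i)) ->
  cint D (fun x => \sum_(i <- r | P i) F i x) = \sum_(i <- r | P i) cint D (F i).
Proof.
move=> mD iF; elim: r => [|i r IH].
  by rewrite big_nil -[RHS](cint0 D); apply: eq_cint => x _; rewrite big_nil.
rewrite big_cons -IH; case Pi: (P i); last first.
  by apply: eq_cint => x _; rewrite big_cons Pi.
rewrite -cintD//; [|exact: iF|exact: cintegrable_sum].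
by apply: eq_cint => x _; rewrite big_cons Pi.
Qed.

Lemma measurable_cmod D h : measurable_fun D (fun x => complex.Re (h x)) ->
  measurable_fun D (fun x => complex.Im (h x)) ->
  measurable_fun D (fun x => cmod (h x)).
Proof.
move=> m1 m2; apply: (measurableT_comp (f := @Num.sqrt R)).
  by apply: continuous_measurable_fun; exact: sqrt_continuous.
by apply: measurable_funD; apply: measurable_funX.
Qed.

Lemma integrable_cmod D h : measurable D -> cintegrable D h ->
  mu.-integrable D (EFin \o (fun x => cmod (h x))).
Proof.
move=> mD [h1 h2].
have i := integrableD mD (integrable_abse h1) (integrable_abse h2).
apply: le_integrable i => //.
  apply/measurable_EFinP; apply: measurable_cmod; apply/measurable_EFinP.
    by have /integrableP[] := h1.
  by have /integrableP[] := h2.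
move=> x _ /=; rewrite lee_fin ger0_norm ?cmod_ge0// ger0_norm ?addr_ge0//.
exact: cmod_le_ReIm.
Qed.

Lemma cintegrable_dominated D h (G : T -> R) : measurable D ->
  measurable_fun D (fun x => complex.Re (h x)) ->
  measurable_fun D (fun x => complex.Im (h x)) ->
  (forall x, D x -> cmod (h x) <= G x) -> mu.-integrable D (EFin \o G) ->
  cintegrable D h.
Proof.
move=> mD m1 m2 hG iG; split; apply: le_integrable iG => //.
- exact/measurable_EFinP.
- move=> x Dx /=; rewrite lee_fin (le_trans (Re_le_cmod _))//.
  by rewrite (le_trans (hG x Dx))// ler_norm.
- exact/measurable_EFinP.
- move=> x Dx /=; rewrite lee_fin (le_trans (Im_le_cmod _))//.
  by rewrite (le_trans (hG x Dx))// ler_norm.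
Qed.

Lemma cmod_cint D h : measurable D -> cintegrable D h ->
  cmod (cint D h) <= \int[mu]_(x in D) cmod (h x).
Proof.
move=> mD ih; set I := cint D h.
have [I0|I0] := eqVneq I 0.
  by rewrite I0 cmod0 Rintegral_ge0// => x _; exact: cmod_ge0.
(* rotate the integral onto the positive real axis *)
pose u := I^* / (cmod I)%:C.
have c0 : cmod I != 0 by rewrite cmod_eq0.
have cC0 : (cmod I)%:C != 0 :> R[i] by rewrite -(rmorph0 (real_complex R)) (inj_eq (@complexI R)).
have uI : u * I = (cmod I)%:C.
  rewrite /u mulrAC [I^* * I]mulrC mul_conj -sqr_cmod expr2 rmorphM/=.
  by rewrite mulfK.
have cu : cmod u = 1.
  by rewrite /u cmodM cmodV cmod_conj cmod_ger0 ?cmod_ge0// divff.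
have -> : cmod I = complex.Re (cint D (fun x => u * h x)).
  by rewrite cintZ// -/I uI.
rewrite /cint/=; apply: le_Rintegral => //.
- by have [] := cintegrableZ u mD ih.
- exact: integrable_cmod.
- move=> x _; apply: le_trans (ler_norm _) _; apply: le_trans (Re_le_cmod _) _.
  by rewrite cmodM cu mul1r.
Qed.

End complex_integral.

(** * Closed forms on rectangles *)

Section goursat.
Context (R : realType).
Local Notation mu := (@lebesgue_measure R).
Implicit Types (f : R -> R) (a b c d s t x y : R).

Definition segint a b f : R := \int[mu]_(s in `[a, b]) f s.

Lemma continuous_integrable a b f : (forall s, a <= s <= b -> {for s, continuous f}) ->
  mu.-integrable `[a, b] (EFin \o f).
Proof.
move=> cf; apply: continuous_compact_integrable; first exact: segment_compact.
apply: continuous_in_subspaceT => s /set_mem/=; rewrite in_itv/= => hs.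
exact: cf.
Qed.

Lemma segint_split a m b f : a <= m -> m <= b ->
  (forall s, a <= s <= b -> {for s, continuous f}) ->
  segint a b f = segint a m f + segint m b f.
Proof.
move=> am mb cf; have ib := continuous_integrable cf.
have im : mu.-integrable `[m, b] (EFin \o f).
  apply: continuous_integrable => s /andP[h1 h2]; apply: cf.
  by rewrite h2 (le_trans am).
apply/eqP; rewrite /segint addrC -subr_eq Rintegral_itvB//.
apply/eqP; rewrite Rintegral_itv_obnd_cbnd//.
by apply: integrableS im => //; apply: subset_itvr; rewrite bnd_simp.
Qed.

Lemma segintD a b f g : (forall s, a <= s <= b -> {for s, continuous f}) ->
  (forall s, a <= s <= b -> {for s, continuous g}) ->
  segint a b (fun s => f s + g s) = segint a b f + segint a b g.
Proof. by move=> cf cg; rewrite /segint RintegralD//; exact: continuous_integrable. Qed.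

Lemma segint_cst a b k : a <= b -> segint a b (fun _ => k) = k * (b - a).
Proof.
move=> ab; rewrite /segint Rintegral_cst//; congr (_ * _).
rewrite -[RHS]/(fine (b - a)%:E); congr fine.
apply: (etrans (lebesgue_measure_itv `[a, b])); rewrite /= lte_fin.
by case: ltP => // h; congr EFin; apply/esym/eqP; rewrite subr_eq0 eq_le ab h.
Qed.

Lemma segint_approx a b f k e : a <= b ->
  (forall s, a <= s <= b -> {for s, continuous f}) ->
  (forall s, a <= s <= b -> `|f s - k| <= e) ->
  `|segint a b f - k * (b - a)| <= e * (b - a).
Proof.
move=> ab cf fe; rewrite -(segint_cst k ab) /segint.
have i1 := continuous_integrable cf.
have i2 : mu.-integrable `[a, b] (EFin \o (fun _ => k)).
  by apply: continuous_integrable => s _; exact: cvg_cst.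
have cfk s : a <= s <= b -> {for s, continuous (fun s => f s - k)}.
  by move=> hs; apply: cvgB; [exact: cf|exact: cvg_cst].
rewrite -RintegralB//; apply: le_trans (le_normr_Rintegral _ _) _ => //.
  exact: continuous_integrable.
rewrite -(segint_cst e ab) /segint; apply: le_Rintegral => //.
- apply: (continuous_integrable (f := fun s => `|f s - k|)) => s hs.
  by apply: cvg_norm; exact: cfk.
- by apply: continuous_integrable => s _; exact: cvg_cst.
Qed.

Section form.
Variables P Q : R -> R -> R.

(** P ds + Q dt is differentiable at (x, y) with a symmetric Jacobian
    ((A, B), (B, C)), that is, closed in Goursat's sense: no continuity of the
    derivatives is assumed. *)
Definition closed_form_at x y := exists A B C, forall e, 0 < e ->
  exists2 dl, 0 < dl & forall s t, `|s - x| < dl -> `|t - y| < dl ->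
    `|P s t - P x y - A * (s - x) - B * (t - y)| <= e * (`|s - x| + `|t - y|) /\
    `|Q s t - Q x y - B * (s - x) - C * (t - y)| <= e * (`|s - x| + `|t - y|).

(** The boundary integral of P ds + Q dt over the rectangle [a,b] x [c,d],
    opposite sides being grouped. *)
Definition circulation a b c d : R :=
  segint a b (fun s => P s c - P s d) + segint c d (fun t => Q b t - Q a t).

Lemma increment_continuous (f : R -> R) x A :
  (forall e, 0 < e -> exists2 dl, 0 < dl & forall s, `|s - x| < dl ->
    `|f s - f x - A * (s - x)| <= e * `|s - x|) -> {for x, continuous f}.
Proof.
move=> H; apply/cvgrPdist_lt => e e0.
have [dl dl0 hd] := H 1 ltr01.
have B0 : 0 < `|A| + 2 by rewrite ltr_wpDl.
apply/nbhs_ballP; exists (Num.min dl (e / (`|A| + 2))) => /=.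
  by rewrite lt_min dl0 divr_gt0.
move=> s; rewrite /ball/= distrC lt_min => /andP[h1 h2].
have := hd s h1; rewrite mul1r => h3.
rewrite distrC -(subrK (A * (s - x)) (f s - f x)).
apply: le_lt_trans (ler_normD _ _) _; rewrite normrM.
move: h2; rewrite ltr_pdivlMr// => h2; have := normr_ge0 (s - x); lra.
Qed.

Lemma closed_form_continuous x y : closed_form_at x y ->
  [/\ {for x, continuous (fun s => P s y)}, {for y, continuous (fun t => P x t)},
      {for x, continuous (fun s => Q s y)} & {for y, continuous (fun t => Q x t)}].
Proof.
move=> [A [B [C H]]]; split.
- apply: (@increment_continuous _ _ A) => e /H[dl dl0 h]; exists dl => // s hs.
  have := h s y hs; rewrite !(subrr, normr0, mulr0, subr0, addr0).
  by move=> /(_ dl0)[].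
- apply: (@increment_continuous _ _ B) => e /H[dl dl0 h]; exists dl => // s hs.
  have := h x s; rewrite !(subrr, normr0, mulr0, subr0, add0r).
  by move=> /(_ dl0 hs)[].
- apply: (@increment_continuous _ _ B) => e /H[dl dl0 h]; exists dl => // s hs.
  have := h s y hs; rewrite !(subrr, normr0, mulr0, subr0, addr0).
  by move=> /(_ dl0)[].
- apply: (@increment_continuous _ _ C) => e /H[dl dl0 h]; exists dl => // s hs.
  have := h x s; rewrite !(subrr, normr0, mulr0, subr0, add0r).
  by move=> /(_ dl0 hs)[].
Qed.

Variables a0 b0 c0 d0 : R.
Hypothesis clP : forall x y, a0 <= x <= b0 -> c0 <= y <= d0 -> closed_form_at x y.

Definition subrect (r : (R * R) * (R * R)) : bool :=
  [&& a0 <= r.1.1, r.1.1 <= r.1.2, r.1.2 <= b0, c0 <= r.2.1, r.2.1 <= r.2.2 & r.2.2 <= d0].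

Definition circ (r : (R * R) * (R * R)) := circulation r.1.1 r.1.2 r.2.1 r.2.2.

Definition mid (p : R * R) : R := (p.1 + p.2) / 2.
Definition half (i : bool) (p : R * R) : R * R := if i then (p.1, mid p) else (mid p, p.2).
Definition quarter (ij : bool * bool) (r : (R * R) * (R * R)) := (half ij.1 r.1, half ij.2 r.2).

Lemma mid_in p : p.1 <= p.2 -> p.1 <= mid p <= p.2.
Proof. by rewrite /mid => h; apply/andP; split; lra. Qed.

Lemma subrect_quarter ij r : subrect r -> subrect (quarter ij r).
Proof.
case: r => [[a b] [c d]]; case: ij => [i j]; rewrite /subrect/= => /and5P[h1 h2 h3 h4 /andP[h5 h6]].
have /andP[m1 m2] := @mid_in (a, b) h2; have /andP[m3 m4] := @mid_in (c, d) h5.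
by case: i; case: j => /=; apply/and5P; split => //; rewrite ?h1 ?h4 //; rewrite /= in m1 m2 m3 m4;
  try (apply/andP; split => //); lra.
Qed.

Lemma circ_quarter r : subrect r ->
  circ r = circ (quarter (true, true) r) + circ (quarter (true, false) r)
         + circ (quarter (false, true) r) + circ (quarter (false, false) r).
Proof.
case: r => [[a b] [c d]]; rewrite /subrect/= => /and5P[h1 h2 h3 h4 /andP[h5 h6]].
have /andP[m1 m2] := @mid_in (a, b) h2; have /andP[m3 m4] := @mid_in (c, d) h5.
rewrite /circ /= /circulation/=.
set m := mid (a, b) in m1 m2 *; set k := mid (c, d) in m3 m4 *; rewrite /= in m1 m2 m3 m4.
have cl s y : a <= s <= b -> c <= y <= d -> closed_form_at s y.
  move=> /andP[s1 s2] /andP[y1 y2]; apply: clP.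
    by rewrite (le_trans h1 s1) (le_trans s2 h3).
  by rewrite (le_trans h4 y1) (le_trans y2 h6).
have cPP s y y' : a <= s <= b -> c <= y <= d -> c <= y' <= d ->
    {for s, continuous (fun s => P s y - P s y')}.
  by move=> hs hy hy'; apply: cvgB;
    [have [] := closed_form_continuous (cl s y hs hy)|have [] := closed_form_continuous (cl s y' hs hy')].
have cQQ s s' y : a <= s <= b -> a <= s' <= b -> c <= y <= d ->
    {for y, continuous (fun y => Q s y - Q s' y)}.
  by move=> hs hs' hy; apply: cvgB;
    [have [] := closed_form_continuous (cl s y hs hy)|have [] := closed_form_continuous (cl s' y hs' hy)].
have [ca cb cm] : [/\ a <= a <= b, a <= b <= b & a <= m <= b] by rewrite !lexx h2 m1 m2.
have [cc cd ck] : [/\ c <= c <= d, c <= d <= d & c <= k <= d] by rewrite !lexx h5 m3 m4.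
have am s : a <= s <= m -> a <= s <= b by move=> /andP[-> /le_trans->].
have mb s : m <= s <= b -> a <= s <= b by move=> /andP[/(le_trans m1)-> ->].
have ck' s : c <= s <= k -> c <= s <= d by move=> /andP[-> /le_trans->].
have kd s : k <= s <= d -> c <= s <= d by move=> /andP[/(le_trans m3)-> ->].
have EP : segint a b (fun s => P s c - P s d) =
    segint a m (fun s => P s c - P s k) + segint a m (fun s => P s k - P s d)
    + (segint m b (fun s => P s c - P s k) + segint m b (fun s => P s k - P s d)).
  rewrite (segint_split m1 m2); last by move=> s hs; exact: cPP.
  rewrite -!segintD; try by move=> s hs; apply: cPP => //; by [apply: am|apply: mb].
  by congr (_ + _); congr (segint _ _ _); apply/funext => s; rewrite addrA subrK.
have EQ : segint c d (fun t => Q b t - Q a t) =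
    segint c k (fun t => Q b t - Q m t) + segint c k (fun t => Q m t - Q a t)
    + (segint k d (fun t => Q b t - Q m t) + segint k d (fun t => Q m t - Q a t)).
  rewrite (segint_split m3 m4); last by move=> s hs; exact: cQQ.
  rewrite -!segintD; try by move=> s hs; apply: cQQ => //; by [apply: ck'|apply: kd].
  by congr (_ + _); congr (segint _ _ _); apply/funext => s; rewrite addrA subrK.
rewrite EP EQ; ring.
Qed.

Definition big_quarter r : bool * bool :=
  if `|circ r| <= 4 * `|circ (quarter (true, true) r)| then (true, true) else
  if `|circ r| <= 4 * `|circ (quarter (true, false) r)| then (true, false) else
  if `|circ r| <= 4 * `|circ (quarter (false, true) r)| then (false, true) else (false, false).

Definition refine r := quarter (big_quarter r) r.

Lemma refine_circ r : subrect r -> `|circ r| <= 4 * `|circ (refine r)|.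
Proof.
move=> sr; rewrite /refine /big_quarter.
case: ifPn => // /negP; case: ifPn => // /negP; case: ifPn => // /negP n3 n2 n1.
rewrite leNgt; apply/negP => n4; have := circ_quarter sr.
move: n1 n2 n3 n4; set x1 := circ (quarter (true, true) r).
set x2 := circ (quarter (true, false) r); set x3 := circ (quarter (false, true) r).
set x4 := circ (quarter (false, false) r); set x := circ r.
move=> /negP; rewrite -ltNge => n1 /negP; rewrite -ltNge => n2 /negP; rewrite -ltNge => n3 n4 E.
have := ler_normD (x1 + x2 + x3) x4; have := ler_normD (x1 + x2) x3; have := ler_normD x1 x2.
rewrite -E; lra.
Qed.

Definition rseq k := iter k refine ((a0, b0), (c0, d0)).

Hypothesis ab0 : a0 <= b0.
Hypothesis cd0 : c0 <= d0.

Lemma subrect_rseq k : subrect (rseq k).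
Proof.
elim: k => [|k IH]; last exact: subrect_quarter.
by rewrite /subrect/= !lexx ab0 cd0.
Qed.

Lemma width_half i p : (half i p).2 - (half i p).1 = (p.2 - p.1) / 2.
Proof. by case: i; rewrite /= /mid; field. Qed.

Lemma width_rseq k : (rseq k).1.2 - (rseq k).1.1 = (b0 - a0) / 2 ^+ k /\
  (rseq k).2.2 - (rseq k).2.1 = (d0 - c0) / 2 ^+ k.
Proof.
elim: k => [|k [IH1 IH2]]; first by rewrite expr0 !divr1.
rewrite /rseq iterS -/(rseq k) /refine /quarter /= !width_half IH1 IH2 !exprS.
by rewrite !invfM; split; rewrite mulrAC -mulrA.
Qed.

Lemma circ_rseq k : `|circ ((a0, b0), (c0, d0))| <= 4 ^+ k * `|circ (rseq k)|.
Proof.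
elim: k => [|k IH]; first by rewrite expr0 mul1r.
apply: le_trans IH _; rewrite exprSr -mulrA ler_wpM2l ?exprn_ge0//.
by rewrite /rseq iterS; apply: refine_circ; exact: subrect_rseq.
Qed.

Lemma half_nested i p : p.1 <= p.2 -> p.1 <= (half i p).1 /\ (half i p).2 <= p.2.
Proof. by move=> /mid_in/andP[h1 h2]; case: i => /=; split. Qed.

Lemma dist_in_itv a b s x : a <= x -> x <= b -> a <= s -> s <= b -> `|s - x| <= b - a.
Proof. by move=> ax xb as_ sb; rewrite ler_norml; apply/andP; split; lra. Qed.

Lemma nested_limit (u : nat -> R * R) (i : nat -> bool) :
  (forall k, (u k).1 <= (u k).2) -> (forall k, u k.+1 = half (i k) (u k)) ->
  exists x, forall k, (u k).1 <= x <= (u k).2.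
Proof.
move=> h1 h2.
have inc k m : (u k).1 <= (u (k + m)%N).1 /\ (u (k + m)%N).2 <= (u k).2.
  elim: m => [|m [IH1 IH2]]; first by rewrite addn0.
  rewrite addnS h2; have [g1 g2] := half_nested (i (k + m)%N) (h1 (k + m)%N).
  by split; [exact: le_trans IH1 g1|exact: le_trans g2 IH2].
have cross k m : (u k).1 <= (u m).2.
  have [_ e2] := inc m k; have [e1 _] := inc k m.
  by apply: le_trans e1 _; rewrite addnC; apply: le_trans (h1 _) _.
pose S := [set (u k).1 | k in setT].
have hS : has_sup S.
  by split; [exists (u 0%N).1; exists 0%N|exists (u 0%N).2 => _ [k _ <-]].
exists (sup S) => k; apply/andP; split.
  by apply: ub_le_sup; [case: hS|exists k].
by apply: ge_sup; [case: hS|move=> _ [m _ <-]].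
Qed.

(** Bisection keeps at least a quarter of the circulation in one of four
    quarters. Near the limit point the form is linear with symmetric matrix, hence
    exact, up to an error proportional to the diameter times the perimeter, and
    this beats the factor 4 ^ k. *)
Theorem goursat : circulation a0 b0 c0 d0 = 0.
Proof.
have [x hx] : exists x, forall k, (rseq k).1.1 <= x <= (rseq k).1.2.
  apply: (@nested_limit (fun k => (rseq k).1) (fun k => (big_quarter (rseq k)).1)) => // k.
  by have := subrect_rseq k; rewrite /subrect => /and5P[].
have [y hy] : exists y, forall k, (rseq k).2.1 <= y <= (rseq k).2.2.
  apply: (@nested_limit (fun k => (rseq k).2) (fun k => (big_quarter (rseq k)).2)) => // k.
  by have := subrect_rseq k; rewrite /subrect => /and5P[_ _ _ _ /andP[]].
have [A [B [C H]]] := clP (hx 0%N) (hy 0%N).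
set w := (b0 - a0) + (d0 - c0).
have w0 : 0 <= w by rewrite addr_ge0 ?subr_ge0.
have key e : 0 < e -> `|circ ((a0, b0), (c0, d0))| <= e * (4 * w ^+ 2).
  move=> e0; have [dl dl0 hdl] := H e e0.
  have [k hk] : exists k, w / 2 ^+ k < dl.
    have : (fun k => w / 2 ^+ k) @ \oo --> (0 : R).
      rewrite -[X in _ --> X](mulr0 w); apply: cvgMl_tmp.
      have : (fun k => (2^-1 : R) ^+ k) @ \oo --> (0 : R).
        by apply: cvg_expr; rewrite ger0_norm// invf_lt1 ?ltr1n.
      by apply: cvg_trans; apply: near_eq_cvg; near=> k; rewrite exprVn.
    move=> /cvgrPdist_lt /(_ _ dl0) [k _ /(_ k (leqnn k))]; rewrite sub0r normrN => h.
    by exists k; apply: le_lt_trans (ler_norm _) h.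
  apply: le_trans (circ_rseq k) _.
  have := subrect_rseq k; have [wk1 wk2] := width_rseq k.
  have := hx k; have := hy k; rewrite /circ.
  case: (rseq k) wk1 wk2 => [[a b] [c d]] /= wk1 wk2 /andP[y1 y2] /andP[x1 x2].
  rewrite /subrect/= => /and5P[h1 h2 h3 h4 /andP[h5 h6]].
  have k0 : (0 : R) < 2 ^+ k by rewrite exprn_gt0.
  set W := w / 2 ^+ k; have WE : W = (b - a) + (d - c) by rewrite wk1 wk2 /W /w mulrDl.
  have W0 : 0 <= W by rewrite WE addr_ge0 ?subr_ge0.
  have cl s t : a <= s <= b -> c <= t <= d ->
    `|P s t - P x y - A * (s - x) - B * (t - y)| <= e * W /\
    `|Q s t - Q x y - B * (s - x) - C * (t - y)| <= e * W.
    move=> /andP[s1 s2] /andP[t1 t2].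
    have sx : `|s - x| <= b - a := dist_in_itv x1 x2 s1 s2.
    have ty : `|t - y| <= d - c := dist_in_itv y1 y2 t1 t2.
    have sW : `|s - x| <= W by rewrite WE (le_trans sx)// lerDl subr_ge0.
    have tW : `|t - y| <= W by rewrite WE (le_trans ty)// lerDr subr_ge0.
    have [e1 e2] := hdl s t (le_lt_trans sW hk) (le_lt_trans tW hk).
    have eW : e * (`|s - x| + `|t - y|) <= e * W by rewrite ler_wpM2l ?(ltW e0)// WE lerD.
    by split; [exact: le_trans e1 eW|exact: le_trans e2 eW].
  have clQ s t : a <= s <= b -> c <= t <= d -> closed_form_at s t.
    move=> /andP[s1 s2] /andP[t1 t2]; apply: clP.
      by rewrite (le_trans h1 s1) (le_trans s2 h3).
    by rewrite (le_trans h4 t1) (le_trans t2 h6).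
  have cPP s y' y'' : a <= s <= b -> c <= y' <= d -> c <= y'' <= d ->
    {for s, continuous (fun s => P s y' - P s y'')}.
    by move=> hs h' h''; apply: cvgB;
      [have [] := closed_form_continuous (clQ s y' hs h')|have [] := closed_form_continuous (clQ s y'' hs h'')].
  have cQQ s s' y' : a <= s <= b -> a <= s' <= b -> c <= y' <= d ->
    {for y', continuous (fun y => Q s y - Q s' y)}.
    by move=> hs h' h''; apply: cvgB;
      [have [] := closed_form_continuous (clQ s y' hs h'')|have [] := closed_form_continuous (clQ s' y' h' h'')].
  have [ca cb] : a <= a <= b /\ a <= b <= b by rewrite !lexx h2.
  have [cc cd] : c <= c <= d /\ c <= d <= d by rewrite !lexx h5.
  have I1 : `|segint a b (fun s => P s c - P s d) - B * (c - d) * (b - a)| <= 2 * (e * W) * (b - a).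
    apply: segint_approx => //.
      by move=> s hs; exact: cPP.
    move=> s hs; have [p1 _] := cl s c hs cc; have [p2 _] := cl s d hs cd.
    have := ler_normB (P s c - P x y - A * (s - x) - B * (c - y)) (P s d - P x y - A * (s - x) - B * (d - y)).
    set z := _ - _ - _ - _ - (_ - _ - _ - _); have -> : z = P s c - P s d - B * (c - d) by rewrite /z; ring.
    by move: p1 p2; clear; lra.
  have I2 : `|segint c d (fun t => Q b t - Q a t) - B * (b - a) * (d - c)| <= 2 * (e * W) * (d - c).
    apply: segint_approx => //.
      by move=> s hs; exact: cQQ.
    move=> s hs; have [_ p1] := cl b s cb hs; have [_ p2] := cl a s ca hs.
    have := ler_normB (Q b s - Q x y - B * (b - x) - C * (s - y)) (Q a s - Q x y - B * (a - x) - C * (s - y)).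
    set z := _ - _ - _ - _ - (_ - _ - _ - _); have -> : z = Q b s - Q a s - B * (b - a) by rewrite /z; ring.
    by move: p1 p2; clear; lra.
  have I3 : `|circulation a b c d| <= 2 * e * W ^+ 2.
    have := ler_normD (segint a b (fun s => P s c - P s d) - B * (c - d) * (b - a))
       (segint c d (fun t => Q b t - Q a t) - B * (b - a) * (d - c)).
    set z := _ - _ + (_ - _); have -> : z = circulation a b c d by rewrite /z /circulation; ring.
    have -> : 2 * e * W ^+ 2 = 2 * (e * W) * (b - a) + 2 * (e * W) * (d - c) by rewrite expr2 {2}WE; ring.
    by move: I1 I2; clear; lra.
  have E4 : 4 ^+ k * (2 * e * W ^+ 2) = e * (2 * w ^+ 2).
    rewrite /W (_ : (4 : R) = 2 ^+ 2); last by ring.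
    rewrite -exprM mulnC exprM expr_div_n; field.
    by rewrite gt_eqF.
  apply: (@le_trans _ _ (4 ^+ k * (2 * e * W ^+ 2))).
    by rewrite ler_wpM2l ?exprn_ge0.
  rewrite E4 ler_wpM2l ?(ltW e0)// ler_wpM2r ?sqr_ge0// ler_nat //.
apply/eqP; rewrite -normr_le0 leNgt; apply/negP => n0.
have v0 : 0 < 4 * w ^+ 2 + 1 by rewrite ltr_wpDl// mulr_ge0// sqr_ge0.
have := key (`|circ ((a0, b0), (c0, d0))| / (4 * w ^+ 2 + 1)).
rewrite divr_gt0// => /(_ isT); rewrite leNgt => /negP; apply.
rewrite mulrAC ltr_pdivrMr// ltr_pM2l//; lra.
Unshelve. all: end_near. Qed.

End form.
End goursat.

(** * The mean value over the unit circle *)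

Section circle_mean.
Context (R : realType).
Local Notation mu := (@lebesgue_measure R).
Implicit Types (F : R[i] -> R[i]) (z : R[i]).

Definition cdiff1 F z := exists D : R[i], forall e : R, 0 < e ->
  exists2 dl : R, 0 < dl & forall h : R[i], cmod h < dl ->
    cmod (F (z + h) - F z - D * h) <= e * cmod h.

(** The exponential of s + i t. *)
Definition polar (s t : R) : R[i] := (expR s * cos t) +i* (expR s * sin t).

Lemma polarD s t h k : polar (s + h) (t + k) = polar s t * polar h k.
Proof. by rewrite /polar expRD cosD sinD; apply: eqReIm => /=; ring. Qed.

Lemma cmod_polar s t : cmod (polar s t) = expR s.
Proof.
rewrite /cmod /sqmod/= !exprMn -mulrDr cos2Dsin2 mulr1 sqrtr_sqr.
by rewrite ger0_norm// expR_ge0.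
Qed.

Lemma polar2pi s t : polar s (t + 2 * pi) = polar s t.
Proof.
have c2 : cos (2 * pi : R) = 1 by rewrite mulr_natl cos2pi.
have s2 : sin (2 * pi : R) = 0 by rewrite mulr_natl sin2pi.
by rewrite /polar cosD sinD c2 s2 !mulr1 !mulr0 subr0 addr0.
Qed.

Lemma derive_increment (f : R -> R) (x D : R) : is_derive x 1 f D ->
  forall e : R, 0 < e -> exists2 dl : R, 0 < dl &
    forall h : R, `|h| < dl -> `|f (x + h) - f x - D * h| <= e * `|h|.
Proof.
move=> [df fD] e e0.
have : (fun h => h^-1 *: ((f \o shift x) (h *: 1) - f x)) @ 0^' --> D.
  by rewrite -fD; exact: df.
move=> /cvgrPdist_le /(_ e e0); rewrite near_withinE.
move=> /nbhs_ballP[dl /= dl0 H]; exists dl => // h hd.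
have [->|h0] := eqVneq h 0; first by rewrite addr0 subrr mulr0 subr0 normr0 mulr0.
have : `|D - h^-1 * (f (h * 1 + x) - f x)| <= e.
  by have := H h; rewrite /ball/= sub0r normrN => /(_ hd h0).
rewrite mulr1 [h + x]addrC => E.
have -> : f (x + h) - f x - D * h = - ((D - h^-1 * (f (x + h) - f x)) * h).
  by field.
by rewrite normrN normrM ler_wpM2r.
Qed.

Lemma polar_increment (e : R) : 0 < e -> exists2 dl : R, 0 < dl &
  forall h k : R, `|h| < dl -> `|k| < dl ->
    cmod (polar h k - 1 - (h +i* k)) <= e * (`|h| + `|k|).
Proof.
move=> e0; pose e1 := Num.min (e / 8) 1.
have e10 : 0 < e1 by rewrite lt_min ltr01 divr_gt0.
have [d1 d10 h1] := derive_increment (is_derive_expR 0) e10.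
have [d2 d20 h2] := derive_increment (is_derive_cos 0) e10.
have [d3 d30 h3] := derive_increment (is_derive_sin 0) e10.
exists (Num.min (Num.min d1 d2) (Num.min d3 (e1 / 2))).
  by rewrite !lt_min d10 d20 d30 divr_gt0.
move=> h k; rewrite !lt_min => /andP[/andP[a1 _] /andP[_ a4]] /andP[/andP[_ b2] /andP[b3 _]].
have E := h1 h a1; have C := h2 k b2; have S := h3 k b3.
rewrite !add0r expR0 mul1r in E; rewrite !add0r cos0 sin0 oppr0 mul0r subr0 in C.
rewrite !add0r sin0 cos0 subr0 mul1r in S.
apply: le_trans (cmod_le_ReIm _) _ => /=.
have e18 : e1 <= e / 8 by rewrite ge_min lexx.
have e11 : e1 <= 1 by rewrite ge_min lexx orbT.
have hn := normr_ge0 h; have kn := normr_ge0 k.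
have X1 : `|expR h - 1| <= 2 * `|h|.
  have := ler_normD (expR h - 1 - h) h; rewrite subrK => H1.
  have : e1 * `|h| <= 1 * `|h| by rewrite ler_wpM2r.
  lra.
have X2 : expR h <= 2.
  have := ler_norm (expR h - 1); lra.
have X0 := expR_ge0 h.
have R1 : `|expR h * cos k - 1 - h| <= 2 * e1 * (`|h| + `|k|).
  have -> : expR h * cos k - 1 - h = expR h * (cos k - 1) + (expR h - 1 - h) by ring.
  apply: le_trans (ler_normD _ _) _; rewrite normrM (ger0_norm X0).
  have : expR h * `|cos k - 1| <= 2 * (e1 * `|k|) by rewrite ler_pM.
  have : 0 <= e1 * `|h| by rewrite mulr_ge0// ltW.
  lra.
have R2 : `|expR h * sin k - 0 - k| <= 3 * e1 * (`|h| + `|k|).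
  have -> : expR h * sin k - 0 - k = expR h * (sin k - k) + (expR h - 1) * k by ring.
  apply: le_trans (ler_normD _ _) _; rewrite !normrM (ger0_norm X0).
  have : expR h * `|sin k - k| <= 2 * (e1 * `|k|) by rewrite ler_pM.
  have : `|expR h - 1| * `|k| <= e1 * `|k|.
    by rewrite ler_wpM2r//; lra.
  have : 0 <= e1 * `|h| by rewrite mulr_ge0// ltW.
  lra.
have : e1 * (`|h| + `|k|) <= e / 8 * (`|h| + `|k|).
  by rewrite ler_wpM2r// addr_ge0.
have : 0 <= e * (`|h| + `|k|) by rewrite mulr_ge0 ?addr_ge0// ltW.
lra.
Qed.

Lemma polar_comp_increment F x y : x <= 0 -> cdiff1 F (polar x y) ->
  exists D : R[i], forall e, 0 < e -> exists2 dl : R, 0 < dl &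
    forall s t, `|s - x| < dl -> `|t - y| < dl ->
     cmod (F (polar s t) - F (polar x y) - D * ((s - x) +i* (t - y)))
       <= e * (`|s - x| + `|t - y|).
Proof.
move=> x0 [D HD]; set z := polar x y.
have z1 : cmod z <= 1 by rewrite cmod_polar -expR0 ler_expR.
exists (D * z) => e e0.
have D1 : 0 < cmod D + 1 by rewrite ltr_wpDl// cmod_ge0.
pose e1 := Num.min 1 (e / 2 / (cmod D + 1)).
have e10 : 0 < e1 by rewrite lt_min ltr01 !divr_gt0.
have e4 : 0 < e / 4 by rewrite divr_gt0.
have [d1 d10 h1] := HD _ e4; have [d2 d20 h2] := polar_increment e10.
exists (Num.min d2 (d1 / 5)) => [|s t]; first by rewrite lt_min d20 divr_gt0.
rewrite !lt_min => /andP[s1 s2] /andP[t1 t2].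
set N := `|s - x| + `|t - y|.
have N0 : 0 <= N by rewrite addr_ge0.
have := h2 _ _ s1 t1; set w := (s - x) +i* (t - y); rewrite -/N.
set r := _ - 1 - w => rN.
have wN : cmod w <= N by exact: cmod_le_ReIm.
have e11 : e1 <= 1 by rewrite ge_min lexx.
have e12 : cmod D * e1 <= e / 2.
  have : e1 * (cmod D + 1) <= e / 2.
    by rewrite -ler_pdivlMr// ge_min lexx orbT.
  have := cmod_ge0 D; have := e10; rewrite mulrDr mulr1 mulrC; lra.
have e1N : e1 * N <= N by rewrite -[leRHS]mul1r ler_wpM2r.
have zwr : polar s t = z + z * (w + r).
  rewrite -{1}(subrK x s) -{1}(subrK y t) [s - x + x]addrC [t - y + y]addrC polarD -/z.
  by rewrite /r; ring.
have hN : cmod (z * (w + r)) <= 2 * N.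
  rewrite cmodM; have := cmodD w r => H.
  have : cmod z * cmod (w + r) <= 1 * cmod (w + r) by rewrite ler_wpM2r// cmod_ge0.
  lra.
have hd : cmod (z * (w + r)) < d1.
  apply: le_lt_trans hN _; rewrite /N; lra.
have K := h1 _ hd.
rewrite zwr.
have -> : F (z + z * (w + r)) - F z - D * z * w =
  (F (z + z * (w + r)) - F z - D * (z * (w + r))) + D * (z * r) by ring.
apply: le_trans (cmodD _ _) _; rewrite (cmodM D) (cmodM z).
have K2 : cmod z * cmod r <= e1 * N.
  have : cmod z * cmod r <= 1 * cmod r by rewrite ler_wpM2r// cmod_ge0.
  lra.
have K3 : cmod D * (cmod z * cmod r) <= cmod D * (e1 * N) by rewrite ler_wpM2l// cmod_ge0.
have K4 : cmod D * e1 * N <= e / 2 * N by rewrite ler_wpM2r.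
have K5 : e / 4 * cmod (z * (w + r)) <= e / 4 * (2 * N) by rewrite ler_wpM2l// ltW.
lra.
Qed.

(** Over one period the horizontal sides cancel, so Goursat's theorem compares
    two circles. *)
Lemma segint_polar_const (P Q : R -> R -> R) (a : R) : a <= 0 ->
  (forall s t, a <= s <= 0 -> closed_form_at P Q s t) ->
  (forall s t, P s (t + 2 * pi) = P s t) ->
  segint 0 (2 * pi) (fun t => Q 0 t) = segint 0 (2 * pi) (fun t => Q a t).
Proof.
move=> a0 cl per.
have p0 : (0 : R) <= 2 * pi by rewrite mulr_ge0// pi_ge0.
have := @goursat _ P Q a 0 0 (2 * pi) _ a0 p0; rewrite /circulation.
have -> : (fun s => P s 0 - P s (2 * pi)) = (fun _ => 0).
  by apply/funext => s; rewrite -[2 * pi]add0r per subrr.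
rewrite segint_cst// mul0r add0r => H.
have cQ s t : a <= s <= 0 -> {for t, continuous (Q s)}.
  by move=> hs; have [] := closed_form_continuous (cl s t hs).
have h00 : a <= (0 : R) <= 0 by rewrite a0 lexx.
have haa : a <= a <= 0 by rewrite lexx a0.
apply/eqP; rewrite -subr_eq0; apply/eqP; rewrite -[RHS]H; last by move=> s t hs _; exact: cl.
rewrite /segint RintegralB//; apply: continuous_integrable => t _; exact: cQ.
Qed.

Lemma segint_limit (Q : R -> R -> R) (l : R) :
  (forall s t, s <= 0 -> {for t, continuous (Q s)}) ->
  (forall e, 0 < e -> exists2 S, S <= 0 & forall t, `|Q S t - l| <= e) ->
  (forall a, a <= 0 -> segint 0 (2 * pi) (fun t => Q 0 t) = segint 0 (2 * pi) (fun t => Q a t)) ->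
  segint 0 (2 * pi) (fun t => Q 0 t) = l * (2 * pi).
Proof.
move=> cQ lQ EQ; have p0 : (0 : R) < 2 * pi by rewrite mulr_gt0// pi_gt0.
apply/eqP; rewrite -subr_eq0 -normr_le0 leNgt; apply/negP => n0.
set x := `|_| in n0.
have [S S0 hS] : exists2 S, S <= 0 & forall t, `|Q S t - l| <= x / 2 / (2 * pi).
  by apply: lQ; rewrite !divr_gt0.
have : x <= x / 2 / (2 * pi) * (2 * pi - 0).
  have xE : x = `|segint 0 (2 * pi) (fun t => Q S t) - l * (2 * pi - 0)|.
    by rewrite /x (EQ S S0) subr0.
  rewrite {1}xE.
  by apply: (segint_approx (ltW p0)) => s _; [exact: cQ|exact: hS].
rewrite subr0 divfK ?gt_eqF//; lra.
Qed.

Definition cis (t : R) : R[i] := cos t +i* sin t.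

Lemma polar0 t : polar 0 t = cis t.
Proof. by rewrite /polar expR0 !mul1r. Qed.

Lemma cmod_cis t : cmod (cis t) = 1.
Proof. by rewrite -polar0 cmod_polar expR0. Qed.

(** Mean value property over the unit circle: in the coordinate
    log z = s + i t the real and imaginary parts of F ds + i F dt are closed
    forms that are 2 pi periodic in t, so the circular mean does not depend on
    the radius and tends to F 0 as s goes to minus infinity. *)
Lemma circle_mean F : (forall z, z != 0 -> cmod z <= 1 -> cdiff1 F z) ->
  (forall e, 0 < e -> exists2 dl : R, 0 < dl &
     forall z, cmod z < dl -> cmod (F z - F 0) <= e) ->
  cint mu `[0, 2 * pi] (fun t => F (cis t)) = (2 * pi)%:C * F 0.
Proof.
move=> dF cF.
have D s t : s <= 0 -> exists D : R[i], forall e, 0 < e -> exists2 dl : R, 0 < dl &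
    forall s' t', `|s' - s| < dl -> `|t' - t| < dl ->
     cmod (F (polar s' t') - F (polar s t) - D * ((s' - s) +i* (t' - t)))
       <= e * (`|s' - s| + `|t' - t|).
  move=> s0; apply: polar_comp_increment => //; apply: dF.
    by rewrite -cmod_gt0 cmod_polar expR_gt0.
  by rewrite cmod_polar -expR0 ler_expR.
pose u s t := complex.Re (F (polar s t)); pose v s t := complex.Im (F (polar s t)).
have clv s t : s <= 0 -> closed_form_at v u s t.
  move=> /(D _ t)[[al be] H]; exists be, al, (- be) => e /H[dl dl0 h].
  exists dl => // s' t' /h{}h /h{}h; split.
    apply: le_trans h; apply: le_trans (Im_le_cmod _).
    by rewrite !(cImD, cImN, cImM) /= /v le_eqVlt; apply/orP; left; apply/eqP; congr (`| _ |); ring.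
  apply: le_trans h; apply: le_trans (Re_le_cmod _).
  by rewrite !(cReD, cReN, cReM) /= /u le_eqVlt; apply/orP; left; apply/eqP; congr (`| _ |); ring.
have clu s t : s <= 0 -> closed_form_at u (fun s t => - v s t) s t.
  move=> /(D _ t)[[al be] H]; exists al, (- be), (- al) => e /H[dl dl0 h].
  exists dl => // s' t' /h{}h /h{}h; split.
    apply: le_trans h; apply: le_trans (Re_le_cmod _).
    by rewrite !(cReD, cReN, cReM) /= /u le_eqVlt; apply/orP; left; apply/eqP; congr (`| _ |); ring.
  apply: le_trans h; apply: le_trans (Im_le_cmod _).
  by rewrite -normrN !(cImD, cImN, cImM) /= /v le_eqVlt; apply/orP; left; apply/eqP; congr (`| _ |); ring.
have lim e : 0 < e -> exists2 S, S <= 0 & forall t, cmod (F (polar S t) - F 0) <= e.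
  move=> /cF[dl dl0 h]; exists (Num.min 0 (ln (dl / 2))); first by rewrite ge_min lexx.
  move=> t; apply: h; rewrite cmod_polar.
  apply: (@le_lt_trans _ _ (dl / 2)); last by lra.
  by rewrite -[leRHS]lnK ?posrE ?divr_gt0// ler_expR ge_min lexx orbT.
have Eu : segint 0 (2 * pi) (fun t => u 0 t) = complex.Re (F 0) * (2 * pi).
  apply: segint_limit.
  - by move=> s t s0; have [] := closed_form_continuous (clv s t s0).
  - move=> e /lim[S S0 h]; exists S => // t; apply: le_trans (h t).
    by rewrite -cReN -cReD; exact: Re_le_cmod.
  - move=> a a0; apply: (segint_polar_const (P := v)) => //.
      by move=> s t /andP[_ s0]; exact: clv.
    by move=> s t; rewrite /v polar2pi.
have Ev : segint 0 (2 * pi) (fun t => - v 0 t) = - complex.Im (F 0) * (2 * pi).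
  apply: (segint_limit (Q := fun s t => - v s t)).
  - by move=> s t s0; have [] := closed_form_continuous (clu s t s0).
  - move=> e /lim[S S0 h]; exists S => // t; apply: le_trans (h t).
    by rewrite -normrN opprD !opprK -cImN -cImD; exact: Im_le_cmod.
  - move=> a a0; apply: (segint_polar_const (P := u) (Q := fun s t => - v s t)) => //.
      by move=> s t /andP[_ s0]; exact: clu.
    by move=> s t; rewrite /u polar2pi.
have Ev' : segint 0 (2 * pi) (fun t => v 0 t) = complex.Im (F 0) * (2 * pi).
  apply/eqP; rewrite -eqr_opp -mulNr -Ev /segint -mulN1r -RintegralZl//.
    by apply/eqP; apply: eq_Rintegral => t _; rewrite mulN1r.
  apply: continuous_integrable => t _.
  by have [] := closed_form_continuous (clv 0 t (lexx 0)).
apply: eqReIm.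
  rewrite ReM_real [RHS]mulrC -Eu /cint/= /segint; apply: eq_Rintegral => t _.
  by rewrite /u polar0.
rewrite ImM_real [RHS]mulrC -Ev' /cint/= /segint; apply: eq_Rintegral => t _.
by rewrite /v polar0.
Qed.

End circle_mean.

(** * Averaging over the rotations of a ball *)

Section ball_integrals.
Context (R : realType) (n : nat).
Local Notation Cn := (Cn R n).
Local Notation muC := (lebesgueC R n).

Lemma integrable_ball_affine (a : R[i]) (c w : Cn) (r : R) (h : Cn -> R) : a != 0 ->
    muC.-integrable (preball w r) (EFin \o (fun p => h (vec p))) ->
  muC.-integrable (preball ((a^-1 : R[i]^o) *: (w - c)) (r / cmod a))
      (EFin \o (fun p => h ((a : R[i]^o) *: vec p + c))) /\
  \int[muC]_(p in preball w r) h (vec p) = sqmod a ^+ n *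
  \int[muC]_(p in preball ((a^-1 : R[i]^o) *: (w - c)) (r / cmod a))
      h ((a : R[i]^o) *: vec p + c).
Proof.
move=> a0 ih.
have [ih' ->] := integrable_affCn (cofn c) (fun _ => a0) (measurable_preball w r) ih.
rewrite prodr_const card_ord preimage_preball// in ih' *; split.
  apply: eq_integrable ih' => [|p _ /=]; first exact: measurable_preball.
  by rewrite vec_affCn.
by congr (_ * _); apply: eq_Rintegral => p _; rewrite vec_affCn.
Qed.

Lemma cint_ball_affine (a : R[i]) (c w : Cn) (r : R) (h : Cn -> R[i]) : a != 0 ->
    cintegrable muC (preball w r) (fun p => h (vec p)) ->
  cintegrable muC (preball ((a^-1 : R[i]^o) *: (w - c)) (r / cmod a))
      (fun p => h ((a : R[i]^o) *: vec p + c)) /\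
  cint muC (preball w r) (fun p => h (vec p)) = (sqmod a ^+ n)%:C *
  cint muC (preball ((a^-1 : R[i]^o) *: (w - c)) (r / cmod a))
      (fun p => h ((a : R[i]^o) *: vec p + c)).
Proof.
move=> a0 [h1 h2].
have [i1 e1] := @integrable_ball_affine a c w r (fun w => complex.Re (h w)) a0 h1.
have [i2 e2] := @integrable_ball_affine a c w r (fun w => complex.Im (h w)) a0 h2.
by split => //; apply: eqReIm; rewrite ?ReM_real ?ImM_real.
Qed.

Lemma measurable_ccont (D : set (Cpow R n)) (h : Cn -> R[i]) : measurable D ->
  (forall p, D p -> ccont h (vec p)) ->
  measurable_fun D (fun p => complex.Re (h (vec p)) : measurableTypeR R) /\
  measurable_fun D (fun p => complex.Im (h (vec p)) : measurableTypeR R).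
Proof.
move=> mD ch; split.
  by apply: (measurable_continuous_vec (f := fun w => complex.Re (h w))) => // p Dp; apply: ccont_Re; exact: ch.
by apply: (measurable_continuous_vec (f := fun w => complex.Im (h w))) => // p Dp; apply: ccont_Im; exact: ch.
Qed.

Lemma preball_finite (w : Cn) (r : R) : (muC (preball w r) < +oo)%E.
Proof.
wlog r0 : r / 0 < r.
  move=> H; have [|r0] := ltP 0 r; first exact: H.
  have [->|rn] := eqVneq r 0.
    suff -> : preball w 0 = set0 by rewrite measure0.
    by apply/seteqP; split => p //; rewrite /preball/= eballE//= ltNge enorm_ge0.
  have -> : preball w r = preball w (- r).
    by apply/seteqP; split => p; rewrite /preball /eball/= sqrrN.
  by apply: H; rewrite oppr_gt0 lt_neqAle rn.
have E : muC (preball w r) = (\int[muC]_(p in preball w r) 1)%E.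
  by rewrite integral_cst ?mul1e//; exact: measurable_preball.
have one0 : (1 : R[i]) != 0 by exact: oner_neq0.
rewrite E (integral_ball_affine w (w := w) (r := r) (F := fun _ => 1%E) one0)//; last exact: measurable_cst.
rewrite subrr scaler0 cmod1 divr1 integral_cst ?mul1e; last exact: measurable_preball.
change ((sqmod (1 : R[i]) ^+ n)%:E * lebesgueC R n (preball 0 r) < +oo)%E.
by rewrite measure_ball// -EFinM ltry.
Qed.

Lemma integrable_cst_ball (w : Cn) (r : R) (M : R) :
  muC.-integrable (preball w r) (EFin \o (fun _ => M)).
Proof.
apply/integrableP; split; first exact: measurable_cst.
rewrite integral_cst; last exact: measurable_preball.
rewrite lte_mul_pinfty//; exact: preball_finite.
Qed.

Lemma cvg_cis (t : R) : (fun m => cis (gridR m t) : R[i]^o) @ \oo --> (cis t : R[i]^o).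
Proof.
have c1 : (fun m => cos (gridR m t)) @ \oo --> cos t.
  by apply: cvg_comp; [exact: cvg_gridR|exact: continuous_cos].
have c2 : (fun m => sin (gridR m t)) @ \oo --> sin t.
  by apply: cvg_comp; [exact: cvg_gridR|exact: continuous_sin].
move=> A /nbhs_cmodP[e e0 eA].
have e2 : 0 < e / 2 by rewrite divr_gt0.
move/cvgrPdist_lt: c1 => /(_ _ e2) c1; move/cvgrPdist_lt: c2 => /(_ _ e2) c2.
suff : \forall m \near \oo, A (cis (gridR m t) : R[i]^o) by [].
near=> m; apply: eA.
apply: le_lt_trans (cmod_le_ReIm _) _ => /=.
have H1 : `|cos t - cos (gridR m t)| < e / 2 by near: m.
have H2 : `|sin t - sin (gridR m t)| < e / 2 by near: m.
rewrite distrC in H1; rewrite distrC in H2; lra.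
Unshelve. all: end_near. Qed.

Section circle_average.
Variables (r : R) (h k : Cn -> R).
Hypothesis ch : forall w, eball 0 r w -> {for w, continuous h}.
Hypothesis ih : muC.-integrable (preball 0 r) (EFin \o (fun p => h (vec p))).
Hypothesis hk : forall w, eball 0 r w ->
  segint 0 (2 * pi) (fun t => h ((cis t : R[i]^o) *: w)) = 2 * pi * k w.

Local Notation mR := (measurableTypeR R).

Lemma eball_rot (t : R) (w : Cn) : eball 0 r ((cis t : R[i]^o) *: w) <-> eball 0 r w.
Proof.
rewrite /eball/=; have E (u : Cn) : \sum_(j < n) sqmod (u 0 j - (0 : Cn) 0 j) = sqn u.
  by apply: eq_bigr => j _; rewrite mxE subr0.
by rewrite !E sqnZ -sqr_cmod cmod_cis expr1n mul1r.
Qed.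

Let S : set (mR * Cpow R n) := `[0%R, (2 * pi)%R]%classic `*` preball 0 r.
Let f (q : mR * Cpow R n) : \bar R := ((fun q => (h ((cis q.1 : R[i]^o) *: vec q.2))%:E) \_ S) q.

Let mS : measurable S.
Proof. by apply: measurableX => //; exact: measurable_preball. Qed.

Let mf : measurable_fun setT f.
Proof.
apply/(measurable_restrict _ mS measurableT); rewrite setTI; apply/measurable_EFinP.
apply: (measurable_fun_discretization (g := fun m q => (gridR m q.1, gridC m q.2))) => //.
  by move=> m; apply: discretization_prod; [exact: discretization_gridR|exact: discretization_gridC].
move=> [t p] [/= _ Bp].
have hc : {for (cis t : R[i]^o) *: vec p, continuous h}.
  by apply: ch; apply/eball_rot.
apply: (cvg_comp (fun m => (cis (gridR m t) : R[i]^o) *: vec (gridC m p)) h); last exact: hc.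
by apply: cvgZ; [exact: cvg_cis|exact: cvg_gridC].
Qed.

Let rot_integral (t : R) :
  muC.-integrable (preball 0 r) (EFin \o (fun p => h ((cis t : R[i]^o) *: vec p))) /\
  \int[muC]_(p in preball 0 r) h ((cis t : R[i]^o) *: vec p) = \int[muC]_(p in preball 0 r) h (vec p).
Proof.
have c0 : cis t != 0 by rewrite -cmod_gt0 cmod_cis.
have [] := @integrable_ball_affine (cis t) 0 0 r h c0 ih.
rewrite subr0 scaler0 cmod_cis divr1 -sqr_cmod cmod_cis expr1n expr1n mul1r => i1 ->.
split; first by apply: eq_integrable i1 => [|p _]; [exact: measurable_preball|rewrite /= addr0].
by apply: eq_Rintegral => p _; rewrite addr0.
Qed.

Let rot_abs (t : R) :
  (\int[muC]_(p in preball 0 r) `|(h ((cis t : R[i]^o) *: vec p))%:E| =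
  \int[muC]_(p in preball 0 r) `|(h (vec p))%:E|)%E.
Proof.
have c0 : cis t != 0 by rewrite -cmod_gt0 cmod_cis.
have /integrableP[mh _] := ih.
have mah : measurable_fun (preball 0 r) ((fun w => `|(h w)%:E|%E) \o @vec R n).
  exact: (measurableT_comp (@abse_measurable _ _) mh).
rewrite [RHS](@integral_ball_affine _ _ (cis t) 0 0 r (fun w => `|(h w)%:E|%E) c0 mah)//.
rewrite subr0 scaler0 cmod_cis divr1 -sqr_cmod cmod_cis expr1n expr1n mul1e.
by apply: eq_integral => p _; rewrite addr0.
Qed.

Let fE t p : f (t, p) = if t \in (`[0%R, (2 * pi)%R]%classic : set R)
  then ((fun p => (h ((cis t : R[i]^o) *: vec p))%:E) \_ (preball 0 r)) p else 0%E.
Proof.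
rewrite /f !patchE /S.
have -> : ((t, p) \in `[0%R, (2 * pi)%R]%classic `*` preball 0 r) =
   (t \in (`[0%R, (2 * pi)%R]%classic : set R)) && (p \in preball 0 r).
  by apply/idP/andP => [/set_mem[/= h1 h2]|[/set_mem h1 /set_mem h2]];
    [split; exact: mem_set|apply: mem_set].
by case: (t \in _).
Qed.

Let intf : (@lebesgue_measure R \x muC)%E.-integrable setT f.
Proof.
apply/integrable12ltyP; first exact: mf.
rewrite (eq_integral ((fun _ => \int[muC]_(p in preball 0 r) `|(h (vec p))%:E|)%E \_ (`[0%R, (2 * pi)%R]%classic : set mR))).
  rewrite -integral_mkcond integral_cst// lte_mul_pinfty//.
  - exact: integral_ge0.
  - have /integrableP[_ hoo] := ih; rewrite ge0_fin_numE//; exact: integral_ge0.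
  - have := lebesgue_measure_itv `[0 : R, 2 * pi]; rewrite /= => ->.
    by case: ifP => // _; rewrite ltry.
move=> t _; rewrite patchE; case: ifPn => ht; last first.
  rewrite integral0_eq// => p _; rewrite fE (negbTE ht)// abse0//.
rewrite -(rot_abs t) [RHS]integral_mkcond; apply: eq_integral => p _.
by rewrite fE ht !patchE; case: ifPn => _ //; rewrite abse0.
Qed.

(** Rotation invariance of Lebesgue measure and Fubini replace a function by
    its averages over the circles through the origin. *)
Lemma ball_circle_average :
  muC.-integrable (preball 0 r) (EFin \o (fun p => k (vec p))) /\
  \int[muC]_(p in preball 0 r) h (vec p) = \int[muC]_(p in preball 0 r) k (vec p).
Proof.
have mB : measurable (preball (0 : Cn) r) by exact: measurable_preball.
have pi2 : (0 : R) < 2 * pi by rewrite mulr_gt0// pi_gt0.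
have I2 p : (\int[@lebesgue_measure R]_t f (t, p) =
    ((fun p => ((2 * pi) * k (vec p))%:E) \_ (preball 0 r)) p)%E.
  rewrite patchE; case: ifPn => Bp; last first.
    rewrite integral0_eq// => t _; rewrite fE patchE (negbTE Bp); by case: ifP.
  rewrite -hk; last by move/set_mem: Bp.
  have cc : forall t, 0 <= t <= 2 * pi -> {for t, continuous (fun t => h ((cis t : R[i]^o) *: vec p))}.
    move=> t _; apply: (cvg_comp (fun t => (cis t : R[i]^o) *: vec p) h); last first.
      by apply: ch; apply/eball_rot; move/set_mem: Bp.
    apply: cvgZ; last exact: cvg_cst.
    move=> A /nbhs_cmodP[e e0 eA].
    have e2 : 0 < e / 2 by rewrite divr_gt0.
    have := @continuous_cos R t; move=> /cvgrPdist_lt /(_ _ e2) c1.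
    have := @continuous_sin R t; move=> /cvgrPdist_lt /(_ _ e2) c2.
    suff : \forall s \near t, A (cis s : R[i]^o) by [].
    near=> s; apply: eA.
    apply: le_lt_trans (cmod_le_ReIm _) _ => /=.
    have H1 : `|cos t - cos s| < e / 2 by near: s.
    have H2 : `|sin t - sin s| < e / 2 by near: s.
    rewrite distrC in H1; rewrite distrC in H2; lra.
  rewrite /segint /Rintegral fineK; last first.
    by apply: integrable_fin_num => //; exact: continuous_integrable.
  rewrite [RHS]integral_mkcond; apply: eq_integral => t _.
  by rewrite fE !patchE Bp.
have I1 t : (\int[muC]_p f (t, p) = ((fun _ => (\int[muC]_(p in preball 0 r) h (vec p))%:E) \_
    (`[0%R, (2 * pi)%R]%classic : set mR)) t)%E.
  rewrite patchE; case: ifPn => ht; last first.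
    by rewrite integral0_eq// => p _; rewrite fE (negbTE ht).
  have [i1 <-] := rot_integral t.
  rewrite /Rintegral fineK; last exact: integrable_fin_num.
  by rewrite [RHS]integral_mkcond; apply: eq_integral => p _; rewrite fE ht.
have ik : muC.-integrable (preball 0 r) (EFin \o (fun p => (2 * pi) * k (vec p))).
  apply/(integrable_mkcond _ mB).
  have -> : (EFin \o (fun p => 2 * pi * k (vec p))) \_ (preball 0 r) =
      fubini_G (@lebesgue_measure R) f by apply/funext => p; rewrite /fubini_G I2.
  have mG := measurable_fubini_G intf; have /integrableP[mff _] := intf.
  have [+ _] := integrable21ltyP (@lebesgue_measure R) muC mff.
  move=> /(_ intf) oo; apply/integrableP; split => //; apply: le_lt_trans oo.
  apply: ge0_le_integral => //.
  - exact: measurableT_comp.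
  - apply: (measurable_fun_fubini_tonelli_G (fun q => `|f q|%E)) => //.
    exact: measurableT_comp.
  - move=> p _; apply: le_abse_integral => //.
    exact: measurable_fun_pair1.
have ik' : muC.-integrable (preball 0 r) (EFin \o (fun p => k (vec p))).
  apply: eq_integrable (integrableRZ (2 * pi)^-1 mB ik) => // p _ /=.
  by rewrite mulKf// gt_eqF.
split => //.
have := Fubini intf.
under eq_integral do rewrite I1.
under [in RHS]eq_integral do rewrite I2.
rewrite -!integral_mkcond integral_cst//.
have L : (@lebesgue_measure R `[0%R, (2 * pi)%R] = (2 * pi)%:E)%E.
  apply: (etrans (lebesgue_measure_itv `[0%R, (2 * pi)%R])); rewrite /= lte_fin pi2.
  by rewrite -EFinB subr0.
move=> E0; have E : ((\int[muC]_(p in preball 0 r) h (vec p) * (2 * pi))%:E =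
    \int[muC]_(x in preball 0 r) (2 * pi * k (vec x))%:E)%E.
  by rewrite EFinM -L.
have : \int[muC]_(p in preball 0 r) ((2 * pi) * k (vec p)) = \int[muC]_(p in preball 0 r) h (vec p) * (2 * pi).
  by rewrite {1}/Rintegral -E.
rewrite RintegralZl// mulrC => /mulIf -> //; by rewrite gt_eqF.
Unshelve. all: end_near. Qed.

End circle_average.
End ball_integrals.

(** * Holomorphic functions on complex lines *)

Section slices.
Context (R : realType) (n : nat).
Local Notation Cn := (Cn R n).
Local Notation mu := (@lebesgue_measure R).
Implicit Types (f : Cn -> R[i]^o) (z w : Cn).

Definition slice f z w (a : R[i]) : R[i] := f (z + (a : R[i]^o) *: w).

Lemma lformZ (L : 'I_n -> R[i]) (a : R[i]) w :
  lform L ((a : R[i]^o) *: w) = a * lform L w :> R[i].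
Proof. by rewrite linearZ. Qed.

Lemma cdiff_slice f z w (a : R[i]) : differentiable f (z + (a : R[i]^o) *: w) ->
  cdiff1 (slice f z w) a.
Proof.
move=> /differentiable_cdiff H; set L := (fun j => _) in H.
exists (lform L w) => e e0.
have w1 : 0 < enorm w + 1 by rewrite ltr_wpDl// enorm_ge0.
have [d d0 hd] := H (e / (enorm w + 1)) (divr_gt0 e0 w1).
exists (d / (enorm w + 1)); first by rewrite divr_gt0.
move=> h; rewrite ltr_pdivlMr// => hh.
have hw : enorm ((h : R[i]^o) *: w) < d.
  rewrite enormZ; apply: le_lt_trans hh; rewrite ler_wpM2l ?cmod_ge0//; lra.
have := hd _ hw; rewrite lformZ [h * _]mulrC.
have -> : z + (a : R[i]^o) *: w + (h : R[i]^o) *: w = z + ((a + h : R[i]) : R[i]^o) *: w.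
  by rewrite -addrA -scalerDl.
move=> /le_trans; apply.
rewrite enormZ mulrAC ler_pdivrMr//.
have := mulr_ge0 (mulr_ge0 (ltW e0) (cmod_ge0 h)) (enorm_ge0 w).
by have := mulr_ge0 (ltW e0) (cmod_ge0 h); nra.
Qed.

Lemma cdiff1_quot (G : R[i] -> R[i]) (a : R[i]) : a != 0 -> cdiff1 G a ->
  cdiff1 (fun x => G x / x) a.
Proof.
move=> a0 [D HD]; exists (D / a - G a / a ^+ 2) => e e0.
have ca : 0 < cmod a by rewrite cmod_gt0.
pose K := cmod (G a) / cmod a ^+ 2 + cmod D / cmod a.
have K0 : 0 <= K.
  by apply: addr_ge0; rewrite divr_ge0 ?cmod_ge0// exprn_ge0// cmod_ge0.
have e1 : 0 < e * cmod a / 4 by rewrite divr_gt0// mulr_gt0.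
have [d d0 hd] := HD _ e1.
pose d' := Num.min d (Num.min (cmod a / 2) (e * cmod a / 4 / (K + 1))).
have K1 : 0 < K + 1 by rewrite ltr_wpDl.
exists d'; first by rewrite !lt_min d0 !divr_gt0// mulr_gt0.
move=> h; rewrite !lt_min => /and3P[h1 h2 h3].
have ah : cmod a / 2 <= cmod (a + h).
  have := cmod_triangle_sub (a + h) a; rewrite addrAC subrr add0r => H.
  have := ler_norm (cmod a - cmod (a + h)); rewrite distrC; lra.
have ah0 : 0 < cmod (a + h) by apply: lt_le_trans ah; rewrite divr_gt0.
have ahn : a + h != 0 by rewrite -cmod_gt0.
set r := G (a + h) - G a - D * h in hd *; have Hr := hd h h1; rewrite -/r in Hr.
have -> : G (a + h) / (a + h) - G a / a - (D / a - G a / a ^+ 2) * h =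
  (r + (G a / a ^+ 2 - D / a) * h ^+ 2) / (a + h).
  rewrite /r; field; by rewrite ?a0 ?ahn.
rewrite cmodM cmodV ler_pdivrMr//.
apply: le_trans (cmodD _ _) _; rewrite cmodM cmodX.
have B1 : cmod (G a / a ^+ 2 - D / a) <= K.
  by apply: le_trans (cmodB _ _) _; rewrite !cmodM !cmodV cmodX.
have c0 := cmod_ge0 h.
have B2 : cmod (G a / a ^+ 2 - D / a) * cmod h ^+ 2 <= e * cmod a / 4 * cmod h.
  rewrite expr2 mulrA ler_wpM2r//.
  move: h3; rewrite ltr_pdivlMr// => h3.
  have : cmod (G a / a ^+ 2 - D / a) * cmod h <= K * cmod h by rewrite ler_wpM2r.
  lra.
have B3 : e * cmod h * (cmod a / 2) <= e * cmod h * cmod (a + h).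
  by rewrite ler_wpM2l// mulr_ge0// ltW.
lra.
Qed.

Lemma cdiff1_sub (G : R[i] -> R[i]) (a c : R[i]) : cdiff1 G a -> cdiff1 (fun x => G x - c) a.
Proof.
move=> [D HD]; exists D => e /HD[d d0 hd]; exists d => // h /hd.
by have -> : G (a + h) - c - (G a - c) = G (a + h) - G a by ring.
Qed.

Lemma cdiff1_ext (G H : R[i] -> R[i]) (a : R[i]) : (exists2 d : R, 0 < d & forall h : R[i], cmod h < d ->
  G (a + h) = H (a + h)) -> cdiff1 G a -> cdiff1 H a.
Proof.
move=> [d d0 E] [D HD]; exists D => e /HD[d' d'0 hd]; exists (Num.min d d').
  by rewrite lt_min d0.
move=> h; rewrite lt_min => /andP[h1 h2].
have := hd h h2; rewrite E//; have := E 0; rewrite addr0 cmod0 => -> //.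
Qed.

Lemma slice_cont f z w e : 0 < e -> differentiable f z -> exists2 dl : R, 0 < dl &
  forall a : R[i], cmod a < dl -> cmod (slice f z w a - slice f z w 0) <= e.
Proof.
move=> e0 /differentiable_cdiff/cdiff_ccont/(_ e e0)[d d0 hd].
have w1 : 0 < enorm w + 1 by rewrite ltr_wpDl// enorm_ge0.
exists (d / (enorm w + 1)) => [|a]; first by rewrite divr_gt0.
rewrite ltr_pdivlMr// => ha; rewrite /slice scale0r addr0; apply/ltW/hd.
rewrite addrAC subrr add0r enormZ; apply: le_lt_trans ha.
by rewrite ler_wpM2l ?cmod_ge0//; lra.
Qed.

Lemma slice_mean0 f z w :
  (forall a : R[i], cmod a <= 1 -> differentiable f (z + (a : R[i]^o) *: w)) ->
  cint mu `[0, 2 * pi] (fun t => f (z + (cis t : R[i]^o) *: w)) = (2 * pi)%:C * f z.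
Proof.
have E0 : slice f z w 0 = f z by rewrite /slice scale0r addr0.
move=> df; have := @circle_mean R (slice f z w); rewrite E0; apply.
  by move=> a a0 a1; apply: cdiff_slice; exact: df.
have dz : differentiable f z by have := df 0; rewrite scale0r addr0 cmod0; apply.
by move=> e e0; have := slice_cont w e0 dz; rewrite E0.
Qed.

(** The slope of a slice at its centre, extended by the derivative, is the
    function whose circular mean is taken. *)
Definition slope f z w (a : R[i]) : R[i] :=
  if a == 0 then lform (fun j => pd j f z) w else (slice f z w a - f z) / a.

Lemma cisV t : (cis t : R[i])^-1 = (cis t)^*.
Proof.
have c0 : cis t != 0 :> R[i] by rewrite -cmod_gt0 cmod_cis.
apply: (mulfI c0); rewrite divff// mul_conj -sqr_cmod cmod_cis expr1n.
by [].
Qed.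

Lemma slice_mean_slope f z w :
  (forall a : R[i], cmod a <= 1 -> differentiable f (z + (a : R[i]^o) *: w)) ->
  cint mu `[0, 2 * pi] (fun t => (f (z + (cis t : R[i]^o) *: w) - f z) * (cis t)^*) =
  (2 * pi)%:C * lform (fun j => pd j f z) w.
Proof.
have E0 : slope f z w 0 = lform (fun j => pd j f z) w by rewrite /slope eqxx.
move=> df; rewrite -E0 -(@circle_mean R (slope f z w)).
- apply: eq_cint => t _; rewrite /slope.
  have c0 : cis t != 0 :> R[i] by rewrite -cmod_gt0 cmod_cis.
  by rewrite (negbTE c0) cisV.
- move=> a a0 a1; have ca : 0 < cmod a by rewrite cmod_gt0.
  apply: (@cdiff1_ext (fun x => (slice f z w x - f z) / x)).
    exists (cmod a) => // h ha; rewrite /slope ifF//; apply/negbTE.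
    apply: contraTneq ha => /eqP; rewrite addr_eq0 => /eqP ->.
    by rewrite cmodN ltxx.
  apply: (cdiff1_quot a0); apply: cdiff1_sub; apply: cdiff_slice; exact: df.
- move=> e e0.
  have := df 0; rewrite scale0r addr0 cmod0 => /(_ ler01) /differentiable_cdiff H.
  have w1 : 0 < enorm w + 1 by rewrite ltr_wpDl// enorm_ge0.
  have [d d0 hd] := H (e / (enorm w + 1)) (divr_gt0 e0 w1).
  exists (d / (enorm w + 1)) => [|a]; first by rewrite divr_gt0.
  rewrite ltr_pdivlMr// /slope eqxx => ha.
  have [_|a0] := eqVneq a 0; first by rewrite subrr cmod0 ltW.
  have aw : enorm ((a : R[i]^o) *: w) < d.
    rewrite enormZ; apply: le_lt_trans ha; rewrite ler_wpM2l ?cmod_ge0//; lra.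
  have := hd _ aw; rewrite lformZ enormZ => hh.
  have -> : (slice f z w a - f z) / a - lform (fun j => pd j f z) w =
    (slice f z w a - f z - a * lform (fun j => pd j f z) w) / a.
    by field.
  rewrite cmodM cmodV ler_pdivrMr ?cmod_gt0//; apply: le_trans hh _.
  rewrite mulrAC ler_pdivrMr//.
  have := mulr_ge0 (mulr_ge0 (ltW e0) (cmod_ge0 a)) (enorm_ge0 w).
  by have := mulr_ge0 (ltW e0) (cmod_ge0 a); nra.
Qed.

Lemma cdiff1_id (a : R[i]) : cdiff1 id a.
Proof.
exists 1 => e e0; exists 1 => // h _.
by rewrite mul1r [a + h]addrC addrK subrr cmod0 mulr_ge0 ?cmod_ge0// ltW.
Qed.

Definition rcont (h : R -> R[i]) (t : R) :=
  {for t, continuous (fun s => complex.Re (h s))} /\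
  {for t, continuous (fun s => complex.Im (h s))}.

Lemma cintegrable_circle (h : R -> R[i]) :
  (forall t, rcont h t) -> cintegrable mu `[0, 2 * pi] h.
Proof.
move=> ch; split; apply: continuous_integrable => t _; first exact: (ch t).1.
exact: (ch t).2.
Qed.

Lemma rcont_cis t : rcont (@cis R) t.
Proof. by split; [exact: continuous_cos|exact: continuous_sin]. Qed.

Lemma rcont_conj h t : rcont h t -> rcont (fun s => (h s)^*) t.
Proof.
move=> [h1 h2]; split.
  have -> // : (fun s => complex.Re (h s)^*) = (fun s => complex.Re (h s)).
  by apply/funext => s; case: (h s).
have -> : (fun s => complex.Im (h s)^*) = (fun s => - complex.Im (h s)).
  by apply/funext => s; case: (h s).
exact: cvgN.
Qed.

Lemma rcontM h g t : rcont h t -> rcont g t -> rcont (fun s => h s * g s) t.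
Proof.
move=> [h1 h2] [g1 g2]; split.
  have -> : (fun s => complex.Re (h s * g s)) = (fun s => complex.Re (h s) * complex.Re (g s) - complex.Im (h s) * complex.Im (g s)).
    by apply/funext => s; rewrite cReM.
  by apply: cvgB; apply: cvgM.
have -> : (fun s => complex.Im (h s * g s)) = (fun s => complex.Re (h s) * complex.Im (g s) + complex.Im (h s) * complex.Re (g s)).
  by apply/funext => s; rewrite cImM.
by apply: cvgD; apply: cvgM.
Qed.

Lemma rcontB h g t : rcont h t -> rcont g t -> rcont (fun s => h s - g s) t.
Proof.
move=> [h1 h2] [g1 g2]; split.
  have -> : (fun s => complex.Re (h s - g s)) = (fun s => complex.Re (h s) - complex.Re (g s)).
    by apply/funext => s; rewrite cReD cReN.
  exact: cvgB.
have -> : (fun s => complex.Im (h s - g s)) = (fun s => complex.Im (h s) - complex.Im (g s)).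
  by apply/funext => s; rewrite cImD cImN.
exact: cvgB.
Qed.

Lemma rcontD h g t : rcont h t -> rcont g t -> rcont (fun s => h s + g s) t.
Proof.
move=> [h1 h2] [g1 g2]; split.
  have -> : (fun s => complex.Re (h s + g s)) = (fun s => complex.Re (h s) + complex.Re (g s)).
    by apply/funext => s; rewrite cReD.
  exact: cvgD.
have -> : (fun s => complex.Im (h s + g s)) = (fun s => complex.Im (h s) + complex.Im (g s)).
  by apply/funext => s; rewrite cImD.
exact: cvgD.
Qed.

Lemma rcont_sum (I : Type) (r : seq I) (F : I -> R -> R[i]) t :
  (forall i, rcont (F i) t) -> rcont (fun s => \sum_(i <- r) F i s) t.
Proof.
move=> H; elim: r => [|i r IH].
  have -> : (fun s => \sum_(i <- [::]) F i s) = (fun _ => 0).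
    by apply/funext => s; rewrite big_nil.
  by split; exact: cvg_cst.
have -> : (fun s => \sum_(j <- i :: r) F j s) = (fun s => F i s + \sum_(j <- r) F j s).
  by apply/funext => s; rewrite big_cons.
exact: rcontD.
Qed.

Lemma rcont_slice f z w t : ccont f (z + (cis t : R[i]^o) *: w) ->
  rcont (fun t => f (z + (cis t : R[i]^o) *: w)) t.
Proof.
move=> cf.
have H e : 0 < e -> \forall s \near t,
    cmod (f (z + (cis t : R[i]^o) *: w) - f (z + (cis s : R[i]^o) *: w)) < e.
  move=> /cf[d d0 hd].
  have w1 : 0 < enorm w + 1 by rewrite ltr_wpDl// enorm_ge0.
  have d2 : 0 < d / (enorm w + 1) / 2 by rewrite !divr_gt0.
  have := @continuous_cos R t; move=> /cvgrPdist_lt /(_ _ d2) c1.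
  have := @continuous_sin R t; move=> /cvgrPdist_lt /(_ _ d2) c2.
  near=> s; rewrite cmod_distC; apply: hd.
  have -> : z + (cis s : R[i]^o) *: w - (z + (cis t : R[i]^o) *: w) = ((cis s - cis t : R[i]) : R[i]^o) *: w.
    by rewrite opprD addrACA subrr add0r -scalerBl.
  rewrite enormZ.
  have H1 : `|cos t - cos s| < d / (enorm w + 1) / 2 by near: s.
  have H2 : `|sin t - sin s| < d / (enorm w + 1) / 2 by near: s.
  have H3 : cmod (cis s - cis t) < d / (enorm w + 1).
    apply: le_lt_trans (cmod_le_ReIm _) _ => /=.
    rewrite distrC in H1; rewrite distrC in H2; lra.
  move: H3; rewrite ltr_pdivlMr// => H3; apply: le_lt_trans H3.
  by rewrite ler_wpM2l ?cmod_ge0//; lra.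
split; apply/cvgrPdist_lt => e /H; apply: filterS => s hs; apply: le_lt_trans hs.
  by rewrite -cReN -cReD; exact: Re_le_cmod.
by rewrite -cImN -cImD; exact: Im_le_cmod.
Unshelve. all: end_near. Qed.

Lemma cint_cisC : cint mu `[0, 2 * pi] (fun t => (cis t : R[i])^*) = 0.
Proof.
have i1 : cintegrable mu `[0, 2 * pi] (@cis R).
  by apply: cintegrable_circle => t; exact: rcont_cis.
rewrite cint_conj//.
have -> : cint mu `[0, 2 * pi] (@cis R) = 0.
  have := @circle_mean R id; rewrite mulr0; apply.
    by move=> a _ _; exact: cdiff1_id.
  by move=> e e0; exists e => // a; rewrite subr0 => /ltW.
by rewrite conjc0.
Qed.

(** Subtracting the value at the centre does not change the integral, because
    the mean of the conjugate of cis vanishes; what remains is the slope. *)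
Lemma slice_mean1 f z w :
  (forall a : R[i], cmod a <= 1 -> differentiable f (z + (a : R[i]^o) *: w)) ->
  cint mu `[0, 2 * pi] (fun t => f (z + (cis t : R[i]^o) *: w) * (cis t)^*) =
  (2 * pi)%:C * lform (fun j => pd j f z) w.
Proof.
move=> df; have dfc t : differentiable f (z + (cis t : R[i]^o) *: w).
  by apply: df; rewrite cmod_cis.
rewrite -slice_mean_slope//.
have cc t : rcont (fun t => (cis t : R[i])^*) t by apply: rcont_conj; exact: rcont_cis.
have i1 : cintegrable mu `[0, 2 * pi] (fun t => f (z + (cis t : R[i]^o) *: w) * (cis t)^*).
  apply: cintegrable_circle => t.
  apply: (@rcontM (fun t => f (z + (cis t : R[i]^o) *: w))) => //.
  by apply: rcont_slice; apply: cdiff_ccont; exact: differentiable_cdiff.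
have i2 : cintegrable mu `[0, 2 * pi] (fun t => (cis t : R[i])^*).
  by apply: cintegrable_circle.
transitivity (cint mu `[0, 2 * pi] (fun t => f (z + (cis t : R[i]^o) *: w) * (cis t)^* - f z * (cis t)^*)).
  rewrite cintB//; last exact: cintegrableZ.
  by rewrite cintZ// cint_cisC mulr0 subr0.
by apply: eq_cint => t _; rewrite mulrBl.
Qed.

End slices.

(** * Derivatives of holomorphic functions and the Cauchy estimate *)

Lemma increment_is_derive (R : realType) (f : R -> R) (x D : R) :
  (forall e : R, 0 < e -> exists2 dl : R, 0 < dl &
    forall h : R, `|h| < dl -> `|f (x + h) - f x - D * h| <= e * `|h|) ->
  is_derive x 1 f D.
Proof.
move=> H.
have C : (fun h => h^-1 *: ((f \o shift x) (h *: 1) - f x)) @ 0^' --> D.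
  apply/cvgrPdist_le => e /H[dl dl0 hd]; rewrite near_withinE.
  apply/nbhs_ballP; exists dl => //= h; rewrite /ball/= sub0r normrN => hh h0.
  have hp : 0 < `|h| by rewrite normr_gt0.
  rewrite [h *: 1]mulr1 [h + x]addrC /GRing.scale/= distrC.
  have -> : h^-1 * (f (x + h) - f x) - D = (f (x + h) - f x - D * h) / h by field.
  by rewrite normrM normfV ler_pdivrMr//; exact: hd.
by split; [apply/cvg_ex; exists D|exact: cvg_lim].
Qed.

Section holomorphic_calculus.
Context (R : realType) (n : nat).
Local Notation Cn := (Cn R n).
Local Notation mu := (@lebesgue_measure R).
Implicit Types (f g : Cn -> R[i]^o) (z w h : Cn).

Lemma cdiff_at_ext f g w L : (exists2 d : R, 0 < d & forall h, enorm h < d -> f (w + h) = g (w + h)) ->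
  cdiff_at f w L -> cdiff_at g w L.
Proof.
move=> [d d0 E] H e /H[d' d'0 hd]; exists (Num.min d d'); first by rewrite lt_min d0.
move=> h; rewrite lt_min => /andP[h1 h2].
have := hd h h2; rewrite E//; have := E 0; rewrite addr0 enorm0 => -> //.
Qed.

Lemma cdiff_at_affine f (a : R[i]) c w L : cdiff_at f ((a : R[i]^o) *: w + c) L ->
  cdiff_at (fun w => f ((a : R[i]^o) *: w + c)) w (fun j => a * L j).
Proof.
move=> H e e0.
have w1 : 0 < cmod a + 1 by rewrite ltr_wpDl// cmod_ge0.
have [d d0 hd] := H (e / (cmod a + 1)) (divr_gt0 e0 w1).
exists (d / (cmod a + 1)); first by rewrite divr_gt0.
move=> h; rewrite ltr_pdivlMr// => hh.
have hw : enorm ((a : R[i]^o) *: h) < d.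
  rewrite enormZ mulrC; apply: le_lt_trans hh; rewrite ler_wpM2l ?enorm_ge0//; lra.
have := hd _ hw; rewrite linearZ/= enormZ.
have -> : (a : R[i]^o) *: w + c + (a : R[i]^o) *: h = (a : R[i]^o) *: (w + h) + c.
  by rewrite scalerDr addrAC.
have -> : (a : R[i]^o) *: lform L h = lform (fun j => a * L j) h.
  by rewrite /lform scaler_sumr; apply: eq_bigr => j _; rewrite -mulrA.
move=> /le_trans; apply.
rewrite mulrA ler_wpM2r ?enorm_ge0// mulrAC ler_pdivrMr//.
by have := mulr_ge0 (ltW e0) (cmod_ge0 a); nra.
Qed.

Lemma differentiable_affine f (a : R[i]) c w : differentiable f ((a : R[i]^o) *: w + c) ->
  differentiable (fun w => f ((a : R[i]^o) *: w + c)) w.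
Proof. by move=> /differentiable_cdiff/cdiff_at_affine/cdiff_differentiable[]. Qed.

Lemma pd_affine f (a : R[i]) c w j : differentiable f ((a : R[i]^o) *: w + c) ->
  pd j (fun w => f ((a : R[i]^o) *: w + c)) w = a * pd j f ((a : R[i]^o) *: w + c).
Proof. by move=> /differentiable_cdiff/cdiff_at_affine/cdiff_differentiable[_]/(_ j). Qed.

Lemma differentiable_shift f c w : differentiable f (w + c) ->
  differentiable (fun w => f (w + c)) w.
Proof.
move=> df; have := @differentiable_affine f 1 c w; rewrite scale1r => /(_ df).
have -> // : (fun w0 : Cn => f ((1 : R[i]^o) *: w0 + c)) = (fun w0 => f (w0 + c)).
by apply/funext => u; rewrite scale1r.
Qed.

Lemma pd_shift f c w j : differentiable f (w + c) ->
  pd j (fun w => f (w + c)) w = pd j f (w + c).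
Proof.
move=> df; have := @pd_affine f 1 c w j; rewrite scale1r mul1r => /(_ df) <-.
by congr pd; apply/funext => u; rewrite scale1r.
Qed.

Lemma differentiable_ext f g w : (exists2 d : R, 0 < d & forall w', enorm (w' - w) < d -> f w' = g w') ->
  differentiable f w -> differentiable g w /\ forall j, pd j g w = pd j f w.
Proof.
move=> [d d0 E] /differentiable_cdiff H; apply: cdiff_differentiable.
apply: cdiff_at_ext H; exists d => // h hd; apply: E.
by rewrite addrAC subrr add0r.
Qed.

Lemma cdiff_atD f g w L K : cdiff_at f w L -> cdiff_at g w K ->
  cdiff_at (fun w => f w + g w) w (fun j => L j + K j).
Proof.
move=> F G e e0; have e2 : 0 < e / 2 by rewrite divr_gt0.
have [d1 d10 h1] := F _ e2; have [d2 d20 h2] := G _ e2.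
exists (Num.min d1 d2) => [|h]; first by rewrite lt_min d10.
rewrite lt_min => /andP[/h1 A /h2 B].
have -> : f (w + h) + g (w + h) - (f w + g w) - lform (fun j => L j + K j) h =
  (f (w + h) - f w - lform L h) + (g (w + h) - g w - lform K h).
  have -> : lform (fun j => L j + K j) h = lform L h + lform K h.
    by rewrite /lform -big_split; apply: eq_bigr => j _; rewrite mulrDl.
  by ring.
apply: le_trans (cmodD _ _) _; lra.
Qed.

Lemma cdiff_atZ (a : R[i]) f w L : cdiff_at f w L ->
  cdiff_at (fun w => a * (f w : R[i])) w (fun j => a * L j).
Proof.
move=> F e e0; have a1 : 0 < cmod a + 1 by rewrite ltr_wpDl// cmod_ge0.
have [d d0 hd] := F _ (divr_gt0 e0 a1); exists d => // h /hd hh.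
have -> : a * (f (w + h) : R[i]) - a * (f w : R[i]) - lform (fun j => a * L j) h =
   a * (f (w + h) - f w - lform L h).
  have -> : lform (fun j => a * L j) h = a * (lform L h : R[i]).
    by rewrite /lform mulr_sumr; apply: eq_bigr => j _; rewrite mulrA.
  by ring.
rewrite cmodM; apply: (@le_trans _ _ ((cmod a + 1) * (e / (cmod a + 1) * enorm h))).
  by apply: ler_pM; rewrite ?cmod_ge0// lerDl.
by rewrite mulrA mulrCA divff ?mulr1// gt_eqF.
Qed.

Lemma cdiff_at_lform L w : cdiff_at (lform L) w L.
Proof.
move=> e e0; exists 1 => // h _; rewrite linearD/=.
have -> : lform L w + lform L h - lform L w - lform L h = 0 :> R[i] by ring.
by rewrite cmod0 mulr_ge0 ?enorm_ge0// ltW.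
Qed.

Lemma holoD f g w : differentiable f w -> differentiable g w ->
  differentiable (fun w => f w + g w) w /\
  forall j, pd j (fun w => f w + g w) w = pd j f w + pd j g w.
Proof.
by move=> /differentiable_cdiff F /differentiable_cdiff G;
  exact: cdiff_differentiable (cdiff_atD F G).
Qed.

Lemma holoZ (a : R[i]) f w : differentiable f w ->
  differentiable (fun w => a * (f w : R[i]) : R[i]^o) w /\
  forall j, pd j (fun w => a * (f w : R[i])) w = a * pd j f w.
Proof. by move=> /differentiable_cdiff F; exact: cdiff_differentiable (cdiff_atZ a F). Qed.

Lemma holoB f g w : differentiable f w -> differentiable g w ->
  differentiable (fun w => f w - g w) w /\
  forall j, pd j (fun w => f w - g w) w = pd j f w - pd j g w.
Proof.
move=> F G; have [G1 G2] := holoZ (-1) G.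
have [H1 H2] := holoD F G1.
have E : (fun w => f w + -1 * (g w : R[i])) = (fun w => f w - g w).
  by apply/funext => u; rewrite mulN1r.
by rewrite E in H1 H2; split => // j; rewrite H2 G2 mulN1r.
Qed.

Lemma cdiff_atM f g w L K : cdiff_at f w L -> cdiff_at g w K ->
  cdiff_at (fun w => (f w : R[i]) * g w) w (fun j => f w * K j + L j * g w).
Proof.
move=> F G e e0.
pose B := cmod (f w) + cmod (g w) + (coefsum L + 1) * (coefsum K + 1) + 1.
have L0 := coefsum_ge0 L; have K0 := coefsum_ge0 K.
have f0 := cmod_ge0 (f w); have g0 := cmod_ge0 (g w).
have LK0 : 0 <= (coefsum L + 1) * (coefsum K + 1) by rewrite mulr_ge0// addr_ge0.
have B0 : 0 < B by rewrite /B; lra.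
pose e1 := Num.min 1 (e / B).
have e10 : 0 < e1 by rewrite lt_min ltr01 divr_gt0.
have e11 : e1 <= 1 by rewrite ge_min lexx.
have eB : e1 * B <= e by rewrite -ler_pdivlMr// ge_min lexx orbT.
clearbody e1.
have [d1 d10 h1] := F _ e10; have [d2 d20 h2] := G _ e10.
exists (Num.min (Num.min d1 d2) e1) => [|h]; first by rewrite !lt_min d10 d20.
rewrite !lt_min -andbA => /and3P[/h1 H1 /h2 H2 he].
have hp := enorm_ge0 h.
set A1 := f (w + h) - f w - lform L h in H1.
set A2 := g (w + h) - g w - lform K h in H2.
have -> : (f (w + h) : R[i]) * g (w + h) - (f w : R[i]) * g w - lform (fun j => f w * K j + L j * g w) h =
  (f w : R[i]) * A2 + (g w : R[i]) * A1 + (A1 + lform L h) * (A2 + lform K h).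
  have -> : lform (fun j => f w * K j + L j * g w) h = (f w : R[i]) * lform K h + (lform L h : R[i]) * g w.
    have E (a b x y u : R[i]) : (a * x + y * b) * u = a * (x * u) + y * u * b by ring.
    by rewrite /lform mulr_sumr mulr_suml -big_split; apply: eq_bigr => j _; exact: E.
  rewrite /A1 /A2; ring.
have bL := lform_bound L h; have bK := lform_bound K h.
apply: le_trans (cmodD _ _) _; apply: le_trans (lerD (cmodD _ _) (lexx _)) _; rewrite !cmodM.
have c1 : cmod (A1 + lform L h) <= (coefsum L + 1) * enorm h.
  apply: le_trans (cmodD _ _) _; rewrite mulrDl mul1r addrC lerD//.
  by apply: le_trans H1 _; rewrite ler_piMl.
have c2 : cmod (A2 + lform K h) <= (coefsum K + 1) * enorm h.
  apply: le_trans (cmodD _ _) _; rewrite mulrDl mul1r addrC lerD//.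
  by apply: le_trans H2 _; rewrite ler_piMl.
have c3 : cmod (A1 + lform L h) * cmod (A2 + lform K h) <=
   (coefsum L + 1) * (coefsum K + 1) * e1 * enorm h.
  apply: le_trans (ler_pM (cmod_ge0 _) (cmod_ge0 _) c1 c2) _.
  rewrite mulrACA -[leRHS]mulrA; apply: ler_wpM2l => //; apply: ler_wpM2r => //; exact: ltW.
have c4 : cmod (f w) * cmod A2 <= cmod (f w) * (e1 * enorm h) by rewrite ler_wpM2l.
have c5 : cmod (g w) * cmod A1 <= cmod (g w) * (e1 * enorm h) by rewrite ler_wpM2l.
have c6 : e1 * B * enorm h <= e * enorm h by rewrite ler_wpM2r.
apply: le_trans c6; apply: le_trans (lerD (lerD c4 c5) c3) _.
have : 0 <= e1 * enorm h by rewrite mulr_ge0// ltW.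
by rewrite /B; nra.
Qed.

Lemma holoM f g w : differentiable f w -> differentiable g w ->
  differentiable (fun w => (f w : R[i]) * g w : R[i]^o) w /\
  forall j, pd j (fun w => (f w : R[i]) * g w) w = (f w : R[i]) * pd j g w + pd j f w * g w.
Proof.
by move=> /differentiable_cdiff F /differentiable_cdiff G;
  exact: cdiff_differentiable (cdiff_atM F G).
Qed.

Lemma holo_cst (a : R[i]) w : differentiable (fun _ : Cn => a : R[i]^o) w /\
  forall j, pd j (fun _ : Cn => a : R[i]^o) w = 0.
Proof.
apply: cdiff_differentiable => e e0; exists 1 => // h _.
by rewrite /lform big1 => [|j _]; rewrite ?mul0r// subrr subr0 cmod0 mulr_ge0 ?enorm_ge0// ltW.
Qed.

Lemma holo_coord (k : 'I_n) w : differentiable (fun w : Cn => w 0 k : R[i]^o) w /\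
  forall j, pd j (fun w : Cn => w 0 k : R[i]^o) w = (j == k)%:R.
Proof.
have -> : (fun w : Cn => w 0 k : R[i]^o) = lform (fun j => (j == k)%:R).
  apply/funext => u; rewrite /lform (bigD1 k)//= eqxx mul1r big1 ?addr0// => j jk.
  by rewrite (negbTE jk) mul0r.
exact: cdiff_differentiable (cdiff_at_lform _ _).
Qed.

(** Mean value inequality: the increment is rotated onto the positive real axis
    and the real mean value theorem is applied to its real part. *)
Lemma increment_le f w h (K : R) :
  (forall s : R, 0 <= s <= 1 -> differentiable f (w + (s%:C : R[i]^o) *: h)) ->
  (forall s : R, 0 <= s <= 1 ->
    cmod (lform (fun j => pd j f (w + (s%:C : R[i]^o) *: h)) h) <= K) ->
  cmod (f (w + h) - f w) <= K.
Proof.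
move=> df dK; set I : R[i] := f (w + h) - f w.
have [I0|I0] := eqVneq I 0.
  have := dK 0; rewrite lexx ler01 => /(_ isT); apply: le_trans.
  by rewrite I0 cmod0 cmod_ge0.
have c0 : cmod I != 0 by rewrite cmod_eq0.
have cp : 0 < cmod I by rewrite cmod_gt0.
pose u := I^* / (cmod I)%:C.
have cC0 : (cmod I)%:C != 0 :> R[i] by rewrite -(rmorph0 (real_complex R)) (inj_eq (@complexI R)).
have uI : u * I = (cmod I)%:C.
  rewrite /u mulrAC [I^* * I]mulrC mul_conj -sqr_cmod expr2 rmorphM/=.
  by rewrite mulfK.
have cu : cmod u = 1.
  by rewrite /u cmodM cmodV cmod_conj cmod_ger0 ?cmod_ge0// divff.
pose F s : R := complex.Re (u * f (w + (s%:C : R[i]^o) *: h)).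
pose dF s : R := complex.Re (u * lform (fun j => pd j f (w + (s%:C : R[i]^o) *: h)) h).
have dFP (s : R) : 0 <= s <= 1 -> is_derive s 1 F (dF s).
  move=> s01; apply: increment_is_derive => e e0.
  have h1 : 0 < enorm h + 1 by rewrite ltr_wpDl// enorm_ge0.
  have [d d0 hd] := differentiable_cdiff (df s s01) (divr_gt0 e0 h1).
  exists (d / (enorm h + 1)); first by rewrite divr_gt0.
  move=> t; rewrite ltr_pdivlMr// => ht.
  have th : enorm ((t%:C : R[i]^o) *: h) < d.
    by rewrite enormZ cmod_real; apply: le_lt_trans ht; rewrite ler_wpM2l//; lra.
  have := hd _ th; rewrite enormZ cmod_real lformZ => H.
  have -> : F (s + t) - F s - dF s * t = complex.Re (u * (f (w + (s%:C : R[i]^o) *: h + (t%:C : R[i]^o) *: h) -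
     f (w + (s%:C : R[i]^o) *: h) - t%:C * lform (fun j => pd j f (w + (s%:C : R[i]^o) *: h)) h)).
    rewrite /F /dF rmorphD scalerDl addrA !mulrBr !cReD !cReN mulrCA ReM_real.
    by congr (_ - _); rewrite mulrC.
  apply: le_trans (Re_le_cmod _) _; rewrite cmodM cu mul1r; apply: le_trans H _.
  rewrite mulrAC ler_pdivrMr//.
  have := mulr_ge0 (mulr_ge0 (ltW e0) (normr_ge0 t)) (enorm_ge0 h).
  by have := mulr_ge0 (ltW e0) (normr_ge0 t); nra.
have [||s] := @MVT R F dF 0 1 ltr01 _ _.
- by move=> s; rewrite in_itv/= => /andP[h1 h2]; apply: dFP; rewrite !ltW.
- apply: derivable_within_continuous => s; rewrite in_itv/= => s01.
  by have [] := dFP s s01.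
rewrite in_itv/= => /andP[s0 s1]; rewrite subr0 mulr1 => E.
have -> : cmod I = F 1 - F 0.
  rewrite /F scale1r scale0r addr0 -cReN -cReD -mulrBr -/I uI //.
rewrite E; apply: le_trans (ler_norm _) _; apply: le_trans (Re_le_cmod _) _.
by rewrite cmodM cu mul1r dK// !ltW.
Qed.

Lemma cmod_circle_mean (h : R -> R[i]) (M : R) : (forall t, rcont h t) ->
  (forall t, cmod (h t) <= M) -> cmod (cint mu `[0, 2 * pi] h) <= 2 * pi * M.
Proof.
move=> ch hM; have ih := cintegrable_circle ch.
have m : measurable (`[0, 2 * pi] : set (measurableTypeR R)) by [].
apply: le_trans (cmod_cint m ih) _.
have i1 : mu.-integrable `[0, 2 * pi] (EFin \o (fun _ => M)).
  by apply: continuous_integrable => s _; exact: cvg_cst.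
apply: le_trans (_ : \int[mu]_(x in `[0, 2 * pi]) M <= _).
  by apply: le_Rintegral => //; exact: integrable_cmod.
have := @segint_cst R 0 (2 * pi) M; rewrite /segint => ->.
  by rewrite subr0 mulrC.
by rewrite mulr_ge0// pi_ge0.
Qed.

(** Cauchy's estimate, read off from a circular mean on the slice of radius
    d through z in the j-th direction. *)
Lemma cauchy_pd f z (d M : R) j : 0 < d ->
  (forall w, enorm (w - z) <= d -> differentiable f w) ->
  (forall w, enorm (w - z) <= d -> cmod (f w) <= M) ->
  cmod (pd j f z) <= M / d.
Proof.
move=> d0 df fM; pose w : Cn := (d%:C : R[i]^o) *: ej R j.
have ew : enorm w = d.
  rewrite /w enormZ cmod_ger0 ?ltW// /enorm /sqn (bigD1 j)//= mxE !eqxx big1 => [|i ij].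
    by rewrite addr0 -[sqmod _]sqr_cmod cmod1 expr1n sqrtr1 mulr1.
  by rewrite mxE eqxx (negbTE ij) sqmod0.
have E (a : R[i]) : enorm (z + (a : R[i]^o) *: w - z) = cmod a * d.
  by rewrite addrAC subrr add0r enormZ ew.
have dw (a : R[i]) : cmod a <= 1 -> differentiable f (z + (a : R[i]^o) *: w).
  by move=> a1; apply: df; rewrite E ler_piMl// ltW.
have := slice_mean1 dw.
have -> : lform (fun j => pd j f z) w = d%:C * pd j f z.
  rewrite /w lformZ; congr (_ * _); rewrite /lform (bigD1 j)//= mxE !eqxx mulr1 big1 ?addr0//.
  by move=> i ij; rewrite mxE (negbTE ij) andbF mulr0.
move=> H; rewrite ler_pdivlMr//.
have pi2 : (0 : R) < 2 * pi by rewrite mulr_gt0// pi_gt0.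
rewrite -(ler_pM2l pi2); have -> : 2 * pi * (cmod (pd j f z) * d) = cmod ((2 * pi)%:C * (d%:C * pd j f z)).
  by rewrite !cmodM !cmod_ger0 1?ltW//; ring.
rewrite -H; apply: cmod_circle_mean => t.
  apply: (@rcontM R (fun t => f (z + (cis t : R[i]^o) *: w))).
    apply: rcont_slice; apply: cdiff_ccont; apply: differentiable_cdiff.
    by apply: dw; rewrite cmod_cis.
  by apply: rcont_conj; exact: rcont_cis.
by rewrite cmodM cmod_conj cmod_cis mulr1; apply: fM; rewrite E cmod_cis mul1r.
Qed.

End holomorphic_calculus.

(** * Partial derivatives of holomorphic functions are holomorphic *)

Section holomorphic_derivatives.
Context (R : realType) (n : nat).
Local Notation Cn := (Cn R n).
Local Notation mu := (@lebesgue_measure R).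
Implicit Types (f g : Cn -> R[i]^o) (z w h : Cn).

Definition ball_holo f z (r : R) := forall w, enorm (w - z) < r -> differentiable f w.

Lemma enorm_mid z w h (s r : R) : 0 <= s <= 1 -> enorm (w - z) < r ->
  enorm (w + h - z) < r -> enorm (w + (s%:C : R[i]^o) *: h - z) < r.
Proof.
move=> /andP[s0 s1] h1 h2.
have -> : w + (s%:C : R[i]^o) *: h - z = (((1 - s)%:C : R[i]) : R[i]^o) *: (w - z) + (s%:C : R[i]^o) *: (w + h - z).
  apply/rowP => k; rewrite !mxE rmorphB rmorph1.
  have E (S a b c : R[i]) : a + S * b - c = (1 - S) * (a - c) + S * (a + b - c) by ring.
  exact: E.
apply: le_lt_trans (enormD _ _) _; rewrite !enormZ !cmod_ger0//; last by lra.
have [->|sn0] := eqVneq s 0; first by rewrite subr0 mul1r mul0r addr0.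
have sp : 0 < s by rewrite lt_neqAle eq_sym sn0.
have A1 : (1 - s) * enorm (w - z) <= (1 - s) * r by apply: ler_wpM2l; [lra|exact: ltW].
have A2 : s * enorm (w + h - z) < s * r by rewrite ltr_pM2l.
lra.
Qed.

Lemma lform_le (L : 'I_n -> R[i]) h (K : R) : (forall j, cmod (L j) <= K) ->
  cmod (lform L h) <= n%:R * K * enorm h.
Proof.
move=> LK; apply: le_trans (lform_bound _ _) _; rewrite ler_wpM2r ?enorm_ge0//.
apply: le_trans (_ : \sum_(j < n) K <= _); first by apply: ler_sum => j _; exact: LK.
by rewrite sumr_const card_ord mulr_natl.
Qed.

Section local_bounds.
Variables (f : Cn -> R[i]^o) (z : Cn) (d M : R).
Hypothesis d0 : 0 < d.
Hypothesis df : ball_holo f z (4 * d).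
Hypothesis fM : forall w, enorm (w - z) < 4 * d -> cmod (f w) <= M.

Let M0 : 0 <= M.
Proof. by apply: (@le_trans _ _ (cmod (f z))); [exact: cmod_ge0|apply: fM; rewrite subrr enorm0 mulr_gt0]. Qed.

Let tri (u w : Cn) (a b : R) : enorm (w - z) < a -> enorm (u - w) <= b -> enorm (u - z) < a + b.
Proof.
move=> h1 h2; have -> : u - z = (w - z) + (u - w) by rewrite [RHS]addrC addrA subrK.
by apply: le_lt_trans (enormD _ _) _; rewrite ltr_leD.
Qed.

Let L1 : R := M / d.

Let pd_bound w j : enorm (w - z) < 3 * d -> cmod (pd j f w) <= L1.
Proof.
move=> hw; apply: cauchy_pd => // u hu.
  by apply: df; apply: lt_le_trans (tri hw hu) _; have := d0; lra.
by apply: fM; apply: lt_le_trans (tri hw hu) _; have := d0; lra.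
Qed.

Let L2 : R := n%:R * L1.

Let lip w h : enorm (w - z) < 3 * d -> enorm (w + h - z) < 3 * d ->
  cmod (f (w + h) - f w) <= L2 * enorm h.
Proof.
move=> h1 h2; apply: increment_le => s s01.
  by apply: df; apply: lt_le_trans (enorm_mid s01 h1 h2) _; have := d0; lra.
by apply: lform_le => j; apply: pd_bound; exact: enorm_mid.
Qed.

Let L2_ge0 : 0 <= L2. Proof. by apply: mulr_ge0 => //; apply: divr_ge0 => //; exact: ltW. Qed.

Let pd_lip w h j : enorm (w - z) < 2 * d -> enorm (w + h - z) < 2 * d ->
  cmod (pd j f (w + h) - pd j f w) <= L2 * enorm h / d.
Proof.
move=> h1 h2.
have dsh u : enorm (u - w) <= d -> differentiable f (u + h).
  move=> hu; apply: df; have hu' : enorm (u + h - (w + h)) <= d by rewrite opprD addrACA subrr addr0.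
  by apply: lt_le_trans (tri h2 hu') _; have := d0; lra.
have du u : enorm (u - w) <= d -> differentiable f u.
  by move=> hu; apply: df; apply: lt_le_trans (tri h1 hu) _; have := d0; lra.
have ww : enorm (w - w) <= d by rewrite subrr enorm0 ltW.
have sh := differentiable_shift (dsh _ ww).
have [_ /(_ j)] := holoB sh (du _ ww); rewrite (pd_shift _ (dsh _ ww)) => <-.
apply: (cauchy_pd (d := d)); [exact: d0| |] => u hu.
  by have [D _] := holoB (differentiable_shift (dsh _ hu)) (du _ hu).
have hu' : enorm (u + h - (w + h)) <= d by rewrite opprD addrACA subrr addr0.
apply: lip; first by apply: lt_le_trans (tri h1 hu) _; have := d0; lra.
by apply: lt_le_trans (tri h2 hu') _; have := d0; lra.
Qed.

Let taylor w h : enorm (w - z) < 2 * d -> enorm (w + h - z) < 2 * d ->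
  cmod (f (w + h) - f w - lform (fun j => pd j f w) h) <= n%:R * (L2 / d) * enorm h ^+ 2.
Proof.
move=> h1 h2; set L := (fun j => pd j f w).
have dl u : differentiable (lform L : Cn -> R[i]^o) u /\ forall j, pd j (lform L) u = L j.
  exact: cdiff_differentiable (cdiff_at_lform _ _).
have d2 : 2 * d <= 4 * d by have := d0; lra.
have -> : f (w + h) - f w - lform L h = (f (w + h) - lform L (w + h)) - (f w - lform L w).
  rewrite linearD/=; ring.
apply: (@increment_le _ _ (fun u => f u - lform L u)) => s s01; have ms := enorm_mid s01 h1 h2.
  have [] // := holoB (df (lt_le_trans ms d2)) (dl _).1.
rewrite expr2 mulrA -[n%:R * _ * _]mulrA; apply: lform_le => j.
have [_ ->] := holoB (df (lt_le_trans ms d2)) (dl (w + (s%:C : R[i]^o) *: h)).1.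
rewrite (dl _).2 /L; apply: le_trans (pd_lip j h1 ms) _.
rewrite mulrAC enormZ cmod_ger0 ?(andP s01).1// ler_wpM2l//; first by rewrite divr_ge0// ltW.
by rewrite ler_piMl ?enorm_ge0//; case/andP: s01.
Qed.

(** Differentiation under the circular mean that represents [pd j f]; the
    second order bound makes the remainder uniform on the circle. *)
Lemma cdiff_at_pd j : exists L, cdiff_at (fun w => pd j f w : R[i]^o) z L.
Proof.
pose e := (d%:C : R[i]^o) *: ej R j; pose pt t : Cn := z + (cis t : R[i]^o) *: e.
have ee : enorm e = d.
  rewrite /e enormZ cmod_ger0 ?ltW// /enorm /sqn (bigD1 j)//= mxE !eqxx big1 => [|i ij].
    by rewrite addr0 -[sqmod _]sqr_cmod cmod1 expr1n sqrtr1 mulr1.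
  by rewrite mxE eqxx (negbTE ij) sqmod0.
have pte t : enorm (pt t - z) = d.
  by rewrite /pt addrAC subrr add0r enormZ cmod_cis mul1r ee.
have cc t : rcont (fun t => (cis t : R[i])^*) t by apply: rcont_conj; exact: rcont_cis.
have cpd k t : rcont (fun t => pd k f (pt t) * (cis t)^*) t.
  apply: (@rcontM R (fun t => pd k f (pt t))); last exact: cc.
  apply: rcont_slice => a a0.
  have L20 : 0 < L2 / d + 1 by rewrite ltr_wpDl// divr_ge0// ltW.
  exists (Num.min d (a / (L2 / d + 1))) => [|u]; first by rewrite lt_min d0 divr_gt0.
  rewrite lt_min -/(pt t) => /andP[u1 u2].
  have := @pd_lip (pt t) (u - pt t) k; rewrite [pt t + (u - pt t)]addrC subrK => H.
  have p2 : enorm (pt t - z) < 2 * d by rewrite pte; have := d0; lra.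
  apply: le_lt_trans (H p2 _) _.
    have -> : u - z = (u - pt t) + (pt t - z) by rewrite addrA subrK.
    by apply: le_lt_trans (enormD _ _) _; rewrite pte mulr_natl mulr2n ltrD2r.
  rewrite mulrAC; apply: le_lt_trans (_ : (L2 / d + 1) * enorm (u - pt t) < _).
    by rewrite ler_wpM2r ?enorm_ge0// lerDl.
  by rewrite mulrC -ltr_pdivlMr.
have pi2 : (0 : R) < 2 * pi by rewrite mulr_gt0// pi_gt0.
have pi2C : (2 * pi)%:C != 0 :> R[i] by rewrite -cmod_eq0 cmod_real normr_eq0 gt_eqF.
have dC : d%:C != 0 :> R[i] by rewrite -cmod_eq0 cmod_real normr_eq0 gt_eqF.
pose A k := cint mu `[0, 2 * pi] (fun t => pd k f (pt t) * (cis t)^*).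
pose c : R[i] := ((2 * pi)%:C * d%:C)^-1.
have repr w : enorm (w - z) < d ->
    pd j f w = c * cint mu `[0, 2 * pi] (fun t => f (w + (cis t : R[i]^o) *: e) * (cis t)^*) /\
    forall t, rcont (fun t => f (w + (cis t : R[i]^o) *: e) * (cis t)^*) t.
  move=> hw.
  have dw (a : R[i]) : cmod a <= 1 -> differentiable f (w + (a : R[i]^o) *: e).
    move=> a1; apply: df; apply: (@lt_le_trans _ _ (d + d)); last by have := d0; lra.
    apply: tri hw _; rewrite addrAC subrr add0r enormZ ee ler_piMl//; exact: ltW.
  split.
    rewrite (slice_mean1 dw).
    have -> : lform (fun j => pd j f w) e = d%:C * pd j f w.
      rewrite /e lformZ; congr (_ * _); rewrite /lform (bigD1 j)//= mxE !eqxx mulr1 big1 ?addr0//.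
      by move=> i ij; rewrite mxE (negbTE ij) andbF mulr0.
    by rewrite [(2 * pi)%:C * (_ * _)]mulrA /c mulKf// mulf_neq0.
  move=> t; apply: (@rcontM R (fun t => f (w + (cis t : R[i]^o) *: e))); last exact: cc.
  apply: rcont_slice; apply: cdiff_ccont; apply: differentiable_cdiff; apply: dw.
  by rewrite cmod_cis.
exists (fun k => c * A k) => a a0.
pose K := n%:R * (L2 / d) / d + 1.
have K0 : 0 < K by rewrite ltr_wpDl// mulr_ge0 ?invr_ge0 ?(ltW d0)// mulr_ge0// divr_ge0// ltW.
exists (Num.min d (a / K)) => [|h]; first by rewrite lt_min d0 divr_gt0.
rewrite lt_min => /andP[hd hK].
have zh : enorm (z + h - z) < d by rewrite addrAC subrr add0r.
have zz : enorm (z - z) < d by rewrite subrr enorm0.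
have [E1 c1] := repr _ zh; have [E2 c2] := repr _ zz.
have m : measurable (`[0, 2 * pi] : set (measurableTypeR R)) by [].
have i1 := cintegrable_circle c1; have i2 := cintegrable_circle c2.
have i3 k := cintegrable_circle (cpd k).
have i4 : cintegrable mu `[0, 2 * pi] (fun t => lform (fun k => pd k f (pt t)) h * (cis t)^*).
  have i6 : cintegrable mu `[0, 2 * pi] (fun t => \sum_(k < n) (h 0 k : R[i]) * (pd k f (pt t) * (cis t)^*)).
    by apply: cintegrable_sum => // k _; exact: cintegrableZ.
  apply: eq_cintegrable i6 => // t _; rewrite /lform mulr_suml; apply: eq_bigr => k _; ring.
have E3 : lform (fun k => c * A k) h = c * cint mu `[0, 2 * pi] (fun t => lform (fun k => pd k f (pt t)) h * (cis t)^*).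
  have -> : cint mu `[0, 2 * pi] (fun t => lform (fun k => pd k f (pt t)) h * (cis t)^*) =
     \sum_(k < n) (h 0 k : R[i]) * A k.
    under eq_bigr do rewrite -cintZ//.
    rewrite -cint_sum//; last by move=> k _; exact: cintegrableZ.
    apply: eq_cint => t _; rewrite /lform mulr_suml; apply: eq_bigr => k _; ring.
  rewrite /lform mulr_sumr; apply: eq_bigr => k _; ring.
rewrite E1 E2 E3 -!mulrBr -!cintB//; last exact: cintegrableB.
rewrite cmodM.
have -> : cmod c = (2 * pi)^-1 / d by rewrite cmodV -rmorphM cmod_ger0 ?mulr_ge0 ?pi_ge0 ?ltW// invfM.
have B : cmod (cint mu `[0, 2 * pi] (fun t => f (z + h + (cis t : R[i]^o) *: e) * (cis t)^* -
    f (z + (cis t : R[i]^o) *: e) * (cis t)^* - lform (fun k => pd k f (pt t)) h * (cis t)^*)) <=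
    2 * pi * (n%:R * (L2 / d) * enorm h ^+ 2).
  apply: cmod_circle_mean => t; last first.
    rewrite -!mulrBl cmodM cmod_conj cmod_cis mulr1 [z + h + _]addrAC; apply: taylor.
      by rewrite pte; have := d0; lra.
    have -> : z + (cis t : R[i]^o) *: e + h - z = h + (pt t - z) by rewrite [_ + h]addrC -addrA.
    by apply: le_lt_trans (enormD _ _) _; rewrite pte mulr_natl mulr2n ltrD2r.
  have i5 s : rcont (fun t => lform (fun k => pd k f (pt t)) h * (cis t)^*) s.
    have -> : (fun t => lform (fun k => pd k f (pt t)) h * (cis t)^*) =
      (fun t => \sum_(k < n) (h 0 k : R[i]) * (pd k f (pt t) * (cis t)^*)).
      apply/funext => u; rewrite /lform mulr_suml; apply: eq_bigr => k _; ring.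
    apply: rcont_sum => k; apply: rcontM; last exact: cpd.
    by split; exact: cvg_cst.
  by apply: rcontB; [apply: rcontB; [exact: c1|exact: c2]|exact: i5].
apply: le_trans (ler_wpM2l _ B) _; first by rewrite mulr_ge0 ?invr_ge0 ?(ltW d0)// ltW.
have -> : (2 * pi)^-1 / d * (2 * pi * (n%:R * (L2 / d) * enorm h ^+ 2)) = (K - 1) * enorm h * enorm h.
  by rewrite /K addrK mulrACA mulVf ?gt_eqF// mul1r [LHS]mulrC [LHS]mulrAC expr2 [LHS]mulrA.
rewrite ler_wpM2r ?enorm_ge0//.
apply: le_trans (_ : K * enorm h <= _); first by rewrite ler_wpM2r ?enorm_ge0// gerBl.
by rewrite mulrC -ler_pdivlMr// ltW.
Qed.

End local_bounds.

(** Cauchy's estimate applied to f, then to increments of f, bounds the second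
    order Taylor remainder near z; the representation of [pd j f] as a circular
    mean can then be differentiated. *)
Lemma holo_pd f z (r : R) j : 0 < r -> ball_holo f z r -> differentiable (fun w => pd j f w : R[i]^o) z.
Proof.
move=> r0 df.
have dz : differentiable f z by apply: df; rewrite subrr enorm0.
have [d1 d10 h1] := cdiff_ccont (differentiable_cdiff dz) ltr01.
pose d := Num.min (r / 4) (d1 / 4).
have d0 : 0 < d by rewrite lt_min !divr_gt0.
have [dr dd1] : 4 * d <= r /\ 4 * d <= d1.
  have : d <= r / 4 by rewrite ge_min lexx.
  have : d <= d1 / 4 by rewrite ge_min lexx orbT.
  lra.
have [] := @cdiff_at_pd f z d (cmod (f z) + 1) d0 _ _ j.
- by move=> w hw; apply: df; exact: lt_le_trans dr.
- move=> w hw; have := h1 w (lt_le_trans hw dd1).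
  have := cmod_triangle_sub (f w) (f z); have := ler_norm (cmod (f w) - cmod (f z)); lra.
by move=> L /cdiff_differentiable[].
Qed.

End holomorphic_derivatives.

(** * The Bergman space of a ball *)

Section square_integrable.
Context (R : realType) (n : nat).
Local Notation Cn := (Cn R n).
Local Notation muC := (lebesgueC R n).
Implicit Types (f g : Cn -> R[i]^o) (z w c : Cn) (r : R).

Lemma eball_norm c r : eball c `|r| = eball c r.
Proof. by apply/funext => w; rewrite /eball/= real_normK// num_real. Qed.

Lemma eball_open c r w : eball c r w -> exists2 d : R, 0 < d &
  forall w', enorm (w' - w) < d -> eball c r w'.
Proof.
rewrite -eball_norm => /(eballE _ _ (normr_ge0 r)) h.
exists (`|r| - enorm (w - c)); first by rewrite subr_gt0.
move=> w' h'; apply/(eballE _ _ (normr_ge0 r)).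
have -> : w' - c = (w' - w) + (w - c) by rewrite addrA subrK.
by apply: le_lt_trans (enormD _ _) _; rewrite -ltrBrDr.
Qed.

Lemma eball_sub c r r' : 0 <= r -> r <= r' -> eball c r `<=` eball c r'.
Proof.
move=> r0 rr w /(eballE _ _ r0) h; apply/(eballE _ _ (le_trans r0 rr)).
exact: lt_le_trans rr.
Qed.

Lemma eball_ccont f c r w : (forall w, eball c r w -> differentiable f w) -> eball c r w -> ccont f w.
Proof. by move=> df /df/differentiable_cdiff/cdiff_ccont. Qed.

Lemma measurable_sqmod_ball f c r : (forall w, eball c r w -> ccont f w) ->
  measurable_fun (preball c r) (fun p => sqmod (f (vec p)) : measurableTypeR R).
Proof.
move=> cf; have [m1 m2] := measurable_ccont (measurable_preball c r) (fun p => cf (vec p)).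
by apply: measurable_funD; apply: measurable_funX.
Qed.

Definition nsq c r f : R := \int[muC]_(p in preball c r) sqmod (f (vec p)).

Lemma nsq_ge0 c r f : 0 <= nsq c r f.
Proof. by apply: Rintegral_ge0 => p _; exact: sqmod_ge0. Qed.

Lemma bergman_integrable c r f : bergman c r f ->
  muC.-integrable (preball c r) (EFin \o (fun p => sqmod (f (vec p)))).
Proof.
move=> [df foo]; apply/integrableP; split.
  apply/measurable_EFinP; apply: measurable_sqmod_ball => w; exact: eball_ccont.
suff -> : (\int[muC]_(p in preball c r) `|(EFin \o (fun p => sqmod (f (vec p)))) p|)%E = L2sq c r f by [].
by apply: eq_integral => p _; rewrite /= ger0_norm ?sqmod_ge0.
Qed.

Lemma L2sqE c r f : bergman c r f -> L2sq c r f = (nsq c r f)%:E.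
Proof.
move=> /bergman_integrable h; rewrite /nsq /Rintegral fineK//.
apply: integrable_fin_num => //; exact: measurable_preball.
Qed.

Lemma integrable_bergman c r f : (forall w, eball c r w -> differentiable f w) ->
  muC.-integrable (preball c r) (EFin \o (fun p => sqmod (f (vec p)))) -> bergman c r f.
Proof.
move=> df /integrableP[_ foo]; split => //.
suff <- : (\int[muC]_(p in preball c r) `|(EFin \o (fun p => sqmod (f (vec p)))) p|)%E = L2sq c r f by [].
by apply: eq_integral => p _; rewrite /= ger0_norm ?sqmod_ge0.
Qed.

Lemma L2sq_ge0 c r f : (0 <= L2sq c r f)%E.
Proof. by apply: integral_ge0 => p _; rewrite lee_fin sqmod_ge0. Qed.

Lemma eq_L2sq c r f g : (forall w, eball c r w -> f w = g w) -> L2sq c r f = L2sq c r g.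
Proof. by move=> fg; apply: eq_integral => p /set_mem /fg ->. Qed.

Lemma eq_bergman c r f g : (forall w, eball c r w -> f w = g w) -> bergman c r f -> bergman c r g.
Proof.
move=> fg [df foo]; split; last by rewrite -(eq_L2sq fg).
move=> w cw; have [d d0 hd] := eball_open cw.
suff [] : differentiable g w /\ forall j, pd j g w = pd j f w by [].
by apply: differentiable_ext (df w cw); exists d => // w' /hd /fg.
Qed.

Lemma bergman_sub c r r' f : 0 <= r -> r <= r' -> bergman c r' f -> bergman c r f.
Proof.
move=> r0 rr bf; have s := @eball_sub c r r' r0 rr; apply: integrable_bergman.
  by move=> w /s; case: bf => df _; exact: df.
apply: integrableS (bergman_integrable bf); [exact: measurable_preball|exact: measurable_preball|].
by move=> p; exact: s.
Qed.

Lemma nsq_sub c r r' f : 0 <= r -> r <= r' -> bergman c r' f -> nsq c r f <= nsq c r' f.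
Proof.
move=> r0 rr bf; have s := @eball_sub c r r' r0 rr.
rewrite -lee_fin -!L2sqE//; last exact: bergman_sub bf.
apply: ge0_subset_integral => //; first exact: measurable_preball.
- exact: measurable_preball.
- by have /integrableP[] := bergman_integrable bf.
- by move=> p _; rewrite lee_fin sqmod_ge0.
- by move=> p; exact: s.
Qed.

Lemma sqmodD_le2 (x y : R[i]) : sqmod (x + y) <= 2 * sqmod x + 2 * sqmod y.
Proof. by have := sqmodD_le x y ltr01 ltr01; rewrite divr1. Qed.

Lemma bergmanZ c r (a : R[i]) f : bergman c r f -> bergman c r (fun w => a * (f w : R[i])).
Proof.
move=> bf; apply: integrable_bergman.
  by move=> w /bf.1 /(holoZ a)[].
apply: eq_integrable (integrableRZ (sqmod a) _ (bergman_integrable bf)); try exact: measurable_preball.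
by move=> p _; rewrite /= sqmodM.
Qed.

Lemma bergmanD c r f g : bergman c r f -> bergman c r g -> bergman c r (fun w => f w + g w).
Proof.
move=> bf bg; have mB := measurable_preball c r; apply: integrable_bergman.
  by move=> w cw; have [] := holoD (bf.1 _ cw) (bg.1 _ cw).
have i1 := integrableRZ 2 mB (bergman_integrable bf).
have i2 := integrableRZ 2 mB (bergman_integrable bg).
apply: le_integrable (integrableD mB i1 i2) => //.
  apply/measurable_EFinP; apply: (measurable_sqmod_ball (f := fun w => f w + g w)) => w cw.
  by apply: ccontD; [exact: eball_ccont bf.1 cw|exact: eball_ccont bg.1 cw].
move=> p _ /=; rewrite lee_fin ger0_norm ?sqmod_ge0//.
by apply: le_trans (sqmodD_le2 _ _) _; exact: ler_norm.
Qed.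

Lemma bergmanN c r f : bergman c r f -> bergman c r (fun w => - f w).
Proof. by move=> /(bergmanZ (-1)); apply: eq_bergman => w _; rewrite mulN1r. Qed.

Lemma bergmanB c r f g : bergman c r f -> bergman c r g -> bergman c r (fun w => f w - g w).
Proof. by move=> bf /bergmanN; exact: bergmanD. Qed.

Lemma bergman_bounded c r f (M : R) : (forall w, eball c r w -> differentiable f w) ->
  (forall w, eball c r w -> cmod (f w) <= M) -> bergman c r f /\ nsq c r f <= M ^+ 2 * fine (muC (preball c r)).
Proof.
move=> df fM; have mB := measurable_preball c r.
have iM := integrable_cst_ball c r (M ^+ 2).
have le p : preball c r p -> sqmod (f (vec p)) <= M ^+ 2.
  move=> /fM h; rewrite -sqr_cmod ler_pXn2r ?nnegrE ?cmod_ge0//.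
  exact: le_trans (cmod_ge0 _) h.
have bf : bergman c r f.
  apply: integrable_bergman => //; apply: le_integrable iM => //.
    by apply/measurable_EFinP; apply: measurable_sqmod_ball => w; exact: eball_ccont.
  by move=> p Bp /=; rewrite lee_fin !ger0_norm ?sqmod_ge0 ?sqr_ge0//; exact: le.
split => //; have -> : M ^+ 2 * fine (muC (preball c r)) = \int[muC]_(p in preball c r) (M ^+ 2).
  by rewrite Rintegral_cst.
by apply: le_Rintegral => //; exact: bergman_integrable.
Qed.

Lemma cintegrable_ip c r f g : bergman c r f -> bergman c r g ->
  cintegrable muC (preball c r) (fun p => f (vec p) * (g (vec p) : R[i])^*).
Proof.
move=> bf bg; have mB := measurable_preball c r.
have cc w : eball c r w -> ccont (fun w => (f w : R[i]) * (g w : R[i])^*) w.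
  by move=> cw; apply: ccontM; [exact: eball_ccont bf.1 cw|apply: ccont_conj; exact: eball_ccont bg.1 cw].
have [m1 m2] := measurable_ccont mB (fun p => cc (vec p)).
apply: (cintegrable_dominated (G := fun p => sqmod (f (vec p)) + sqmod (g (vec p)))) => //.
  move=> p _; rewrite cmodM cmod_conj -!sqr_cmod.
  have := sqr_ge0 (cmod (f (vec p)) - cmod (g (vec p))); rewrite sqrrB.
  have := sqr_ge0 (cmod (f (vec p))); have := sqr_ge0 (cmod (g (vec p))).
  by rewrite -mulr_natr; lra.
exact: eq_integrable (integrableD mB (bergman_integrable bf) (bergman_integrable bg)).
Qed.

Definition ip c r f g : R[i] := cint muC (preball c r) (fun p => f (vec p) * (g (vec p) : R[i])^*).

Lemma eq_ip c r f f' g g' : (forall w, eball c r w -> f w = f' w) ->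
  (forall w, eball c r w -> g w = g' w) -> ip c r f g = ip c r f' g'.
Proof. by move=> e1 e2; apply: eq_cint => p Bp; rewrite e1// e2. Qed.

Lemma ipC c r f g : bergman c r f -> bergman c r g -> ip c r g f = (ip c r f g)^*.
Proof.
move=> bf bg; have mB := measurable_preball c r.
rewrite /ip -cint_conj//; last exact: cintegrable_ip.
by apply: eq_cint => p _; rewrite rmorphM/= conjcK mulrC.
Qed.

Lemma ipDl c r f f' g : bergman c r f -> bergman c r f' -> bergman c r g ->
  ip c r (fun w => f w + f' w) g = ip c r f g + ip c r f' g.
Proof.
move=> bf bf' bg; rewrite /ip -cintD; [|exact: measurable_preball|exact: cintegrable_ip|exact: cintegrable_ip].
by apply: eq_cint => p _; rewrite mulrDl.
Qed.

Lemma ipZl c r (a : R[i]) f g : bergman c r f -> bergman c r g ->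
  ip c r (fun w => a * (f w : R[i])) g = a * ip c r f g.
Proof.
move=> bf bg; rewrite /ip -cintZ; [|exact: measurable_preball|exact: cintegrable_ip].
by apply: eq_cint => p _; rewrite mulrA.
Qed.

Lemma ipDr c r f g g' : bergman c r f -> bergman c r g -> bergman c r g' ->
  ip c r f (fun w => g w + g' w) = ip c r f g + ip c r f g'.
Proof.
move=> bf bg bg'; rewrite /ip -cintD; [|exact: measurable_preball|exact: cintegrable_ip|exact: cintegrable_ip].
by apply: eq_cint => p _; rewrite rmorphD mulrDr.
Qed.

Lemma ipZr c r (a : R[i]) f g : bergman c r f -> bergman c r g ->
  ip c r f (fun w => a * (g w : R[i])) = a^* * ip c r f g.
Proof.
move=> bf bg; rewrite /ip -cintZ; [|exact: measurable_preball|exact: cintegrable_ip].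
by apply: eq_cint => p _; rewrite rmorphM mulrCA.
Qed.

Lemma ipBl c r f f' g : bergman c r f -> bergman c r f' -> bergman c r g ->
  ip c r (fun w => f w - f' w) g = ip c r f g - ip c r f' g.
Proof.
move=> bf bf' bg; rewrite /ip -cintB; [|exact: measurable_preball|exact: cintegrable_ip|exact: cintegrable_ip].
by apply: eq_cint => p _; rewrite mulrBl.
Qed.

Lemma ipBr c r f g g' : bergman c r f -> bergman c r g -> bergman c r g' ->
  ip c r f (fun w => g w - g' w) = ip c r f g - ip c r f g'.
Proof.
move=> bf bg bg'; rewrite /ip -cintB; [|exact: measurable_preball|exact: cintegrable_ip|exact: cintegrable_ip].
by apply: eq_cint => p _; rewrite rmorphB mulrBr.
Qed.

Lemma ip_nsq c r f : ip c r f f = (nsq c r f)%:C.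
Proof.
rewrite /ip /cint; apply: eqReIm => /=.
  by apply: eq_Rintegral => p _; rewrite mul_conj.
have -> : (0 : R) = \int[muC]_(p in preball c r) 0 by rewrite /Rintegral integral0.
by apply: eq_Rintegral => p _; rewrite mul_conj.
Qed.

Definition nrm c r f : R := Num.sqrt (nsq c r f).

Lemma nrm_ge0 c r f : 0 <= nrm c r f. Proof. exact: sqrtr_ge0. Qed.

Lemma sqr_nrm c r f : nrm c r f ^+ 2 = nsq c r f.
Proof. by rewrite sqr_sqrtr// nsq_ge0. Qed.

(** Optimizing over t gives the product of the square roots; replacing them by
    their sums with a small e avoids the degenerate cases A = 0 and B = 0. *)
Lemma amgm_le (x A B : R) : 0 <= A -> 0 <= B ->
  (forall t : R, 0 < t -> 2 * x <= t * A + B / t) -> x <= Num.sqrt A * Num.sqrt B.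
Proof.
move=> A0 B0 H; set a := Num.sqrt A; set b := Num.sqrt B.
have a0 : 0 <= a by exact: sqrtr_ge0. have b0 : 0 <= b by exact: sqrtr_ge0.
have K (e : R) : 0 < e -> x <= (a + e) * (b + e).
  move=> e0; have ae : 0 < a + e by rewrite ltr_wpDl.
  have be : 0 < b + e by rewrite ltr_wpDl.
  have := H ((b + e) / (a + e)) (divr_gt0 be ae).
  rewrite -[A]sqr_sqrtr// -[B]sqr_sqrtr// -/a -/b.
  have h1 : (b + e) / (a + e) * a ^+ 2 <= (a + e) * (b + e).
    rewrite mulrAC ler_pdivrMr// [leRHS]mulrAC -expr2 mulrC ler_wpM2r ?(ltW be)//.
    by rewrite ler_pXn2r ?nnegrE ?lerDl ?(ltW e0) ?(ltW ae).
  have h2 : b ^+ 2 / ((b + e) / (a + e)) <= (a + e) * (b + e).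
    rewrite invf_div mulrA ler_pdivrMr// mulrC -mulrA ler_wpM2l ?(ltW ae)// -expr2.
    by rewrite ler_pXn2r ?nnegrE ?lerDl ?(ltW e0) ?(ltW be).
  lra.
apply/ler_addgt0Pr => e e0.
pose d := Num.min 1 (e / (a + b + 1)).
have s0 : 0 < a + b + 1 by rewrite ltr_wpDl// addr_ge0.
have d0 : 0 < d by rewrite lt_min ltr01 divr_gt0.
have d1 : d <= 1 by rewrite ge_min lexx.
have d2 : d * (a + b + 1) <= e by rewrite -ler_pdivlMr// ge_min lexx orbT.
have d3 : d * d <= d by rewrite ler_piMl ?(ltW d0).
have := K d d0; nra.
Qed.

Lemma cauchy_schwarz c r f g : bergman c r f -> bergman c r g ->
  cmod (ip c r f g) <= nrm c r f * nrm c r g.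
Proof.
move=> bf bg; have mB := measurable_preball c r.
have i1 := bergman_integrable bf; have i2 := bergman_integrable bg.
apply: amgm_le; try exact: nsq_ge0.
move=> t t0; have := cmod_cint mB (cintegrable_ip bf bg); rewrite -/(ip c r f g) => h.
have j1 := integrableRZ (t / 2) mB i1; have j2 := integrableRZ (t^-1 / 2) mB i2.
have : \int[muC]_(p in preball c r) cmod (f (vec p) * (g (vec p) : R[i])^*) <=
   t / 2 * nsq c r f + t^-1 / 2 * nsq c r g.
  rewrite /nsq -!RintegralZl// -RintegralD//; apply: le_Rintegral => //.
  - exact: (integrable_cmod mB (cintegrable_ip bf bg)).
  - exact: eq_integrable (integrableD mB j1 j2).
  move=> p _; rewrite cmodM cmod_conj -!sqr_cmod.
  set x := cmod (f _); set y := cmod (g _).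
  have := sqr_ge0 (t * x - y); rewrite sqrrB -mulr_natr => q.
  have : 0 <= ((t * x) ^+ 2 - t * x * y * 2 + y ^+ 2) / t / 2 by rewrite !divr_ge0// ltW.
  have -> : ((t * x) ^+ 2 - t * x * y * 2 + y ^+ 2) / t / 2 = t / 2 * x ^+ 2 - x * y + t^-1 / 2 * y ^+ 2.
    by field; rewrite gt_eqF.
  lra.
rewrite -/(nsq c r f) -/(nsq c r g) [_ / t]mulrC; lra.
Qed.

Lemma nrmD c r f g : bergman c r f -> bergman c r g ->
  nrm c r (fun w => f w + g w) <= nrm c r f + nrm c r g.
Proof.
move=> bf bg; have bfg := bergmanD bf bg.
have [->|n0] := eqVneq (nrm c r (fun w => f w + g w)) 0; first by rewrite addr_ge0 ?nrm_ge0.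
have np : 0 < nrm c r (fun w => f w + g w) by rewrite lt_neqAle eq_sym n0 nrm_ge0.
rewrite -(ler_pM2l np) -expr2 sqr_nrm mulrDr.
have <- : cmod (ip c r (fun w => f w + g w) (fun w => f w + g w)) = nsq c r (fun w => f w + g w).
  by rewrite ip_nsq cmod_ger0// nsq_ge0.
rewrite ipDr//; apply: le_trans (cmodD _ _) _.
by apply: lerD; apply: cauchy_schwarz.
Qed.

Lemma nrmZ c r (a : R[i]) f : bergman c r f -> nrm c r (fun w => a * (f w : R[i])) = cmod a * nrm c r f.
Proof.
move=> bf; rewrite /nrm /cmod -sqrtrM ?sqmod_ge0//; congr Num.sqrt.
rewrite /nsq -RintegralZl//; [|exact: measurable_preball|exact: bergman_integrable].
by apply: eq_Rintegral => p _; rewrite sqmodM.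
Qed.

(** Averaging over circles turns the one-variable mean value property into the
    one for balls. *)
Lemma ball_mean f z d : 0 < d -> (forall w, eball 0 d w -> differentiable f (z + w)) ->
  cintegrable muC (preball 0 d) (fun p => f (z + vec p)) ->
  cint muC (preball 0 d) (fun p => f (z + vec p)) = (fine (muC (preball 0 d)))%:C * f z.
Proof.
move=> d0 df [i1 i2].
have dw w (a : R[i]) : eball 0 d w -> cmod a <= 1 -> differentiable f (z + (a : R[i]^o) *: w).
  move=> /(eball0E _ (ltW d0)) dw a1; apply: df; apply/(eball0E _ (ltW d0)).
  by rewrite enormZ; apply: le_lt_trans dw; rewrite ler_piMl// enorm_ge0.
have cf w : eball 0 d w -> ccont (fun w => f (z + w)) w.
  move=> dw'; have : differentiable (fun w => f (w + z)) w.
    by apply: differentiable_shift; rewrite addrC; exact: df.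
  move=> /differentiable_cdiff/cdiff_ccont; apply: ccont_ext; exists 1 => // w' _.
  by rewrite addrC.
have mB : measurable (preball (0 : Cn) d) by exact: measurable_preball.
apply: eqReIm; rewrite ?ReM_real ?ImM_real.
  have [||_ E] := @ball_circle_average R n d (fun w => complex.Re (f (z + w))) (fun=> complex.Re (f z)) _ i1.
  - by move=> w /cf /ccont_Re.
  - move=> w Bw; have := @slice_mean0 R n f z w (fun a => dw w a Bw).
    by move=> /(congr1 (@complex.Re R)); rewrite ReM_real.
  by rewrite [LHS]E Rintegral_cst// mulrC.
have [||_ E] := @ball_circle_average R n d (fun w => complex.Im (f (z + w))) (fun=> complex.Im (f z)) _ i2.
- by move=> w /cf /ccont_Im.
- move=> w Bw; have := @slice_mean0 R n f z w (fun a => dw w a Bw).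
  by move=> /(congr1 (@complex.Im R)); rewrite ImM_real.
by rewrite [LHS]E Rintegral_cst// mulrC.
Qed.

(** The volume of the ball of radius d. *)
Definition bvol d : R := pi ^+ n * (d ^+ 2) ^+ n / n`!%:R.

Lemma bvol_gt0 d : 0 < d -> 0 < bvol d.
Proof. by move=> d0; rewrite divr_gt0 ?ltr0n ?fact_gt0// mulr_gt0// !exprn_gt0// pi_gt0. Qed.

Lemma nsq_shift f c r : (forall w, eball c r w -> ccont f w) ->
  (L2sq c r f = L2sq 0 r (fun w => f (w + c))).
Proof.
move=> cf; have mf := measurable_sqmod_ball cf.
rewrite /L2sq (@integral_ball_affine _ _ 1 c c r (fun w => (sqmod (f w))%:E)); last 3 first.
- exact: oner_neq0.
- exact/measurable_EFinP.
- by move=> p _; rewrite lee_fin sqmod_ge0.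
rewrite subrr scaler0 cmod1 divr1 -sqr_cmod cmod1 !expr1n mul1e.
by apply: eq_integral => p _; rewrite scale1r.
Qed.

(** Evaluation at a point is bounded: the mean value property over a ball
    contained in the domain, followed by the inequality
    2 |f| <= |f|^2 / |f(z)| + |f(z)| under the integral sign. *)
Lemma sqmod_le_nsq f c r z d : 0 < d -> enorm (z - c) + d <= r -> bergman c r f ->
  sqmod (f z) * bvol d <= nsq c r f.
Proof.
move=> d0 zd bf; have r0 : 0 <= r by apply: le_trans zd; rewrite addr_ge0 ?enorm_ge0// ltW.
have sub : eball z d `<=` eball c r.
  move=> w /(eballE _ _ (ltW d0)) h; apply/(eballE _ _ r0).
  have -> : w - c = (w - z) + (z - c) by rewrite addrA subrK.
  by apply: le_lt_trans (enormD _ _) _; apply: lt_le_trans zd; rewrite addrC ltrD2l.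
have bz : bergman z d f.
  apply: integrable_bergman; first by move=> w /sub; exact: bf.1.
  apply: integrableS (bergman_integrable bf); [exact: measurable_preball|exact: measurable_preball|].
  by move=> p; exact: sub.
have le1 : nsq z d f <= nsq c r f.
  rewrite -lee_fin -!L2sqE//; apply: ge0_subset_integral; try exact: measurable_preball.
  - by have /integrableP[] := bergman_integrable bf.
  - by move=> p _; rewrite lee_fin sqmod_ge0.
  - by move=> p; exact: sub.
apply: le_trans le1; pose g : Cn -> R[i]^o := fun w => f (w + z).
have shz w : eball 0 d w -> eball z d (w + z).
  by move=> /(eball0E _ (ltW d0)) h; apply/(eballE _ _ (ltW d0)); rewrite addrK.
have dg w : eball 0 d w -> differentiable g w.
  by move=> /shz /bz.1 h; exact: differentiable_shift.
have E2 : L2sq z d f = L2sq 0 d g.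
  by apply: nsq_shift => w /(eball_ccont bz.1).
have bg : bergman 0 d g by split => //; rewrite -E2; case: bz.
have -> : nsq z d f = nsq 0 d g by apply: EFin_inj; rewrite -!L2sqE.
have mB : measurable (preball (0 : Cn) d) by exact: measurable_preball.
have ig : cintegrable muC (preball 0 d) (fun p => g (vec p)).
  have cc w : eball 0 d w -> ccont g w by exact: eball_ccont.
  have [m1 m2] := measurable_ccont mB (fun p => cc (vec p)).
  apply: (cintegrable_dominated (G := fun p => sqmod (g (vec p)) + 1)) => //.
    by move=> p _; rewrite -sqr_cmod; have := sqr_ge0 (cmod (g (vec p)) - 1); have := cmod_ge0 (g (vec p)); nra.
  exact: eq_integrable (integrableD mB (bergman_integrable bg) (integrable_cst_ball 0 d 1)).
have mean := @ball_mean f z d d0.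
have V : fine (muC (preball 0 d)) = bvol d by rewrite measure_ball.
have {mean} mean : cint muC (preball 0 d) (fun p => g (vec p)) = (bvol d)%:C * f z.
  rewrite -V -mean.
  - by apply: eq_cint => p _; rewrite /g addrC.
  - by move=> w Bw; apply: bz.1; rewrite addrC; exact: shz.
  - by apply: eq_cintegrable ig => // p _; rewrite /g addrC.
have v0 := bvol_gt0 d0.
have [f0|fz] := eqVneq (f z : R[i]) 0; first by rewrite f0 sqmod0 mul0r nsq_ge0.
set x := cmod (f z); have x0 : 0 < x by rewrite cmod_gt0.
have h := cmod_cint mB ig; rewrite mean cmodM cmod_ger0 ?(ltW v0)// -/x in h.
have j1 := integrableRZ (x^-1 / 2) mB (bergman_integrable bg).
have j2 := integrable_cst_ball (0 : Cn) d (x / 2).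
have : \int[muC]_(p in preball 0 d) cmod (g (vec p)) <= x^-1 / 2 * nsq 0 d g + x / 2 * bvol d.
  rewrite /nsq -RintegralZl//; last exact: bergman_integrable.
  have -> : x / 2 * bvol d = \int[muC]_(p in preball 0 d) (x / 2) by rewrite Rintegral_cst// V.
  rewrite -RintegralD//; apply: le_Rintegral => //.
  - exact: integrable_cmod.
  - exact: eq_integrable (integrableD mB j1 j2).
  move=> p _; rewrite -sqr_cmod; set y := cmod _.
  have : 0 <= (y - x) ^+ 2 / x / 2 by rewrite !divr_ge0 ?sqr_ge0// ltW.
  have -> : (y - x) ^+ 2 / x / 2 = x^-1 / 2 * y ^+ 2 + x / 2 - y by field; rewrite gt_eqF.
  lra.
move=> h2; have h3 : bvol d * x / 2 <= x^-1 / 2 * nsq 0 d g by lra.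
rewrite -sqr_cmod -/x.
have : x * (bvol d * x / 2) <= x * (x^-1 / 2 * nsq 0 d g) by apply: ler_wpM2l; [exact: ltW|exact: h3].
have -> : x * (x^-1 / 2 * nsq 0 d g) = nsq 0 d g / 2 by field; rewrite gt_eqF.
nra.
Qed.

End square_integrable.

(** * Divergence in a real direction on a ball *)

Section sphere.
Context (R : realType) (n : nat).
Local Notation Cn := (Cn R n).
Local Notation muC := (lebesgueC R n).

Lemma measurable_sphere (r : R) : measurable [set p : Cpow R n | enorm (vec p) = r].
Proof.
have -> : [set p : Cpow R n | enorm (vec p) = r] = (fun p => enorm (vec p - 0)) @^-1` [set r].
  by apply/seteqP; split => p /=; rewrite subr0.
rewrite -[X in measurable X]setTI; apply: (measurable_enorm (0 : Cn)) => //.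
Qed.

(** The sphere is squeezed between balls, whose volume depends continuously on
    the radius. *)
Lemma sphere_null (r : R) : 0 < r -> muC [set p | enorm (vec p) = r] = 0%E.
Proof.
move=> r0; set S := [set p | _]; have mS : measurable S := measurable_sphere r.
have mB : measurable (preball (0 : Cn) r) by exact: measurable_preball.
have le (d : R) : 0 < d -> (muC S + (bvol n r)%:E <= (bvol n (r + d))%:E)%E.
  move=> d0; rewrite /bvol -!measure_ball ?addr_gt0// -measureU//; last first.
    by apply/seteqP; split => // p [/= Sp]; rewrite /preball/= (eball0E _ (ltW r0)) Sp ltxx.
  apply: le_measure; rewrite ?inE; [exact: measurableU|exact: measurable_preball|].
  move=> p [/= Sp|]; rewrite /preball/= (eball0E _ (ltW (addr_gt0 r0 d0))).
    by rewrite Sp ltrDl.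
  by move=> /(eball0E _ (ltW r0)) h; apply: lt_trans h _; rewrite ltrDl.
have fin : muC S \is a fin_num.
  rewrite ge0_fin_numE//; apply: le_lt_trans (ltry (bvol n (r + 1))).
  by apply: le_trans (le _ ltr01); rewrite leeDl// lee_fin ltW// bvol_gt0.
rewrite -(fineK fin) in le *; set x := fine (muC S) in le *; congr EFin.
have x0 : 0 <= x by apply: fine_ge0.
apply/eqP; rewrite eq_le x0 andbT leNgt; apply/negP => xp.
have cb : {for r, continuous (bvol (R := R) n)}.
  apply: cvgM; last exact: cvg_cst; apply: cvgM; first exact: cvg_cst.
  by apply: (cvg_comp (fun d : R => d ^+ 2) (fun y => y ^+ n)); exact: exprn_continuous.
move/cvgrPdist_lt: cb => /(_ _ xp) /nbhs_ballP[d /= d0 H].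
have d2 : 0 < d / 2 by rewrite divr_gt0.
have := H (r + d / 2); rewrite /ball/= opprD addrA subrr add0r normrN gtr0_norm//.
rewrite ltr_pdivrMr// ltr_pMr// ltr1n => /(_ isT) h.
have := le _ d2; rewrite -EFinD lee_fin => h'.
have := ler_norm (bvol n (r + d / 2) - bvol n r); rewrite distrC => h2.
have := lt_le_trans h (le_trans _ (le_refl x)); lra.
Qed.

End sphere.

Section ball_divergence.
Context (R : realType) (n : nat).
Local Notation Cn := (Cn R n).
Local Notation muC := (lebesgueC R n).
Variables (r M L : R) (k D : Cn -> R) (v : Cn).
Hypothesis r0 : 0 < r.
Hypothesis L0 : 0 <= L.
Hypothesis kM : forall u, enorm u < r -> `|k u| <= M.
Hypothesis kL : forall u w, enorm u < r -> enorm w < r -> `|k u - k w| <= L * enorm (u - w).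
Hypothesis kD : forall u, enorm u < r -> forall e : R, 0 < e -> exists2 d : R, 0 < d &
  forall t : R, `|t| < d -> `|k (u + (t%:C : R[i]^o) *: v) - k u - t * D u| <= e * `|t|.
Hypothesis cD : forall u, enorm u < r -> {for u, continuous D}.

(** The derivative of [sqn] at u in the direction v. *)
Definition dsqn (u : Cn) : R := \sum_(j < n) 2 * complex.Re ((u 0 j : R[i]) * (v 0 j : R[i])^*).

Lemma sqnD (u : Cn) (t : R) : sqn (u + (t%:C : R[i]^o) *: v) = sqn u + t * dsqn u + t ^+ 2 * sqn v.
Proof.
rewrite /sqn /dsqn !mulr_sumr -!big_split; apply: eq_bigr => j _ /=.
rewrite !mxE /=; case: (u 0 j) => a b; case: (v 0 j) => c d; rewrite /sqmod /=; ring.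
Qed.

Let M0 : 0 <= M.
Proof. by have := kM (u := 0); rewrite enorm0 => /(_ r0); apply: le_trans. Qed.

(* the function with compact support whose translates are compared *)
Let H (u : Cn) : R := if enorm u < r then (sqn u - r ^+ 2) * k u else 0.

Let C : R := r ^+ 2 * L + 2 * r * M.

Let C0 : 0 <= C.
Proof. by rewrite /C addr_ge0 ?mulr_ge0// ?sqr_ge0// ltW. Qed.

Let half_lip u w : enorm u < r -> r <= enorm w -> `|(sqn u - r ^+ 2) * k u| <= C * enorm (u - w).
Proof.
move=> ur rw; rewrite normrM -sqr_enorm.
have e0 := enorm_ge0 u.
have A : `|enorm u ^+ 2 - r ^+ 2| <= 2 * r * enorm (u - w).
  rewrite ler0_norm; last by rewrite subr_le0 ler_pXn2r ?nnegrE ?enorm_ge0 ?(ltW r0) ?(ltW ur).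
  rewrite opprB subr_sqr.
  have := enorm_triangle_sub u w; have := ler_norm (- (enorm u - enorm w)); rewrite normrN => h1 h2.
  have h3 : r - enorm u <= enorm (u - w) by lra.
  have h4 : 0 <= r - enorm u by lra.
  nra.
apply: le_trans (ler_pM _ _ A (kM ur)) _ => //.
have := mulr_ge0 (mulr_ge0 (sqr_ge0 r) L0) (enorm_ge0 (u - w)).
by rewrite /C mulrDl; lra.
Qed.

Let H_lip u w : `|H u - H w| <= C * enorm (u - w).
Proof.
rewrite /H; have [ur|ur] := ltP (enorm u) r; have [wr|wr] := ltP (enorm w) r.
- have -> : (sqn u - r ^+ 2) * k u - (sqn w - r ^+ 2) * k w =
    (sqn u - r ^+ 2) * (k u - k w) + (sqn u - sqn w) * k w by ring.
  apply: le_trans (ler_normD _ _) _; rewrite !normrM /C mulrDl -!sqr_enorm.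
  have e0 := enorm_ge0 u; have e1 := enorm_ge0 w.
  apply: lerD.
    rewrite -mulrA; apply: ler_pM => //; last exact: kL.
    rewrite ler0_norm; last by rewrite subr_le0 ler_pXn2r ?nnegrE ?enorm_ge0 ?(ltW r0) ?(ltW ur).
    by rewrite opprB gerBl sqr_ge0.
  rewrite mulrAC; apply: ler_pM => //; last exact: kM.
  rewrite subr_sqr normrM mulrC; apply: ler_pM => //; last exact: enorm_triangle_sub.
  rewrite ger0_norm ?addr_ge0//; lra.
- by rewrite subr0; exact: half_lip.
- by rewrite sub0r normrN enorm_distC; exact: half_lip.
- by rewrite subr0 normr0 mulr_ge0// enorm_ge0.
Qed.

Let H0 u : r <= enorm u -> H u = 0.
Proof. by rewrite /H leNgt => /negbTE ->. Qed.

Let cH u : {for u, continuous H}.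
Proof.
apply: continuous_enormP => e e0; have C1 : 0 < C + 1 by rewrite ltr_wpDl.
exists (e / (C + 1)); first by rewrite divr_gt0.
move=> w; rewrite ltr_pdivlMr// => h; apply: le_lt_trans (H_lip _ _) _.
by apply: le_lt_trans h; rewrite mulrC ler_wpM2l ?enorm_ge0// lerDl.
Qed.

Let mH : measurable_fun setT (fun p => H (vec p) : measurableTypeR R).
Proof. by apply: measurable_continuous_vec => // p _; exact: cH. Qed.

Let restrict_cst (s a : R) (p : Cpow R n) :
  ((EFin \o (fun _ => a)) \_ (preball (0 : Cn) s)) p = (if p \in preball (0 : Cn) s then a else 0)%:E.
Proof. by rewrite patchE; case: ifP. Qed.

Let integrable_step (s a : R) : muC.-integrable setT
  (EFin \o (fun p => if p \in preball (0 : Cn) s then a else 0)).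
Proof.
have := integrable_cst_ball (0 : Cn) s a.
move=> /(integrable_mkcond _ (measurable_preball _ _)).
by apply: eq_integrable => // p _; exact: restrict_cst.
Qed.

Let iH : muC.-integrable setT (EFin \o (fun p => H (vec p))).
Proof.
apply: le_integrable (integrable_step r (r ^+ 2 * M)) => //; first exact/measurable_EFinP.
move=> p _ /=; rewrite lee_fin /H; case: ifPn => h; last by rewrite normr0.
rewrite mem_set; last by apply/(eball0E _ (ltW r0)).
apply: le_trans (ler_norm _); rewrite normrM; apply: ler_pM => //; last exact: kM.
rewrite -sqr_enorm ler0_norm; last by rewrite subr_le0 ler_pXn2r ?nnegrE ?enorm_ge0 ?ltW.
by rewrite opprB gerBl sqr_ge0.
Qed.

Let transl (c : Cn) : muC.-integrable setT (EFin \o (fun p => H (vec p + c))) /\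
  \int[muC]_p H (vec p + c) = \int[muC]_p H (vec p).
Proof.
have [] := integrable_affCn (a := fun _ => 1) (cofn c) (fun _ => oner_neq0 _) measurableT iH.
rewrite preimage_setT big1 => [|i _]; last by rewrite -sqr_cmod cmod1 expr1n.
rewrite mul1r => i1 e1; split.
  by apply: eq_integrable i1 => // p _ /=; rewrite vec_affCn scale1r.
by rewrite e1; apply: eq_Rintegral => p _; rewrite vec_affCn scale1r.
Qed.

Let quot (m : nat) (p : Cpow R n) : R :=
  m.+1%:R * (H (vec p + ((m.+1%:R^-1)%:C : R[i]^o) *: v) - H (vec p)).

Let quot_integrable m : muC.-integrable setT (EFin \o quot m) /\ \int[muC]_p quot m p = 0.
Proof.
have [i1 e1] := transl (((m.+1%:R^-1)%:C : R[i]^o) *: v).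
have i2 := integrableB measurableT i1 iH.
split.
  by apply: eq_integrable (integrableRZ m.+1%:R measurableT i2) => // p _ /=.
by rewrite /quot RintegralZl// RintegralB// e1 subrr mulr0.
Qed.

Let quot_le m p : (`|(quot m p)%:E| <= (if p \in preball (0 : Cn) (r + enorm v) then C * enorm v else 0)%:E)%E.
Proof.
have m0 : 0 < m.+1%:R :> R by [].
have rv : 0 <= r + enorm v by rewrite addr_ge0 ?enorm_ge0// ltW.
rewrite lee_fin; case: ifPn => [_|/negP h].
  rewrite normrM ger0_norm//; apply: le_trans (ler_wpM2l _ (H_lip _ _)) _ => //.
  rewrite [vec p + _]addrC addrK enormZ cmod_ger0 ?invr_ge0// mulrCA mulVKf//.
have {h} h : r + enorm v <= enorm (vec p).
  by rewrite leNgt; apply/negP => h'; apply: h; apply/mem_set/(eball0E _ rv).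
rewrite /quot !H0 ?subrr ?mulr0 ?normr0//.
  by apply: le_trans h; rewrite lerDl enorm_ge0.
have := enorm_triangle_sub (vec p) (- (((m.+1%:R^-1)%:C : R[i]^o) *: v)).
rewrite opprK enormN => h1.
have h2 : enorm (((m.+1%:R^-1)%:C : R[i]^o) *: v) <= enorm v.
  by rewrite enormZ cmod_ger0 ?invr_ge0// ler_piMl ?enorm_ge0// invf_le1// ler1n.
have := ler_norm (enorm (vec p) - enorm (((m.+1%:R^-1)%:C : R[i]^o) *: v)); lra.
Qed.

Let h (u : Cn) : R := dsqn u * k u + (sqn u - r ^+ 2) * D u.

Let quot_cvg p : enorm (vec p) != r ->
  (fun m => (quot m p)%:E) @ \oo --> ((EFin \o (fun p => h (vec p))) \_ (preball (0 : Cn) r)) p.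
Proof.
set u := vec p => ur.
have small (d : R) : 0 < d -> \forall m \near \oo, (m.+1%:R^-1 : R) < d.
  by move=> d0; exact: near_infty_natSinv_lt (PosNum d0).
have vn : 0 < enorm v + 1 by rewrite ltr_wpDl// enorm_ge0.
rewrite patchE; case: ifPn => Bp; last first.
  have {}ur : r < enorm u.
    rewrite lt_neqAle eq_sym ur /= leNgt; apply/negP => h1.
    by move/negP: Bp; apply; apply/mem_set/(eball0E _ (ltW r0)).
  have -> : (point : \bar R) = 0%E by [].
  apply: cvg_near_cst; have d0 : 0 < (enorm u - r) / (enorm v + 1) by rewrite divr_gt0// subr_gt0.
  apply: filterS (small _ d0) => m /= hm; rewrite /quot (H0 (u := vec p)) ?(ltW ur)// H0 ?subrr ?mulr0//.
  have := enorm_triangle_sub u (- (((m.+1%:R^-1)%:C : R[i]^o) *: v)).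
  rewrite opprK enormN enormZ cmod_ger0 ?invr_ge0// => h1.
  have := ler_norm (enorm u - m.+1%:R^-1 * enorm v) => h2.
  move: hm; rewrite ltr_pdivlMr// mulrDr mulr1 => hm.
  have i0 : 0 < (m.+1%:R^-1 : R) by rewrite invr_gt0.
  move: (le_trans h2 h1) hm i0; move: (m.+1%:R^-1) => t Ht hm i0.
  by apply: le_trans Ht; lra.
have {Bp} ul : enorm u < r by move/set_mem: Bp => /(eball0E _ (ltW r0)).
apply/cvg_EFin; first by apply: nearW.
apply/cvgrPdist_le => e e0.
pose B := r ^+ 2 + `|dsqn u| + sqn v * (M + 1) + 1.
have sv := sqn_ge0 v.
have B0 : 0 < B by rewrite /B; have := sqr_ge0 r; have := normr_ge0 (dsqn u); have := M0; nra.
have e1 : 0 < e / B by rewrite divr_gt0.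
have [d d0 hd] := kD ul e1.
have cd : 0 < Num.min d (Num.min ((r - enorm u) / (enorm v + 1)) (e / B / (L * (enorm v + 1) + 1))).
  by rewrite !lt_min d0 !divr_gt0 ?subr_gt0// ltr_wpDl// mulr_ge0// ltW.
have Mle := kM ul.
apply: filterS (small _ cd) => m; rewrite !lt_min => /and3P[h1 h2 h3].
set t : R := m.+1%:R^-1 in h1 h2 h3.
have t0 : 0 < t by rewrite invr_gt0.
have tn : m.+1%:R = t^-1 by rewrite invrK.
set u' : Cn := u + (t%:C : R[i]^o) *: v.
have u'l : enorm u' < r.
  rewrite /u'; apply: le_lt_trans (enormD _ _) _; rewrite enormZ cmod_ger0 ?(ltW t0)//.
  by move: h2; rewrite ltr_pdivlMr// mulrDr mulr1; lra.
have hk := hd t; rewrite gtr0_norm// -/u' in hk; have {}hk := hk h1.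
have hl := kL u'l ul; rewrite {2}/u' [u + _]addrC addrK enormZ cmod_ger0 ?(ltW t0)// in hl.
have Mle' := kM u'l.
have -> : h u - quot m p = - (((sqn u - r ^+ 2) * ((k u' - k u - t * D u) / t)
   + dsqn u * (k u' - k u) + t * (sqn v * k u'))).
  rewrite /h /quot /H -/u -/u' ul u'l tn /u' sqnD -/u'; field; exact: lt0r_neq0.
rewrite normrN; apply: le_trans (ler_normD _ _) _; apply: le_trans (lerD (ler_normD _ _) (lexx _)) _.
rewrite !normrM normfV (gtr0_norm t0) (ger0_norm sv).
have E1 : `|k u' - k u - t * D u| / t <= e / B by rewrite ler_pdivrMr.
have E2 : `|k u' - k u| <= e / B.
  apply: le_trans hl _; move: h3; rewrite ltr_pdivlMr; last by rewrite ltr_wpDl// mulr_ge0// ltW.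
  have := mulr_ge0 L0 (ltW t0); have := mulr_ge0 (mulr_ge0 L0 (ltW t0)) (enorm_ge0 v); nra.
have E3 : t <= e / B.
  move: h3; rewrite ltr_pdivlMr; last by rewrite ltr_wpDl// mulr_ge0// ltW.
  have := mulr_ge0 (mulr_ge0 (ltW t0) L0) (ltW vn); nra.
have E4 : `|sqn u - r ^+ 2| <= r ^+ 2.
  rewrite -sqr_enorm ler0_norm; last by rewrite subr_le0 ler_pXn2r ?nnegrE ?enorm_ge0 ?ltW.
  by rewrite opprB gerBl sqr_ge0.
have F1 : `|sqn u - r ^+ 2| * (`|k u' - k u - t * D u| / t) <= r ^+ 2 * (e / B).
  by apply: ler_pM => //; rewrite divr_ge0// ltW.
have F2 : `|dsqn u| * `|k u' - k u| <= `|dsqn u| * (e / B) by rewrite ler_wpM2l.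
have F3 : t * (sqn v * `|k u'|) <= e / B * (sqn v * (M + 1)).
  apply: ler_pM; [exact: ltW|exact: mulr_ge0|exact: E3|].
  by apply: ler_wpM2l => //; rewrite (le_trans Mle')// lerDl.
have F4 : B * (e / B) = e by rewrite mulrCA divff ?mulr1// gt_eqF.
have F5 : e / B * (r ^+ 2 + `|dsqn u| + sqn v * (M + 1)) <= e.
  by rewrite -[leRHS]F4 [leRHS]mulrC ler_wpM2l ?(ltW e1)// /B lerDl.
move: F5; rewrite !mulrDr; lra.
Qed.

(** Translation invariance of Lebesgue measure makes the integral of every
    difference quotient of [H] vanish; [H] is Lipschitz because its first factor
    vanishes on the sphere, so that dominated convergence applies. *)
Lemma ball_divergence :
  \int[muC]_(p in preball (0 : Cn) r) (dsqn (vec p) * k (vec p) + (sqn (vec p) - r ^+ 2) * D (vec p)) = 0.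
Proof.
have mB : measurable (preball (0 : Cn) r) by exact: measurable_preball.
have ch u : eball 0 r u -> {for u, continuous h}.
  move=> /(eball0E _ (ltW r0)) ur.
  have ck : {for u, continuous k}.
    apply: continuous_enormP => e e0; have L1 : 0 < L + 1 by rewrite ltr_wpDl.
    exists (Num.min (r - enorm u) (e / (L + 1))); first by rewrite lt_min subr_gt0 ur divr_gt0.
    move=> w; rewrite lt_min => /andP[w1]; rewrite ltr_pdivlMr// => w2.
    have wr : enorm w < r.
      have -> : w = (w - u) + u by rewrite subrK.
      by apply: le_lt_trans (enormD _ _) _; rewrite -ltrBrDr.
    apply: le_lt_trans (kL wr ur) _; apply: le_lt_trans w2.
    by rewrite mulrC ler_wpM2l ?enorm_ge0// lerDl.
  have cs : {for u, continuous (@sqn R n)}.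
    have -> : @sqn R n = (fun w => enorm (w - 0) ^+ 2).
      by apply/funext => w; rewrite subr0 sqr_enorm.
    by apply: (cvg_comp (fun w : Cn => enorm (w - 0)) (fun y => y ^+ 2));
      [exact: continuous_enorm|exact: exprn_continuous].
  have cd : {for u, continuous dsqn}.
    have -> : dsqn = (fun w => sqn (w + ((1 : R)%:C : R[i]^o) *: v) - sqn w - sqn v).
      by apply/funext => w; rewrite sqnD; ring.
    have c1 : {for u, continuous (fun w : Cn => sqn (w + ((1 : R)%:C : R[i]^o) *: v))}.
      have -> : (fun w : Cn => sqn (w + ((1 : R)%:C : R[i]^o) *: v)) = (fun w => enorm (w - - v) ^+ 2).
        by apply/funext => w; rewrite opprK scale1r sqr_enorm.
      by apply: (cvg_comp (fun w : Cn => enorm (w - - v)) (fun y => y ^+ 2));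
        [exact: continuous_enorm|exact: exprn_continuous].
    exact: (cvgB (cvgB c1 cs) (cvg_cst _)).
  exact: (cvgD (cvgM cd ck) (cvgM (cvgB cs (cvg_cst _)) (cD ur))).
have mh : measurable_fun setT ((EFin \o (fun p => h (vec p))) \_ (preball (0 : Cn) r)).
  apply/(measurable_restrict _ mB measurableT); rewrite setTI; apply/measurable_EFinP.
  by apply: measurable_continuous_vec => // p; exact: ch.
have [] := @dominated_convergence _ _ _ muC setT measurableT (fun m => EFin \o quot m)
  ((EFin \o (fun p => h (vec p))) \_ (preball (0 : Cn) r))
  (EFin \o (fun p => if p \in preball (0 : Cn) (r + enorm v) then C * enorm v else 0)) _ mh _ (integrable_step _ _) _.
- by move=> m; have [/integrableP[]] := quot_integrable m.
- exists [set p | enorm (vec p) = r]; split; [exact: measurable_sphere|exact: sphere_null|].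
  move=> p /= h1; apply: contrapT => h2; apply: h1 => _; apply: quot_cvg.
  by apply/eqP.
- by apply: aeW => p m _; exact: quot_le.
move=> _ _; rewrite -integral_mkcond => lim.
have Z : (fun m => \int[muC]_p (EFin \o quot m) p)%E = (fun _ => 0%E).
  apply/funext => m; have [i1 e1] := quot_integrable m.
  by rewrite -[LHS]fineK; [congr EFin; exact: e1|exact: integrable_fin_num].
rewrite /Rintegral.
suff -> : (\int[muC]_(x in preball (0 : Cn) r) (h (vec x))%:E = 0)%E by [].
suff lim0 : (fun m => \int[muC]_p (EFin \o quot m) p)%E @ \oo --> 0%E.
  exact: (cvg_unique _ lim lim0).
by rewrite Z; exact: cvg_cst.
Qed.

End ball_divergence.

(** * Derivatives of complex functions of a real variable *)

Section real_direction.
Context (R : realType).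
Implicit Types (p q : R -> R[i]) (D : R[i]).

Definition real_deriv0 p D := forall e : R, 0 < e -> exists2 d : R, 0 < d &
  forall t : R, `|t| < d -> cmod (p t - p 0 - t%:C * D) <= e * `|t|.

Lemma real_deriv0_ext p q D : (exists2 d : R, 0 < d & forall t : R, `|t| < d -> p t = q t) ->
  real_deriv0 p D -> real_deriv0 q D.
Proof.
move=> [d d0 E] H e /H[d' d'0 h]; exists (Num.min d d'); first by rewrite lt_min d0.
move=> t; rewrite lt_min => /andP[t1 t2]; have := h t t2.
by rewrite !E// normr0.
Qed.

Lemma real_deriv0_cst (a : R[i]) : real_deriv0 (fun _ => a) 0.
Proof.
by move=> e e0; exists 1 => // t _; rewrite mulr0 subr0 subrr cmod0 mulr_ge0// ltW.
Qed.

Lemma real_deriv0D p q D E : real_deriv0 p D -> real_deriv0 q E -> real_deriv0 (fun t => p t + q t) (D + E).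
Proof.
move=> P Q e e0; have e2 : 0 < e / 2 by rewrite divr_gt0.
have [d1 d10 h1] := P _ e2; have [d2 d20 h2] := Q _ e2.
exists (Num.min d1 d2) => [|t]; first by rewrite lt_min d10.
rewrite lt_min => /andP[/h1 A /h2 B].
have -> : p t + q t - (p 0 + q 0) - t%:C * (D + E) = (p t - p 0 - t%:C * D) + (q t - q 0 - t%:C * E) by ring.
apply: le_trans (cmodD _ _) _; lra.
Qed.

Lemma real_deriv0_bound p D : real_deriv0 p D -> exists2 d : R, 0 < d &
  forall t : R, `|t| < d -> cmod (p t - p 0) <= (cmod D + 1) * `|t|.
Proof.
move=> /(_ _ ltr01)[d d0 h]; exists d => // t /h; rewrite mul1r => ht.
have -> : p t - p 0 = (p t - p 0 - t%:C * D) + t%:C * D by ring.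
by apply: le_trans (cmodD _ _) _; rewrite cmodM cmod_real mulrDl mul1r addrC [cmod D * _]mulrC lerD2l.
Qed.

Lemma real_deriv0M p q D E : real_deriv0 p D -> real_deriv0 q E -> real_deriv0 (fun t => p t * q t) (D * q 0 + p 0 * E).
Proof.
move=> P Q e e0.
pose B := cmod (q 0) + cmod (p 0) + (cmod D + 1) * (cmod E + 1) + 1.
have := (cmod_ge0 (q 0), cmod_ge0 (p 0), cmod_ge0 D, cmod_ge0 E) => -[[[a0 b0] D0] E0].
have DE0 : 0 <= (cmod D + 1) * (cmod E + 1) by rewrite mulr_ge0// addr_ge0.
have B0 : 0 < B by rewrite /B; lra.
have eB : 0 < e / B by rewrite divr_gt0.
have [d1 d10 h1] := P _ eB; have [d2 d20 h2] := Q _ eB.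
have [d3 d30 h3] := real_deriv0_bound P; have [d4 d40 h4] := real_deriv0_bound Q.
exists (Num.min (Num.min d1 d2) (Num.min (Num.min d3 d4) (e / B))) => [|t].
  by rewrite !lt_min d10 d20 d30 d40.
rewrite !lt_min => /andP[/andP[/h1 A1 /h2 A2] /andP[/andP[/h3 A3 /h4 A4] A5]].
have -> : p t * q t - p 0 * q 0 - t%:C * (D * q 0 + p 0 * E) =
  (p t - p 0 - t%:C * D) * q 0 + p 0 * (q t - q 0 - t%:C * E) + (p t - p 0) * (q t - q 0) by ring.
apply: le_trans (cmodD _ _) _; apply: le_trans (lerD (cmodD _ _) (lexx _)) _; rewrite !cmodM.
have t0 := normr_ge0 t.
have c1 : cmod (p t - p 0 - t%:C * D) * cmod (q 0) <= e / B * `|t| * cmod (q 0) by rewrite ler_wpM2r.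
have c2 : cmod (p 0) * cmod (q t - q 0 - t%:C * E) <= cmod (p 0) * (e / B * `|t|) by rewrite ler_wpM2l.
have c3 : cmod (p t - p 0) * cmod (q t - q 0) <= (cmod D + 1) * (cmod E + 1) * (e / B) * `|t|.
  apply: le_trans (ler_pM (cmod_ge0 _) (cmod_ge0 _) A3 A4) _.
  rewrite mulrACA -[leRHS]mulrA; apply: ler_wpM2l => //; apply: ler_wpM2r => //; exact: ltW.
apply: le_trans (lerD (lerD c1 c2) c3) _.
have -> : e * `|t| = e / B * `|t| * B by rewrite mulrAC divfK// gt_eqF.
have : 0 <= e / B * `|t| by rewrite mulr_ge0// ltW.
by rewrite /B; nra.
Qed.

Lemma real_deriv0Z (a : R[i]) p D : real_deriv0 p D -> real_deriv0 (fun t => a * p t) (a * D).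
Proof. by move=> P; have := real_deriv0M (real_deriv0_cst a) P; rewrite mul0r add0r. Qed.

Lemma real_deriv0_conj p D : real_deriv0 p D -> real_deriv0 (fun t => (p t)^*) D^*.
Proof.
move=> P e /P[d d0 h]; exists d => // t /h.
have -> : (p t)^* - (p 0)^* - t%:C * D^* = (p t - p 0 - t%:C * D)^*.
  by rewrite !rmorphB rmorphM /= oppr0.
by rewrite cmod_conj.
Qed.

Lemma cRe_incr (a b c : R[i]) (t : R) :
  complex.Re a - complex.Re b - t * complex.Re c = complex.Re (a - b - t%:C * c).
Proof. by rewrite !cReD !cReN ReM_real. Qed.

Lemma cIm_incr (a b c : R[i]) (t : R) :
  complex.Im a - complex.Im b - t * complex.Im c = complex.Im (a - b - t%:C * c).
Proof. by rewrite !cImD !cImN ImM_real. Qed.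

Lemma real_deriv0_Re p D : real_deriv0 p D -> is_derive (0 : R) 1 (fun t => complex.Re (p t)) (complex.Re D).
Proof.
move=> P; apply: increment_is_derive => e /P[d d0 h]; exists d => // t /h.
rewrite add0r [_ * t]mulrC cRe_incr; apply: le_trans; exact: Re_le_cmod.
Qed.

Lemma real_deriv0_Im p D : real_deriv0 p D -> is_derive (0 : R) 1 (fun t => complex.Im (p t)) (complex.Im D).
Proof.
move=> P; apply: increment_is_derive => e /P[d d0 h]; exists d => // t /h.
rewrite add0r [_ * t]mulrC cIm_incr; apply: le_trans; exact: Im_le_cmod.
Qed.

Lemma real_deriv0_real_derive n (v z : Cn R n) (g : Cn R n -> R[i]) D :
  real_deriv0 (fun t => g (z + (t%:C : R[i]^o) *: v)) D -> real_derive v g z = D.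
Proof.
move=> P; rewrite /real_derive !derive1E.
have [_ ->] := real_deriv0_Re P; have [_ ->] := real_deriv0_Im P.
by case: D {P}.
Qed.

Lemma real_deriv0_holo n (f : Cn R n -> R[i]^o) (u v : Cn R n) : differentiable f u ->
  real_deriv0 (fun t => f (u + (t%:C : R[i]^o) *: v)) (lform (fun j => pd j f u) v).
Proof.
move=> df e e0; have v1 : 0 < enorm v + 1 by rewrite ltr_wpDl// enorm_ge0.
have [d d0 hd] := differentiable_cdiff df (divr_gt0 e0 v1).
exists (d / (enorm v + 1)) => [|t]; first by rewrite divr_gt0.
rewrite ltr_pdivlMr// => ht.
have th : enorm ((t%:C : R[i]^o) *: v) < d.
  by rewrite enormZ cmod_real; apply: le_lt_trans ht; rewrite ler_wpM2l//; lra.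
have := hd _ th; rewrite enormZ cmod_real lformZ scale0r addr0 => H.
apply: le_trans H _; rewrite mulrAC ler_pdivrMr//.
have := mulr_ge0 (mulr_ge0 (ltW e0) (normr_ge0 t)) (enorm_ge0 v).
by have := mulr_ge0 (ltW e0) (normr_ge0 t); nra.
Qed.

End real_direction.

(** * Bounded operators between concentric balls *)

Section bergman_operators.
Context (R : realType) (n : nat).
Local Notation Cn := (Cn R n).
Local Notation muC := (lebesgueC R n).
Local Notation bg r := (bergman (0 : Cn) r).
Implicit Types (f g : Cn -> R[i]^o) (u w : Cn) (r s : R).

Lemma eval_le r s f w : r < s -> enorm w <= r -> bg s f ->
  cmod (f w) <= (Num.sqrt (bvol n (s - r)))^-1 * nrm 0 s f.
Proof.
move=> rs wr bf; have d0 : 0 < s - r by rewrite subr_gt0.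
have v0 := bvol_gt0 n d0.
rewrite mulrC ler_pdivlMr ?sqrtr_gt0// -sqrtrM ?sqmod_ge0// ler_wsqrtr//.
by apply: sqmod_le_nsq => //; rewrite subr0; lra.
Qed.

Lemma pd_le r s : r < s -> exists2 C : R, 0 <= C & forall f w j, bg s f -> enorm w <= r ->
  cmod (pd j f w) <= C * nrm 0 s f.
Proof.
move=> rs; pose d := (s - r) / 2; have d0 : 0 < d by rewrite divr_gt0// subr_gt0.
have rd : r + d < s by rewrite /d; lra.
exists ((Num.sqrt (bvol n (s - (r + d))))^-1 / d).
  by rewrite !mulr_ge0 ?invr_ge0 ?sqrtr_ge0// ltW.
move=> f w j bf wr; have s0 : 0 <= s.
  by have := enorm_ge0 w; lra.
have le u : enorm (u - w) <= d -> enorm u <= r + d.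
  move=> h; have -> : u = w + (u - w) by rewrite addrC subrK.
  by apply: le_trans (enormD _ _) _; rewrite lerD.
rewrite mulrAC; apply: cauchy_pd => [|u hu|u hu]; first exact: d0.
  by apply: bf.1; apply/(eball0E _ s0); exact: le_lt_trans (le _ hu) rd.
by apply: eval_le => //; exact: le.
Qed.

(** Cauchy's estimate with evaluation bounds controls derivatives uniformly on a
    smaller ball, so differentiation costs an arbitrarily small loss of radius. *)
Lemma pd_bergman r s : 0 <= r -> r < s -> exists2 C : R, 0 <= C & forall f j, bg s f ->
  bg r (fun w => pd j f w) /\ nrm 0 r (fun w => pd j f w) <= C * nrm 0 s f.
Proof.
move=> r0 rs; have [C C0 H] := pd_le rs; have s0 := le_lt_trans r0 rs.
exists (C * Num.sqrt (fine (muC (preball 0 r)))) => [|f j bf].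
  by rewrite mulr_ge0// sqrtr_ge0.
have [|w|] := @bergman_bounded R n 0 r (fun w => pd j f w) (C * nrm 0 s f).
- move=> w /(eball0E _ r0) wr; apply: (@holo_pd _ _ f w (s - r)); first by rewrite subr_gt0.
  move=> u hu; apply: bf.1; apply/(eball0E _ (ltW s0)).
  have -> : u = (u - w) + w by rewrite subrK.
  by apply: le_lt_trans (enormD _ _) _; lra.
- by move=> /(eball0E _ r0)/ltW; exact: H.
move=> b1 b2; split => //.
rewrite [leRHS]mulrAC -[C * _](@ger0_norm R) ?mulr_ge0 ?nrm_ge0// -sqrtr_sqr -sqrtrM ?sqr_ge0//.
exact: ler_wsqrtr.
Qed.

Definition coord_mul (j : 'I_n) f : Cn -> R[i]^o := fun w => (w 0 j : R[i]) * f w.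

Lemma coord_mul_bergman r j f : 0 <= r -> bg r f -> bg r (coord_mul j f) /\ nrm 0 r (coord_mul j f) <= r * nrm 0 r f.
Proof.
move=> r0 bf; have mB := measurable_preball (0 : Cn) r.
have df w : eball 0 r w -> differentiable (coord_mul j f) w.
  by move=> rw; have [] := holoM (holo_coord j w).1 (bf.1 w rw).
have le p : preball (0 : Cn) r p -> sqmod (coord_mul j f (vec p)) <= r ^+ 2 * sqmod (f (vec p)).
  move=> /(eball0E _ r0) h; rewrite sqmodM ler_wpM2r ?sqmod_ge0//.
  rewrite -sqr_cmod ler_pXn2r ?nnegrE ?cmod_ge0//.
  exact: le_trans (cmod_coord _ _) (ltW h).
have i1 := integrableRZ (r ^+ 2) mB (bergman_integrable bf).
have b1 : bg r (coord_mul j f).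
  apply: integrable_bergman => //; apply: le_integrable i1 => //.
    by apply/measurable_EFinP; apply: measurable_sqmod_ball => w; exact: eball_ccont.
  move=> p Bp /=; rewrite lee_fin !ger0_norm ?sqmod_ge0 ?mulr_ge0 ?sqr_ge0 ?sqmod_ge0//.
  exact: le.
split => //.
rewrite -[X in X * _](@ger0_norm R)// -sqrtr_sqr -sqrtrM ?sqr_ge0//; apply: ler_wsqrtr.
rewrite /nsq -RintegralZl//; last exact: bergman_integrable.
by apply: le_Rintegral => //; exact: bergman_integrable.
Qed.

(** The functions to which [pd], its adjoint and integration by parts on B_r all
    apply: being holomorphic past the boundary, they are bounded and Lipschitz on
    B_r together with their derivatives. *)
Definition bergman_ext r f := exists2 s, r < s & bg s f.

Lemma bergman_ext_bergman r f : 0 <= r -> bergman_ext r f -> bg r f.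
Proof. move=> r0 [s rs]; exact: (bergman_sub r0 (ltW rs)). Qed.

Lemma bergman_extD r f g : 0 <= r -> bergman_ext r f -> bergman_ext r g -> bergman_ext r (fun w => f w + g w).
Proof.
move=> r0 [s rs bf] [s' rs' bg']; exists (Num.min s s'); first by rewrite lt_min rs rs'.
have m0 : 0 <= Num.min s s' by rewrite le_min (le_trans r0 (ltW rs)) (le_trans r0 (ltW rs')).
by apply: bergmanD; [apply: bergman_sub bf|apply: bergman_sub bg'] => //; rewrite ge_min lexx ?orbT.
Qed.

Lemma bergman_extZ r (a : R[i]) f : bergman_ext r f -> bergman_ext r (fun w => a * (f w : R[i])).
Proof. by move=> [s rs bf]; exists s => //; exact: bergmanZ. Qed.

Lemma bergman_extB r f g : 0 <= r -> bergman_ext r f -> bergman_ext r g -> bergman_ext r (fun w => f w - g w).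
Proof.
move=> r0 bf /(bergman_extZ (-1)) b; have [s rs h] := bergman_extD r0 bf b; exists s; first exact: rs.
by apply: eq_bergman h => w _; rewrite mulN1r.
Qed.

Lemma bergman_ext_coord_mul r j f : 0 <= r -> bergman_ext r f -> bergman_ext r (coord_mul j f).
Proof.
move=> r0 [s rs bf]; exists s => //.
by have [] := coord_mul_bergman j (le_trans r0 (ltW rs)) bf.
Qed.

Lemma bergman_ext_pd r j f : 0 <= r -> bergman_ext r f -> bergman_ext r (fun w => pd j f w).
Proof.
move=> r0 [s rs bf]; exists ((r + s) / 2); first lra.
have m0 : 0 <= (r + s) / 2 by lra.
have ms : (r + s) / 2 < s by lra.
by have [C C0 /(_ f j bf)[]] := pd_bergman m0 ms.
Qed.

Lemma bergman_ext_holo r f : 0 <= r -> bergman_ext r f -> forall w, enorm w <= r -> differentiable f w.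
Proof.
move=> r0 [s rs bf] w wr; apply: bf.1; apply/eball0E; last exact: le_lt_trans rs.
exact: le_trans (ltW rs).
Qed.

Lemma bergman_ext0 r : bergman_ext r (fun _ => 0).
Proof.
exists (r + 1); first by rewrite ltrDl.
by have [w _|w _|b _] := @bergman_bounded R n 0 (r + 1) (fun _ => 0) 0;
  [exact: (holo_cst 0 w).1|rewrite cmod0|exact: b].
Qed.

Lemma bergman_ext_sum r (I : Type) (l : seq I) (F : I -> Cn -> R[i]^o) : 0 <= r ->
  (forall i, bergman_ext r (F i)) -> bergman_ext r (fun w => \sum_(i <- l) F i w).
Proof.
move=> r0 H; elim: l => [|i l [s rs IH]].
  have [s rs h] := bergman_ext0 r; exists s => //; apply: eq_bergman h => w _.
  by rewrite big_nil.
have [s' rs' h] := bergman_extD r0 (H i) (ex_intro2 _ _ s rs IH).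
by exists s' => //; apply: eq_bergman h => w _; rewrite big_cons.
Qed.

Lemma ip_suml r (I : Type) (l : seq I) (F : I -> Cn -> R[i]^o) g : 0 <= r ->
  (forall i, bergman_ext r (F i)) -> bergman_ext r g ->
  ip 0 r (fun w => \sum_(i <- l) F i w) g = \sum_(i <- l) ip 0 r (F i) g.
Proof.
move=> r0 bF bg; have b := bergman_ext_bergman r0.
have mB := measurable_preball (0 : Cn) r.
rewrite /ip -cint_sum//; last by move=> i _; apply: cintegrable_ip; exact: b.
by apply: eq_cint => p _; rewrite mulr_suml.
Qed.

Lemma bergman_ext_bounds r f : 0 < r -> bergman_ext r f -> exists M L : R, [/\ 0 <= M, 0 <= L,
  forall u, enorm u < r -> cmod (f u) <= M &
  forall u w, enorm u < r -> enorm w < r -> cmod (f u - f w) <= L * enorm (u - w)].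
Proof.
move=> r0 [s rs bf]; have [C C0 H] := pd_le rs; have s0 := ltW (lt_trans r0 rs).
exists ((Num.sqrt (bvol n (s - r)))^-1 * nrm 0 s f), (n%:R * (C * nrm 0 s f)); split.
- by rewrite mulr_ge0 ?invr_ge0 ?sqrtr_ge0.
- by rewrite !mulr_ge0 ?nrm_ge0.
- by move=> u ur; apply: eval_le => //; exact: ltW.
move=> u w ur wr.
suff : cmod (f (w + (u - w)) - f w) <= n%:R * (C * nrm 0 s f) * enorm (u - w) by rewrite [w + _]addrC subrK.
have md (t : R) : 0 <= t <= 1 -> enorm (w + (t%:C : R[i]^o) *: (u - w)) < r.
  move=> t01; have := @enorm_mid R n 0 w (u - w) t r t01; rewrite !subr0; apply => //.
  by rewrite addrC subrK.
apply: increment_le => t t01.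
  by apply: bf.1; apply/(eball0E _ s0); exact: lt_trans (md t t01) rs.
by apply: lform_le => j; apply: H => //; exact/ltW/md.
Qed.

Lemma ball_divergenceC r f g (v : Cn) : 0 < r -> bergman_ext r f -> bergman_ext r g ->
  cint muC (preball 0 r) (fun p => (dsqn v (vec p))%:C * ((f (vec p) : R[i]) * (g (vec p) : R[i])^*) +
    (sqn (vec p) - r ^+ 2)%:C * ((lform (fun j => pd j f (vec p)) v : R[i]) * (g (vec p) : R[i])^* +
       (f (vec p) : R[i]) * (lform (fun j => pd j g (vec p)) v : R[i])^*)) = 0.
Proof.
move=> r0 bf bg.
have [Mf [Lf [Mf0 Lf0 Mfb Lfb]]] := bergman_ext_bounds r0 bf.
have [Mg [Lg [Mg0 Lg0 Mgb Lgb]]] := bergman_ext_bounds r0 bg.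
pose k u : R[i] := (f u : R[i]) * (g u : R[i])^*.
pose Dk u : R[i] := (lform (fun j => pd j f u) v : R[i]) * (g u : R[i])^* +
  (f u : R[i]) * (lform (fun j => pd j g u) v : R[i])^*.
have kM u : enorm u < r -> cmod (k u) <= Mf * Mg.
  by move=> ur; rewrite cmodM cmod_conj; apply: ler_pM; rewrite ?cmod_ge0 ?Mfb ?Mgb.
have L0 : 0 <= Lf * Mg + Mf * Lg by rewrite addr_ge0 ?mulr_ge0.
have kL u w : enorm u < r -> enorm w < r -> cmod (k u - k w) <= (Lf * Mg + Mf * Lg) * enorm (u - w).
  move=> ur wr; have -> : k u - k w = (f u - f w) * (g u : R[i])^* + (f w : R[i]) * (g u - g w : R[i])^*.
    by rewrite /k rmorphB; ring.
  apply: le_trans (cmodD _ _) _; rewrite !cmodM !cmod_conj mulrDl; apply: lerD.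
    by rewrite mulrAC; apply: ler_pM; rewrite ?cmod_ge0 ?Lfb ?Mgb.
  by rewrite -mulrA; apply: ler_pM; rewrite ?cmod_ge0 ?Mfb ?Lgb.
have dk u : enorm u < r -> real_deriv0 (fun t => k (u + (t%:C : R[i]^o) *: v)) (Dk u).
  move=> ur; have := real_deriv0M (real_deriv0_holo v (bergman_ext_holo (ltW r0) bf (ltW ur))) (real_deriv0_conj (real_deriv0_holo v (bergman_ext_holo (ltW r0) bg (ltW ur)))).
  by rewrite scale0r addr0.
have cl h u : bergman_ext r h -> enorm u < r -> ccont (fun u => lform (fun j => pd j h u) v) u.
  move=> bh ur; apply: ccont_sum => j _; apply: ccontM; last exact: ccont_cst.
  apply: cdiff_ccont; apply: differentiable_cdiff.
  exact: (bergman_ext_holo (ltW r0) (bergman_ext_pd j (ltW r0) bh) (ltW ur)).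
have cc h u : bergman_ext r h -> enorm u < r -> ccont h u.
  by move=> bh ur; apply: cdiff_ccont; apply: differentiable_cdiff; apply: (bergman_ext_holo (ltW r0) bh (ltW ur)).
have cD u : enorm u < r -> ccont Dk u.
  move=> ur; apply: ccontD.
    by apply: ccontM; [exact: cl|apply: ccont_conj; exact: cc].
  by apply: ccontM; [exact: cc|apply: ccont_conj; exact: cl].
have e0 u : u + ((0 : R)%:C : R[i]^o) *: v = u by rewrite scale0r addr0.
apply: eqReIm => /=.
- have H := @ball_divergence R n r (Mf * Mg) (Lf * Mg + Mf * Lg) (fun u => complex.Re (k u)) (fun u => complex.Re (Dk u)) v r0 L0.
  rewrite -[RHS]H.
  + by apply: eq_Rintegral => p _; rewrite cReD !ReM_real.
  + by move=> u ur; apply: le_trans (Re_le_cmod _) (kM u ur).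
  + by move=> u w ur wr; rewrite -cReN -cReD; apply: le_trans (Re_le_cmod _) (kL u w ur wr).
  + move=> u ur e /(dk u ur)[d d0 hd]; exists d => // t /hd; rewrite e0 cRe_incr; apply: le_trans; exact: Re_le_cmod.
  + by move=> u /cD /ccont_Re.
- have H := @ball_divergence R n r (Mf * Mg) (Lf * Mg + Mf * Lg) (fun u => complex.Im (k u)) (fun u => complex.Im (Dk u)) v r0 L0.
  rewrite -[RHS]H.
  + by apply: eq_Rintegral => p _; rewrite cImD !ImM_real.
  + by move=> u ur; apply: le_trans (Im_le_cmod _) (kM u ur).
  + by move=> u w ur wr; rewrite -cImN -cImD; apply: le_trans (Im_le_cmod _) (kL u w ur wr).
  + move=> u ur e /(dk u ur)[d d0 hd]; exists d => // t /hd; rewrite e0 cIm_incr; apply: le_trans; exact: Im_le_cmod.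
  + by move=> u /cD /ccont_Im.
Qed.

End bergman_operators.

Lemma conjc_sum (R : realType) (I : Type) (l : seq I) (F : I -> R[i]) :
  conjc (\sum_(i <- l) F i) = \sum_(i <- l) conjc (F i).
Proof. exact: rmorph_sum. Qed.

(** * The adjoint of a partial derivative *)

Section adjoint.
Context (R : realType) (n : nat).
Local Notation Cn := (Cn R n).
Local Notation muC := (lebesgueC R n).
Variable r : R.
Hypothesis r0 : 0 < r.
Implicit Types (f g : Cn -> R[i]^o) (u w : Cn).

Let B f (bf : bergman_ext r f) : bergman 0 r f := bergman_ext_bergman (ltW r0) bf.
Let mB : measurable (preball (0 : Cn) r). Proof. exact: measurable_preball. Qed.

Lemma lform_ej (L : 'I_n -> R[i]) (a : R[i]) j : lform L ((a : R[i]^o) *: ej R j) = a * L j :> R[i].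
Proof.
rewrite lformZ; congr (_ * _); rewrite /lform (bigD1 j)//= mxE !eqxx mulr1 big1 ?addr0// => i ij.
by rewrite mxE (negbTE ij) andbF mulr0.
Qed.

Lemma dsqn_ej (a : R[i]) j u : dsqn ((a : R[i]^o) *: ej R j) u = 2 * complex.Re ((u 0 j : R[i]) * a^*).
Proof.
rewrite /dsqn (bigD1 j)//= big1 => [|i ij].
  by rewrite !mxE !eqxx addr0 /= mulr1.
have -> : ((((a : R[i]^o) *: ej R j) 0 i : R[i])^* = 0 :> R[i])%R.
  by rewrite !mxE (negbTE ij) andbF mulr0; exact: conjc0.
by rewrite mulr0 /= mulr0.
Qed.

Lemma ball_divergence_ej (a : R[i]) j f g : bergman_ext r f -> bergman_ext r g ->
  cint muC (preball 0 r) (fun p => (2 * complex.Re ((vec p 0 j : R[i]) * a^*))%:C * ((f (vec p) : R[i]) * (g (vec p) : R[i])^*) +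
    (sqn (vec p) - r ^+ 2)%:C * (a * (pd j f (vec p)) * (g (vec p) : R[i])^* +
       (f (vec p) : R[i]) * (a * pd j g (vec p))^*)) = 0.
Proof.
move=> bf bg; rewrite -[RHS](ball_divergenceC ((a : R[i]^o) *: ej R j) r0 bf bg).
apply: eq_cint => p _.
have K (A A' : R) (ab rho x x' y y' b c : R[i]) : A = A' -> x = x' -> y = y' ->
    A%:C * ab + rho * (x * b + c * y^*) = A'%:C * ab + rho * (x' * b + c * y'^*).
  by move=> -> -> ->.
apply: K; first exact: esym (dsqn_ej a j (vec p)).
  exact: esym (lform_ej (fun j => pd j f (vec p)) a j).
exact: esym (lform_ej (fun j => pd j g (vec p)) a j).
Qed.

(* the integrals into which the real directions e_j and i e_j are regrouped *)
Let weight_int f g (h : Cn -> R[i]^o) (h' : Cn -> R[i]^o) : bergman_ext r f -> bergman_ext r g -> bergman_ext r h -> bergman_ext r h' ->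
  cintegrable muC (preball 0 r) (fun p => (h (vec p) : R[i]) * (h' (vec p) : R[i])^* +
     (sqn (vec p) - r ^+ 2)%:C * ((f (vec p) : R[i]) * (g (vec p) : R[i])^*)) /\
  cint muC (preball 0 r) (fun p => (h (vec p) : R[i]) * (h' (vec p) : R[i])^* +
     (sqn (vec p) - r ^+ 2)%:C * ((f (vec p) : R[i]) * (g (vec p) : R[i])^*)) =
  ip 0 r h h' + (\sum_(k < n) ip 0 r (coord_mul k f) (coord_mul k g) - (r ^+ 2)%:C * ip 0 r f g).
Proof.
move=> bf bg bh bh'.
pose Y (p : Cpow R n) : R[i] := (h (vec p) : R[i]) * (h' (vec p) : R[i])^* +
  (\sum_(k < n) (coord_mul k f (vec p) : R[i]) * (coord_mul k g (vec p) : R[i])^* - (r ^+ 2)%:C * ((f (vec p) : R[i]) * (g (vec p) : R[i])^*)).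
have E p : Y p = (h (vec p) : R[i]) * (h' (vec p) : R[i])^* +
     (sqn (vec p) - r ^+ 2)%:C * ((f (vec p) : R[i]) * (g (vec p) : R[i])^*).
  rewrite /Y rmorphB mulrBl; congr (_ + (_ - _)).
  rewrite /sqn rmorph_sum mulr_suml; apply: eq_bigr => k _.
  transitivity ((sqmod (vec p 0 k : R[i]))%:C * ((f (vec p) : R[i]) * (g (vec p) : R[i])^*)); last by [].
  by rewrite -mul_conj /coord_mul rmorphM; ring.
have i1 := cintegrable_ip (B bh) (B bh').
have i2 := cintegrable_ip (B bf) (B bg).
have i3 k : cintegrable muC (preball 0 r) (fun p => (coord_mul k f (vec p) : R[i]) * (coord_mul k g (vec p) : R[i])^*).
  by apply: cintegrable_ip; apply: B; apply: bergman_ext_coord_mul => //; exact: ltW.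
have i4 : cintegrable muC (preball 0 r) (fun p => \sum_(k < n) (coord_mul k f (vec p) : R[i]) * (coord_mul k g (vec p) : R[i])^*).
  by apply: cintegrable_sum.
have i5 := cintegrableZ (r ^+ 2)%:C mB i2.
have i6 := cintegrableB mB i4 i5.
split; first by apply: eq_cintegrable (cintegrableD mB i1 i6) => // p _; exact: E.
transitivity (cint muC (preball 0 r) Y); first by apply: eq_cint => p _; rewrite E.
by rewrite /Y cintD// cintB// cint_sum// cintZ.
Qed.

(** Integration by parts for the antiholomorphic derivative in the j-th
    direction; no boundary term appears because of the factor |u|^2 - r^2. *)
Lemma ball_ibp f g j : bergman_ext r f -> bergman_ext r g ->
  ip 0 r (coord_mul j f) g + \sum_(k < n) ip 0 r (coord_mul k f) (coord_mul k (pd j g : Cn -> R[i]^o)) =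
  (r ^+ 2)%:C * ip 0 r f (fun w => pd j g w).
Proof.
move=> bf bg; have bF := bergman_ext_pd j (ltW r0) bf; have bG := bergman_ext_pd j (ltW r0) bg.
have [i1 e1] := weight_int bf bG (bergman_ext_coord_mul j (ltW r0) bf) bg.
have [i2 e2] := weight_int bF bg bf (bergman_ext_coord_mul j (ltW r0) bg).
set X := (fun p : Cpow R n => _) in i1 e1; set X' := (fun p : Cpow R n => _) in i2 e2.
have H1 := ball_divergence_ej 1 j bf bg.
have H2 := ball_divergence_ej (0 +i* 1) j bf bg.
have K1 (u a b c d rho : R[i]) : u * a * b^* + rho * (a * d^*) + (a * (u * b)^* + rho * (c * b^*)) =
    (2 * complex.Re (u * 1^*))%:C * (a * b^*) + rho * (1 * c * b^* + a * (1 * d)^*).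
  by case: u a b c d rho => [? ?] [? ?] [? ?] [? ?] [? ?] [? ?]; apply: eqReIm => /=; ring.
have K2 (u a b c d rho : R[i]) : (0 +i* 1) * (a * (u * b)^* + rho * (c * b^*) - (u * a * b^* + rho * (a * d^*))) =
    (2 * complex.Re (u * (0 +i* 1)^*))%:C * (a * b^*) + rho * ((0 +i* 1) * c * b^* + a * ((0 +i* 1) * d)^*).
  by case: u a b c d rho => [? ?] [? ?] [? ?] [? ?] [? ?] [? ?]; apply: eqReIm => /=; ring.
have E1 : cint muC (preball 0 r) X + cint muC (preball 0 r) X' = 0.
  rewrite -cintD// -[RHS]H1; apply: eq_cint => p _.
  exact: K1.
have E2 : (0 +i* 1) * (cint muC (preball 0 r) X' - cint muC (preball 0 r) X) = 0.
  rewrite -cintB// -cintZ//; last exact: cintegrableB.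
  rewrite -[RHS]H2; apply: eq_cint => p _.
  exact: K2.
have i0 : (0 +i* 1 : R[i]) != 0 by rewrite -cmod_eq0 cmodi oner_eq0.
move/eqP: E2; rewrite mulf_eq0 (negbTE i0) /= subr_eq0 => /eqP E2.
move: E1; rewrite E2 -mulr2n => /eqP; rewrite mulrn_eq0 /= e1 addrA subr_eq0 => /eqP.
exact.
Qed.

Lemma ball_ibp_conj f g j : bergman_ext r f -> bergman_ext r g ->
  ip 0 r f (coord_mul j g) + \sum_(k < n) ip 0 r (coord_mul k (pd j f : Cn -> R[i]^o)) (coord_mul k g) =
  (r ^+ 2)%:C * ip 0 r (fun w => pd j f w) g.
Proof.
move=> bf bg; have s0 := ltW r0.
have K (x y z x' y' z' : R[i]) (t : R) : conjc x = x' -> conjc y = y' -> conjc z = z' ->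
    x + y = t%:C * z -> x' + y' = t%:C * z'.
  move=> <- <- <- E; transitivity (conjc (x + y)).
    by case: x y {E} => [? ?] [? ?]; apply: eqReIm => /=; ring.
  by rewrite E; case: z {E} => ? ?; apply: eqReIm => /=; ring.
have c f' g' : bergman_ext r f' -> bergman_ext r g' -> conjc (ip 0 r f' g') = ip 0 r g' f'.
  by move=> b b'; apply: esym; apply: ipC; exact: B.
apply: K (ball_ibp j bg bf).
- by apply: c => //; exact: bergman_ext_coord_mul.
- apply: etrans (conjc_sum _ _) _; apply: eq_bigr => k _.
  by apply: c; apply: bergman_ext_coord_mul => //; exact: bergman_ext_pd.
- by apply: c => //; exact: bergman_ext_pd.
Qed.

(** The radial derivative; a monomial of degree d is an eigenvector with
    eigenvalue d. *)
Definition euler f : Cn -> R[i]^o := fun w => \sum_(k < n) coord_mul k (pd k f) w.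

(** The adjoint of [pd j] in the Bergman space of the ball of radius r. *)
Definition pd_adj j f : Cn -> R[i]^o := fun w =>
  (r ^- 2)%:C * coord_mul j (fun w => euler f w + n.+1%:R * (f w : R[i])) w.

Lemma bergman_ext_euler f : bergman_ext r f -> bergman_ext r (euler f).
Proof.
move=> bf; apply: bergman_ext_sum => [|k]; first exact: ltW.
by apply: bergman_ext_coord_mul; [exact: ltW|apply: bergman_ext_pd => //; exact: ltW].
Qed.

Lemma bergman_ext_pd_adj j f : bergman_ext r f -> bergman_ext r (pd_adj j f).
Proof.
move=> bf; apply: bergman_extZ; apply: bergman_ext_coord_mul; first exact: ltW.
by apply: bergman_extD; [exact: ltW|exact: bergman_ext_euler|exact: bergman_extZ].
Qed.

(** Three integrations by parts: of f against g; of euler f + n f against g;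
    and, with the two derivatives exchanged, of each u_k f against the derivative
    of g, summed over k. The terms with |u|^2 cancel in the combination. *)
Lemma ip_pd_adj j f g : bergman_ext r f -> bergman_ext r g ->
  ip 0 r (pd_adj j f) g = ip 0 r f (fun w => pd j g w).
Proof.
move=> bf bg; have s0 := ltW r0.
pose G : Cn -> R[i]^o := fun w => pd j g w; have bG : bergman_ext r G by exact: bergman_ext_pd.
pose h : Cn -> R[i]^o := fun w => euler f w + n%:R * (f w : R[i]).
have bh : bergman_ext r h by apply: bergman_extD => //; [exact: bergman_ext_euler|exact: bergman_extZ].
have I1 := ball_ibp j bf bg; have I3 := ball_ibp j bh bg.
pose F k : Cn -> R[i]^o := fun w => pd k (coord_mul k f) w.
have bF k : bergman_ext r (F k) by apply: bergman_ext_pd => //; exact: bergman_ext_coord_mul.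
have Fh w : eball 0 r w -> \sum_(k < n) F k w = h w.
  move=> /(eball0E _ s0)/ltW wr; rewrite /h /euler.
  have -> : n%:R * (f w : R[i]) = \sum_(k < n) (f w : R[i]).
    by rewrite sumr_const card_ord mulr_natl.
  rewrite -big_split; apply: eq_bigr => k _.
  have [_ /(_ k) E] := holoM (holo_coord k w).1 (bergman_ext_holo s0 bf wr).
  by rewrite /F [LHS]E (holo_coord k w).2 eqxx mul1r.
have I2 : \sum_(k < n) ip 0 r (coord_mul k f) (coord_mul k G) + \sum_(l < n) ip 0 r (coord_mul l h) (coord_mul l G) =
    (r ^+ 2)%:C * ip 0 r h G.
  have : \sum_(k < n) (ip 0 r (coord_mul k f) (coord_mul k G) + \sum_(l < n) ip 0 r (coord_mul l (F k)) (coord_mul l G)) =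
      \sum_(k < n) (r ^+ 2)%:C * ip 0 r (F k) G.
    by apply: eq_bigr => k _; exact: (ball_ibp_conj k (bergman_ext_coord_mul k s0 bf) bG).
  rewrite big_split /= -mulr_sumr exchange_big /=.
  rewrite -(ip_suml _ s0 bF bG) (eq_ip Fh (fun w _ => erefl)) => <-; congr (_ + _).
  apply: eq_bigr => l _; rewrite -ip_suml//; [|by move=> k; exact: bergman_ext_coord_mul|exact: bergman_ext_coord_mul].
  by apply: eq_ip => // w Bw; rewrite /coord_mul -mulr_sumr Fh.
have E : ip 0 r (coord_mul j h) g = \sum_(k < n) ip 0 r (coord_mul k f) (coord_mul k G).
  apply: (addIr (\sum_(l < n) ip 0 r (coord_mul l h) (coord_mul l G))).
  by rewrite I2 I3.
have r2 : (r ^+ 2)%:C != 0 :> R[i] by rewrite -cmod_eq0 cmod_real normr_eq0 expf_neq0// gt_eqF.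
apply: (mulfI r2); rewrite -I1 -E -ipDl; [|exact: B (bergman_ext_coord_mul j s0 bf)|exact: B (bergman_ext_coord_mul j s0 bh)|exact: B].
rewrite -ipZl; [|exact: B (bergman_ext_pd_adj j bf)|exact: B].
apply: eq_ip => // w _; rewrite /pd_adj mulrA -rmorphM mulfV ?expf_neq0 ?gt_eqF// mul1r.
by rewrite /coord_mul /h -natr1; ring.
Qed.

End adjoint.

(** * Smooth families in a Bergman space *)

Lemma cvge0P (R : realType) (T : Type) (F : set_system T) {FF : Filter F} (f : T -> \bar R) :
  (forall x, 0 <= f x)%E ->
  (f @ F --> (0 : \bar R)%E) <-> (forall e : R, 0 < e -> \forall x \near F, (f x < e%:E)%E).
Proof.
move=> f0; split.
  move=> H e e0; have : nbhs (0 : \bar R)%E [set y | (y < e%:E)%E].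
    change (nbhs (0 : R) (fun r : R => (r%:E < e%:E)%E)).
    apply/nbhs_ballP; exists e => //= r; rewrite /ball/= sub0r normrN lte_fin.
    exact: le_lt_trans (ler_norm _).
  by move/H.
move=> H A hA; have : nbhs (0 : R) (fun r : R => A r%:E) by [].
move=> /nbhs_ballP[e /= e0 eA].
suff : \forall x \near F, A (f x) by [].
have := H e e0; apply: filterS => x fx.
have := f0 x; case: (f x) fx => [r| |] //; rewrite lte_fin lee_fin => re r0.
by apply: eA; rewrite /ball/= sub0r normrN ger0_norm.
Qed.

Section norm_calculus.
Context (R : realType) (n : nat).
Local Notation Cn := (Cn R n).
Local Notation bg r := (bergman (0 : Cn) r).
Implicit Types (F G T : Cn -> Cn -> R[i]^o) (f g : Cn -> R[i]^o) (u v w z : Cn) (r s : R).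

Definition norm_cont r F z := forall e : R, 0 < e -> exists2 d : R, 0 < d &
  forall z', enorm (z' - z) < d -> nrm 0 r (fun w => F z' w - F z w) < e.

Definition norm_deriv r v F g z := forall e : R, 0 < e -> exists2 d : R, 0 < d &
  forall t : R, t != 0 -> `|t| < d ->
    nrm 0 r (fun w => (t%:C)^-1 * (F (z + (t%:C : R[i]^o) *: v) w - F z w) - g w) < e.

(** [class_C] for the Bergman norm, in terms of real norms. *)
Fixpoint norm_class r k F : Prop :=
  [/\ forall z, bg r (F z), forall z, norm_cont r F z
    & if k is m.+1 then forall v, exists2 G, forall z, norm_deriv r v F (G z) z & norm_class r m G else True].

Lemma L2sq_lt r f (e : R) : bg r f -> 0 < e -> (L2sq 0 r f < (e ^+ 2)%:E)%E = (nrm 0 r f < e).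
Proof.
move=> bf e0; rewrite L2sqE// lte_fin -sqr_nrm ltr_pXn2r ?nnegrE ?nrm_ge0//.
exact: ltW.
Qed.

Lemma bergman_quot r f g h (a : R[i]) : bg r f -> bg r g -> bg r h ->
  bg r (fun w => a * (f w - g w) - h w).
Proof. by move=> bf bg' bh; exact: bergmanB (bergmanZ a (bergmanB bf bg')) bh. Qed.

Lemma norm_contP r F z : (forall z, bg r (F z)) ->
  (L2sq 0 r (F z' - F z) @[z' --> z] --> (0 : \bar R)%E) <-> norm_cont r F z.
Proof.
move=> bF; have bB z' : bg r (fun w => F z' w - F z w) by exact: bergmanB.
have -> : (fun z' => L2sq 0 r (F z' - F z)) = (fun z' => L2sq 0 r (fun w => F z' w - F z w)) by [].
apply: (iff_trans (@cvge0P R _ (nbhs z) _ _ (fun z' => L2sq_ge0 _ _ _))).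
split=> [H e e0|H e e0].
  have [d d0 hd] := (nbhs_enormP _ _).1 (H (e ^+ 2) (exprn_gt0 2 e0)).
  by exists d => // z' /hd; rewrite L2sq_lt.
have se0 : 0 < Num.sqrt e by rewrite sqrtr_gt0.
have [d d0 hd] := H _ se0; apply/nbhs_enormP; exists d => // z' /hd.
by rewrite -L2sq_lt// sqr_sqrtr// ltW.
Qed.

Lemma norm_derivP r v F g z : (forall z, bg r (F z)) -> bg r g ->
  (L2sq 0 r ((t%:C)^-1 *: (F (z + (t%:C : R[i]^o) *: v) - F z) - g)
      @[t --> (0 : R)^'] --> (0 : \bar R)%E) <-> norm_deriv r v F g z.
Proof.
move=> bF bG.
have bB t : bg r (fun w => (t%:C)^-1 * (F (z + (t%:C : R[i]^o) *: v) w - F z w) - g w).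
  exact: bergman_quot.
have -> : (fun t : R => L2sq 0 r ((t%:C)^-1 *: (F (z + (t%:C : R[i]^o) *: v) - F z) - g)) =
  (fun t : R => L2sq 0 r (fun w => (t%:C)^-1 * (F (z + (t%:C : R[i]^o) *: v) w - F z w) - g w)) by [].
apply: (iff_trans (@cvge0P R _ ((0 : R)^') _ _ (fun t => L2sq_ge0 _ _ _))).
split=> [H e e0|H e e0].
  have := H (e ^+ 2) (exprn_gt0 2 e0); rewrite near_withinE => /nbhs_ballP[d /= d0 hd].
  exists d => // t t0 td; rewrite -L2sq_lt//; apply: hd => //.
  by rewrite /ball/= sub0r normrN.
have se0 : 0 < Num.sqrt e by rewrite sqrtr_gt0.
have [d d0 hd] := H _ se0; rewrite near_withinE; apply/nbhs_ballP; exists d => //= t.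
rewrite /ball/= sub0r normrN => td t0; have := hd t t0 td.
by rewrite -L2sq_lt// sqr_sqrtr// ltW.
Qed.

(** On [bergman] functions the extended-real squared norm is the square of a
    real norm, so both hierarchies of derivatives have the same limits. *)
Lemma class_C_norm_class r k F : class_C (bergman (0 : Cn) r) (L2sq (0 : Cn) r) k F <-> norm_class r k F.
Proof.
elim: k F => [|k IH] F.
  by split=> -[h1 h2 _]; split => // z; [apply/norm_contP => //; exact: h2|apply/(norm_contP _ h1); exact: h2].
split=> -[h1 h2 h3]; split => //; try by move=> z; apply/norm_contP => //; exact: h2.
  move=> v; have [G G1 /IH G2] := h3 v; exists G => // z; apply/norm_derivP => //.
  by case: k {IH h3} G2 => [|k] [].
move=> v; have [G G1 G2] := h3 v; exists G; last exact/IH.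
move=> z; apply/(norm_derivP _ _ h1); last exact: G1.
by case: k {IH h3} G2 => [|k] [].
Qed.

Lemma norm_class_bg r k F : norm_class r k F -> forall z, bg r (F z).
Proof. by case: k => [|k] []. Qed.

Lemma eq_nrm r f g : (forall w, eball 0 r w -> f w = g w) -> nrm 0 r f = nrm 0 r g.
Proof. by move=> E; congr Num.sqrt; apply: eq_Rintegral => p /set_mem /E ->. Qed.

Lemma norm_class_eq r k F F' : (forall z w, eball 0 r w -> F z w = F' z w) -> norm_class r k F -> norm_class r k F'.
Proof.
move=> E; have H1 : (forall z, bg r (F z)) -> forall z, bg r (F' z).
  by move=> h z; apply: eq_bergman (h z) => w; exact: E.
have H2 : (forall z, norm_cont r F z) -> forall z, norm_cont r F' z.
  move=> h z e /(h z)[d d0 hd]; exists d => // z' /hd.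
  by rewrite (eq_nrm (g := fun w => F' z' w - F' z w))// => w Bw; rewrite !E.
case: k => [|k] [h1 h2 h3]; split => //; [exact: H1|exact: H2|exact: H1|exact: H2|].
move=> v; have [G G1 G2] := h3 v; exists G => // z e /(G1 z)[d d0 hd]; exists d => // t t0 td.
rewrite -(eq_nrm (f := fun w => (t%:C)^-1 * (F (z + (t%:C : R[i]^o) *: v) w - F z w) - G z w)).
  exact: hd.
by move=> w Bw; rewrite !E.
Qed.

Lemma norm_classD r k F G : norm_class r k F -> norm_class r k G -> norm_class r k (fun z w => F z w + G z w).
Proof.
elim: k F G => [|k IH] F G [F1 F2 F3] [G1 G2 G3].
all: have bD : forall z, bg r (fun w => F z w + G z w) by move=> z; exact: bergmanD.
all: have cD : forall z, norm_cont r (fun z w => F z w + G z w) z.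
1,3: move=> z e e0; have e2 : 0 < e / 2 by rewrite divr_gt0.
1,2: have [d1 d10 h1] := F2 z _ e2; have [d2 d20 h2] := G2 z _ e2.
1,2: exists (Num.min d1 d2) => [|z']; first by rewrite lt_min d10.
1,2: rewrite lt_min => /andP[/h1 A1 /h2 A2].
1,2: rewrite (eq_nrm (g := fun w => (F z' w - F z w) + (G z' w - G z w))); last by move=> w _; ring.
1,2: apply: le_lt_trans (nrmD (bergmanB (F1 z') (F1 z)) (bergmanB (G1 z') (G1 z))) _; lra.
  by split.
split => // v; have [F' F'1 F'2] := F3 v; have [G' G'1 G'2] := G3 v.
exists (fun z w => F' z w + G' z w); last exact: IH.
move=> z e e0; have e2 : 0 < e / 2 by rewrite divr_gt0.
have [d1 d10 h1] := F'1 z _ e2; have [d2 d20 h2] := G'1 z _ e2.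
exists (Num.min d1 d2) => [|t t0]; first by rewrite lt_min d10.
rewrite lt_min => /andP[/(h1 t t0) A1 /(h2 t t0) A2].
rewrite (eq_nrm (g := fun w => ((t%:C)^-1 * (F (z + (t%:C : R[i]^o) *: v) w - F z w) - F' z w) +
  ((t%:C)^-1 * (G (z + (t%:C : R[i]^o) *: v) w - G z w) - G' z w))); last by move=> w _; ring.
have bq H H' : (forall z, bg r (H z)) -> bg r H' -> bg r (fun w => (t%:C)^-1 * (H (z + (t%:C : R[i]^o) *: v) w - H z w) - H' w).
  by move=> b1 b2; exact: bergman_quot.
apply: le_lt_trans (nrmD (bq _ _ F1 (norm_class_bg F'2 z)) (bq _ _ G1 (norm_class_bg G'2 z))) _; lra.
Qed.

(** Bounded linear operators from B_s to B_r; linearity is asked on the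
    target ball, where the class of A f lives. *)
Definition bounded_op s r (A : (Cn -> R[i]^o) -> (Cn -> R[i]^o)) :=
  (exists2 C : R, 0 <= C & forall f, bg s f -> bg r (A f) /\ nrm 0 r (A f) <= C * nrm 0 s f) /\
  (forall f g (a b : R[i]), bg s f -> bg s g -> forall w, eball 0 r w ->
     A (fun w => a * (f w : R[i]) + b * (g w : R[i])) w = a * (A f w : R[i]) + b * (A g w : R[i])).

Lemma bounded_op_lin3 s r A f g h (a : R[i]) : bounded_op s r A -> bg s f -> bg s g -> bg s h ->
  forall w, eball 0 r w ->
  a * (A f w - A g w) - A h w = A (fun w => a * (f w - g w) - h w) w.
Proof.
move=> [_ L] bf bg' bh w Bw.
have b1 : bg s (fun w => a * (f w : R[i]) + - a * (g w : R[i])).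
  by apply: bergmanD; exact: bergmanZ.
have -> : (fun w => a * (f w - g w) - h w) =
    (fun w => 1 * ((fun w => a * (f w : R[i]) + - a * (g w : R[i])) w : R[i]) + -1 * (h w : R[i])).
  by apply/funext => u; ring.
rewrite (L _ _ 1 (-1) b1 bh w Bw) (L _ _ a (- a) bf bg' w Bw); ring.
Qed.

Lemma norm_deriv_op s r A v F g z : bounded_op s r A -> (forall z, bg s (F z)) -> bg s g ->
  norm_deriv s v F g z -> norm_deriv r v (fun z => A (F z)) (A g) z.
Proof.
move=> bA bF bG H e e0; have [[C C0 HC] _] := bA; have C1 : 0 < C + 1 by rewrite ltr_wpDl.
have [d d0 hd] := H _ (divr_gt0 e0 C1); exists d => // t t0 td.
rewrite (eq_nrm (fun w => bounded_op_lin3 (t%:C)^-1 bA (bF _) (bF z) bG (w := w))).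
have bq : bg s (fun w => (t%:C)^-1 * (F (z + (t%:C : R[i]^o) *: v) w - F z w) - g w).
  exact: bergman_quot.
have [_ le] := HC _ bq; apply: le_lt_trans le _.
have := hd t t0 td; rewrite ltr_pdivlMr// mulrC; apply: le_lt_trans.
by rewrite ler_wpM2r ?nrm_ge0// lerDl.
Qed.

(** A bounded linear operator maps difference quotients to difference quotients,
    hence commutes with the derivatives in the parameter. *)
Lemma norm_class_op s r A k F : bounded_op s r A -> norm_class s k F -> norm_class r k (fun z => A (F z)).
Proof.
move=> bA; have [[C C0 HC] L] := bA; have C1 : 0 < C + 1 by rewrite ltr_wpDl.
elim: k F => [|k IH] F [F1 F2 F3].
all: have bD : forall z, bg r (A (F z)) by move=> z; have [] := HC _ (F1 z).
all: have cD : forall z, norm_cont r (fun z => A (F z)) z.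
1,3: move=> z e e0; have [d d0 hd] := F2 z _ (divr_gt0 e0 C1); exists d => // z' /hd.
1,2: rewrite ltr_pdivlMr// => h.
1,2: rewrite (eq_nrm (g := A (fun w => 1 * (F z' w : R[i]) + -1 * (F z w : R[i]))));
    last by move=> w Bw; rewrite (L _ _ 1 (-1) (F1 z') (F1 z) w Bw) mul1r mulN1r.
1,2: have [|_ le] := HC (fun w => 1 * (F z' w : R[i]) + -1 * (F z w : R[i]));
    first by apply: bergmanD; exact: bergmanZ.
1,2: apply: le_lt_trans le _; rewrite (eq_nrm (g := fun w => F z' w - F z w));
    last by move=> w _; rewrite mul1r mulN1r.
1,2: apply: le_lt_trans h; rewrite mulrC ler_wpM2l ?nrm_ge0// lerDl//.
  by split.
split => // v; have [G G1 G2] := F3 v; exists (fun z => A (G z)); last exact: IH.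
by move=> z; apply: (norm_deriv_op bA) => //; exact: norm_class_bg G2 z.
Qed.

Lemma bounded_op_id s r : 0 <= r -> r <= s -> bounded_op s r id.
Proof.
move=> r0 rs; split => //; exists 1 => // f bf; split; first exact: bergman_sub bf.
by rewrite mul1r ler_wsqrtr// nsq_sub.
Qed.

Lemma bounded_op_comp s r q A B : bounded_op s r A -> bounded_op r q B ->
  (forall f g w, (forall w, eball 0 r w -> f w = g w) -> eball 0 q w -> B f w = B g w) ->
  bounded_op s q (fun f => B (A f)).
Proof.
move=> [[C C0 HC] LA] [[D D0 HD] LB] ext; split.
  exists (D * C) => [|f bf]; first exact: mulr_ge0.
  have [b1 n1] := HC f bf; have [b2 n2] := HD _ b1; split => //.
  by apply: le_trans n2 _; rewrite -mulrA ler_wpM2l.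
move=> f g a b bf bg' w Bw; have [b1 _] := HC f bf; have [b2 _] := HC g bg'.
rewrite -LB//; apply: ext => // u Bu; exact: LA.
Qed.

Lemma bounded_opD s r A B : bounded_op s r A -> bounded_op s r B -> bounded_op s r (fun f w => A f w + B f w).
Proof.
move=> [[C C0 HC] LA] [[D D0 HD] LB]; split.
  exists (C + D) => [|f bf]; first exact: addr_ge0.
  have [b1 n1] := HC f bf; have [b2 n2] := HD f bf; split; first exact: bergmanD.
  by apply: le_trans (nrmD b1 b2) _; rewrite mulrDl lerD.
by move=> f g a b bf bg' w Bw; rewrite LA// LB//; ring.
Qed.

Lemma bounded_opZ s r A (c : R[i]) : bounded_op s r A -> bounded_op s r (fun f w => c * (A f w : R[i])).
Proof.
move=> [[C C0 HC] LA]; split.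
  exists (cmod c * C) => [|f bf]; first by rewrite mulr_ge0// cmod_ge0.
  have [b1 n1] := HC f bf; split; first exact: bergmanZ.
  by rewrite nrmZ// -mulrA ler_wpM2l// cmod_ge0.
by move=> f g a b bf bg' w Bw; rewrite LA//; ring.
Qed.

Lemma bounded_op_sum s r (I : Type) (l : seq I) (A : I -> (Cn -> R[i]^o) -> (Cn -> R[i]^o)) : 0 <= r ->
  (forall i, bounded_op s r (A i)) -> bounded_op s r (fun f w => \sum_(i <- l) A i f w).
Proof.
move=> r0 H; elim: l => [|i l IH].
  split.
    exists 0 => // f bf; have b0 : bg r (fun w => \sum_(i <- [::]) A i f w).
      have b0 := bergman_ext_bergman r0 (@bergman_ext0 R n r).
      by apply: eq_bergman b0 => w _; rewrite big_nil.
    split => //; rewrite mul0r (eq_nrm (g := fun w => (0 : R[i]) * ((\sum_(i <- [::]) A i f w) : R[i]))).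
      by rewrite nrmZ// cmod0 mul0r.
    by move=> w _; rewrite big_nil mulr0.
  by move=> f g a b _ _ w _; rewrite !big_nil !mulr0 addr0.
have := bounded_opD (H i) IH.
suff -> : (fun (f : Cn -> R[i]^o) w => \sum_(j <- i :: l) A j f w) = (fun f w => A i f w + \sum_(j <- l) A j f w) by [].
by apply/funext => f; apply/funext => w; rewrite big_cons.
Qed.

Lemma bounded_op_coord_mul r j : 0 <= r -> bounded_op r r (coord_mul j).
Proof.
move=> r0; split; first by exists r => [//|f bf]; exact: (coord_mul_bergman j r0 bf).
by move=> f g a b _ _ w _; rewrite /coord_mul; ring.
Qed.

Lemma bounded_op_pd s r j : 0 <= r -> r < s -> bounded_op s r (fun f w => pd j f w).
Proof.
move=> r0 rs; split.
  by have [C C0 H] := pd_bergman n r0 rs; exists C => // f; exact: H.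
move=> f g a b bf bg' w Bw.
have Bs : eball 0 s w by exact: eball_sub r0 (ltW rs) w Bw.
have [d1 e1] := holoZ a (bf.1 w Bs); have [d2 e2] := holoZ b (bg'.1 w Bs).
by have [_ ->] := holoD d1 d2; rewrite e1 e2.
Qed.

Lemma bounded_op_pd_adj s r q j : 0 < r -> r < s -> bounded_op s r (pd_adj q j).
Proof.
move=> r0 rs; rewrite /pd_adj.
apply: bounded_opZ; apply: (@bounded_op_comp s r r (fun f w => euler f w + n.+1%:R * (f w : R[i])) (coord_mul j)).
- apply: bounded_opD; last by apply: bounded_opZ; apply: bounded_op_id; exact: ltW.
  apply: bounded_op_sum => [|k]; first exact: ltW.
  apply: (@bounded_op_comp s r r (fun f w => pd k f w) (coord_mul k)).
  + by apply: bounded_op_pd => //; exact: ltW.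
  + by apply: bounded_op_coord_mul; exact: ltW.
  + by move=> f g w E Bw; rewrite /coord_mul E.
- by apply: bounded_op_coord_mul; exact: ltW.
- by move=> f g w E Bw; rewrite /coord_mul E.
Qed.

Lemma bounded_op_scale s (a : R) : 0 < a -> 0 <= s -> bounded_op s (s / a) (fun f w => f ((a%:C : R[i]^o) *: w)).
Proof.
move=> a0 s0; have sa0 : 0 <= s / a by rewrite divr_ge0// ltW.
have aC : a%:C != 0 :> R[i] by rewrite -cmod_eq0 cmod_real normr_eq0 gt_eqF.
have sub w : eball 0 (s / a) w -> eball 0 s ((a%:C : R[i]^o) *: w).
  move=> /(eball0E _ sa0) h; apply/(eball0E _ s0).
  by rewrite enormZ cmod_ger0 ?(ltW a0)// mulrC -ltr_pdivlMr.
split => //; pose q := sqmod (a%:C : R[i]) ^+ n.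
have q0 : 0 < q by rewrite exprn_gt0// lt_neqAle sqmod_ge0 eq_sym sqmod_eq0 aC.
exists (Num.sqrt q^-1) => [|f bf]; first exact: sqrtr_ge0.
have E : (L2sq 0 s f = q%:E * L2sq 0 (s / a) (fun w => f ((a%:C : R[i]^o) *: w)))%E.
  rewrite /L2sq (@integral_ball_affine _ _ a%:C 0 0 s (fun w => (sqmod (f w))%:E))//.
  - rewrite subr0 scaler0 cmod_ger0 ?(ltW a0)//; congr (_ * _)%E.
    by apply: eq_integral => p _; rewrite addr0.
  - apply/measurable_EFinP; apply: measurable_sqmod_ball => w; exact: eball_ccont bf.1.
  - by move=> p _; rewrite lee_fin sqmod_ge0.
have b1 : bg (s / a) (fun w => f ((a%:C : R[i]^o) *: w)).
  split.
    move=> w /sub /bf.1 h; have := @differentiable_affine R n f a%:C 0 w.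
    rewrite addr0 => /(_ h).
    by have -> : (fun w => f ((a%:C : R[i]^o) *: w + 0)) = (fun w => f ((a%:C : R[i]^o) *: w)) by apply/funext => u; rewrite addr0.
  have := bf.2; rewrite E; case: (L2sq _ _ _) (L2sq_ge0 0 (s / a) (fun w => f ((a%:C : R[i]^o) *: w))) => [x| |] //.
    by move=> _ _; rewrite ltry.
  by rewrite gt0_muley// lte_fin.
split => //; rewrite -sqrtrM ?invr_ge0 ?(ltW q0)// ler_wsqrtr//.
have -> : nsq 0 s f = q * nsq 0 (s / a) (fun w => f ((a%:C : R[i]^o) *: w)).
  by apply: EFin_inj; rewrite -L2sqE// E L2sqE// EFinM.
by rewrite mulKf// gt_eqF.
Qed.

End norm_calculus.

(** * Symmetry of mixed derivatives *)

Section schwarz.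
Context (R : realType) (n : nat).
Local Notation Cn := (Cn R n).

Definition has_slope (f fa : Cn -> R) (c : Cn) := forall z (e : R), 0 < e -> exists2 d : R, 0 < d &
  forall t : R, `|t| < d -> `|f (z + (t%:C : R[i]^o) *: c) - f z - t * fa z| <= e * `|t|.

Lemma has_slope_derive f fa c z (s : R) : has_slope f fa c ->
  is_derive s 1 (fun t : R => f (z + (t%:C : R[i]^o) *: c)) (fa (z + (s%:C : R[i]^o) *: c)).
Proof.
move=> H; apply: increment_is_derive => e /(H (z + (s%:C : R[i]^o) *: c))[d d0 hd].
exists d => // t /hd.
have -> : z + ((s + t)%:C : R[i]^o) *: c = z + (s%:C : R[i]^o) *: c + (t%:C : R[i]^o) *: c.
  by rewrite rmorphD scalerDl addrA.
by rewrite [fa _ * t]mulrC.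
Qed.

(** Two applications of the mean value theorem, in the direction a and then in
    the direction b. *)
Lemma second_difference (a b : Cn) f fa fab z (h : R) : 0 < h -> has_slope f fa a -> has_slope fa fab b ->
  exists x y : R, [/\ 0 <= x <= h, 0 <= y <= h &
    f (z + (h%:C : R[i]^o) *: a + (h%:C : R[i]^o) *: b) - f (z + (h%:C : R[i]^o) *: a)
    - (f (z + (h%:C : R[i]^o) *: b) - f z) =
    h * h * fab (z + (x%:C : R[i]^o) *: a + (y%:C : R[i]^o) *: b)].
Proof.
move=> h0 H1 H2.
pose p (t : R) := f (z + (h%:C : R[i]^o) *: b + (t%:C : R[i]^o) *: a) - f (z + (t%:C : R[i]^o) *: a).
pose dp (t : R) := fa (z + (h%:C : R[i]^o) *: b + (t%:C : R[i]^o) *: a) - fa (z + (t%:C : R[i]^o) *: a).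
have pP (t : R) : is_derive t 1 p (dp t).
  exact: is_deriveB (has_slope_derive _ t H1) (has_slope_derive _ t H1).
have [|x xh E1] := @MVT R p dp 0 h h0 _ _.
  by apply: derivable_within_continuous => t _; have [] := pP t.
pose q (t : R) := fa (z + (x%:C : R[i]^o) *: a + (t%:C : R[i]^o) *: b).
have qP (t : R) : is_derive t 1 q (fab (z + (x%:C : R[i]^o) *: a + (t%:C : R[i]^o) *: b)).
  exact: has_slope_derive.
have [|y yh E2] := @MVT R q (fun t => fab (z + (x%:C : R[i]^o) *: a + (t%:C : R[i]^o) *: b)) 0 h h0 _ _.
  by apply: derivable_within_continuous => t _; have [] := qP t.
exists x, y; split.
- by move: xh; rewrite in_itv/= => /andP[h1 h2]; rewrite !ltW.
- by move: yh; rewrite in_itv/= => /andP[h1 h2]; rewrite !ltW.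
move: E1; rewrite /p /dp subr0 !scale0r !addr0 [z + _ *: b + _]addrAC => ->.
move: E2; rewrite /q subr0 scale0r addr0 [z + _ *: b + _ *: a]addrAC => ->.
by rewrite mulrC mulrA mulrAC.
Qed.

(** The second difference along a and b is symmetric, and both orders of
    evaluation give values of the mixed derivatives near z. *)
Lemma schwarz_real (a b : Cn) (f fa fb fab fba : Cn -> R) : has_slope f fa a -> has_slope f fb b ->
  has_slope fa fab b -> has_slope fb fba a ->
  forall z, (forall e : R, 0 < e -> exists2 d : R, 0 < d & forall w, enorm (w - z) < d -> `|fab w - fab z| < e) ->
  (forall e : R, 0 < e -> exists2 d : R, 0 < d & forall w, enorm (w - z) < d -> `|fba w - fba z| < e) ->
  fab z = fba z.
Proof.
move=> H1 H2 H3 H4 z c1 c2; apply/eqP; rewrite -subr_eq0 -normr_le0 leNgt; apply/negP => p0.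
set e := `|_| in p0; have e2 : 0 < e / 2 by rewrite divr_gt0.
have [d1 d10 h1] := c1 _ e2; have [d2 d20 h2] := c2 _ e2.
have s0 : 0 < enorm a + enorm b + 1 by rewrite ltr_wpDl// addr_ge0 ?enorm_ge0.
pose h := Num.min d1 d2 / (enorm a + enorm b + 1) / 2.
have m0 : 0 < Num.min d1 d2 by rewrite lt_min d10.
have h0 : 0 < h by rewrite !divr_gt0.
have small (x y : R) (u v : Cn) : (u = a /\ v = b) \/ (u = b /\ v = a) -> 0 <= x <= h -> 0 <= y <= h ->
    enorm (z + (x%:C : R[i]^o) *: u + (y%:C : R[i]^o) *: v - z) < Num.min d1 d2.
  move=> uv /andP[x0 xh] /andP[y0 yh].
  have -> : z + (x%:C : R[i]^o) *: u + (y%:C : R[i]^o) *: v - z = (x%:C : R[i]^o) *: u + (y%:C : R[i]^o) *: v.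
    by rewrite -[z + _ + _]addrA [z + _]addrC addrK.
  apply: le_lt_trans (enormD _ _) _; rewrite !enormZ !cmod_ger0//.
  have eu := enorm_ge0 u; have ev := enorm_ge0 v.
  have uvE : enorm u + enorm v = enorm a + enorm b by case: uv => -[-> ->] //; rewrite addrC.
  apply: le_lt_trans (_ : h * (enorm a + enorm b + 1) < _).
    rewrite -uvE; have A1 : x * enorm u <= h * enorm u by rewrite ler_wpM2r.
    have A2 : y * enorm v <= h * enorm v by rewrite ler_wpM2r.
    by rewrite !mulrDr mulr1; lra.
  have -> : h * (enorm a + enorm b + 1) = Num.min d1 d2 / 2 by rewrite /h mulrAC divfK// gt_eqF.
  by rewrite ltr_pdivrMr// ltr_pMr// ltr1n.
have [x [y [xh yh E]]] := second_difference z h0 H1 H3.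
have [x' [y' [xh' yh' E']]] := second_difference z h0 H2 H4.
have EE : fab (z + (x%:C : R[i]^o) *: a + (y%:C : R[i]^o) *: b) = fba (z + (x'%:C : R[i]^o) *: b + (y'%:C : R[i]^o) *: a).
  have hh : h * h != 0 by rewrite mulf_neq0// gt_eqF.
  apply: (mulfI hh); rewrite -E -E' [z + _ *: b + _ *: a]addrAC; ring.
have A1 := small x y a b (or_introl (conj erefl erefl)) xh yh.
have A2 := small x' y' b a (or_intror (conj erefl erefl)) xh' yh'.
move: A1 A2; rewrite !lt_min => /andP[/h1 A1 _] /andP[_ /h2 A2].
rewrite EE in A1; set P := fba _ in A1 A2.
have : e <= `|P - fab z| + `|P - fba z|.
  rewrite /e; have -> : fab z - fba z = (P - fba z) - (P - fab z) by ring.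
  by apply: le_trans (ler_normB _ _) _; rewrite addrC.
lra.
Qed.

End schwarz.

Section schwarz_complex.
Context (R : realType) (n : nat).
Local Notation Cn := (Cn R n).

Lemma schwarz (a b : Cn) (g ga gb gab gba : Cn -> R[i]) :
  (forall z, real_deriv0 (fun t => g (z + (t%:C : R[i]^o) *: a)) (ga z)) ->
  (forall z, real_deriv0 (fun t => g (z + (t%:C : R[i]^o) *: b)) (gb z)) ->
  (forall z, real_deriv0 (fun t => ga (z + (t%:C : R[i]^o) *: b)) (gab z)) ->
  (forall z, real_deriv0 (fun t => gb (z + (t%:C : R[i]^o) *: a)) (gba z)) ->
  (forall z, ccont gab z) -> (forall z, ccont gba z) -> forall z, gab z = gba z.
Proof.
move=> H1 H2 H3 H4 c1 c2 z.
have re f fa (c : Cn) : (forall z, real_deriv0 (fun t => f (z + (t%:C : R[i]^o) *: c)) (fa z)) ->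
   has_slope (fun z => complex.Re (f z)) (fun z => complex.Re (fa z)) c.
  move=> H w e /(H w)[d d0 hd]; exists d => // t /hd; rewrite scale0r addr0 cRe_incr.
  by apply: le_trans; exact: Re_le_cmod.
have im f fa (c : Cn) : (forall z, real_deriv0 (fun t => f (z + (t%:C : R[i]^o) *: c)) (fa z)) ->
   has_slope (fun z => complex.Im (f z)) (fun z => complex.Im (fa z)) c.
  move=> H w e /(H w)[d d0 hd]; exists d => // t /hd; rewrite scale0r addr0 cIm_incr.
  by apply: le_trans; exact: Im_le_cmod.
have cre f : ccont f z -> forall e : R, 0 < e -> exists2 d : R, 0 < d & forall w, enorm (w - z) < d -> `|complex.Re (f w) - complex.Re (f z)| < e.
  move=> H e /H[d d0 hd]; exists d => // w /hd; rewrite -cReN -cReD; apply: le_lt_trans; exact: Re_le_cmod.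
have cim f : ccont f z -> forall e : R, 0 < e -> exists2 d : R, 0 < d & forall w, enorm (w - z) < d -> `|complex.Im (f w) - complex.Im (f z)| < e.
  move=> H e /H[d d0 hd]; exists d => // w /hd; rewrite -cImN -cImD; apply: le_lt_trans; exact: Im_le_cmod.
apply: eqReIm.
  exact: (schwarz_real (re _ _ _ H1) (re _ _ _ H2) (re _ _ _ H3) (re _ _ _ H4) (cre _ (c1 z)) (cre _ (c2 z))).
exact: (schwarz_real (im _ _ _ H1) (im _ _ _ H2) (im _ _ _ H3) (im _ _ _ H4) (cim _ (c1 z)) (cim _ (c2 z))).
Qed.

End schwarz_complex.

(** * Derivatives of smooth families in the parameter *)

Section smooth_families.
Context (R : realType) (n : nat).
Local Notation Cn := (Cn R n).
Local Notation bg r := (bergman (0 : Cn) r).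
Implicit Types (F G T : Cn -> Cn -> R[i]^o) (f g : Cn -> R[i]^o) (u v w z : Cn) (r s : R).

Definition smooth_family r F := forall k, norm_class r k F.

Definition family_deriv v F : Cn -> Cn -> R[i]^o := fun z w => real_derive v (fun z' => F z' w) z.

Lemma smooth_family_bg r F : smooth_family r F -> forall z, bg r (F z).
Proof. by move=> H; exact: norm_class_bg (H 0%N). Qed.

Lemma smooth_family_eq r F G : (forall z w, eball 0 r w -> F z w = G z w) -> smooth_family r F -> smooth_family r G.
Proof. by move=> E H k; apply: norm_class_eq (H k). Qed.

Lemma smooth_family_op s r A F : bounded_op s r A -> smooth_family s F -> smooth_family r (fun z => A (F z)).
Proof. by move=> bA H k; apply: norm_class_op (H k). Qed.

Lemma smooth_familyD r F G : smooth_family r F -> smooth_family r G -> smooth_family r (fun z w => F z w + G z w).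
Proof. by move=> H K k; exact: norm_classD. Qed.

Lemma smooth_familyZ r (a : R[i]) F : 0 <= r -> smooth_family r F -> smooth_family r (fun z w => a * (F z w : R[i])).
Proof. by move=> r0 H; exact (@smooth_family_op r r (fun f w => a * (f w : R[i])) F (bounded_opZ a (bounded_op_id n r0 (lexx r))) H). Qed.

Lemma smooth_family_sub r s F : 0 <= r -> r <= s -> smooth_family s F -> smooth_family r F.
Proof. by move=> r0 rs H; exact (@smooth_family_op s r id F (bounded_op_id n r0 rs) H). Qed.

Lemma norm_deriv_real_deriv0 r v F g z w : enorm w < r -> (forall z, bg r (F z)) -> bg r g -> norm_deriv r v F g z ->
  real_deriv0 (fun t => F (z + (t%:C : R[i]^o) *: v) w) (g w).
Proof.
move=> wr bF bG H e e0; set K := (Num.sqrt (bvol n (r - enorm w)))^-1.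
have K0 : 0 <= K by rewrite invr_ge0 sqrtr_ge0.
have K1 : 0 < K + 1 by rewrite ltr_wpDl.
have [d d0 hd] := H _ (divr_gt0 e0 K1); exists d => // t td.
rewrite scale0r addr0.
have [->|t0] := eqVneq t 0.
  by rewrite scale0r addr0 subrr sub0r rmorph0 mul0r oppr0 cmod0 normr0 mulr0.
have tC : t%:C != 0 :> R[i] by rewrite -cmod_eq0 cmod_real normr_eq0.
pose q : Cn -> R[i]^o := fun w => (t%:C)^-1 * (F (z + (t%:C : R[i]^o) *: v) w - F z w) - g w.
have -> : F (z + (t%:C : R[i]^o) *: v) w - F z w - t%:C * g w = t%:C * (q w : R[i]).
  by rewrite /q mulrBr mulVKf.
rewrite cmodM cmod_real mulrC ler_wpM2r//.
have bq : bg r q by exact: bergman_quot.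
apply: le_trans (eval_le wr (lexx _) bq) _; rewrite -/K.
have := hd t t0 td; rewrite ltr_pdivlMr// -/q => /ltW; apply: le_trans.
by rewrite mulrC ler_wpM2l ?nrm_ge0// lerDl.
Qed.

(** The derivatives provided by smoothness are derivatives in norm; evaluation
    being bounded, they agree with the pointwise derivatives [family_deriv v F]. *)
Lemma smooth_family_der r F v : 0 <= r -> smooth_family r F -> smooth_family r (family_deriv v F) /\ forall z, norm_deriv r v F (family_deriv v F z) z.
Proof.
move=> r0 H; have bF := smooth_family_bg H.
have K k : exists2 G, (forall z w, eball 0 r w -> G z w = family_deriv v F z w) & (forall z, norm_deriv r v F (G z) z) /\ norm_class r k G.
  have [_ _ /(_ v)[G G1 G2]] := H k.+1; exists G => //.
  move=> z w /(eball0E _ r0) wr; apply/esym/real_deriv0_real_derive.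
  exact: (norm_deriv_real_deriv0 wr bF (norm_class_bg G2 z) (G1 z)).
split.
  move=> k; have [G GE [_ G2]] := K k; exact: norm_class_eq GE G2.
move=> z; have [G GE [G1 _]] := K 0%N.
move=> e /(G1 z)[d d0 hd]; exists d => // t t0 td; have := hd t t0 td.
suff -> : nrm 0 r (fun w => (t%:C)^-1 * (F (z + (t%:C : R[i]^o) *: v) w - F z w) - G z w) =
  nrm 0 r (fun w => (t%:C)^-1 * (F (z + (t%:C : R[i]^o) *: v) w - F z w) - family_deriv v F z w) by [].
by apply: eq_nrm => w Bw; rewrite GE.
Qed.

Lemma smooth_family_real_deriv0 r F v z w : smooth_family r F -> enorm w < r ->
  real_deriv0 (fun t => F (z + (t%:C : R[i]^o) *: v) w) (family_deriv v F z w).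
Proof.
move=> H wr; have r0 : 0 <= r by exact: le_trans (enorm_ge0 w) (ltW wr).
have [H1 H2] := smooth_family_der v r0 H.
exact: (norm_deriv_real_deriv0 wr (smooth_family_bg H) (smooth_family_bg H1 z) (H2 z)).
Qed.

Lemma family_deriv_op s r A F v z w : bounded_op s r A -> smooth_family s F -> 0 <= s -> enorm w < r ->
  family_deriv v (fun z => A (F z)) z w = A (family_deriv v F z) w.
Proof.
move=> bA H s0 wr; have [H1 H2] := smooth_family_der v s0 H.
have bA' := smooth_family_bg (smooth_family_op bA H).
apply: real_deriv0_real_derive; apply: (norm_deriv_real_deriv0 wr bA').
  by case: bA => -[C _ HC] _; have [] := HC _ (smooth_family_bg H1 z).
exact: norm_deriv_op bA (smooth_family_bg H) (smooth_family_bg H1 z) (H2 z).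
Qed.

(** Continuity in norm is pointwise continuity because evaluation is bounded. *)
Lemma smooth_family_ccont r F z w : smooth_family r F -> enorm w < r -> ccont (fun z => F z w) z.
Proof.
move=> H wr e e0; have [bF cF _] := H 0%N.
set K := (Num.sqrt (bvol n (r - enorm w)))^-1.
have K0 : 0 <= K by rewrite invr_ge0 sqrtr_ge0.
have K1 : 0 < K + 1 by rewrite ltr_wpDl.
have [d d0 hd] := cF z _ (divr_gt0 e0 K1); exists d => // z' /hd.
rewrite ltr_pdivlMr// mulrC; apply: le_lt_trans.
apply: le_trans (eval_le wr (lexx _) (bergmanB (bF z') (bF z))) _.
by rewrite -/K ler_wpM2r ?nrm_ge0// lerDl.
Qed.

Lemma family_deriv_comm r F a b z w : smooth_family r F -> enorm w < r -> family_deriv a (family_deriv b F) z w = family_deriv b (family_deriv a F) z w.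
Proof.
move=> H wr; have r0 : 0 <= r by exact: le_trans (enorm_ge0 w) (ltW wr).
have Ha := (smooth_family_der a r0 H).1; have Hb := (smooth_family_der b r0 H).1.
have Hab := (smooth_family_der b r0 Ha).1; have Hba := (smooth_family_der a r0 Hb).1.
apply/esym; apply: (@schwarz R n a b (fun z => F z w) (fun z => family_deriv a F z w) (fun z => family_deriv b F z w)
  (fun z => family_deriv b (family_deriv a F) z w) (fun z => family_deriv a (family_deriv b F) z w)) => z'.
- exact: (smooth_family_real_deriv0 a z' H wr).
- exact: (smooth_family_real_deriv0 b z' H wr).
- exact: (smooth_family_real_deriv0 b z' Ha wr).
- exact: (smooth_family_real_deriv0 a z' Hb wr).
- exact: (smooth_family_ccont z' Hab wr).
- exact: (smooth_family_ccont z' Hba wr).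
Qed.

(** The chain rule behind the passage to the trivialization: the centre of the
    ball moves together with z. *)
Lemma real_deriv0_moving r F (v c : Cn) z u : smooth_family r F -> enorm u < r ->
  real_deriv0 (fun t => F (z + (t%:C : R[i]^o) *: v) (u - (t%:C : R[i]^o) *: c))
      (family_deriv v F z u - lform (fun j => pd j (F z) u) c).
Proof.
move=> H ur; have r0 : 0 <= r by exact: le_trans (enorm_ge0 u) (ltW ur).
have [H1 H2] := smooth_family_der v r0 H; have bF := smooth_family_bg H; have bG := smooth_family_bg H1 z.
have Bu : eball 0 r u by apply/(eball0E _ r0).
set q := (enorm u + r) / 2; have qr : q < r by rewrite /q; lra.
have uq : 0 < q - enorm u by rewrite /q; lra.
set K := (Num.sqrt (bvol n (r - q)))^-1.
have K0 : 0 <= K by rewrite invr_ge0 sqrtr_ge0.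
have K1 : 0 < K + 1 by rewrite ltr_wpDl.
move=> e e0; have e3 : 0 < e / 3 by rewrite divr_gt0.
have [d1 d10 h1] := H2 z _ (divr_gt0 e3 K1).
have [d2 d20 h2] := eball_ccont bG.1 Bu e3.
have [d3 d30 h3] := real_deriv0_holo (- c) ((bF z).1 u Bu) e3.
have c1 : 0 < enorm c + 1 by rewrite ltr_wpDl// enorm_ge0.
exists (Num.min (Num.min d1 (d2 / (enorm c + 1))) (Num.min d3 ((q - enorm u) / (enorm c + 1)))) => [|t].
  by rewrite !lt_min d10 d30 !divr_gt0.
rewrite !lt_min => /andP[/andP[t1 t2] /andP[t3 t4]].
rewrite !scale0r addr0 subr0.
have tc (m : R) : `|t| < m / (enorm c + 1) -> enorm ((t%:C : R[i]^o) *: c) < m.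
  rewrite ltr_pdivlMr// => h; rewrite enormZ cmod_real; apply: le_lt_trans h.
  by rewrite ler_wpM2l// lerDl.
set u' := u - (t%:C : R[i]^o) *: c.
have u'q : enorm u' <= q.
  by apply: le_trans (enormB _ _) _; have := tc _ t4; lra.
have A2 : cmod (family_deriv v F z u' - family_deriv v F z u) < e / 3.
  by apply: h2; rewrite /u' [u - _]addrC addrK enormN; exact: tc.
have := h3 t t3; rewrite scale0r addr0 scalerN -/u' linearN/= => A3.
have [t0|t0] := eqVneq t 0.
  by rewrite t0 /u' t0 !scale0r addr0 subr0 subrr sub0r rmorph0 mul0r oppr0 cmod0 normr0 mulr0.
have tC : t%:C != 0 :> R[i] by rewrite -cmod_eq0 cmod_real normr_eq0.
pose qt : Cn -> R[i]^o := fun w => (t%:C)^-1 * (F (z + (t%:C : R[i]^o) *: v) w - F z w) - family_deriv v F z w.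
have A1 : cmod (qt u') <= e / 3.
  have bq : bg r qt by exact: bergman_quot.
  apply: le_trans (eval_le qr u'q bq) _; rewrite -/K.
  have := h1 t t0 t1; rewrite ltr_pdivlMr// -/qt => /ltW; apply: le_trans.
  by rewrite mulrC ler_wpM2l ?nrm_ge0// lerDl.
have -> : F (z + (t%:C : R[i]^o) *: v) u' - F z u - t%:C * (family_deriv v F z u - lform (fun j => pd j (F z) u) c) =
  t%:C * (qt u' : R[i]) + t%:C * (family_deriv v F z u' - family_deriv v F z u) + (F z u' - F z u - t%:C * - lform (fun j => pd j (F z) u) c).
  rewrite /qt; have E (x y x' s g g' l : R[i]) : s != 0 ->
    x - y - s * (g - l) = s * (s^-1 * (x - x') - g') + s * (g' - g) + (x' - y - s * - l).
    by move=> tt; field.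
  exact: E.
apply: le_trans (cmodD _ _) _; apply: le_trans (lerD (cmodD _ _) (lexx _)) _.
rewrite !cmodM cmod_real.
have B1 : `|t| * cmod (qt u') <= `|t| * (e / 3) by rewrite ler_wpM2l.
have B2 : `|t| * cmod (family_deriv v F z u' - family_deriv v F z u) <= `|t| * (e / 3) by rewrite ler_wpM2l// ltW.
lra.
Qed.

Definition dzF j F : Cn -> Cn -> R[i]^o := fun z w => dz j (fun z' => F z' w) z.
Definition dzbarF j F : Cn -> Cn -> R[i]^o := fun z w => dzbar j (fun z' => F z' w) z.

Let ie (j : 'I_n) : Cn := ((0 +i* 1 : R[i]) : R[i]^o) *: ej R j.

Lemma smooth_family_dzF r j F : 0 <= r -> smooth_family r F -> smooth_family r (dzF j F).
Proof.
move=> r0 H; have H1 := (smooth_family_der (ej R j) r0 H).1; have H2 := (smooth_family_der (ie j) r0 H).1.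
apply: smooth_family_eq (smooth_familyD (smooth_familyZ 2^-1 r0 H1) (smooth_familyZ (- (2^-1 * (0 +i* 1))) r0 H2)) => z w _.
by rewrite /dzF /dz /family_deriv -/(ie j) mulrBr mulNr mulrA.
Qed.

Lemma smooth_family_dzbarF r j F : 0 <= r -> smooth_family r F -> smooth_family r (dzbarF j F).
Proof.
move=> r0 H; have H1 := (smooth_family_der (ej R j) r0 H).1; have H2 := (smooth_family_der (ie j) r0 H).1.
apply: smooth_family_eq (smooth_familyD (smooth_familyZ 2^-1 r0 H1) (smooth_familyZ (2^-1 * (0 +i* 1)) r0 H2)) => z w _.
by rewrite /dzbarF /dzbar /family_deriv -/(ie j) mulrDr mulrA.
Qed.

Let lin2 (p q x y x' y' : R[i]) : x = x' -> y = y' -> p * x + q * y = p * x' + q * y'.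
Proof. by move=> -> ->. Qed.

Lemma dzF_op s r A F j z w : bounded_op s r A -> smooth_family s F -> 0 <= s -> enorm w < r ->
  dzF j (fun z => A (F z)) z w = A (dzF j F z) w.
Proof.
move=> bA H s0 wr; have r0 : 0 <= r by exact: le_trans (enorm_ge0 w) (ltW wr).
have H1 := smooth_family_bg (smooth_family_der (ej R j) s0 H).1 z; have H2 := smooth_family_bg (smooth_family_der (ie j) s0 H).1 z.
have Bw : eball 0 r w by apply/(eball0E _ r0).
have E : dzF j F z = (fun w => 2^-1 * (family_deriv (ej R j) F z w : R[i]) + (- (2^-1 * (0 +i* 1))) * (family_deriv (ie j) F z w : R[i])).
  by apply/funext => u; rewrite /dzF /dz /family_deriv -/(ie j) mulrBr mulNr mulrA.
rewrite E (bA.2 _ _ _ _ H1 H2 w Bw).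
apply: etrans (lin2 _ _ (family_deriv_op (ej R j) z bA H s0 wr) (family_deriv_op (ie j) z bA H s0 wr)).
by rewrite /dzF /dz /family_deriv -/(ie j) mulrBr mulNr mulrA.
Qed.

Lemma dzbarF_op s r A F j z w : bounded_op s r A -> smooth_family s F -> 0 <= s -> enorm w < r ->
  dzbarF j (fun z => A (F z)) z w = A (dzbarF j F z) w.
Proof.
move=> bA H s0 wr; have r0 : 0 <= r by exact: le_trans (enorm_ge0 w) (ltW wr).
have H1 := smooth_family_bg (smooth_family_der (ej R j) s0 H).1 z; have H2 := smooth_family_bg (smooth_family_der (ie j) s0 H).1 z.
have Bw : eball 0 r w by apply/(eball0E _ r0).
have E : dzbarF j F z = (fun w => 2^-1 * (family_deriv (ej R j) F z w : R[i]) + (2^-1 * (0 +i* 1)) * (family_deriv (ie j) F z w : R[i])).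
  by apply/funext => u; rewrite /dzbarF /dzbar /family_deriv -/(ie j) mulrDr mulrA.
rewrite E (bA.2 _ _ _ _ H1 H2 w Bw).
apply: etrans (lin2 _ _ (family_deriv_op (ej R j) z bA H s0 wr) (family_deriv_op (ie j) z bA H s0 wr)).
by rewrite /dzbarF /dzbar /family_deriv -/(ie j) mulrDr mulrA.
Qed.

Lemma family_deriv_lin r F G (a b : R[i]) v z w : smooth_family r F -> smooth_family r G -> enorm w < r ->
  family_deriv v (fun z w => a * (F z w : R[i]) + b * (G z w : R[i])) z w = a * (family_deriv v F z w : R[i]) + b * (family_deriv v G z w : R[i]).
Proof.
by move=> HF HG wr; apply: real_deriv0_real_derive; exact: (real_deriv0D (real_deriv0Z a (smooth_family_real_deriv0 v z HF wr)) (real_deriv0Z b (smooth_family_real_deriv0 v z HG wr))).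
Qed.

(** Both orders are the same combination of four second derivatives along real
    directions. *)
Lemma dz_dzbar_comm r F j k z w : smooth_family r F -> enorm w < r ->
  dzF j (dzbarF k F) z w = dzbarF k (dzF j F) z w.
Proof.
move=> H wr; have r0 : 0 <= r by exact: le_trans (enorm_ge0 w) (ltW wr).
have Hd v := (smooth_family_der v r0 H).1.
have E1 : dzbarF k F = (fun z w => 2^-1 * (family_deriv (ej R k) F z w : R[i]) + (2^-1 * (0 +i* 1)) * (family_deriv (ie k) F z w : R[i])).
  by apply/funext => z'; apply/funext => u; rewrite /dzbarF /dzbar /family_deriv -/(ie k) mulrDr mulrA.
have E2 : dzF j F = (fun z w => 2^-1 * (family_deriv (ej R j) F z w : R[i]) + (- (2^-1 * (0 +i* 1))) * (family_deriv (ie j) F z w : R[i])).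
  by apply/funext => z'; apply/funext => u; rewrite /dzF /dz /family_deriv -/(ie j) mulrBr mulNr mulrA.
have E3 G : dzF j G z w = 2^-1 * (family_deriv (ej R j) G z w : R[i]) + (- (2^-1 * (0 +i* 1))) * (family_deriv (ie j) G z w : R[i]).
  by rewrite /dzF /dz /family_deriv -/(ie j) mulrBr mulNr mulrA.
have E4 G : dzbarF k G z w = 2^-1 * (family_deriv (ej R k) G z w : R[i]) + (2^-1 * (0 +i* 1)) * (family_deriv (ie k) G z w : R[i]).
  by rewrite /dzbarF /dzbar /family_deriv -/(ie k) mulrDr mulrA.
have D1 v : family_deriv v (dzbarF k F) z w = 2^-1 * (family_deriv v (family_deriv (ej R k) F) z w : R[i]) + (2^-1 * (0 +i* 1)) * (family_deriv v (family_deriv (ie k) F) z w : R[i]).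
  rewrite E1; exact: (family_deriv_lin _ _ v z (Hd _) (Hd _) wr).
have D2 v : family_deriv v (dzF j F) z w = 2^-1 * (family_deriv v (family_deriv (ej R j) F) z w : R[i]) + (- (2^-1 * (0 +i* 1))) * (family_deriv v (family_deriv (ie j) F) z w : R[i]).
  rewrite E2; exact: (family_deriv_lin _ _ v z (Hd _) (Hd _) wr).
have C a b : family_deriv a (family_deriv b F) z w = family_deriv b (family_deriv a F) z w by exact: family_deriv_comm wr.
apply: etrans (E3 _) _; apply: etrans (lin2 _ _ (D1 _) (D1 _)) _.
apply: esym; apply: etrans (E4 _) _; apply: etrans (lin2 _ _ (D2 _) (D2 _)) _.
have K (p q x y x' y' X Y X' Y' : R[i]) : X = x -> Y = x' -> X' = y -> Y' = y' ->
    p * (p * X + - q * Y) + q * (p * X' + - q * Y') = p * (p * x + q * y) + - q * (p * x' + q * y').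
  by move=> -> -> -> ->; ring.
exact: (K _ _ _ _ _ _ _ _ _ _ (C _ _) (C _ _) (C _ _) (C _ _)).
Qed.

End smooth_families.

(** * Sections over centred balls *)

Section sections.
Context (R : realType) (n : nat).
Local Notation Cn := (Cn R n).
Local Notation muC := (lebesgueC R n).
Local Notation bg r := (bergman (0 : Cn) r).
Implicit Types (s t : familyCn R n) (f g : Cn -> R[i]^o) (u v w z c : Cn).

(** Translating the fibre over z, a ball around conj z, to the origin turns
    sections of the bundle into families on one fixed ball. *)
Definition centred s : familyCn R n := fun z u => s z (u + conjv z).

Lemma conjv_add (z v : Cn) (x : R) : conjv (z + (x%:C : R[i]^o) *: v) = conjv z + (x%:C : R[i]^o) *: conjv v.
Proof.
apply/rowP => j; rewrite !mxE; case: (z 0 j) => a b; case: (v 0 j) => a' b'.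
by apply: eqReIm => /=; ring.
Qed.

(** The trivialization uses the unit ball and a dilation; dilations are bounded
    operators. *)
Lemma smooth_section_smooth_family r s : 0 < r -> smooth_section r s <-> smooth_family r (centred s).
Proof.
move=> r0; have r0' := ltW r0; have rC : r%:C != 0 :> R[i] by rewrite -cmod_eq0 cmod_real normr_eq0 gt_eqF.
split=> H k.
  have Hk : norm_class 1 k (trivialization r s) by apply/class_C_norm_class; exact: H.
  have ri : 0 < r^-1 by rewrite invr_gt0.
  have := norm_class_op (bounded_op_scale n ri ler01) Hk; rewrite div1r invrK.
  apply: norm_class_eq => z w _; rewrite /trivialization /centred scalerA; congr (s z (_ + _)).
  have -> : (r%:C * (r^-1)%:C : R[i]) = 1 by rewrite -rmorphM mulfV ?gt_eqF.
  by rewrite scale1r.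
apply/class_C_norm_class; have := norm_class_op (bounded_op_scale n r0 r0') (H k); rewrite divff ?gt_eqF//.
Qed.

Lemma extendable_bergman_ext eps s : 0 < eps -> extendable_section eps s -> exists2 r, eps < r & smooth_family r (centred s).
Proof.
move=> e0 [r er H]; exists r => //; apply/smooth_section_smooth_family => //; exact: lt_trans er.
Qed.

Lemma smooth_family_extendable eps r s : 0 < eps -> eps < r -> smooth_family r (centred s) -> extendable_section eps s.
Proof. by move=> e0 er H; exists r => //; apply/smooth_section_smooth_family => //; exact: lt_trans er. Qed.

Lemma conjv_ej j : conjv (ej R j : Cn) = ej R j.
Proof.
apply/rowP => k; rewrite !mxE; case: (_ && _); apply: eqReIm => /=; by rewrite ?oppr0.
Qed.

Lemma conjv_iej j : conjv (((0 +i* 1 : R[i]) : R[i]^o) *: ej R j : Cn) = ((- (0 +i* 1) : R[i]) : R[i]^o) *: ej R j.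
Proof.
by apply/rowP => k; rewrite !mxE; case: (_ && _); apply: eqReIm => /=; ring.
Qed.

(** Differentiating in z with w fixed moves the point of the translated ball
    against conj z, hence the extra term. *)
Lemma centred_nabla01 r s k z u : smooth_family r (centred s) -> enorm u < r ->
  centred (nabla01 k s) z u = dzbarF k (centred s) z u - pd k (centred s z) u.
Proof.
move=> H ur; have r0 : 0 <= r by exact: le_trans (enorm_ge0 u) (ltW ur).
have D v : real_derive v (fun z' => s z' (u + conjv z)) z =
    family_deriv v (centred s) z u - lform (fun j => pd j (centred s z) u) (conjv v).
  apply: real_deriv0_real_derive; apply: real_deriv0_ext (real_deriv0_moving v (conjv v) z H ur).
  exists 1 => // x _; rewrite /centred conjv_add; congr (s _ _).
  by rewrite [conjv z + _]addrC addrA subrK.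
rewrite /centred /nabla01 /dzbar !D conjv_ej conjv_iej.
have E1 : lform (fun j => pd j (centred s z) u) (ej R k) = pd k (centred s z) u.
  by have := lform_ej (fun j => pd j (centred s z) u) 1 k; rewrite scale1r mul1r.
rewrite (lform_ej (fun j => pd j (centred s z) u) (- (0 +i* 1)) k) E1.
rewrite /dzbarF /dzbar -/(family_deriv (ej R k) (centred s) z u) -/(family_deriv _ (centred s) z u).
have K (i x y p : R[i]) : i * i = -1 -> 2^-1 * (x - p + i * (y - - i * p)) = 2^-1 * (x + i * y) - p.
  move=> ii; have -> : x - p + i * (y - - i * p) = x + i * y - p + (i * i) * p by ring.
  by rewrite ii; field.
by apply: K; apply: eqReIm => /=; ring.
Qed.

Lemma smooth_family_nabla01 r q s k : 0 <= q -> q < r -> smooth_family r (centred s) -> smooth_family q (centred (nabla01 k s)).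
Proof.
move=> q0 qr H; have r0 : 0 <= r by exact: le_trans (ltW qr).
have H1 := smooth_family_sub q0 (ltW qr) (smooth_family_dzbarF k r0 H).
have H2 := smooth_family_op (bounded_op_pd k q0 qr) H.
apply: smooth_family_eq (smooth_familyD H1 (smooth_familyZ (-1) q0 H2)) => z u /(eball0E _ q0) uq.
by rewrite (centred_nabla01 k z H (lt_trans uq qr)) mulN1r.
Qed.

(** The explicit (1,0)-part of the Chern connection. *)
Definition chern10 eps (j : 'I_n) s : familyCn R n := fun z w =>
  dzF j (centred s) z (w - conjv z) + pd_adj eps j (centred s z) (w - conjv z).

Lemma centred_chern10 eps j s z u : centred (chern10 eps j s) z u = dzF j (centred s) z u + pd_adj eps j (centred s z) u.
Proof. by rewrite /centred /chern10 addrK. Qed.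

Lemma smooth_family_chern10 eps r q j s : 0 < q -> q < r -> smooth_family r (centred s) -> smooth_family q (centred (chern10 eps j s)).
Proof.
move=> q0 qr H; have r0 : 0 <= r by exact: le_trans (ltW q0) (ltW qr).
have H1 := smooth_family_sub (ltW q0) (ltW qr) (smooth_family_dzF j r0 H).
have H2 := smooth_family_op (bounded_op_pd_adj eps j q0 qr) H.
by apply: smooth_family_eq (smooth_familyD H1 H2) => z u _; rewrite centred_chern10.
Qed.

Lemma between (a b : R) : a < b -> exists2 c, a < c & c < b.
Proof. by move=> ab; exists ((a + b) / 2); lra. Qed.

Lemma extendable_nabla01 eps k s : 0 < eps -> extendable_section eps s -> extendable_section eps (nabla01 k s).
Proof.
move=> e0 /(extendable_bergman_ext e0)[r er H]; have [q eq qr] := between er.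
apply: (smooth_family_extendable e0 eq); apply: smooth_family_nabla01 qr H; exact: le_trans (ltW e0) (ltW eq).
Qed.

Lemma extendable_chern10 eps j s : 0 < eps -> extendable_section eps s -> extendable_section eps (chern10 eps j s).
Proof.
move=> e0 /(extendable_bergman_ext e0)[r er H]; have [q eq qr] := between er.
apply: (smooth_family_extendable e0 eq); apply: smooth_family_chern10 qr H; exact: lt_trans eq.
Qed.

Lemma smooth_family_bergman_ext eps r s z : 0 <= eps -> eps < r -> smooth_family r (centred s) -> bergman_ext eps (centred s z).
Proof. by move=> e0 er H; exists r => //; exact: smooth_family_bg. Qed.

Lemma extendable_lin eps s t (a b : R[i]) : 0 < eps -> extendable_section eps s -> extendable_section eps t ->
  extendable_section eps (fun z w => a * (s z w : R[i]) + b * (t z w : R[i])).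
Proof.
move=> e0 /(extendable_bergman_ext e0)[r er H] /(extendable_bergman_ext e0)[r' er' H'].
pose q := Num.min r r'; have eq : eps < q by rewrite lt_min er.
have q0 : 0 <= q by exact: le_trans (ltW e0) (ltW eq).
have qr : q <= r by rewrite ge_min lexx.
have qr' : q <= r' by rewrite ge_min lexx orbT.
apply: (smooth_family_extendable e0 eq).
by apply: smooth_family_eq (smooth_familyD (smooth_familyZ a q0 (smooth_family_sub q0 qr H)) (smooth_familyZ b q0 (smooth_family_sub q0 qr' H'))) => z u _.
Qed.

Lemma bergman_shift c r f : bg r (fun u => f (u + c)) -> bergman c r f.
Proof.
move=> [df foo].
have df' w : eball c r w -> differentiable f w.
  move=> cw; have B0 : eball 0 r (w - c).
    move: cw; rewrite /eball/=; under eq_bigr do rewrite -[w 0 _ - c 0 _]subr0.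
    by move=> h; under eq_bigr do rewrite !mxE.
  have := @differentiable_shift R n (fun u => f (u + c)) (- c) w (df _ B0).
  by have -> : (fun u => f (u - c + c)) = f by apply/funext => u; rewrite subrK.
by split => //; rewrite nsq_shift// => w; exact: eball_ccont.
Qed.

Lemma ip_shift c r f g : bg r (fun u => f (u + c)) -> bg r (fun u => g (u + c)) ->
  ip c r f g = ip 0 r (fun u => f (u + c)) (fun u => g (u + c)).
Proof.
move=> /bergman_shift bf /bergman_shift bg'.
have [_] := @cint_ball_affine R n 1 c c r (fun w => (f w : R[i]) * (g w : R[i])^*) (oner_neq0 _) (cintegrable_ip bf bg').
rewrite /ip => ->; rewrite subrr scaler0 cmod1 divr1 -sqr_cmod cmod1 !expr1n mul1r.
by apply: eq_cint => p _; rewrite scale1r.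
Qed.

Lemma inner_centred eps s t z : bg eps (centred s z) -> bg eps (centred t z) ->
  inner eps z (s z) (t z) = ip 0 eps (centred s z) (centred t z).
Proof. by move=> bs bt; rewrite -(ip_shift bs bt). Qed.

(** The increment of the square norm splits into three products with a small
    factor, each bounded by the Cauchy-Schwarz inequality. *)
Lemma real_deriv0_ip r (F : familyCn R n) g v z : (forall z, bg r (F z)) -> bg r g -> norm_deriv r v F g z ->
  real_deriv0 (fun x => ip 0 r (F (z + (x%:C : R[i]^o) *: v)) (F (z + (x%:C : R[i]^o) *: v)))
      (ip 0 r g (F z) + ip 0 r (F z) g).
Proof.
move=> bF bg' H e e0.
set a := nrm 0 r (F z); set b := nrm 0 r g.
have a0 : 0 <= a by exact: nrm_ge0. have b0 : 0 <= b by exact: nrm_ge0.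
have B0 : 0 < 2 * a + 2 * b + 1 + b * (b + 1) + 1 by have := mulr_ge0 b0 b0; nra.
set B := _ + 1 in B0.
pose e1 := Num.min 1 (e / B).
have e10 : 0 < e1 by rewrite lt_min ltr01 divr_gt0.
have e11 : e1 <= 1 by rewrite ge_min lexx.
have eB : e1 * B <= e by rewrite -ler_pdivlMr// ge_min lexx orbT.
clearbody e1; have [d d0 hd] := H _ e10.
exists (Num.min d e1) => [|x]; first by rewrite lt_min d0.
rewrite lt_min => /andP[xd xe]; rewrite !scale0r addr0.
have [->|x0] := eqVneq x 0.
  by rewrite scale0r addr0 subrr sub0r rmorph0 mul0r oppr0 cmod0 normr0 mulr0.
have xC : x%:C != 0 :> R[i] by rewrite -cmod_eq0 cmod_real normr_eq0.
set P := F (z + (x%:C : R[i]^o) *: v).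
pose q : Cn -> R[i]^o := fun w => (x%:C)^-1 * (P w - F z w) - g w.
have bq : bg r q := bergman_quot _ (bF _) (bF z) bg'.
have nq : nrm 0 r q <= e1 by apply: ltW; exact: hd.
pose D : Cn -> R[i]^o := fun w => P w - F z w.
have bD : bg r D := bergmanB (bF _) (bF z).
have bP : bg r P := bF _.
have DE w : D w = x%:C * (q w + g w).
  by rewrite /q /D subrK mulVKf.
have bqg := bergmanD bq bg'.
have nD : nrm 0 r D <= `|x| * (b + 1).
  rewrite (eq_nrm (fun w _ => DE w)) nrmZ// cmod_real ler_wpM2l//.
  by apply: le_trans (nrmD bq bg') _; rewrite addrC lerD2l; exact: le_trans nq e11.
have E1 : ip 0 r P P - ip 0 r (F z) (F z) - x%:C * (ip 0 r g (F z) + ip 0 r (F z) g) =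
   x%:C * (ip 0 r q P + ip 0 r g D + ip 0 r (F z) q).
  have -> : ip 0 r P P = ip 0 r D P + ip 0 r (F z) P.
    by rewrite -ipDl//; apply: eq_ip => // w _; rewrite /D subrK.
  have -> : ip 0 r (F z) P = ip 0 r (F z) D + ip 0 r (F z) (F z).
    by rewrite -ipDr//; apply: eq_ip => // w _; rewrite /D subrK.
  have -> : ip 0 r D P = x%:C * (ip 0 r q P + ip 0 r g P).
    by rewrite -ipDl// -ipZl//; apply: eq_ip => // w _; exact: DE.
  have -> : ip 0 r (F z) D = x%:C * (ip 0 r (F z) q + ip 0 r (F z) g).
    have cx : conjc (x%:C : R[i]) = x%:C by apply: eqReIm => //=; rewrite oppr0.
    rewrite -ipDr//.
    apply: etrans (etrans (ipZr x%:C (bF z) bqg) (congr1 (fun c : R[i] => c * ip 0 r (F z) (fun w => q w + g w)) cx)).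
    by apply: eq_ip => // w _; exact: DE.
  have -> : ip 0 r g P = ip 0 r g D + ip 0 r g (F z).
    by rewrite -ipDr//; apply: eq_ip => // w _; rewrite /D subrK.
  ring.
rewrite E1 cmodM cmod_real mulrC ler_wpM2r//.
apply: le_trans eB.
apply: le_trans (cmodD _ _) _; apply: le_trans (lerD (cmodD _ _) (lexx _)) _.
have nP : nrm 0 r P <= a + (b + 1).
  have -> : nrm 0 r P = nrm 0 r (fun w => F z w + D w) by apply: eq_nrm => w _; rewrite /D addrC subrK.
  apply: le_trans (nrmD (bF z) bD) _; rewrite lerD2l; apply: le_trans nD _.
  by rewrite ler_piMl ?addr_ge0// (le_trans (ltW xe)).
have c1 : cmod (ip 0 r q P) <= e1 * (a + (b + 1)).
  apply: le_trans (cauchy_schwarz bq bP) _; apply: ler_pM => //; exact: nrm_ge0.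
have c2 : cmod (ip 0 r g D) <= b * (e1 * (b + 1)).
  apply: le_trans (cauchy_schwarz bg' bD) _; apply: ler_pM => //; first exact: nrm_ge0.
  by apply: le_trans nD _; rewrite ler_wpM2r ?addr_ge0// ltW.
have c3 : cmod (ip 0 r (F z) q) <= a * e1.
  apply: le_trans (cauchy_schwarz (bF z) bq) _; apply: ler_pM => //; exact: nrm_ge0.
apply: le_trans (lerD (lerD c1 c2) c3) _; rewrite /B.
have := mulr_ge0 (ltW e10) b0; nra.
Qed.

End sections.

(** * The Chern connection *)

Section chern_connection.
Context (R : realType) (n : nat).
Local Notation Cn := (Cn R n).
Local Notation bg r := (bergman (0 : Cn) r).
Variable eps : R.
Hypothesis eps0 : 0 < eps.
Implicit Types (s t : familyCn R n) (f g : Cn -> R[i]^o) (u v w z : Cn).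

Let e0 : 0 <= eps := ltW eps0.

Lemma fiberP z w : fiber eps z w -> enorm (w - conjv z) < eps.
Proof. by move/(eballE _ _ e0). Qed.

Let lin2 (p q x y x' y' : R[i]) : x = x' -> y = y' -> p * x + q * y = p * x' + q * y'.
Proof. by move=> -> ->. Qed.

Lemma dzF_lin r (F G : familyCn R n) (a b : R[i]) j z u : smooth_family r F -> smooth_family r G -> enorm u < r ->
  dzF j (fun z w => a * (F z w : R[i]) + b * (G z w : R[i])) z u = a * (dzF j F z u : R[i]) + b * (dzF j G z u : R[i]).
Proof.
move=> HF HG ur.
have D v := family_deriv_lin a b v z HF HG ur.
rewrite /dzF /dz -!/(family_deriv _ _ z u).
have K (h i x y x' y' X Y : R[i]) : X = a * x + b * x' -> Y = a * y + b * y' ->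
   h * (X - i * Y) = a * (h * (x - i * y)) + b * (h * (x' - i * y')) by move=> -> ->; ring.
exact: (K _ _ _ _ _ _ _ _ (D _) (D _)).
Qed.

Lemma dzbarF_lin r (F G : familyCn R n) (a b : R[i]) j z u : smooth_family r F -> smooth_family r G -> enorm u < r ->
  dzbarF j (fun z w => a * (F z w : R[i]) + b * (G z w : R[i])) z u = a * (dzbarF j F z u : R[i]) + b * (dzbarF j G z u : R[i]).
Proof.
move=> HF HG ur.
have D v := family_deriv_lin a b v z HF HG ur.
rewrite /dzbarF /dzbar -!/(family_deriv _ _ z u).
have K (h i x y x' y' X Y : R[i]) : X = a * x + b * x' -> Y = a * y + b * y' ->
   h * (X + i * Y) = a * (h * (x + i * y)) + b * (h * (x' + i * y')) by move=> -> ->; ring.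
exact: (K _ _ _ _ _ _ _ _ (D _) (D _)).
Qed.

Lemma pd_adj_lin r f g (a b : R[i]) j u : eps < r -> bg r f -> bg r g -> enorm u < eps ->
  pd_adj eps j (fun w => a * (f w : R[i]) + b * (g w : R[i])) u = a * (pd_adj eps j f u : R[i]) + b * (pd_adj eps j g u : R[i]).
Proof.
by move=> er bf bg' ue; apply: (bounded_op_pd_adj eps j eps0 er).2 => //; apply/(eball0E _ e0).
Qed.

Lemma chern10_lin j s t (a b : R[i]) z w : extendable_section eps s -> extendable_section eps t -> fiber eps z w ->
  chern10 eps j (fun z' w' => a * (s z' w' : R[i]) + b * (t z' w' : R[i])) z w =
  a * (chern10 eps j s z w : R[i]) + b * (chern10 eps j t z w : R[i]).
Proof.
move=> /(extendable_bergman_ext eps0)[r1 er1 H1] /(extendable_bergman_ext eps0)[r2 er2 H2] /fiberP ue.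
pose r := Num.min r1 r2; have er : eps < r by rewrite lt_min er1.
have r0 : 0 <= r := le_trans e0 (ltW er).
have HF : smooth_family r (centred s) by apply: smooth_family_sub H1 => //; rewrite ge_min lexx.
have HG : smooth_family r (centred t) by apply: smooth_family_sub H2 => //; rewrite ge_min lexx orbT.
have K (x y x' y' X Y : R[i]) : X = a * x + b * x' -> Y = a * y + b * y' ->
  X + Y = a * (x + y) + b * (x' + y') by move=> -> ->; ring.
apply: (K _ _ _ _ _ _ (dzF_lin a b j z HF HG (lt_trans ue er))).
exact: (pd_adj_lin a b j er (smooth_family_bg HF z) (smooth_family_bg HG z) ue).
Qed.

(** The scalar case of a norm derivative. *)
Lemma smooth_fun_real_deriv0 (phi : Cn -> R[i]) v z : smooth_fun phi ->
  real_deriv0 (fun x => phi (z + (x%:C : R[i]^o) *: v)) (real_derive v phi z).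
Proof.
move=> /(_ 1%N)[_ _ /(_ v)[G H _]].
suff D : real_deriv0 (fun x => phi (z + (x%:C : R[i]^o) *: v)) (G z) by rewrite (real_deriv0_real_derive D).
move: (H z) => {}H.
have s0 (x : R) : (0 <= (sqmod ((x%:C)^-1 *: (phi (z + (x%:C : R[i]^o) *: v) - phi z) - G z))%:E)%E.
  by rewrite lee_fin sqmod_ge0.
move/(cvge0P s0) : H => H e ep.
have := H _ (exprn_gt0 2 ep); rewrite near_withinE => /nbhs_ballP[d /= d0 hd].
exists d => // t td; rewrite scale0r addr0.
have [->|t0] := eqVneq t 0.
  by rewrite scale0r addr0 subrr sub0r rmorph0 mul0r oppr0 cmod0 normr0 mulr0.
have tC : t%:C != 0 :> R[i] by rewrite -cmod_eq0 cmod_real normr_eq0.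
have := hd t; rewrite /ball/= sub0r normrN lte_fin => /(_ td t0).
set q := _ - G z => hq.
have -> : phi (z + (t%:C : R[i]^o) *: v) - phi z - t%:C * G z = t%:C * (q : R[i]).
  by rewrite /q /GRing.scale/= mulrBr mulVKf.
rewrite cmodM cmod_real mulrC ler_wpM2r// -(@ler_pXn2r _ 2)// ?nnegrE ?cmod_ge0 ?(ltW ep)//.
by rewrite sqr_cmod ltW.
Qed.

Let cvge_zero (T : Type) (F : set_system T) (FF : Filter F) (f : T -> \bar R) :
  (forall x, f x = 0%E) -> f @ F --> (0 : \bar R)%E.
Proof.
move=> f0; apply/cvge0P => [x|e ep]; first by rewrite f0.
by apply: filterE => x; rewrite f0 lte_fin.
Qed.

Lemma smooth_fun_cst (c : R[i]) : smooth_fun (fun _ : Cn => c).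
Proof.
have H0 (z : Cn) : (sqmod ((c : R[i]^o) - c))%:E @[z' --> z] --> (0 : \bar R)%E.
  by apply: (@cvge_zero _ (nbhs z) _) => z'; rewrite subrr sqmod0.
suff H k : class_C setT (fun x : R[i]^o => (sqmod x)%:E) k (fun _ : Cn => (c : R[i]^o)) by [].
elim: k c H0 => [|k IH] c' H0; first by split.
split=> // v; exists (fun _ => 0); last first.
  by apply: IH => z; apply: (@cvge_zero _ (nbhs z) _) => z'; rewrite subrr sqmod0.
move=> z; apply: (@cvge_zero _ ((0 : R)^') _) => x.
by rewrite subrr scaler0 subr0 sqmod0.
Qed.

Lemma dz_cst (c : R[i]) j z : dz j (fun _ : Cn => c) z = 0.
Proof.
have D v : real_derive v (fun _ : Cn => c) z = 0.
  by apply: real_deriv0_real_derive; exact: real_deriv0_cst.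
by rewrite /dz !D mulr0 subr0 mulr0.
Qed.

(** Additivity and the Leibniz rule hold for both terms, [pd_adj] being linear
    over functions of z; the metric identity is the duality of [pd] and
    [pd_adj]. *)
Lemma chern10_is_nabla10 : is_nabla10 eps (@chern10 R n eps).
Proof.
split.
- by move=> j s; exact: extendable_chern10.
- move=> j s t bs bt z w fw; have := chern10_lin j 1 1 bs bt fw.
  rewrite !mul1r => <-; congr (chern10 eps j _ z w).
  by apply/funext => z'; apply/funext => w'; rewrite !mul1r.
- move=> j phi s sphi /(extendable_bergman_ext eps0)[r er H] z w /fiberP ue.
  set u := w - conjv z in ue.
  have D v : real_derive v (fun z' => phi z' * (centred s z' u : R[i])) z =
      real_derive v phi z * (centred s z u : R[i]) + phi z * (family_deriv v (centred s) z u : R[i]).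
    apply: real_deriv0_real_derive.
    have := real_deriv0M (smooth_fun_real_deriv0 v z sphi) (smooth_family_real_deriv0 v z H (lt_trans ue er)).
    by rewrite scale0r addr0.
  have A : pd_adj eps j (fun u => phi z * (centred s z u : R[i])) u = phi z * (pd_adj eps j (centred s z) u : R[i]).
    have := pd_adj_lin (phi z) 0 j er (smooth_family_bg H z) (smooth_family_bg H z) ue.
    rewrite mul0r addr0 => <-; congr (pd_adj eps j _ u).
    by apply/funext => u'; rewrite mul0r addr0.
  have W : s z w = centred s z u by rewrite /centred /u subrK.
  rewrite /chern10 -/u W.
  have -> : dzF j (centred (fun z' w' => phi z' * (s z' w' : R[i]))) z u =
      dz j phi z * (centred s z u : R[i]) + phi z * (dzF j (centred s) z u : R[i]).
    rewrite /dzF /dz.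
    have K (h i x y x' y' X Y c d : R[i]) : X = x * c + d * x' -> Y = y * c + d * y' ->
      h * (X - i * Y) = h * (x - i * y) * c + d * (h * (x' - i * y')) by move=> -> ->; ring.
    exact: (K _ _ _ _ _ _ _ _ _ _ (D _) (D _)).
  by rewrite [X in _ + X]A mulrDr addrA.
- move=> j s /(extendable_bergman_ext eps0)[r er H] z.
  have He := smooth_family_sub e0 (ltW er) H.
  have bs z' : bg eps (centred s z') := smooth_family_bg He z'.
  have -> : (fun z' => inner eps z' (s z') (s z')) = (fun z' => ip 0 eps (centred s z') (centred s z')).
    by apply/funext => z'; exact: inner_centred.
  have G v := (smooth_family_der v e0 He).1; have bG v : bg eps (family_deriv v (centred s) z) := smooth_family_bg (G v) z.
  have D v : real_derive v (fun z' => ip 0 eps (centred s z') (centred s z')) z =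
      ip 0 eps (family_deriv v (centred s) z) (centred s z) + ip 0 eps (centred s z) (family_deriv v (centred s) z).
    apply: real_deriv0_real_derive; apply: real_deriv0_ip => //; exact: (smooth_family_der v e0 He).2.
  have bx : bergman_ext eps (centred s z) by exact: smooth_family_bergman_ext er H.
  have b1 : bg eps (dzF j (centred s) z) := smooth_family_bg (smooth_family_dzF j e0 He) z.
  have b2 : bg eps (pd_adj eps j (centred s z)) := bergman_ext_bergman e0 (bergman_ext_pd_adj eps0 j bx).
  have b3 : bg eps (dzbarF j (centred s) z) := smooth_family_bg (smooth_family_dzbarF j e0 He) z.
  have b4 : bg eps (fun w => pd j (centred s z) w) := bergman_ext_bergman e0 (bergman_ext_pd j e0 bx).
  have T1 : ip 0 eps (centred (chern10 eps j s) z) (centred s z) =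
      ip 0 eps (dzF j (centred s) z) (centred s z) + ip 0 eps (pd_adj eps j (centred s z)) (centred s z).
    rewrite -(ipDl b1 b2 (bs z)).
    by apply: eq_ip => [w _|w _]; [exact: (centred_chern10 eps j s z w)|].
  have T2 : ip 0 eps (centred s z) (centred (nabla01 j s) z) =
      ip 0 eps (centred s z) (dzbarF j (centred s) z) - ip 0 eps (centred s z) (fun w => pd j (centred s z) w).
    rewrite -(ipBr (bs z) b3 b4).
    apply: eq_ip => [//|w /(eball0E _ e0) we].
    exact: (centred_nabla01 j z H (lt_trans we er)).
  have bc : bg eps (centred (chern10 eps j s) z).
    by apply: eq_bergman (bergmanD b1 b2) => w _; exact: (esym (centred_chern10 eps j s z w)).
  have bn : bg eps (centred (nabla01 j s) z).
    apply: eq_bergman (bergmanB b3 b4) => w /(eball0E _ e0) we.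
    exact: (esym (centred_nabla01 j z H (lt_trans we er))).
  rewrite (inner_centred bc (bs z)) (inner_centred (bs z) bn).
  rewrite T1 T2 (ip_pd_adj eps0 j bx bx) /dz !D.
  set ie := _ *: ej R j.
  have E1 : ip 0 eps (dzF j (centred s) z) (centred s z) =
      2^-1 * ip 0 eps (family_deriv (ej R j) (centred s) z) (centred s z) + - (2^-1 * (0 +i* 1)) * ip 0 eps (family_deriv ie (centred s) z) (centred s z).
    rewrite -(ipZl _ (bG _) (bs z)) -(ipZl _ (bG _) (bs z)) -(ipDl (bergmanZ _ (bG _)) (bergmanZ _ (bG _)) (bs z)).
    apply: eq_ip => [w _|//]; rewrite /dzF /dz -!/(family_deriv _ _ z w).
    have K (h i x y : R[i]) : h * (x - i * y) = h * x + - (h * i) * y by ring.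
    exact: K.
  have E2 : ip 0 eps (centred s z) (dzbarF j (centred s) z) =
      conjc 2^-1 * ip 0 eps (centred s z) (family_deriv (ej R j) (centred s) z) + conjc (2^-1 * (0 +i* 1)) * ip 0 eps (centred s z) (family_deriv ie (centred s) z).
    set a := (2^-1 : R[i]); set b := a * _.
    apply: etrans (f_equal2 +%R (ipZr a (bs z) (bG (ej R j))) (ipZr b (bs z) (bG ie))).
    apply: etrans (ipDr (bs z) (bergmanZ a (bG _)) (bergmanZ b (bG _))).
    apply: eq_ip => [//|w _]; rewrite /dzbarF /dzbar -!/(family_deriv _ _ z w).
    have K (h i x y : R[i]) : h * (x + i * y) = h * x + (h * i) * y by ring.
    exact: K.
  rewrite E1 E2.
  have c2 : conjc (2^-1 : R[i]) = 2^-1.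
    have -> : (2^-1 : R[i]) = (2^-1 : R)%:C by rewrite fmorphV rmorph_nat.
    by apply: eqReIm => //=; rewrite oppr0.
  have c3 : conjc (2^-1 * (0 +i* 1) : R[i]) = - (2^-1 * (0 +i* 1)).
    have -> : (2^-1 : R[i]) = (2^-1 : R)%:C by rewrite fmorphV rmorph_nat.
    by apply: eqReIm => /=; ring.
  rewrite c2 c3.
  have K (h i a b c d q : R[i]) : h * (a + b - i * (c + d)) = h * a + - (h * i) * c + q + (h * b + - (h * i) * d - q) by ring.
  exact: K.
Qed.

End chern_connection.

(** * Uniqueness of the connection and the curvature operator *)

Section curvature.
Context (R : realType) (n : nat).
Local Notation Cn := (Cn R n).
Local Notation bg r := (bergman (0 : Cn) r).
Implicit Types (s t : familyCn R n) (f g : Cn -> R[i]^o) (u v w z : Cn).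

(** Evaluation bounds make the norm definite on functions on the ball. *)
Lemma nsq0_ball r f w : bg r f -> nsq 0 r f = 0 -> enorm w < r -> f w = 0.
Proof.
move=> bf f0 wr; have d0 : 0 < r - enorm w by rewrite subr_gt0.
have wd : enorm (w - 0) + (r - enorm w) <= r by rewrite subr0 addrC subrK.
have := sqmod_le_nsq d0 wd bf; rewrite f0.
have b0 := bvol_gt0 n d0.
by rewrite pmulr_lle0// => q0; apply/eqP; rewrite -sqmod_eq0 eq_le q0 sqmod_ge0.
Qed.

(** A bounded operator only sees f on the ball: the difference has norm 0, and so
    has its image, which is holomorphic. *)
Lemma bounded_op_ext (p r : R) A f g w : bounded_op p r A -> bg p f -> bg p g -> (forall u, eball 0 p u -> f u = g u) ->
  enorm w < r -> A f w = A g w.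
Proof.
move=> bA bf bg' E wr; have r0 : 0 <= r := le_trans (enorm_ge0 w) (ltW wr).
pose h : Cn -> R[i]^o := fun w => 1 * (f w : R[i]) + (-1) * (g w : R[i]).
have bh : bg p h := bergmanD (bergmanZ 1 bf) (bergmanZ (-1) bg').
have h0 : nrm 0 p h = 0.
  have E0 u : eball 0 p u -> h u = 0 * (f u : R[i]).
    by move=> su; rewrite /h (E u su) mul1r mulN1r mul0r subrr.
  by rewrite (eq_nrm E0) nrmZ// cmod0 mul0r.
case: (bA) => -[C _ HC] lin; have [bAh] := HC _ bh; rewrite h0 mulr0 => nA.
have n0 : nsq 0 r (A h) = 0.
  by rewrite -sqr_nrm; have -> : nrm 0 r (A h) = 0; [apply/eqP; rewrite eq_le nA nrm_ge0|rewrite expr0n].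
have := lin f g 1 (-1) bf bg' w ((eball0E w r0).2 wr).
rewrite -/h (nsq0_ball bAh n0 wr).
have K (x y : R[i]) : 0 = 1 * x + -1 * y -> x = y by rewrite mul1r mulN1r => /esym/subr0_eq.
exact: K.
Qed.

Variable eps : R.
Hypothesis eps0 : 0 < eps.
Let e0 : 0 <= eps := ltW eps0.

Lemma extendable_bg s z : extendable_section eps s -> bg eps (centred s z).
Proof. by move=> /(extendable_bergman_ext eps0)[r er H]; apply: bergman_ext_bergman => //; exact: smooth_family_bergman_ext er H. Qed.

(** If two operators satisfy the defining identities, their difference D is
    linear over the constants and D s is orthogonal to s; polarization makes
    D s orthogonal to every section, hence to itself. *)
Lemma nabla10_unique D1 D2 j s z w : is_nabla10 eps D1 -> is_nabla10 eps D2 ->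
  extendable_section eps s -> fiber eps z w -> D1 j s z w = D2 j s z w.
Proof.
move=> N1 N2 es.
pose D t : familyCn R n := fun z w => 1 * (D1 j t z w : R[i]) + (-1) * (D2 j t z w : R[i]).
have eD t : extendable_section eps t -> extendable_section eps (D t).
  by move=> et; apply: extendable_lin => //; [exact: nabla10_section N1 _ _ et|exact: nabla10_section N2 _ _ et].
have D0 t : extendable_section eps t -> ip 0 eps (centred (D t) z) (centred t z) = 0.
  move=> et; have b1 := extendable_bg z (nabla10_section N1 j et).
  have b2 := extendable_bg z (nabla10_section N2 j et); have bt := extendable_bg z et.
  have := nabla10_metric N2 j et z; rewrite (nabla10_metric N1 j et z) => /addIr.
  rewrite (inner_centred b1 bt) (inner_centred b2 bt) => E.
  have := ipDl (bergmanZ 1 b1) (bergmanZ (-1) b2) bt.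
  have K (x y p q X : R[i]) : p = 1 * x -> q = -1 * y -> x = y -> X = p + q -> X = 0.
    by move=> -> -> -> ->; ring.
  exact: (K _ _ _ _ _ (ipZl 1 b1 bt) (ipZl (-1) b2 bt) E).
have linD Di t t' (a : R[i]) z' w' : is_nabla10 eps Di -> extendable_section eps t -> extendable_section eps t' ->
    fiber eps z' w' -> Di j (fun z w => t z w + a * (t' z w : R[i])) z' w' = Di j t z' w' + a * (Di j t' z' w' : R[i]).
  move=> Ni et et' fw; have ea : extendable_section eps (fun z w => a * (t' z w : R[i])).
    have := extendable_lin a 0 eps0 et' et'.
    suff -> : (fun z w => a * (t' z w : R[i]) + 0 * (t' z w : R[i])) = (fun z w => a * (t' z w : R[i])) :> familyCn R n by [].
    by apply/funext => z1; apply/funext => w1; rewrite mul0r addr0.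
  have A := nabla10_additive Ni j et ea fw.
  have := nabla10_leibniz Ni j (smooth_fun_cst n a) et' fw; rewrite dz_cst => B.
  apply: etrans A _.
  have K (x y p q : R[i]) : y = 0 * p + q -> x + y = x + q by move=> ->; rewrite mul0r add0r.
  exact: K B.
have pol t (a : R[i]) : extendable_section eps t ->
    a^* * ip 0 eps (centred (D s) z) (centred t z) + a * ip 0 eps (centred (D t) z) (centred s z) = 0.
  move=> et; pose t' : familyCn R n := fun z w => s z w + a * (t z w : R[i]).
  have et' : extendable_section eps t'.
    have := extendable_lin 1 a eps0 es et.
    suff -> : (fun z w => 1 * (s z w : R[i]) + a * (t z w : R[i])) = t' by [].
    by apply/funext => z1; apply/funext => w1; rewrite mul1r.
  have bs := extendable_bg z es; have bt := extendable_bg z et.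
  have bDs := extendable_bg z (eD _ es); have bDt := extendable_bg z (eD _ et).
  have E : ip 0 eps (centred (D t') z) (centred t' z) =
      ip 0 eps (fun u => centred (D s) z u + a * (centred (D t) z u : R[i])) (fun u => centred s z u + a * (centred t z u : R[i])).
    apply: eq_ip => // u eu.
    have fu : fiber eps z (u + conjv z) by apply/(eballE _ _ e0); rewrite addrK; exact/(eball0E _ e0).
    have K (x y x' y' X Y : R[i]) : X = x + a * x' -> Y = y + a * y' ->
       1 * X + -1 * Y = 1 * x + -1 * y + a * (1 * x' + -1 * y') by move=> -> ->; ring.
    exact: (K _ _ _ _ _ _ (linD D1 s t a z _ N1 es et fu) (linD D2 s t a z _ N2 es et fu)).
  have := D0 t' et'; rewrite E.
  have bat := bergmanZ a bt; have baDt := bergmanZ a bDt.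
  have E1 := ipDl bDs baDt (bergmanD bs bat).
  have E2 := ipDr bDs bs bat; have E3 := ipDr baDt bs bat.
  have E4 := ipZr a bDs bt; have E5 := ipZl a bDt bs; have E6 := ipZl a bDt bat.
  have E7 := ipZr a bDt bt.
  have Z1 := D0 _ es; have Z2 := D0 _ et.
  move: E1 E2 E3 E4 E5 E6 E7 Z1 Z2.
  set I1 := ip _ _ _ _; set I2 := ip _ _ _ _; set I3 := ip _ _ _ _.
  set I4 := ip _ _ _ _; set I5 := ip _ _ _ _; set I6 := ip _ _ _ _; set I7 := ip _ _ _ _.
  set I8 := ip _ _ _ _; set I9 := ip _ _ _ _; set I10 := ip _ _ _ _; set I11 := ip _ _ _ _.
  move=> -> -> -> -> -> -> E7 Z1 Z2; rewrite Z1 E7 Z2 => E8; rewrite -E8; ring.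
move=> fw; have eDs := eD _ es; have bDs := extendable_bg z eDs.
have P1 := pol _ 1 eDs; have P2 := pol _ (0 +i* 1) eDs.
have Z : ip 0 eps (centred (D s) z) (centred (D s) z) = 0.
  move: P1 P2; set X := ip _ _ _ _; set Y := ip _ _ _ _ => P1 P2.
  have K (x y : R[i]) : 1^* * x + 1 * y = 0 -> (0 +i* 1)^* * x + (0 +i* 1) * y = 0 -> x = 0.
    case: x => a b; case: y => c d [] /=; rewrite !(mul0r, mulr0, mul1r, oppr0, subr0, addr0, add0r) => h1 h2 [].
    by rewrite !(mul0r, mulr0, mul1r, oppr0, subr0, addr0, add0r, sub0r, mulN1r, opprK) => h3 h4; apply: eqReIm => /=; lra.
  exact: K P1 P2.
have n0 : nsq 0 eps (centred (D s) z) = 0 by move: Z; rewrite ip_nsq => -[].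
have := nsq0_ball bDs n0 (fiberP eps0 fw).
rewrite /centred subrK.
have K (x y : R[i]) : 1 * x + -1 * y = 0 -> x = y by rewrite mul1r mulN1r => /subr0_eq.
exact: K.
Qed.

(** [xget] returns some operator with the defining properties, and on the fibres
    there is only one. *)
Lemma nabla10E j s z w : extendable_section eps s -> fiber eps z w ->
  nabla10 eps j s z w = chern10 eps j s z w.
Proof.
apply: nabla10_unique (chern10_is_nabla10 n eps0).
exact: (xgetPex _ (ex_intro _ _ (chern10_is_nabla10 n eps0))).
Qed.

(** [nabla01] differentiates in z at fixed w, so it only sees the germ in z. *)
Lemma nabla01_germ r s t k z u : smooth_family r (centred t) -> enorm u < r ->
  (forall v, exists2 d : R, 0 < d & forall x : R, `|x| < d ->
     t (z + (x%:C : R[i]^o) *: v) (u + conjv z) = s (z + (x%:C : R[i]^o) *: v) (u + conjv z)) ->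
  centred (nabla01 k s) z u = centred (nabla01 k t) z u.
Proof.
move=> H ur E.
suff D v : real_derive v (fun z' => s z' (u + conjv z)) z = real_derive v (fun z' => t z' (u + conjv z)) z.
  by rewrite /centred /nabla01 /dzbar !D.
have D : real_deriv0 (fun x : R => t (z + (x%:C : R[i]^o) *: v) (u + conjv z))
    (family_deriv v (centred t) z u - lform (fun j => pd j (centred t z) u) (conjv v)).
  apply: real_deriv0_ext (real_deriv0_moving v (conjv v) z H ur).
  exists 1 => // x _; rewrite /centred conjv_add; congr (t _ _).
  by rewrite [conjv z + _]addrC addrA subrK.
rewrite [RHS](@real_deriv0_real_derive R n v z (fun z' => t z' (u + conjv z)) _ D).
by apply: real_deriv0_real_derive; exact: real_deriv0_ext (E v) D.
Qed.

Lemma enorm_line u v : enorm u < eps -> exists2 d : R, 0 < d & forall x : R, `|x| < d ->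
  enorm (u - (x%:C : R[i]^o) *: v) < eps.
Proof.
move=> ue; have q0 : 0 < enorm v + 1 by rewrite ltr_wpDl ?enorm_ge0.
exists ((eps - enorm u) / (enorm v + 1)); first by rewrite divr_gt0// subr_gt0.
move=> x; rewrite ltr_pdivlMr// => hx; apply: le_lt_trans (enormB _ _) _.
rewrite enormZ cmod_real; have := normr_ge0 x; move: hx.
by have := enorm_ge0 v; nra.
Qed.

(** In the translated picture the connection is dz_j + A_j and dzbar_k - pd_k,
    where A_j, pd_k act in the fibre variable and commute with dz, dzbar: only
    the commutator of A_j and pd_k survives. *)
Lemma centred_curvature r s j k z u : eps < r -> smooth_family r (centred s) -> enorm u < eps ->
  centred (curvature eps j k s) z u =
  pd k (pd_adj eps j (centred s z)) u - pd_adj eps j (fun w => pd k (centred s z) w) u.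
Proof.
move=> er H ue; have r0 : 0 <= r := le_trans e0 (ltW er).
have [q eq qr] := between er; have q0 : 0 < q := lt_trans eps0 eq.
have q0' := ltW q0.
have es : extendable_section eps s := smooth_family_extendable eps0 er H.
have fu : fiber eps z (u + conjv z) by apply/(eballE _ _ e0); rewrite addrK.
have uq := lt_trans ue eq; have ur := lt_trans ue er.
have E1 : nabla10 eps j (nabla01 k s) z (u + conjv z) =
    dzF j (centred (nabla01 k s)) z u + pd_adj eps j (centred (nabla01 k s) z) u.
  apply: etrans (nabla10E j (extendable_nabla01 k eps0 es) fu) _.
  exact: (centred_chern10 eps j (nabla01 k s) z u).
have smP : smooth_family q (fun z => (fun w => pd k (centred s z) w)) := smooth_family_op (bounded_op_pd k q0' qr) H.
have smB : smooth_family q (dzbarF k (centred s)) := smooth_family_sub q0' (ltW qr) (smooth_family_dzbarF k r0 H).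
have E2 : dzF j (centred (nabla01 k s)) z u = dzF j (dzbarF k (centred s)) z u - pd k (dzF j (centred s) z) u.
  have V z' : centred (nabla01 k s) z' u = 1 * (dzbarF k (centred s) z' u : R[i]) + (-1) * (pd k (centred s z') u : R[i]).
    by rewrite (centred_nabla01 k z' H ur) mul1r mulN1r.
  have V' : dzF j (centred (nabla01 k s)) z u = dz j (fun z' => 1 * (dzbarF k (centred s) z' u : R[i]) + (-1) * (pd k (centred s z') u : R[i])) z.
    exact: (congr1 (fun g : Cn -> R[i] => dz j g z) (funext V)).
  have K (x y X y' : R[i]) : y = y' -> X = 1 * x + -1 * y -> X = x - y' by move=> -> ->; ring.
  apply: K (etrans V' (dzF_lin 1 (-1) j z smB smP uq)).
  exact: (dzF_op j z (bounded_op_pd k e0 er) H r0 ue).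
  have E3 : pd_adj eps j (centred (nabla01 k s) z) u = pd_adj eps j (dzbarF k (centred s) z) u - pd_adj eps j (fun w => pd k (centred s z) w) u.
  have K (x y X : R[i]) : X = 1 * x + -1 * y -> X = x - y by move=> ->; ring.
  have smN := smooth_family_nabla01 k q0' qr H.
  apply: K; apply: etrans (pd_adj_lin eps0 1 (-1) j eq (smooth_family_bg smB z) (smooth_family_bg smP z) ue).
  apply: (bounded_op_ext (bounded_op_pd_adj eps j eps0 eq) (smooth_family_bg smN z) _ _ ue).
    exact: bergmanD (bergmanZ _ (smooth_family_bg smB z)) (bergmanZ _ (smooth_family_bg smP z)).
  move=> w /(eball0E _ q0') wq.
  have K' (x y X : R[i]) : X = x - y -> X = 1 * x + -1 * y by move=> ->; ring.
  exact: K' (centred_nabla01 k z H (lt_trans wq qr)).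
have smC : smooth_family q (centred (chern10 eps j s)) := smooth_family_chern10 eps j q0 qr H.
have E4 : nabla01 k (nabla10 eps j s) z (u + conjv z) =
    dzbarF k (centred (chern10 eps j s)) z u - pd k (centred (chern10 eps j s) z) u.
  apply: etrans _ (centred_nabla01 k z smC uq); apply: nabla01_germ smC uq _ => v.
  have [d d0 hd] := enorm_line (conjv v) ue; exists d => // x xd; apply/esym/nabla10E => //.
  apply/(eballE _ _ e0); rewrite conjv_add opprD addrA addrK; exact: hd.
have smA : smooth_family q (fun z => pd_adj eps j (centred s z)) := smooth_family_op (bounded_op_pd_adj eps j q0 qr) H.
have smZ' : smooth_family q (dzF j (centred s)) := smooth_family_sub q0' (ltW qr) (smooth_family_dzF j r0 H).
have TC z' : centred (chern10 eps j s) z' = (fun w => 1 * (dzF j (centred s) z' w : R[i]) + 1 * (pd_adj eps j (centred s z') w : R[i])).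
  by apply/funext => w; rewrite centred_chern10 !mul1r.
have E5 : dzbarF k (centred (chern10 eps j s)) z u = dzbarF k (dzF j (centred s)) z u + pd_adj eps j (dzbarF k (centred s) z) u.
  have -> : centred (chern10 eps j s) = (fun z w => 1 * (dzF j (centred s) z w : R[i]) + 1 * (pd_adj eps j (centred s z) w : R[i])).
    by apply/funext => z'; exact: TC.
  have K (x y X y' : R[i]) : y = y' -> X = 1 * x + 1 * y -> X = x + y' by move=> -> ->; ring.
  apply: K (dzbarF_lin 1 1 k z smZ' smA uq).
  exact: (dzbarF_op k z (bounded_op_pd_adj eps j eps0 er) H r0 ue).
have E6 : pd k (centred (chern10 eps j s) z) u = pd k (dzF j (centred s) z) u + pd k (pd_adj eps j (centred s z)) u.
  rewrite TC; have K (x y X : R[i]) : X = 1 * x + 1 * y -> X = x + y by move=> ->; ring.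
  by apply: K; apply: (bounded_op_pd k e0 eq).2 (smooth_family_bg smZ' z) (smooth_family_bg smA z) _ _; apply/(eball0E _ e0).
have E7 := dz_dzbar_comm j k z H ur.
have K (a b c d a' b' c' d' e e' f p q1 : R[i]) : a = b + c -> b = d - d' -> c = e - e' -> a' = b' - c' -> b' = f + e ->
   c' = d' + p -> d = f -> e' = q1 -> a - a' = p - q1 by move=> -> -> -> -> -> -> -> ->; ring.
exact: (K _ _ _ _ _ _ _ _ _ _ _ _ _ E1 E2 E3 E4 E5 E6 E7 erefl).
Qed.

End curvature.

(** * Monomials *)

Section multi_indices.
Context (n : nat).
Implicit Types (a b g : multi n) (j k : 'I_n).

Definition incr a j : multi n := [ffun i => (a i + (i == j))%N].
Definition decr a j : multi n := [ffun i => (a i - (i == j))%N].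

Lemma incrE a j k : incr a j k = (a k + (k == j))%N. Proof. by rewrite ffunE. Qed.
Lemma decrE a j k : decr a j k = (a k - (k == j))%N. Proof. by rewrite ffunE. Qed.

Lemma incrK a j : decr (incr a j) j = a.
Proof. by apply/ffunP => i; rewrite decrE incrE addnK. Qed.

Lemma decrK a j : a j != 0%N -> incr (decr a j) j = a.
Proof.
move=> aj; apply/ffunP => i; rewrite incrE decrE; case: eqP => [->|_]; last by rewrite subn0 addn0.
by rewrite subnK// lt0n.
Qed.

Lemma incr_inj j : injective (incr^~ j).
Proof. by move=> a b /(congr1 (decr^~ j)); rewrite !incrK. Qed.

Lemma decr_incr a j k : j != k -> decr (incr a k) j = incr (decr a j) k.
Proof.
move=> jk; apply/ffunP => i; rewrite decrE !incrE decrE.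
by case: (i =P j) => [->|_]; [rewrite (negPf jk) !addn0|rewrite !subn0].
Qed.

Lemma incr_gt0 a j : incr a j j != 0%N.
Proof. by rewrite incrE eqxx addn1. Qed.

Lemma mlen_incr a j : mlen (incr a j) = (mlen a).+1.
Proof.
rewrite /mlen (bigD1 j)//= [in RHS](bigD1 j)//= incrE eqxx addn1 addSn; congr (_ + _).+1.
by apply: eq_bigr => i ij; rewrite incrE (negPf ij) addn0.
Qed.

Lemma mlen_decr a j : a j != 0%N -> (mlen (decr a j)).+1 = mlen a.
Proof. by move=> aj; rewrite -(mlen_incr _ j) decrK. Qed.

Lemma fact_incr a j : (\prod_i (incr a j i)`! = (a j).+1 * \prod_i (a i)`!)%N.
Proof.
rewrite (bigD1 j)//= [in RHS](bigD1 j)//= incrE eqxx addn1 factS mulnA; congr (_ * _)%N.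
by apply: eq_bigr => i ij; rewrite incrE (negPf ij) addn0.
Qed.

(** Induction on the length: any index with a nonzero entry is an increment. *)
Lemma multi_ind (P : multi n -> Prop) : P [ffun=> 0%N] -> (forall a j, P a -> P (incr a j)) -> forall a, P a.
Proof.
move=> P0 PS a; elim: {a}(mlen a) {-2}a (erefl (mlen a)) => [|m IH] a am.
  suff -> : a = [ffun=> 0%N] by [].
  apply/ffunP => i; rewrite ffunE; apply/eqP; rewrite -leqn0 -am /mlen (bigD1 i)//=; exact: leq_addr.
have [j aj] : exists j, a j != 0%N.
  apply: contrapT => a0; move: am; rewrite /mlen big1// => i _.
  by apply: contrapT => /eqP ai; apply: a0; exists i.
by rewrite -(decrK aj); apply: PS; apply: IH; apply/eqP; rewrite -eqSS mlen_decr ?am.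
Qed.

End multi_indices.

Section monomials.
Context (R : realType) (n : nat).
Local Notation Cn := (Cn R n).
Local Notation bg r := (bergman (0 : Cn) r).
Implicit Types (f : Cn -> R[i]^o) (u w : Cn) (a b g : multi n) (j k : 'I_n).

Definition monomial a : Cn -> R[i]^o := fun u => \prod_(j < n) (u 0 j : R[i]) ^+ a j.

Lemma monomial0 u : monomial [ffun=> 0%N] u = 1.
Proof. by rewrite /monomial big1// => j _; rewrite ffunE expr0. Qed.

Lemma monomial_incr a j u : monomial (incr a j) u = (u 0 j : R[i]) * monomial a u.
Proof.
rewrite /monomial (bigD1 j)//= [in RHS](bigD1 j)//= incrE eqxx addn1 exprS -mulrA; congr (_ * (_ * _)).
by apply: eq_bigr => i ij; rewrite incrE (negPf ij) addn0.
Qed.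

Lemma coord_mul_decr a j u : (a j)%:R * (coord_mul j (monomial (decr a j)) u : R[i]) = (a j)%:R * monomial a u.
Proof.
have [->|aj] := eqVneq (a j) 0%N; first by rewrite !mul0r.
by rewrite /coord_mul -monomial_incr decrK.
Qed.

Lemma holo_monomial a w : differentiable (monomial a) w /\ forall k, pd k (monomial a) w = (a k)%:R * monomial (decr a k) w.
Proof.
elim/multi_ind: a => [|a j [da pa]].
  have -> : monomial [ffun=> 0%N] = (fun _ => 1) by apply/funext => u; exact: monomial0.
  by have [d p] := holo_cst (1 : R[i]) w; split=> // k; rewrite p ffunE mul0r.
have -> : monomial (incr a j) = (fun u => (u 0 j : R[i]) * (monomial a u : R[i])) by apply/funext => u; exact: monomial_incr.
have [dc pc] := @holo_coord R n j w.
have [d p] := holoM dc da; split=> // k; rewrite p pa pc.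
have [->|kj] := eqVneq k j.
  rewrite incrK incrE eqxx.
  have K (x y q m : R[i]) : q * (y * x) = q * m -> y * (q * x) + 1 * m = (q + 1) * m.
    by move=> E; rewrite mulrCA E; ring.
  have -> : ((a j + true)%:R : R[i]) = (a j)%:R + 1 by rewrite natrD.
  exact: (K (monomial (decr a j) w) (w 0 j) (a j)%:R (monomial a w) (coord_mul_decr a j w)).
rewrite decr_incr// monomial_incr incrE (negPf kj) addn0.
by rewrite mul0r addr0 mulrCA.
Qed.

Lemma bergman_ext_monomial r a : 0 <= r -> bergman_ext r (monomial a).
Proof.
move=> r0; elim/multi_ind: a => [|a j ba].
  exists (r + 1); first by rewrite ltrDl.
  apply: (@bergman_bounded R n 0 (r + 1) _ 1 _ _).1 => w _; last by rewrite monomial0 cmod1.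
  by have [] := holo_monomial [ffun=> 0%N] w.
suff -> : monomial (incr a j) = coord_mul j (monomial a) by exact: bergman_ext_coord_mul.
by apply/funext => u; exact: monomial_incr.
Qed.

Lemma euler_monomial a u : euler (monomial a) u = (mlen a)%:R * monomial a u.
Proof.
rewrite /mlen natr_sum mulr_suml; apply: eq_bigr => k _; rewrite -coord_mul_decr /coord_mul (holo_monomial a u).2.
exact: mulrCA.
Qed.

Lemma pd_adj_monomial r a j u : pd_adj r j (monomial a) u = (r ^- 2)%:C * ((mlen a + n.+1)%:R * monomial (incr a j) u).
Proof.
rewrite /pd_adj /coord_mul euler_monomial monomial_incr natrD.
have K (c x p q m : R[i]) : c * (x * (p * m + q * m)) = c * ((p + q) * (x * m)) by ring.
exact: K.
Qed.

(** The square norm of a monomial on the ball of radius r, by [ip_monomial]. *)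
Definition mweight (r : R) a : R :=
  pi ^+ n * r ^+ (2 * (mlen a + n)) * (\prod_(j < n) (a j)`!)%N%:R / (mlen a + n)`!%:R.

Lemma mweight_incr r a j : mweight r (incr a j) = r ^+ 2 * (a j).+1%:R / (mlen a + n.+1)%:R * mweight r a.
Proof.
rewrite /mweight mlen_incr fact_incr addSn addnS factS mulnSr exprD !natrM.
have A0 : (mlen a + n)`!%:R != 0 :> R by rewrite pnatr_eq0 -lt0n fact_gt0.
have B0 : (mlen a + n).+1%:R != 0 :> R by rewrite pnatr_eq0.
move: A0 B0; move: (_`!%:R) (_.+1%:R) => A B A0 B0.
by field; rewrite A0.
Qed.

(** Monomials are orthogonal: [pd_adj] raises an exponent and its adjoint [pd]
    lowers one, which reduces every product to the volume of the ball. *)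
Lemma ip_monomial r a g : 0 < r -> ip 0 r (monomial a) (monomial g) = (a == g)%:R * (mweight r a)%:C.
Proof.
move=> r0; have r0' := ltW r0.
have B b := bergman_ext_bergman r0' (bergman_ext_monomial b r0').
have step b h j : ip 0 r (monomial (incr b j)) (monomial h) =
    (r ^+ 2)%:C / (mlen b + n.+1)%:R * ((h j)%:R * ip 0 r (monomial b) (monomial (decr h j))).
  set q := (mlen b + n.+1)%:R.
  have q0 : q != 0 :> R[i] by rewrite pnatr_eq0 addnS.
  have rC : (r ^+ 2)%:C * (r ^- 2)%:C = 1 :> R[i] by rewrite -rmorphM mulfV// expf_neq0 ?gt_eqF.
  have E1 : ip 0 r (pd_adj r j (monomial b)) (monomial h) = (r ^- 2)%:C * q * ip 0 r (monomial (incr b j)) (monomial h).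
    rewrite -(ipZl _ (B _) (B _)); apply: eq_ip => // w _.
    by rewrite (pd_adj_monomial r b j w) mulrA.
  have E2 : ip 0 r (monomial b) (fun w => pd j (monomial h) w) = (h j)%:R * ip 0 r (monomial b) (monomial (decr h j)).
    have -> : ((h j)%:R : R[i]) = ((h j)%:R)^* by rewrite -(rmorph_nat (real_complex R)); apply: eqReIm => //=; rewrite oppr0.
    rewrite -(ipZr _ (B _) (B _)); apply: eq_ip => // w _.
    exact: (holo_monomial h w).2.
  have := ip_pd_adj r0 j (bergman_ext_monomial b r0') (bergman_ext_monomial h r0').
  rewrite E1 E2 => <-.
  have K (x y X : R[i]) : x * y = 1 -> X = x / q * (y * q * X).
    by move=> xy; rewrite -[LHS]mul1r -xy; field.
  exact: K.
elim/multi_ind: a g => [|a j IH] g; last first.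
  rewrite step IH mweight_incr.
  have [gj|gj] := eqVneq (g j) 0%N.
    have -> : (incr a j == g) = false.
      by apply/eqP => E; move: (incr_gt0 a j); rewrite E gj.
    by rewrite gj !mul0r mulr0.
  have -> : (incr a j == g) = (a == decr g j).
    by apply/eqP/eqP => [<-|->]; [rewrite incrK|rewrite decrK].
  case: eqP => [->|_]; last by rewrite !mul0r !mulr0.
  have -> : (decr g j j).+1 = g j by rewrite decrE eqxx subn1 prednK// lt0n.
  move: (mweight r _) => W; rewrite !mul1r !rmorphM fmorphV !rmorph_nat.
  have K (x p q w : R[i]) : x / q * (p * w) = x * p / q * w by ring.
  exact: K.
elim/multi_ind: g => [|g j _].
  rewrite eqxx mul1r ip_nsq; congr (_%:C).
  have mE : mweight r [ffun=> 0%N] = pi ^+ n * (r ^+ 2) ^+ n / n`!%:R.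
    have l0 : mlen ([ffun=> 0%N] : multi n) = 0%N by apply: big1 => i _; rewrite ffunE.
    rewrite /mweight l0 add0n big1 ?mulr1 ?exprM// => i _; by rewrite ffunE.
  rewrite mE /nsq -[RHS]/(fine (_%:E)) -(measure_ball _ r0).
  under eq_Rintegral => p _ do rewrite monomial0 /sqmod/= expr1n expr0n/= addr0.
  rewrite /Rintegral integral_cst ?mul1e//; exact: measurable_preball.
rewrite (ipC (B _) (B _)) step.
have E : incr g j = [ffun=> 0%N] -> False by move=> E; move: (incr_gt0 g j); rewrite E ffunE.
have -> : ([ffun=> 0%N] == incr g j) = false by apply/eqP => /esym.
by rewrite ffunE !mul0r mulr0; apply: eqReIm => //=; rewrite oppr0.
Qed.

End monomials.

Arguments monomial R {n} a _.

(** * The orthonormal frame *)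

Section frame.
Context (R : realType) (n : nat).
Local Notation Cn := (Cn R n).
Local Notation bg r := (bergman (0 : Cn) r).
Implicit Types (f g : Cn -> R[i]^o) (u w z : Cn) (a b c : multi n) (j k : 'I_n).

Lemma pd_adj_monomialZ r (x : R[i]) a k u :
  pd_adj r k (fun w => x * (monomial R a w : R[i])) u = x * ((r ^- 2)%:C * ((mlen a + n.+1)%:R * monomial R (incr a k) u)).
Proof.
rewrite -(pd_adj_monomial r a k u) /pd_adj /coord_mul.
have E : euler (fun w => x * (monomial R a w : R[i])) u = x * (euler (monomial R a) u : R[i]).
  rewrite /euler mulr_sumr; apply: eq_bigr => i _; rewrite /coord_mul.
  rewrite ((holoZ x (holo_monomial a u).1).2 i); exact: mulrCA.
rewrite E.
have K (c y p q m : R[i]) : c * (y * (x * p + q * (x * m))) = x * (c * (y * (p + q * m))) by ring.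
exact: K.
Qed.

(** The commutator of [pd] and [pd_adj] preserves the degree: it shifts one unit
    from the j-th to the k-th exponent, and acts for j = k by the number |a| + n as
    well. *)
Lemma commutator_monomial r a j k u :
  pd j (pd_adj r k (monomial R a)) u - pd_adj r k (fun w => pd j (monomial R a) w) u =
  (r ^- 2)%:C * ((incr a k j)%:R * (monomial R (decr (incr a k) j) u : R[i]) +
                 (j == k)%:R * ((mlen a + n)%:R * (monomial R a u : R[i]))).
Proof.
have -> : pd_adj r k (monomial R a) = (fun w => (r ^- 2)%:C * (mlen a + n.+1)%:R * (monomial R (incr a k) w : R[i])).
  by apply/funext => w; rewrite pd_adj_monomial mulrA.
rewrite ((holoZ _ (holo_monomial (incr a k) u).1).2 j) (holo_monomial _ _).2.
have -> : (fun w => pd j (monomial R a) w) = (fun w => (a j)%:R * (monomial R (decr a j) w : R[i])).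
  by apply/funext => w; rewrite (holo_monomial _ _).2.
rewrite pd_adj_monomialZ; have [jk|jk] := eqVneq j k; last first.
  rewrite (decr_incr a jk) incrE (negPf jk) addn0 mul0r addr0.
  have [->|aj] := eqVneq (a j) 0%N.
    have K (x p m X : R[i]) : x * p * (0 * m) - 0 * X = x * (0 * m) by ring.
    exact: K.
  rewrite addnS -(mlen_decr aj) addSn -addnS [in X in _ - X]addnS.
  set M := (mlen (decr a j) + n)%N; rewrite -addnS -/M.
  have -> : (mlen (decr a j) + n.+2)%:R = M.+1%:R + 1 :> R[i] by rewrite !addnS -/M natr1.
  have K (r2 x p m : R[i]) : r2 * (p + 1) * (x * m) - x * (r2 * (p * m)) = r2 * (x * m) by ring.
  exact: K.
rewrite -jk incrK incrE eqxx addn1 !addnS mul1r.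
have [aj|aj] := eqVneq (a j) 0%N.
  rewrite aj mul0r subr0 -[(_ + n).+1]addn1 natrD.
  have K (r2 p m : R[i]) : r2 * (p + 1) * (1 * m) = r2 * (1 * m + p * m) by ring.
  exact: K.
rewrite (_ : (mlen (decr a j) + n).+1 = (mlen a + n)%N); last by rewrite -addSn mlen_decr.
rewrite (decrK aj) -[(_ + n).+1%:R]natr1 -[(a j).+1%:R]natr1.
have K (r2 x p m : R[i]) : r2 * (p + 1) * ((x + 1) * m) - x * (r2 * (p * m)) = r2 * ((x + 1) * m + p * m) by ring.
exact: K.
Qed.

Variable eps : R.
Hypothesis eps0 : 0 < eps.
Let e0 : 0 <= eps := ltW eps0.

Definition frame_coef a : R := powR pi (- (n%:R / 2)) * eps ^- (mlen a + n)
   * Num.sqrt ((mlen a + n)`!%:R / (\prod_(j < n) (a j)`!)%:R).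

Lemma frame_coef_gt0 a : 0 < frame_coef a.
Proof.
rewrite /frame_coef !mulr_gt0 ?powR_gt0 ?pi_gt0 ?invr_gt0 ?exprn_gt0// sqrtr_gt0 divr_gt0 ?ltr0n ?fact_gt0//.
by rewrite prodn_gt0// => j; exact: fact_gt0.
Qed.

Lemma frame_coef_sqr a : frame_coef a ^+ 2 * mweight eps a = 1.
Proof.
have A0 : (mlen a + n)`!%:R != 0 :> R by rewrite pnatr_eq0 -lt0n fact_gt0.
have B0 : (\prod_(j < n) (a j)`!)%N%:R != 0 :> R.
  by rewrite pnatr_eq0 -lt0n prodn_gt0// => j; exact: fact_gt0.
have p0 : pi ^+ n != 0 :> R by rewrite expf_neq0// gt_eqF// pi_gt0.
rewrite /frame_coef /mweight !exprMn sqr_sqrtr ?divr_ge0//.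
have -> : powR (pi : R) (- (n%:R / 2)) ^+ 2 = (pi ^+ n)^-1.
  rewrite -powR_mulrn ?powR_ge0// -powRrM mulNr divfK ?pnatr_eq0// powRN powR_mulrn// ltW// pi_gt0//.
rewrite exprVn -exprM mulnC.
have C0 : eps ^+ (2 * (mlen a + n)) != 0 by rewrite expf_neq0// gt_eqF.
move: C0 A0 B0 p0; move: (eps ^+ _) ((_ + _)`!%:R : R) ((\prod_(_ < _) _)%N%:R : R) (pi ^+ n : R).
move=> A C D E C0 A0 B0 p0.
by field; rewrite C0 A0 B0.
Qed.

(** Both sides come from the norm of the monomial [incr a k], reached from a and
    from b. *)
Lemma frame_coef_ratio a b j k : incr a k = incr b j ->
  (incr a k j)%:R * frame_coef a = Num.sqrt (incr a k j)%:R * Num.sqrt (incr a k k)%:R * frame_coef b.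
Proof.
move=> E; set c := incr a k.
have l : mlen a = mlen b by apply/eqP; rewrite -eqSS -(mlen_incr a k) E mlen_incr.
have := mweight_incr eps a k; rewrite E mweight_incr -l.
have -> : (a k).+1 = c k by rewrite /c incrE eqxx addn1.
have -> : (b j).+1 = c j by rewrite /c E incrE eqxx addn1.
have q0 : (mlen a + n.+1)%:R != 0 :> R by rewrite pnatr_eq0 addnS.
have e20 : eps ^+ 2 != 0 by rewrite expf_neq0// gt_eqF.
have := frame_coef_sqr a; have := frame_coef_sqr b; have := frame_coef_gt0 a; have := frame_coef_gt0 b.
move: (frame_coef a) (frame_coef b) (mweight eps a) (mweight eps b) (mlen a + n.+1)%:R q0 => x y W V q q0 y0 x0 yV xW WV.
have E1 : (c j)%:R * V = (c k)%:R * W.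
  have K (e s V' t W' : R) : e != 0 -> e * s / q * V' = e * t / q * W' -> s * V' = t * W'.
    move=> e'0 /(congr1 (fun t => t * (q / e))).
    by rewrite (_ : e * s / q * V' * (q / e) = s * V') => [->|]; field; apply/andP.
  exact: K e20 WV.
have E2 : x ^+ 2 * (c j)%:R = y ^+ 2 * (c k)%:R.
  have -> : x ^+ 2 * (c j)%:R = x ^+ 2 * (c j)%:R * (y ^+ 2 * V) by rewrite yV mulr1.
  have -> : y ^+ 2 * (c k)%:R = y ^+ 2 * (c k)%:R * (x ^+ 2 * W) by rewrite xW mulr1.
  move: E1; move: (c j)%:R (c k)%:R => p p' E1.
  rewrite (_ : _ * (y ^+ 2 * V) = x ^+ 2 * y ^+ 2 * (p * V)); first by rewrite E1; ring.
  by ring.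
have E3 : x * Num.sqrt (c j)%:R = y * Num.sqrt (c k)%:R.
  apply/eqP; rewrite -(@eqrXn2 _ 2) ?mulr_ge0 ?sqrtr_ge0 ?(ltW x0) ?(ltW y0)//.
  by rewrite !exprMn !sqr_sqrtr// E2.
have K (s t : R) : x * s = y * t -> s ^+ 2 * x = s * t * y.
  by move=> h; rewrite expr2 -mulrA [s * x]mulrC h; ring.
by apply: etrans _ (K _ _ E3); rewrite sqr_sqrtr.
Qed.

Definition centred_frame a : Cn -> R[i]^o := fun u => (frame_coef a)%:C * (monomial R a u : R[i]).

Lemma centred_frameE a z u : centred (frame eps a) z u = centred_frame a u.
Proof. by rewrite /centred /frame /centred_frame /monomial; congr (_ * _); apply: eq_bigr => j _; rewrite mxE addrK. Qed.

Lemma bergman_ext_centred_frame a : bergman_ext eps (centred_frame a).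
Proof. exact: (bergman_extZ _ (bergman_ext_monomial _ e0)). Qed.

Let B f (bf : bergman_ext eps f) := bergman_ext_bergman e0 bf.

Let conj_real (x : R) : (x%:C)^* = x%:C :> R[i]. Proof. by apply: eqReIm => //=; rewrite oppr0. Qed.

Let ipZr_self (x : R[i]) f g : x^* = x -> bergman_ext eps f -> bergman_ext eps g ->
  ip 0 eps f (fun w => x * (g w : R[i])) = x * ip 0 eps f g.
Proof.
by move=> E bf bg'; exact: (etrans (ipZr x (B bf) (B bg')) (congr1 (fun c : R[i] => c * ip 0 eps f g) E)).
Qed.

Lemma ip_centred_frame f a : bergman_ext eps f -> ip 0 eps f (centred_frame a) = (frame_coef a)%:C * ip 0 eps f (monomial R a).
Proof. by move=> bf; apply: (ipZr_self (conj_real _) bf (bergman_ext_monomial a e0)). Qed.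

Lemma centred_frame_orthonormal a b : ip 0 eps (centred_frame a) (centred_frame b) = (a == b)%:R.
Proof.
rewrite ip_centred_frame; last exact: bergman_ext_centred_frame.
rewrite (ipZl _ (B (bergman_ext_monomial _ e0)) (B (bergman_ext_monomial _ e0))) ip_monomial//.
case: eqP => [->|_]; last by rewrite mul0r !mulr0.
have := congr1 (real_complex R) (frame_coef_sqr b); rewrite /= mul1r rmorphM rmorphXn => E.
by rewrite mulrA -expr2 E.
Qed.

Section expansion.
Variables (z : Cn) (f : Cn -> R[i]^o) (xi : multi n -> R[i]).
Hypothesis fxi : frame_expansion eps z f xi.
Hypothesis bf : bergman_ext eps (fun u => f (u + conjv z)).
Let F : Cn -> R[i]^o := fun u => f (u + conjv z).
Let S (l : seq (multi n)) : Cn -> R[i]^o := fun u => \sum_(a <- l) xi a * (centred_frame a u : R[i]).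

Let bS l : bergman_ext eps (S l).
Proof. by apply: bergman_ext_sum => // a; exact: bergman_extZ (bergman_ext_centred_frame a). Qed.

Lemma expansion_approx (d : R) : 0 < d -> exists A : seq (multi n), forall l,
  uniq l -> {subset A <= l} -> nrm 0 eps (fun u => F u - S l u) < d.
Proof.
move=> d0; have [A HA] := fxi (exprn_gt0 2 d0); exists A => l ul Al.
have bFS : bg eps (fun u => F u - S l u) := bergmanB (B bf) (B (bS l)).
rewrite -(L2sq_lt bFS d0).
have E u : f (u + conjv z) - \sum_(a <- l) xi a * (frame eps a z (u + conjv z) : R[i]) = F u - S l u.
  by congr (_ - _); apply: eq_bigr => a _; rewrite -(centred_frameE a z u).
have E' : L2sq (conjv z) eps (fun w => f w - \sum_(a <- l) xi a * (frame eps a z w : R[i])) = L2sq 0 eps (fun u => F u - S l u).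
  rewrite nsq_shift; first by congr (L2sq 0 eps); apply/funext => u; exact: E.
  have bG : bg eps (fun u => f (u + conjv z) - \sum_(a <- l) xi a * (frame eps a z (u + conjv z) : R[i])).
    by apply: eq_bergman bFS => u _; exact: (esym (E u)).
  have [dG _] := bergman_shift (f := fun w => f w - \sum_(a <- l) xi a * (frame eps a z w : R[i])) bG.
  by move=> w; exact: eball_ccont dG.
by rewrite -E'; exact: HA.
Qed.

Lemma nrm_centred_frame a : nrm 0 eps (centred_frame a) = 1.
Proof.
have := centred_frame_orthonormal a a; rewrite eqxx ip_nsq => -[E].
by rewrite /nrm E sqrtr1.
Qed.

(** Orthonormality isolates one coefficient in every partial sum that contains
    it, and the remainder tends to 0. *)
Lemma expansion_coef a : xi a = ip 0 eps F (centred_frame a).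
Proof.
suff H (d : R) : 0 < d -> cmod (ip 0 eps F (centred_frame a) - xi a) < d.
  apply/esym/eqP; rewrite -subr_eq0 -cmod_eq0; apply/negPn/negP => h.
  by have := H (cmod (ip 0 eps F (centred_frame a) - xi a)); rewrite ltxx lt_neqAle eq_sym h cmod_ge0 => /(_ isT).
move=> d0; have [A HA] := expansion_approx d0.
have := HA (undup (a :: A)) (undup_uniq _) (fun x => _); set l := undup _ => H.
have {}H : nrm 0 eps (fun u => F u - S l u) < d.
  by apply: H => x xA; rewrite mem_undup inE xA orbT.
have E : ip 0 eps (S l) (centred_frame a) = xi a.
  rewrite (ip_suml (F := fun b u => xi b * (centred_frame b u : R[i])) l e0 (fun b => bergman_extZ (xi b) (bergman_ext_centred_frame b)) (bergman_ext_centred_frame a)).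
  have al : a \in l by rewrite mem_undup mem_head.
  rewrite (bigD1_seq a al (undup_uniq _))/= big1 => [|b ba].
    by rewrite addr0 (ipZl _ (B (bergman_ext_centred_frame a)) (B (bergman_ext_centred_frame a))) centred_frame_orthonormal eqxx mulr1.
  by rewrite (ipZl _ (B (bergman_ext_centred_frame b)) (B (bergman_ext_centred_frame a))) centred_frame_orthonormal (negPf ba) mulr0.
have := cauchy_schwarz (bergmanB (B bf) (B (bS l))) (B (bergman_ext_centred_frame a)).
rewrite (ipBl (B bf) (B (bS l)) (B (bergman_ext_centred_frame a))) E nrm_centred_frame mulr1 => h.
exact: le_lt_trans h H.
Qed.

(** The Cauchy-Schwarz inequality, applied to the remainder of the expansion. *)
Lemma expansion_ip g (d : R) : bergman_ext eps g -> 0 < d -> exists A : seq (multi n), forall l,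
  uniq l -> {subset A <= l} ->
  cmod (ip 0 eps g F - \sum_(a <- l) (xi a)^* * ip 0 eps g (centred_frame a)) <= d.
Proof.
move=> bg' d0; have N0 : 0 < nrm 0 eps g + 1 by rewrite ltr_wpDl// nrm_ge0.
have [A HA] := expansion_approx (divr_gt0 d0 N0); exists A => l ul Al.
have h := HA l ul Al.
have -> : \sum_(a <- l) (xi a)^* * ip 0 eps g (centred_frame a) = ip 0 eps g (S l).
  rewrite (ipC (B (bS l)) (B bg')).
  rewrite (ip_suml (F := fun b u => xi b * (centred_frame b u : R[i])) l e0 (fun b => bergman_extZ (xi b) (bergman_ext_centred_frame b)) bg').
  rewrite conjc_sum; apply: eq_bigr => a _.
  rewrite -(ipC (bergmanZ (xi a) (B (bergman_ext_centred_frame a))) (B bg')).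
  exact: (esym (ipZr _ (B bg') (B (bergman_ext_centred_frame a)))).
rewrite -(ipBr (B bg') (B bf) (B (bS l))).
apply: le_trans (cauchy_schwarz (B bg') (bergmanB (B bf) (B (bS l)))) _.
move: h; rewrite ltr_pdivlMr// => h.
by have := nrm_ge0 (0 : Cn) eps g; have := nrm_ge0 (0 : Cn) eps (fun u => F u - S l u); nra.
Qed.

(** The curvature in the fibre variable, by [centred_curvature]. *)
Definition commutator j k g : Cn -> R[i]^o := fun u =>
  pd k (pd_adj eps j g) u - pd_adj eps j (fun w => pd k g w) u.

Lemma bergman_ext_commutator j k g : bergman_ext eps g -> bergman_ext eps (commutator j k g).
Proof.
move=> bg'; apply: bergman_extB => //.
- exact: (bergman_ext_pd k e0 (bergman_ext_pd_adj eps0 j bg')).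
- exact: (bergman_ext_pd_adj eps0 j (bergman_ext_pd k e0 bg')).
Qed.

(** Since [pd] and [pd_adj] are adjoint, the adjoint of a commutator is the
    commutator with the indices exchanged; this moves the computation from the
    section to the monomials. *)
Lemma ip_commutator j k g h : bergman_ext eps g -> bergman_ext eps h ->
  ip 0 eps (commutator j k g) h = ip 0 eps g (commutator k j h).
Proof.
move=> bg' bh.
have bAg := bergman_ext_pd_adj eps0 j bg'; have bAh := bergman_ext_pd_adj eps0 k bh.
have bpg := bergman_ext_pd k e0 bg'; have bph := bergman_ext_pd j e0 bh.
have E1 : ip 0 eps (fun w => pd k (pd_adj eps j g) w) h = ip 0 eps g (fun w => pd j (pd_adj eps k h) w).
  rewrite (ipC (B bh) (B (bergman_ext_pd k e0 bAg))) -(ip_pd_adj eps0 k bh bAg) -(ipC (B bAh) (B bAg)).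
  exact: (ip_pd_adj eps0 j bg' bAh).
have E2 : ip 0 eps (pd_adj eps j (fun w => pd k g w)) h = ip 0 eps g (pd_adj eps k (fun w => pd j h w)).
  rewrite (ip_pd_adj eps0 j bpg bh) (ipC (B bph) (B bpg)) -(ip_pd_adj eps0 k bph bg').
  exact: (esym (ipC (B (bergman_ext_pd_adj eps0 k bph)) (B bg'))).
apply: etrans (ipBl (B (bergman_ext_pd k e0 bAg)) (B (bergman_ext_pd_adj eps0 j bpg)) (B bh)) _.
rewrite E1 E2.
exact: (esym (ipBr (B bg') (B (bergman_ext_pd j e0 bAh)) (B (bergman_ext_pd_adj eps0 k bph)))).
Qed.

Lemma ip_commutator_centred_frame j k a : ip 0 eps (commutator j k F) (centred_frame a) =
  (eps ^- 2)%:C * ((Num.sqrt (incr a k j)%:R)%:C * (Num.sqrt (incr a k k)%:R)%:C * xi_lower xi (incr a k) j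
    + (j == k)%:R * ((mlen a + n)%:R * xi a)).
Proof.
have bm b : bergman_ext eps (monomial R b) := bergman_ext_monomial b e0.
rewrite ip_centred_frame; last exact: bergman_ext_commutator.
rewrite ip_commutator//.
have -> : ip 0 eps F (commutator k j (monomial R a)) =
   (eps ^- 2)%:C * ((incr a k j)%:R * ip 0 eps F (monomial R (decr (incr a k) j)) +
                 (j == k)%:R * ((mlen a + n)%:R * ip 0 eps F (monomial R a))).
  set X := monomial R (decr _ _); set x := (incr a k j)%:R : R[i]; set y := (j == k)%:R * (mlen a + n)%:R : R[i].
  have cr (m : nat) : (m%:R : R[i])^* = m%:R by rewrite -(rmorph_nat (real_complex R)); exact: conj_real.
  have cy : y^* = y by rewrite /y -natrM; exact: cr.
  have -> : ip 0 eps F (commutator k j (monomial R a)) =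
      ip 0 eps F (fun u => (eps ^- 2)%:C * (x * (X u : R[i]) + y * (monomial R a u : R[i]))).
    apply: eq_ip => // u _; apply: etrans (commutator_monomial eps a j k u) _.
    by rewrite [in LHS]mulrA.
  have b1 := bergman_extZ x (bm (decr (incr a k) j)); have b2 := bergman_extZ y (bm a).
  apply: etrans (ipZr_self (conj_real _) bf (bergman_extD e0 b1 b2)) _; congr (_ * _).
  apply: etrans (ipDr (B bf) (B b1) (B b2)) _; rewrite [X in _ = _ + X]mulrA.
  exact: (f_equal2 +%R (ipZr_self (cr _) bf (bm _)) (ipZr_self cy bf (bm a))).
have Xa b : xi b = (frame_coef b)%:C * ip 0 eps F (monomial R b) by rewrite expansion_coef ip_centred_frame.
rewrite (Xa a).
have [c0|c0] := eqVneq (incr a k j) 0%N.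
  rewrite /xi_lower c0 eqxx; ring.
have <- : (incr a k j)%:R * (frame_coef a)%:C * ip 0 eps F (monomial R (decr (incr a k) j)) =
   (Num.sqrt (incr a k j)%:R)%:C * (Num.sqrt (incr a k k)%:R)%:C * xi_lower xi (incr a k) j.
  rewrite /xi_lower (negPf c0).
  have -> : [ffun i => (incr a k i - (i == j))%N] = decr (incr a k) j by [].
  rewrite Xa mulrA; congr (_ * _).
  have := congr1 (real_complex R) (@frame_coef_ratio a (decr (incr a k) j) j k (esym (decrK c0))).
  by rewrite /= !rmorphM rmorph_nat.
ring.
Qed.

End expansion.
End frame.

(** * Summation of the curvature coefficients *)

(** The truncated curvature sums are not partial sums of the series but lie
    between two consecutive ones, which gives the same limit. *)
Lemma esum_sandwich (R : realType) (T : choiceType) (D : nat -> seq T) (t : T -> R) (c : nat -> R) (L : R) :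
  (forall x, 0 <= t x) -> (forall N, uniq (D N)) ->
  (forall X : seq T, exists N, {subset X <= D N}) ->
  (forall N M, (N <= M)%N -> {subset D N <= D M}) ->
  (forall N, \sum_(x <- D N) t x <= c N <= \sum_(x <- D N.+1) t x) ->
  (forall d, 0 < d -> exists N0, forall N, (N0 <= N)%N -> `|c N - L| <= d) ->
  (\esum_(x in [set: T]) (t x)%:E)%E = L%:E.
Proof.
move=> t0 uD cov mon sand lim; apply/eqP; rewrite eq_le; apply/andP; split.
  apply: ge_ereal_sup => _ [X [finX _] <-].
  rewrite fsbig_finite//=; set l := finmap.enum_fset _; have ul : uniq l by exact: finmap.fset_uniq.
  rewrite sumEFin; apply/lee_addgt0Pr => d d0; rewrite -EFinD lee_fin.
  have [N1 h1] := cov l; have [N0 h0] := lim _ d0; pose N := maxn N0 N1.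
  have lD : {subset l <= D N} by move=> x /h1; apply: mon; exact: leq_maxr.
  have : \sum_(x <- l) t x <= \sum_(x <- D N) t x.
    have -> : \sum_(x <- l) t x = \sum_(x <- [seq x <- D N | x \in l]) t x.
      apply: perm_big; apply: uniq_perm => //; first exact: filter_uniq.
      by move=> x; rewrite mem_filter; case xl : (x \in l) => //=; rewrite lD.
    by rewrite big_filter [leRHS](bigID (fun x => x \in l))/= lerDl; apply: sumr_ge0.
  have /andP[a _] := sand N; move/le_trans => /(_ _ a) h; apply: le_trans h _.
  by have := h0 N (leq_maxl _ _); rewrite ler_norml => /andP[_]; rewrite lerBlDl.
apply/lee_addgt0Pr => d d0; have [N h] := lim _ d0.
have := h N (leqnn N); rewrite ler_norml => /andP[lo _].
apply: (@le_trans _ _ ((\sum_(x <- D N.+1) t x) + d)%:E).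
  by rewrite lee_fin; have /andP[_ b] := sand N; move: lo b; move: (\sum_(_ <- _) _) => S; lra.
rewrite EFinD leeD2r//; apply: esum_ge; exists [set` D N.+1].
  by split=> //; exact: finite_seq.
by rewrite -fsbig_seq// sumEFin.
Qed.

Section multi_ball.
Variable n : nat.
Implicit Types (a : multi n) (N : nat).

Definition multi_le N : seq (multi n) :=
  [seq a <- undup [seq [ffun j => h j : nat] | h : {ffun 'I_n -> 'I_N.+1}] | (mlen a <= N)%N].

Lemma mem_multi_le N a : (a \in multi_le N) = (mlen a <= N)%N.
Proof.
rewrite mem_filter; case: leqP => //= aN; rewrite mem_undup; apply/mapP.
have aj j : (a j < N.+1)%N.
  by rewrite ltnS; apply: leq_trans aN; rewrite /mlen (bigD1 j)//=; exact: leq_addr.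
exists [ffun j => Ordinal (aj j)]; first by rewrite mem_enum.
by apply/ffunP => j; rewrite !ffunE.
Qed.

Lemma uniq_multi_le N : uniq (multi_le N).
Proof. exact: filter_uniq (undup_uniq _). Qed.

Lemma multi_le_cover (X : seq (multi n)) : exists N, {subset X <= multi_le N}.
Proof.
exists (\sum_(a <- X) mlen a)%N => a aX; rewrite mem_multi_le.
by rewrite (big_rem a)//= leq_addr.
Qed.

Lemma multi_le_mon N M : (N <= M)%N -> {subset multi_le N <= multi_le M}.
Proof. by move=> NM a; rewrite !mem_multi_le => /leq_trans; exact. Qed.

(** Raising the exponent k is a bijection onto the indices with k-th entry
    nonzero. *)
Lemma sum_incr (R : nmodType) N (k : 'I_n) (F : multi n -> R) : (forall g : multi n, g k = 0%N -> F g = 0) ->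
  \sum_(a <- multi_le N) F (incr a k) = \sum_(g <- multi_le N.+1) F g.
Proof.
move=> F0; rewrite -(big_map (fun a => incr a k) xpredT F).
rewrite [RHS](bigID (fun g : multi n => g k != 0%N))/= [X in _ + X]big1 ?addr0; last by move=> g /negPn/eqP; exact: F0.
rewrite -[RHS]big_filter; apply: perm_big; apply: uniq_perm.
- by rewrite map_inj_uniq ?uniq_multi_le//; exact: incr_inj.
- exact: filter_uniq (uniq_multi_le _).
move=> g; rewrite mem_filter mem_multi_le; apply/mapP/andP => [[a]|[gk gN]].
  by rewrite mem_multi_le => aN ->; rewrite incr_gt0 mlen_incr.
by exists (decr g k); [rewrite mem_multi_le -ltnS mlen_decr|rewrite decrK].
Qed.

End multi_ball.

Section curvature_form.
Context (R : realType) (n : nat).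
Local Notation Cn := (Cn R n).
Implicit Types (u v w z : Cn) (a g : multi n) (j k : 'I_n).
Variables (eps eps' : R) (sigma : familyCn R n) (z : Cn) (xi : multi n -> R[i]) (v : Cn).
Hypothesis eps0 : 0 < eps.
Hypothesis lt_eps : eps < eps'.
Hypothesis smooth_sigma : smooth_section eps' sigma.
Hypothesis sigmaE : frame_expansion eps z (sigma z) xi.
Let e0 : 0 <= eps := ltW eps0.
Let F : Cn -> R[i]^o := fun u => sigma z (u + conjv z).

Let smooth_familyT : smooth_family eps' (centred sigma).
Proof. by apply/smooth_section_smooth_family => //; exact: lt_trans lt_eps. Qed.

Let bF : bergman_ext eps F. Proof. exact: (smooth_family_bergman_ext z e0 lt_eps smooth_familyT). Qed.

Let Phi : Cn -> R[i]^o := fun u =>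
  \sum_(p : 'I_n * 'I_n) ((v 0 p.1 : R[i]) * (v 0 p.2 : R[i])^*) * (commutator eps p.1 p.2 F u : R[i]).

Let bPhi : bergman_ext eps Phi.
Proof. by apply: bergman_ext_sum => // p; apply: bergman_extZ; exact: bergman_ext_commutator. Qed.

Let ip_Phi f : bergman_ext eps f -> ip 0 eps Phi f =
  \sum_(p : 'I_n * 'I_n) ((v 0 p.1 : R[i]) * (v 0 p.2 : R[i])^*) * ip 0 eps (commutator eps p.1 p.2 F) f.
Proof.
move=> bf; have bc p := bergman_ext_commutator eps0 p.1 p.2 bF.
rewrite (ip_suml (F := fun p u => ((v 0 p.1 : R[i]) * (v 0 p.2 : R[i])^*) * (commutator eps p.1 p.2 F u : R[i])) _ e0 _ bf).
  by apply: eq_bigr => p _; exact: (ipZl _ (bergman_ext_bergman e0 (bc p)) (bergman_ext_bergman e0 bf)).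
by move=> p; exact: (bergman_extZ _ (bc p)).
Qed.

Lemma curvature_form_ip : curvature_form eps sigma z v = ip 0 eps Phi F.
Proof.
rewrite (ip_Phi bF) -(pair_bigA _ (fun j k => ((v 0 j : R[i]) * (v 0 k : R[i])^*) * ip 0 eps (commutator eps j k F) F))/=.
apply: eq_bigr => j _; apply: eq_bigr => k _.
have E w : eball 0 eps w -> centred (curvature eps j k sigma) z w = commutator eps j k F w.
  by move=> /(eball0E _ e0) we; exact: (centred_curvature eps0 j k z lt_eps smooth_familyT we).
have bc : bergman 0 eps (centred (curvature eps j k sigma) z).
  by apply: eq_bergman (bergman_ext_bergman e0 (bergman_ext_commutator eps0 j k bF)) => w we; exact: (esym (E w we)).
rewrite (inner_centred bc (bergman_ext_bergman e0 bF)).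
have K (x y p q : R[i]) : x = y -> x * p * q = p * q * y by move=> ->; ring.
by apply: K; apply: eq_ip.
Qed.

Let P g : R[i] := \sum_(j < n) (Num.sqrt (g j)%:R)%:C * xi_lower xi g j * (v 0 j : R[i]).
Let W a : R := \sum_(j < n) (mlen a + n)%:R * sqmod (xi a) * sqmod (v 0 j).
Let Q g k : R[i] := (Num.sqrt (g k)%:R)%:C * xi_lower xi g k * (v 0 k : R[i]).

Let xi_lower_incr a k : xi_lower xi (incr a k) k = xi a.
Proof. by rewrite /xi_lower (negPf (incr_gt0 a k)) -[in RHS](incrK a k). Qed.

Let term a : (xi a)^* * ip 0 eps Phi (centred_frame eps a) =
  (eps ^- 2)%:C * (\sum_(k < n) (Q (incr a k) k)^* * P (incr a k) + (W a)%:C).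
Proof.
rewrite (ip_Phi (bergman_ext_centred_frame eps0 a)) -(pair_bigA _ (fun j k => ((v 0 j : R[i]) * (v 0 k : R[i])^*) * ip 0 eps (commutator eps j k F) (centred_frame eps a)))/=.
rewrite exchange_big/= mulr_sumr /W rmorph_sum -big_split mulr_sumr; apply: eq_bigr => k _ /=.
under eq_bigr => j _ do rewrite (ip_commutator_centred_frame eps0 sigmaE bF j k a).
rewrite /Q xi_lower_incr /P.
set s := Num.sqrt _; set M := (mlen a + n)%:R; set c := (eps ^- 2)%:C.
have E j : (v 0 j : R[i]) * (v 0 k : R[i])^* * (c * ((Num.sqrt (incr a k j)%:R)%:C * s%:C * xi_lower xi (incr a k) j
    + (j == k)%:R * (M * xi a))) =
  c * (v 0 k : R[i])^* * s%:C * ((Num.sqrt (incr a k j)%:R)%:C * xi_lower xi (incr a k) j * (v 0 j : R[i])) +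
  (j == k)%:R * (c * (v 0 k : R[i])^* * (v 0 j : R[i]) * M * xi a).
  have K (x y c' p s' q d m t : R[i]) : x * y * (c' * (p * s' * q + d * (m * t))) = c' * y * s' * (p * q * x) + d * (c' * y * x * m * t) by ring.
  exact: K.
under eq_bigr => j _ do rewrite E.
rewrite big_split/= -mulr_sumr [X in _ + X](bigD1 k)//= eqxx mul1r [X in _ + (_ + X)]big1 ?addr0; last first.
  by move=> j /negPf ->; rewrite mul0r.
set S := \sum_(j < n) _.
have K (x y S' m : R[i]) (c' s' m' : R) : m = m'%:C ->
   x^* * (c'%:C * y^* * s'%:C * S' + c'%:C * y^* * y * m * x) = c'%:C * ((s'%:C * x * y)^* * S' + (m' * sqmod x * sqmod y)%:C).
  move=> ->; case: x => x1 x2; case: y => y1 y2; case: S' => S1 S2.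
  by apply: eqReIm => /=; rewrite /sqmod /=; ring.
by apply: K; rewrite rmorph_nat.
Qed.

Let C N : R := \sum_(g <- multi_le n N.+1) sqmod (P g) + \sum_(a <- multi_le n N) W a.

(** Reindexed by g = a + c_k, the shift terms have the k-independent factor
    P g, and the other factors add up to its conjugate. *)
Let partial_sum N : \sum_(a <- multi_le n N) (xi a)^* * ip 0 eps Phi (centred_frame eps a) = (eps ^- 2 * C N)%:C.
Proof.
under eq_bigr => a _ do rewrite term.
rewrite -mulr_sumr rmorphM; congr (_ * _); rewrite /C rmorphD !rmorph_sum big_split/=; congr (_ + _).
rewrite exchange_big/=.
under eq_bigr => k _.
  rewrite (@sum_incr n _ N k (fun g => (Q g k)^* * P g)); last first.
    move=> g gk; rewrite /Q /xi_lower gk eqxx mulr0 mul0r.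
    have K (x : R[i]) : (0 : R[i])^* * x = 0 by case: x => x1 x2; apply: eqReIm => /=; ring.
    exact: K.
  over.
rewrite exchange_big/=; apply: eq_bigr => g _.
rewrite -mulr_suml -mul_conj mulrC; congr (_ * _).
exact: (esym (conjc_sum (index_enum _) (fun k => Q g k))).
Qed.

(** The truncations of the expansion give real numbers, so the limit is real. *)
Lemma curvature_form_esum : exists2 s : R,
  ((eps ^- 2)%:E * \esum_(a in [set: multi n]) (sqmod (P a) + W a)%R%:E)%E = s%:E &
  curvature_form eps sigma z v = s%:C.
Proof.
have W0 a : 0 <= W a.
  by apply: sumr_ge0 => j _; rewrite !mulr_ge0 ?sqmod_ge0.
have approx d : 0 < d -> exists N0, forall N, (N0 <= N)%N ->
    cmod (ip 0 eps Phi F - (eps ^- 2 * C N)%:C) <= d.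
  move=> d0; have [A HA] := expansion_ip eps0 sigmaE bF bPhi d0.
  have [N0 h0] := multi_le_cover A; exists N0 => N NN.
  rewrite -partial_sum; apply: HA; first exact: uniq_multi_le.
  by move=> a /h0; exact: multi_le_mon.
have e20 : 0 < eps ^+ 2 by rewrite exprn_gt0.
pose s := complex.Re (ip 0 eps Phi F).
exists s.
  rewrite (@esum_sandwich R _ (@multi_le n) (fun a => sqmod (P a) + W a) C (eps ^+ 2 * s)).
  - by rewrite -EFinM mulKf// gt_eqF.
  - by move=> a; rewrite addr_ge0// sqmod_ge0.
  - exact: uniq_multi_le.
  - exact: multi_le_cover.
  - exact: multi_le_mon.
  - have incl (G : multi n -> R) N : (forall a, 0 <= G a) -> \sum_(a <- multi_le n N) G a <= \sum_(a <- multi_le n N.+1) G a.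
      move=> G0; have -> : \sum_(a <- multi_le n N) G a = \sum_(a <- multi_le n N.+1 | (mlen a <= N)%N) G a.
        rewrite -[RHS]big_filter; apply: perm_big.
        apply: uniq_perm => [||a]; [exact: uniq_multi_le|exact: filter_uniq (uniq_multi_le _ _)|].
        by rewrite [RHS](mem_filter (fun i => (mlen i <= N)%N)) !mem_multi_le; case: leqP => //= aN; rewrite ltnW.
      by rewrite [leRHS](bigID (fun a => (mlen a <= N)%N))/= lerDl; apply: sumr_ge0.
    have split N : \sum_(a <- multi_le n N) (sqmod (P a) + W a) = \sum_(a <- multi_le n N) sqmod (P a) + \sum_(a <- multi_le n N) W a.
      exact: big_split.
    move=> N; rewrite !split /C; apply/andP; split.
    + by rewrite lerD2r; apply: incl => a; exact: sqmod_ge0.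
    + by rewrite lerD2l; exact: incl.
  - move=> d d0; have [N0 h0] := approx _ (divr_gt0 d0 e20); exists N0 => N /h0.
    move=> h; have := le_trans (Re_le_cmod _) h.
    rewrite ler_pdivlMr// cReD cReN /= -/s -{2}(gtr0_norm e20) -normrM distrC.
    have -> : (s - eps ^- 2 * C N) * eps ^+ 2 = - (C N - eps ^+ 2 * s).
      by rewrite mulrBl mulrAC mulVf ?gt_eqF// mul1r opprB mulrC.
    by rewrite normrN distrC.
rewrite curvature_form_ip; apply: eqReIm => //=.
apply/eqP; rewrite -normr_le0; apply/ler_addgt0Pr => d d0; rewrite add0r.
have [N h] := approx _ d0; have := le_trans (Im_le_cmod _) (h N (leqnn N)).
by rewrite cImD cImN /= subr0.
Qed.

End curvature_form.

Theorem theorem3p10 (R : realType) (n : nat) (eps eps' : R)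
    (eps_gt0 : 0 < eps) (eps_lt : eps < eps')
    (sigma : familyCn R n) (sigma_smooth : smooth_section eps' sigma)
    (z : Cn R n) (xi : multi n -> R[i])
    (sigmaE : frame_expansion eps z (sigma z) xi) (v : Cn R n) :
  exists2 s : R,
    ((eps ^- 2)%:E *
       \esum_(a in [set: multi n])
         (sqmod (\sum_(j < n)
                   (Num.sqrt (a j)%:R)%:C * xi_lower xi a j * (v 0 j : R[i]))
          + \sum_(j < n) (mlen a + n)%:R * sqmod (xi a) * sqmod (v 0 j))%R%:E)%E
      = s%:E
    & curvature_form eps sigma z v = s%:C.
Proof. exact: (curvature_form_esum v eps_gt0 eps_lt sigma_smooth sigmaE). Qed.
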